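(* Let $d\ge 3$ and $n\ge 2$, and fix an integer $\ell$ with $0\le \ell\le 2$. Then the set \[ \{ f\in\mathrm{End}_d^n : f \text{ is post-critically finite of type } (k,\ell) \text{ for some } k\in\mathbb{N}\} \] is contained in a proper Zariski closed subset of $\mathrm{End}_d^n$.
   Context: Work over an algebraically closed field $\mathbb{F}$ of characteristic $0$. For $n\ge1,d\ge1$, $\mathrm{End}_d^n$ is the set of morphisms $f:\mathbb{P}^n\to\mathbb{P}^n$ of algebraic degree $d$ (i.e. $f^*\mathcal{O}(1)=\mathcal{O}(d)$; equivalently $f=[f_0:\dots:f_n]$ with $f_i$ homogeneous of degree $d$ with no common zero); it is identified with the Zariski open complement of the Macaulay resultant hypersurface in $\mathbb{P}^N$, $N=(n+1)\binom{d+n}{n}-1$, and carries the Zariski topology. The critical locus of $f$ is $\mathcal{C}_f=\{\det(\partial f_i/\partial x_j)=0\}\subset\mathbb{P}^n$. The map $f$ is post-critically finite (PCF) if there exist $k\ge1$ and $\ell\ge0$ with $f^{k+\ell}(\mathcal{C}_f)\subseteq f^{\ell}(\mathcal{C}_f)$; if $k$ and $\ell$ are chosen minimally, $f$ is PCF of type $(k,\ell)$, with period $k$ and tail-length $\ell$. *)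

(* Defs.v *)
From HB Require Import structures.
From mathcomp Require Import all_boot all_order all_algebra.
From mathcomp Require Import mpoly.
Set Implicit Arguments. Unset Strict Implicit. Unset Printing Implicit Defensive.
Import Order.TTheory GRing.Theory.
Local Open Scope ring_scope.

Section PCF.
Variables (F : closedFieldType) (n d : nat).

(* Homogeneous coordinates x_0..x_n : polynomials in n+1 variables.
   A point of P^n is represented by a nonzero vector of its affine cone. *)
Definition vec := 'I_n.+1 -> F.

Definition polymap := 'I_n.+1 -> {mpoly F[n.+1]}.

Definition is_End (f : polymap) : Prop :=
  (forall i, f i \is d.-homog) /\
  (forall x : vec, (forall i, (f i).@[x] = 0) -> x = (fun _ => 0)).

Definition nonzero (x : vec) : Prop := x <> (fun _ => 0).

Definition fmap (f : polymap) (x : vec) : vec := fun i => (f i).@[x].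

Definition jac_det (f : polymap) (x : vec) : F :=
  \det (\matrix_(i < n.+1, j < n.+1) (mderiv j (f i)).@[x]).

Definition crit (f : polymap) : vec -> Prop :=
  fun x => nonzero x /\ jac_det f x = 0.

(* image in P^n of a cone S : all nonzero multiples of f(x), x in S *)
Definition pimage (f : polymap) (S : vec -> Prop) : vec -> Prop :=
  fun y => exists x, S x /\ exists c : F, c != 0 /\ y = (fun i => c * fmap f x i).

Definition crit_iter (f : polymap) (m : nat) : vec -> Prop :=
  iter m (pimage f) (crit f).

Definition pcf_rel (f : polymap) (k l : nat) : Prop :=
  (1 <= k)%N /\ forall y, crit_iter f (k + l) y -> crit_iter f l y.

Definition pcf_type (f : polymap) (k l : nat) : Prop :=
  pcf_rel f k l /\
  (forall k' l', pcf_rel f k' l' -> (l <= l')%N) /\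
  (forall k', pcf_rel f k' l -> (k <= k')%N).

(* Coordinates on P^N: the coefficient of each degree-d monomial in each f_i *)
Definition coef_index : finType :=
  ('I_n.+1 * {m : 'X_{1..n.+1 < d.+1} | mdeg m == d})%type.

Definition coeffs (f : polymap) : 'I_#|coef_index| -> F :=
  fun j => let p := enum_val j in (f p.1)@_(val (val p.2) : 'X_{1..n.+1}).

End PCF.

(* Main.v *)
(** Write [N = n + 1], [h = det Df], [C = {h = 0}], [u = f^l] and [g = f^(k+l)]; post-critical
    finiteness gives [g(C) ⊆ u(C)].  For generic [f] three things hold.  First, [F[x]] is free
    over [F[u]] and over [F[g]], with a perfect pairing given by the coordinate of top degree.
    Second, [h] is prime and [F[x]/(h)] is integrally closed, because the partial derivatives of
    [h] along some coordinate plane have no common zero in that plane (a dimension count on the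
    coefficients of [f]).  Third, [u] is birational from [C] onto its image: [x] is recovered from
    [u(x)] by minors of a Macaulay matrix, which has corank one for a perturbation
    [(x_0^d - d/(d-1) x_0^(d-1) L, x_1^d, ..., x_n^d)] of the power map.

    By birationality [g] lifts through [u] to a rational self-map [z] of [C].  The forms of degree
    [deg h - N > 0] are the canonical forms of [C]; traces against the pairing, together with
    normality, turn the monomials [z^m] of that degree into forms [t_m] of the same degree and
    proportional to them.  Then [u_i(t)] and [g_i] are proportional on [C], and comparing degrees
    contradicts [deg g > deg u].

    So a nonzero polynomial in the coefficients vanishes on all post-critically finite maps with
    tail length [l]; as these maps form a cone, each homogeneous component of it vanishes too. *)

Require Import Defs.
From HB Require Import structures.
From mathcomp Require Import all_boot all_order all_algebra all_fingroup.
From mathcomp Require Import mpoly ring zify mxtens.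
From Stdlib Require Import Classical FunctionalExtensionality.
Set Implicit Arguments. Unset Strict Implicit. Unset Printing Implicit Defensive.
Import Order.TTheory GRing.Theory.
Local Open Scope ring_scope.

(** The obstacle is that the lift [z] is only rational: clearing denominators may raise the degree
    of its coordinates on [C], so [u(z) = g] alone gives no contradiction. Canonical forms are what
    pulls back without change of degree, and there are nonconstant ones because
    [deg h - N = N (d - 2)] is positive for [d >= 3]; geometrically, [C] is of general type. No
    differentials occur: the canonical module is realized as a dual, a form [a] acting by
    [b -> Theta(q a b)] modulo the equation [H] of the image, where [h q = H(u)] or [h q = H(g)].
    Pull-back along [z] is the adjoint of the trace along [z]; that trace is taken over [F[g]],
    transported by [u], and made polynomial by normality. Normality and irreducibility are both
    tested on one coordinate plane because the parameter count is favourable there: three vanishing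
    derivatives against the two parameters of a point of the plane. The other generic conditions are
    open, so each needs only one witness map, and the witnesses may differ. *)

Section Divisibility.
Variable R : idomainType.
Implicit Types a b c p q : R.

Definition dvdR a b := exists c, b = c * a.

Definition prime_elt p :=
  [/\ p != 0, p \isn't a GRing.unit &
      forall a b, dvdR p (a * b) -> dvdR p a \/ dvdR p b].

(** The factors are prime rather than merely irreducible, which makes the factorization unique up to
    units. *)
Definition factorial := forall a, a != 0 ->
  exists u s, [/\ u \is a GRing.unit, {in s, forall p, prime_elt p}
                & a = u * \prod_(p <- s) p].

Lemma dvdR_refl a : dvdR a a.
Proof. by exists 1; rewrite mul1r. Qed.

Lemma dvdR0 a : dvdR a 0.
Proof. by exists 0; rewrite mul0r. Qed.

Lemma dvdR_mull a b c : dvdR a b -> dvdR a (c * b).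
Proof. by case=> k ->; exists (c * k); rewrite mulrA. Qed.

Lemma dvdR_mulr a b c : dvdR a b -> dvdR a (b * c).
Proof. by rewrite mulrC; apply: dvdR_mull. Qed.

Lemma dvdR_trans b a c : dvdR a b -> dvdR b c -> dvdR a c.
Proof. by move=> [k ->] [l ->]; exists (l * k); rewrite mulrA. Qed.

Lemma dvdR_add a b c : dvdR a b -> dvdR a c -> dvdR a (b + c).
Proof. by move=> [k ->] [l ->]; exists (k + l); rewrite mulrDl. Qed.

Lemma dvdR_opp a b : dvdR a b -> dvdR a (- b).
Proof. by case=> k ->; exists (- k); rewrite mulNr. Qed.

Lemma dvdR_sub a b c : dvdR a b -> dvdR a c -> dvdR a (b - c).
Proof. by move=> ab /dvdR_opp; apply: dvdR_add. Qed.

Lemma dvdR_sum a (I : Type) (r : seq I) (P : pred I) (E : I -> R) :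
  (forall i, P i -> dvdR a (E i)) -> dvdR a (\sum_(i <- r | P i) E i).
Proof.
move=> aE; elim/big_rec: _ => [|i x Pi ax]; first exact: dvdR0.
by apply: dvdR_add => //; apply: aE.
Qed.

Lemma dvdR_unitl u a b : u \is a GRing.unit -> dvdR a (u * b) -> dvdR a b.
Proof. by move=> uu /(dvdR_mull u^-1); rewrite mulrA mulVr // mul1r. Qed.

Lemma prime_prod p (I : Type) (s : seq I) (E : I -> R) :
  prime_elt p -> dvdR p (\prod_(i <- s) E i) ->
  exists s1 i s2, s = s1 ++ i :: s2 /\ dvdR p (E i).
Proof.
case=> p0 pu pP; elim: s => [|i s IH].
  rewrite big_nil => -[k k1]; case/negP: pu.
  by apply/unitrPr; exists k; rewrite mulrC.
rewrite big_cons => /pP[pi|/IH[s1 [j [s2 [-> pj]]]]].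
  by exists [::], i, s.
by exists (i :: s1), j, s2.
Qed.

Lemma prime_exp p a k : prime_elt p -> dvdR p (a ^+ k) -> dvdR p a.
Proof.
case=> p0 pu pP; elim: k => [|k IH]; last by rewrite exprS => /pP[|/IH].
rewrite expr0 => -[k k1]; case/negP: pu.
by apply/unitrPr; exists k; rewrite mulrC.
Qed.

Lemma prime_dvd_prime p q : prime_elt p -> prime_elt q -> dvdR p q ->
  exists2 u, u \is a GRing.unit & q = u * p.
Proof.
move=> [p0 pu _] [q0 qu qP] [c qE]; exists c => //.
have [|[k ck]|[k pk]] := qP c p; first by rewrite -qE; apply: dvdR_refl.
  case/negP: pu; apply/unitrPr; exists k.
  have c0 : c != 0 by apply: contraNneq q0 => c0; rewrite qE c0 mul0r.
  by apply: (mulfI c0); rewrite mulr1 [RHS]ck qE; ring.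
apply/unitrPr; exists k; apply: (mulIf p0); rewrite mul1r [RHS]pk qE; ring.
Qed.

Lemma dvd_prime_exp p a k : prime_elt p -> dvdR a (p ^+ k) ->
  a \is a GRing.unit \/ dvdR p a.
Proof.
move=> pp; have [p0 pu pP] := pp; elim: k a => [|k IH] a.
  rewrite expr0 => -[c c1]; left.
  by apply/unitrPr; exists c; rewrite mulrC.
case=> c; rewrite exprS => pE.
have [|[k' cE]|] := pP c a; first by rewrite -pE; apply/dvdR_mulr/dvdR_refl.
  apply: IH; exists k'; apply: (mulfI p0).
  by rewrite pE cE; ring.
by right.
Qed.

Lemma dvd_coefP p (f : {poly R}) : (forall i, dvdR p f`_i) ->
  exists q : {poly R}, f = p *: q.
Proof.
move=> pf; have [G GE] : exists G : nat -> R, forall i, f`_i = G i * p.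
  have ex i : exists c, f`_i == c * p by have [c /eqP] := pf i; exists c.
  by exists (fun i => xchoose (ex i)) => i; apply/eqP/(xchooseP (ex i)).
exists (\poly_(i < size f) G i); apply/polyP=> i; rewrite coefZ coef_poly mulrC.
by case: ltnP => [//|le]; rewrite mul0r nth_default.
Qed.

(** Induction on the number of prime factors of the leading coefficient: a prime dividing all
    coefficients is associate to one of them, and dividing it out removes that factor. This stands
    in for a gcd of the coefficients. *)
Lemma primitive_part (ps : seq R) (f : {poly R}) u :
  {in ps, forall p, prime_elt p} -> u \is a GRing.unit -> f != 0 ->
  lead_coef f = u * \prod_(p <- ps) p ->
  exists c (g : {poly R}), [/\ c != 0, f = c *: g
   & forall p, prime_elt p -> ~ (forall i, dvdR p g`_i)].
Proof.
have [m le_m] := ubnP (size ps); elim: m => // m IH in ps f u le_m *.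
move=> psP uu f0 lf.
have [[p [pp pf]]|nex] := classic (exists p, prime_elt p /\ forall i, dvdR p f`_i);
  last first.
  exists 1, f; split; rewrite ?oner_eq0 ?scale1r // => p pp pf.
  by apply: nex; exists p.
have [p0 pu pP] := pp.
have [|s1 [q [s2 [psE pq]]]] := @prime_prod p R ps id pp.
  by apply: (dvdR_unitl uu); rewrite -lf lead_coefE.
have qp : prime_elt q by apply: psP; rewrite psE mem_cat inE eqxx orbT.
have [v vu qE] := prime_dvd_prime pp qp pq.
have [f' fE] := dvd_coefP pf.
have f'0 : f' != 0 by apply: contraNneq f0 => f'0; rewrite fE f'0 scaler0.
have [|||||c [g [c0 f'E gP]]] := IH (s1 ++ s2) f' (u * v).
- by move: le_m; rewrite psE !size_cat /= addnS ltnS.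
- by move=> r; rewrite mem_cat => rs; apply: psP; rewrite psE mem_cat inE orbCA rs orbT.
- by rewrite unitrMl.
- by [].
- apply: (mulfI p0); rewrite -lead_coefZ -fE lf psE !big_cat /= big_cons qE; ring.
exists (p * c), g; split=> //; first by rewrite mulf_neq0.
by rewrite -scalerA -f'E.
Qed.

(** Gauss's lemma: if [i] and [k] are the least indices at which [p] fails to divide a coefficient
    of [f] and of [g], then modulo [p] the coefficient of [f * g] at [i + k] is the product of these
    two. *)
Lemma prime_content p (f g : {poly R}) : prime_elt p ->
  (forall i, dvdR p (f * g)`_i) ->
  (forall i, dvdR p f`_i) \/ (forall i, dvdR p g`_i).
Proof.
move=> [p0 pu pP] pfg; apply: NNPP => /not_or_and[nf ng].
have [i [Ni mi]] : exists i, ~ dvdR p f`_i /\ forall j, (j < i)%N -> dvdR p f`_j.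
  apply: NNPP => nex; apply: nf => i; elim/ltn_ind: i => i IH.
  by apply: NNPP => Ni; apply: nex; exists i.
have [k [Nk mk]] : exists i, ~ dvdR p g`_i /\ forall j, (j < i)%N -> dvdR p g`_j.
  apply: NNPP => nex; apply: ng => j; elim/ltn_ind: j => j IH.
  by apply: NNPP => Nj; apply: nex; exists j.
have := pfg (i + k)%N; rewrite coefM.
have lti : (i < (i + k).+1)%N by rewrite ltnS leq_addr.
rewrite (bigD1 (Ordinal lti)) //= addKn => pS.
have : dvdR p (f`_i * g`_k).
  rewrite -[f`_i * g`_k](addrK (\sum_(j < (i + k).+1 | j != Ordinal lti) f`_j * g`_(i + k - j))).
  apply: dvdR_sub => //; apply: dvdR_sum => j ji.
  have [ltj|ltj|eqj] := ltngtP j i; last by case/eqP: ji; apply/val_inj.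
    by apply/dvdR_mulr/mi.
  apply/dvdR_mull/mk; rewrite ltn_subLR; last by rewrite -ltnS.
  by rewrite ltn_add2r.
by case/pP.
Qed.

End Divisibility.

(** * Unique factorization in polynomial rings *)

Section FactorialPoly.
Variable R : idomainType.
Hypothesis ufdR : factorial R.
Implicit Types (f g : {poly R}).

Lemma prime_polyC (p : R) : prime_elt p -> prime_elt (p%:P : {poly R}).
Proof.
move=> pp; have [p0 pu pP] := pp; split; first by rewrite polyC_eq0.
  by rewrite poly_unitE coefC eqxx (negPf pu) andbF.
have dv f : (forall i, dvdR p f`_i) -> dvdR (p%:P : {poly R}) f.
  by move=> /dvd_coefP[q ->]; exists q; rewrite mulrC mul_polyC.
move=> a b [c abE]; have [|/dv|/dv] := @prime_content _ p a b pp; [|by left|by right].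
by move=> i; rewrite abE coefMC; apply/dvdR_mull/dvdR_refl.
Qed.

Definition primitive f := forall p, prime_elt p -> ~ (forall i, dvdR p f`_i).

Lemma primitive_decomp f : f != 0 ->
  exists c g, [/\ c != 0, f = c *: g & primitive g].
Proof.
move=> f0; have [|u [s [uu sP lf]]] := ufdR (a := lead_coef f).
  by rewrite lead_coef_eq0.
exact: primitive_part lf.
Qed.

(** The primes of [c] are removed one at a time: each divides every coefficient of [q * g], hence,
    [g] being primitive, every coefficient of [q]. *)
Lemma gauss_dvd (c : R) f g q : c != 0 -> primitive g -> c *: f = q * g -> dvdR g f.
Proof.
move=> c0 gP; have [u [s [uu sP ->]]] := ufdR c0.
elim: s q sP => [|p s IH] q sP.
  rewrite big_nil mulr1 => fE; exists (u^-1 *: q).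
  by rewrite -scalerAl -fE scalerA mulVr // scale1r.
rewrite big_cons mulrCA -scalerA => fE.
have pp : prime_elt p by apply: sP; rewrite mem_head.
have [|/dvd_coefP[q' qE]|] := @prime_content _ p q g pp.
- by move=> i; rewrite -fE coefZ; apply/dvdR_mulr/dvdR_refl.
- apply: (IH q') => [r rs|]; first by apply: sP; rewrite inE rs orbT.
  have p0 : p != 0 by case: pp.
  move: fE; rewrite qE -scalerAl -!mul_polyC => /mulfI; apply.
  by rewrite polyC_eq0.
by move/(gP _ pp).
Qed.

Lemma factorial_poly : factorial {poly R}.
Proof.
move=> f; have [m le_m] := ubnP (size f); elim: m => // m IH in f le_m *.
move=> f0; have [c [g [c0 fE gP]]] := primitive_decomp f0.
have g0 : g != 0 by apply: contraNneq f0 => g0; rewrite fE g0 scaler0.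
have [u [s [uu sP cE]]] := ufdR c0.
suff [v [t [vu tP gE]]] : exists v t, [/\ v \is a GRing.unit,
    {in t, forall p : {poly R}, prime_elt p} & g = v * \prod_(p <- t) p].
  exists (u%:P * v), (map polyC s ++ t); split.
  - by rewrite unitrMl // poly_unitE coefC eqxx uu size_polyC; case: (u =P 0) uu => [->|]; rewrite ?unitr0.
  - move=> p; rewrite mem_cat => /orP[/mapP[q qs ->]|]; last exact: tP.
    exact/prime_polyC/sP.
  rewrite big_cat /= big_map fE gE cE -mul_polyC polyCM rmorph_prod /=; ring.
have szf : size f = size g by rewrite fE size_scale.
have [sz1|sz1] := leqP (size g) 1.
  move: gP g0; rewrite (size1_polyC sz1) => gP g0; exists (g`_0)%:P, [::].
  split=> //; last by rewrite big_nil mulr1.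
  have a0 : g`_0 != 0 by rewrite polyC_eq0 in g0.
  have [v [t [vu tP gE]]] := ufdR a0.
  suff t0 : t = [::].
    rewrite poly_unitE coefC eqxx size_polyC a0 /= gE t0 big_nil mulr1 //.
  case: t tP gE => // p t tP gE; have pp : prime_elt p by apply: tP; rewrite mem_head.
  case: (gP p pp) => i; rewrite coefC; case: ifP => _; last exact: dvdR0.
  by rewrite gE big_cons; exists (v * \prod_(j <- t) j); ring.
(* a non-constant pseudo-divisor of [g] of least size has a prime primitive part *)
pose P k := exists q : {poly R}, [/\ size q = k, (1 < k)%N & q %| g].
have [k [[q [sq k1 qg]] kmin]] : exists k, P k /\ forall j, P j -> (k <= j)%N.
  have exP : exists k, P k by exists (size g), g; split; rewrite ?dvdpp.
  apply: NNPP => nex; case: exP => k; elim/ltn_ind: k => k IHk Pk.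
  apply: nex; exists k; split=> // j Pj; rewrite leqNgt; apply/negP => lt.
  exact: IHk lt Pj.
have q0 : q != 0 by rewrite -size_poly_gt0 sq ltnW.
have [a [r [a0 qE rP]]] := primitive_decomp q0.
have sr : size r = k by rewrite -sq qE size_scale.
have r0 : r != 0 by rewrite -size_poly_gt0 sr ltnW.
have rg : r %| g by apply: dvdp_trans qg; rewrite qE dvdpZr // dvdpp.
(* Over a domain [%|] is divisibility up to a nonzero scalar; primitivity of [r] turns it into
   genuine divisibility. *)
have dvdr b : r %| b -> dvdR r b.
  by case/Pdiv.Idomain.dvdpP => -[c' q'] /= c'0 E; apply: (gauss_dvd c'0 rP E).
have rp : prime_elt r.
  split=> //; first by rewrite poly_unitE sr; move: k1; case: (k) => [|[|]].
  move=> b b' [cc bbE].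
  have rbb : r %| b * b' by rewrite bbE dvdp_mull ?dvdpp.
  (* By minimality of [k], a nonconstant gcd of [r] and [b] has the size of [r], so [r] is coprime
     to [b] or divides it. *)
  have [cop|ncop] := boolP (coprimep r b).
    by right; apply: dvdr; rewrite -(Gauss_dvdpr _ cop).
  left; apply: dvdr; have dg := dvdp_gcdl r b.
  have kg : (k <= size (gcdp r b))%N.
    apply: kmin; exists (gcdp r b); split=> //; last exact: dvdp_trans dg rg.
    by rewrite ltn_neqAle eq_sym -coprimep_def ncop size_poly_gt0 gcdp_eq0 (negPf r0).
  have := dvdp_leq r0 dg; rewrite sr => gk.
  have /eqp_dvdl <- : gcdp r b %= r.
    by rewrite -dvdp_size_eqp // sr eqn_leq gk kg.
  exact: dvdp_gcdr.
have [w gE] := dvdr g rg.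
have w0 : w != 0 by apply: contraNneq g0 => w0; rewrite gE w0 mul0r.
have [||v [t [vu tP wE]]] := IH w; rewrite ?w0 //.
  rewrite -ltnS; apply: leq_trans le_m; rewrite ltnS szf gE size_mul // sr.
  by move: k1; case: (k) => [|[|k']] // _; rewrite !addnS /= ltnS leq_addr.
exists v, (r :: t); split=> //; last by rewrite gE wE big_cons; ring.
by move=> p; rewrite inE => /predU1P[->//|/tP].
Qed.

End FactorialPoly.

Section RingIso.
Variables (R S : idomainType) (f : {rmorphism R -> S}) (g : {rmorphism S -> R}).
Hypotheses (fK : cancel f g) (gK : cancel g f).

Lemma dvdR_iso a b : dvdR (f a) (f b) -> dvdR a b.
Proof. by case=> c E; exists (g c); rewrite -[b]fK E rmorphM /= fK. Qed.

Lemma prime_iso a : prime_elt a -> prime_elt (f a).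
Proof.
case=> a0 au aP; split.
- by apply: contraNneq a0 => E; rewrite -[a]fK E rmorph0.
- by apply: contraNN au => E; rewrite -[a]fK rmorph_unit.
move=> b c [d E].
have [] := aP (g b) (g c).
- by exists (g d); rewrite -rmorphM E rmorphM /= fK.
- by case=> k E1; left; exists (f k); rewrite -rmorphM -E1 gK.
by case=> k E1; right; exists (f k); rewrite -rmorphM -E1 gK.
Qed.

Lemma factorial_iso : factorial R -> factorial S.
Proof.
move=> ufR b b0; have [|u [s [uu sP E]]] := ufR (g b).
  by apply: contraNneq b0 => E; rewrite -[b]gK E rmorph0.
exists (f u), (map f s); split; first exact: rmorph_unit.
  by move=> _ /mapP[p ps ->]; apply/prime_iso/sP.
by rewrite -[b]gK E rmorphM big_map rmorph_prod.
Qed.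

End RingIso.

Lemma factorial_field (F : fieldType) : factorial F.
Proof. by move=> a a0; exists a, [::]; rewrite big_nil mulr1 unitfE. Qed.

(** * Polynomials in n+1 variables as polynomials in the last one *)

Section Univariate.
Variables (F : fieldType) (n : nat).
Local Notation wd := (widen_ord (leqnSn n)).

Lemma muniX (m : 'X_{1..n.+1}) :
  muni ('X_[m] : {mpoly F[n.+1]}) =
  'X_[[multinom m (wd i) | i < n]] *: 'X^(m ord_max).
Proof. by rewrite muniE msuppX big_seq1 mcoeffX eqxx scale1r. Qed.

Lemma muni_mwiden (p : {mpoly F[n]}) : muni (mwiden p) = p%:P.
Proof.
elim/mpolyind: p => [|c m p _ _ IH]; first by rewrite mwiden0 muni0 polyC0.
rewrite mwidenD muniD IH polyCD; congr (_ + _).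
rewrite mwidenZ mwidenX muniZ muniX mnmwiden_ordmax expr0 -!mul_polyC mulr1 -polyCM.
rewrite mul_mpolyC; congr (_ *: _)%:P; congr 'X_[_].
by apply/mnmP=> i; rewrite mnmE mnmwiden_widen.
Qed.

Lemma muni_Xmax : muni ('X_ord_max : {mpoly F[n.+1]}) = 'X.
Proof.
rewrite muniX mnm1E eqxx expr1 (_ : [multinom _ | _ < _] = 0%MM).
  by rewrite mpolyX0 scale1r.
apply/mnmP=> i; rewrite mnmE mnm1E mnm0E; case: eqP => // /(congr1 val) /= E.
by have := ltn_ord i; rewrite -E ltnn.
Qed.

Definition mjoin (q : {poly {mpoly F[n]}}) : {mpoly F[n.+1]} :=
  horner_eval 'X_ord_max (map_poly (@mwiden n F) q).

HB.instance Definition _ := GRing.RMorphism.copy mjoin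
  (horner_eval 'X_ord_max \o map_poly (@mwiden n F)).

Lemma mjoin0 : mjoin 0 = 0. Proof. exact: rmorph0. Qed.
Lemma mjoinD : {morph mjoin : p q / p + q}. Proof. exact: rmorphD. Qed.
Lemma mjoinM : {morph mjoin : p q / p * q}. Proof. exact: rmorphM. Qed.
Lemma mjoinXn k : {morph mjoin : p / p ^+ k}. Proof. exact: rmorphXn. Qed.

Lemma mjoinC c : mjoin c%:P = mwiden c.
Proof. by rewrite /mjoin /horner_eval map_polyC hornerC. Qed.

Lemma mjoinX : mjoin 'X = 'X_ord_max.
Proof. by rewrite /mjoin /horner_eval map_polyX hornerX. Qed.

Lemma mjoinK : cancel mjoin (@muni n F).
Proof.
elim/poly_ind => [|p c IH]; first by rewrite mjoin0 muni0.
rewrite mjoinD mjoinM mjoinX mjoinC muniD muniM IH muni_Xmax.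
by rewrite muni_mwiden.
Qed.

Lemma mjoin_muniX (m : 'X_{1..n.+1}) : mjoin (muni 'X_[m]) = 'X_[m].
Proof.
rewrite muniX -mul_polyC mjoinM mjoinXn mjoinC mjoinX.
rewrite mwidenX mpolyXn -mpolyXD; apply: f_equal; apply/mnmP=> i.
rewrite mnmDE mulmnE mnm1E.
have [lt|] := ltnP i n.
  have -> : i = wd (Ordinal lt) by apply/val_inj.
  rewrite mnmwiden_widen mnmE; case: eqP => [/(congr1 val) /= E|_].
    by exfalso; move: (lt); rewrite -E ltnn.
  by rewrite mul0n addn0.
move=> ge; have -> : i = ord_max.
  by apply/val_inj/eqP; rewrite eqn_leq ge -ltnS ltn_ord.
by rewrite eqxx mul1n mnmwiden_ordmax add0n.
Qed.

Lemma muniK : cancel (@muni n F) mjoin.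
Proof.
elim/mpolyind => [|c m p _ _ IH]; first by rewrite muni0 mjoin0.
have E : mjoin (muni (c *: 'X_[m])) = c *: 'X_[m].
  by rewrite muniZ -mul_polyC mjoinM mjoinC mjoin_muniX mwidenC mul_mpolyC.
by rewrite muniD mjoinD; apply: (f_equal2 +%R E IH).
Qed.

Lemma meval_muniX (m : 'X_{1..n.+1}) v :
  (map_poly (meval (v \o wd)) (muni 'X_[m])).[v ord_max] = ('X_[m] : {mpoly F[n.+1]}).@[v].
Proof.
rewrite muniX -mul_polyC (rmorphM (map_poly _)) /= map_polyC hornerM hornerC /=.
rewrite map_polyXn hornerXn !mevalX big_ord_recr /=; apply: f_equal2; last by [].
by apply: eq_bigr => i _; rewrite mnmE.
Qed.

Lemma meval_muni (p : {mpoly F[n.+1]}) v :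
  p.@[v] = (map_poly (meval (v \o wd)) (muni p)).[v ord_max].
Proof.
elim/mpolyind: p => [|c m p _ _ IH]; first by rewrite meval0 muni0 map_poly0 horner0.
have E : (c *: 'X_[m]).@[v] =
    (map_poly (meval (v \o wd)) (muni (c *: 'X_[m]))).[v ord_max].
  rewrite mevalZ muniZ -mul_polyC (rmorphM (map_poly _)) /= map_polyC hornerM.
  by rewrite hornerC /= mevalC meval_muniX.
rewrite mevalD muniD (raddfD (map_poly _)) hornerD; apply: (f_equal2 +%R E IH).
Qed.

Lemma meval_muni_ext (p : {mpoly F[n.+1]}) (w : 'I_n.+1 -> F) v : w \o wd =1 v ->
  p.@[w] = (map_poly (meval v) (muni p)).[w ord_max].
Proof.
move=> E; rewrite meval_muni; apply: f_equal2; last by [].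
by apply: eq_map_poly => r; apply: meval_eq.
Qed.

Lemma extend_point (v : 'I_n -> F) x :
  exists w : 'I_n.+1 -> F, w ord_max = x /\ w \o wd =1 v.
Proof.
exists (fun i => oapp v x (insub (val i))); split=> [|i] /=.
  by rewrite insubF ?ltnn.
by rewrite (insubT (fun k => (k < n)%N) (ltn_ord i)) /=; congr v; apply: val_inj.
Qed.

End Univariate.

Lemma factorial_mpoly (F : fieldType) n : factorial {mpoly F[n]}.
Proof.
elim: n => [|n IH].
  have K1 : cancel (@mpolyC 0 F) (@mcoeff 0 F 0%MM).
    by move=> c; rewrite mcoeffC eqxx mulr1.
  have K2 : cancel (@mcoeff 0 F 0%MM) (@mpolyC 0 F).
    by move=> p; rewrite -nvar0_mpolyC.
  exact: (factorial_iso K1 K2 (@factorial_field F)).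
exact: (factorial_iso (@mjoinK F n) (@muniK F n) (factorial_poly IH)).
Qed.

(** * Elimination and the Nullstellensatz for a prime polynomial *)

Lemma prime_coprimep (S : idomainType) (P Q : {poly S}) :
  prime_elt P -> (1 < size P)%N -> ~ dvdR P Q -> coprimep P Q.
Proof.
move=> [P0 _ PP] sP nPQ; apply: contraT => ncop; exfalso.
have := dvdp_gcdlr P Q; set D := gcdp P Q.
have D0 : D != 0 by rewrite gcdp_eq0 (negPf P0).
have sD : (1 < size D)%N by rewrite ltn_neqAle eq_sym -coprimep_def ncop size_poly_gt0.
case/andP=> /Pdiv.Idomain.dvdpP[[c k] /= c0 E] /Pdiv.Idomain.dvdpP[[c' k'] /= c'0 E'].
have nsmall (a : S) q : a != 0 -> a%:P = q * P -> False.
  move=> a0 aE; have q0 : q != 0.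
    by apply: contraNneq a0 => q0; rewrite -polyC_eq0 aE q0 mul0r.
  have := congr1 (fun q : {poly S} => size q) aE; rewrite size_polyC a0 size_mul //.
  move: sP; rewrite -(prednK (n := size P)) ?size_poly_gt0 //.
  case: (size P).-1 => // j _; rewrite !addnS /= => -[] /eqP; rewrite eq_sym addn_eq0.
  by rewrite size_poly_eq0 (negPf q0).
(* [P] divides [D * k] up to a scalar. If it divides the common divisor [D], it divides a scalar
   multiple of [Q]; if it divides the cofactor [k], then [D] is constant. *)
have [||] := PP D k.
- by exists c%:P; rewrite mul_polyC E mulrC.
- case=> d DE; have [||] := PP c'%:P Q.
  + by exists (k' * d); rewrite mul_polyC E' DE mulrA.
  + by case=> q /nsmall; apply.
  + exact: nPQ.
case=> d kE; have /(congr1 (fun q : {poly S} => size q)) : c%:P = d * D.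
  by apply: (mulIf P0); rewrite mul_polyC E kE; ring.
have d0 : d != 0.
  apply: contraNneq P0 => d0; move: E; rewrite kE d0 !mul0r => /eqP.
  by rewrite -mul_polyC mulf_eq0 polyC_eq0 (negPf c0).
rewrite size_polyC c0 size_mul //; move: sD; case: (size D) => [|[|j]] // _.
by rewrite !addnS /= => -[] /eqP; rewrite eq_sym addn_eq0 size_poly_eq0 (negPf d0).
Qed.

Lemma coprimep_const (S : idomainType) (P Q : {poly S}) : coprimep P Q ->
  exists c u v, c != 0 /\ c%:P = u * P + v * Q.
Proof.
case/Bezout_coprimepP=> [[u v]] /= E; have /eqp_size := E; rewrite size_poly1 => sz.
have := size1_polyC (eq_leq sz); set c := _`_0 => cE.
exists c, u, v; split=> //; rewrite -polyC_eq0 -cE -size_poly_gt0 sz //.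
Qed.

Section Closed.
Variable F : closedFieldType.

Lemma infinite_closed (s : seq F) : exists x, x \notin s.
Proof.
pose p : {poly F} := \prod_(a <- s) ('X - a%:P) * 'X + 1.
have sp : size (\prod_(a <- s) ('X - a%:P) * 'X : {poly F}) = (size s).+2.
  by rewrite size_mulX ?size_prod_XsubC // monic_neq0 // monic_prod_XsubC.
have /closed_rootP[x] : size p != 1.
  by rewrite /p size_polyDl sp // size_poly1.
rewrite rootE !hornerE => /eqP E; exists x; apply/negP => xs.
have : root (\prod_(a <- s) ('X - a%:P)) x by rewrite root_prod_XsubC.
by move/rootP=> r0; move: E; rewrite r0 mul0r add0r => /eqP; rewrite oner_eq0.
Qed.

Lemma poly_nonroot (p : {poly F}) : p != 0 -> exists x, p.[x] != 0.
Proof.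
move=> p0; have [r pE] := closed_field_poly_normal p.
have [x xr] := infinite_closed r; exists x.
by rewrite -rootE pE rootZ ?lead_coef_eq0 // root_prod_XsubC.
Qed.

Lemma mpoly_nonroot n (p : {mpoly F[n]}) : p != 0 -> exists v, p.@[v] != 0.
Proof.
elim: n p => [|n IH] p p0.
  exists (fun _ => 0); rewrite (nvar0_mpolyC p) mevalC; apply: contraNneq p0.
  by move=> E; rewrite (nvar0_mpolyC p) E mpolyC0.
have P0 : muni p != 0 by apply: contraNneq p0 => E; rewrite -(muniK p) E rmorph0.
have [|v lv] := IH (lead_coef (muni p)); first by rewrite lead_coef_eq0.
have [|x Px] := @poly_nonroot (map_poly (meval v) (muni p)).
  apply: contraNneq lv => E; have := congr1 (fun q : {poly F} => q`_(size (muni p)).-1) E.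
  by rewrite coef_map /= coef0 -lead_coefE => ->.
have [w [wx wv]] := extend_point v x; exists w.
by rewrite (meval_muni_ext _ wv) wx.
Qed.

(** A Bezout relation cleared of denominators puts some nonzero [r], free of the last variable, in
    the ideal of [P] and [Q]. Above a point where neither [r] nor the leading coefficient of [P]
    vanishes, [P] has a root and [Q] is nonzero there. *)
Lemma coprimep_separate n (P Q : {poly {mpoly F[n]}}) :
  coprimep P Q -> (1 < size P)%N ->
  exists v x, (map_poly (meval v) P).[x] = 0 /\ (map_poly (meval v) Q).[x] != 0.
Proof.
move=> cop sP; have [r [a [b [r0 rE]]]] := coprimep_const cop.
have l0 : lead_coef P != 0 by rewrite lead_coef_eq0 -size_poly_gt0 ltnW.
have [v] := mpoly_nonroot (mulf_neq0 r0 l0).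
rewrite mevalM mulf_eq0 negb_or => /andP[rv lv].
have sPv : size (map_poly (meval v) P) = size P by rewrite size_map_poly_id0.
have /closed_rootP[x /rootP Px] : size (map_poly (meval v) P) != 1.
  by rewrite sPv neq_ltn sP orbT.
exists v, x; split=> //; apply: contraNneq rv => Qx.
move/(congr1 (fun q => (map_poly (meval v) q).[x])): rE.
rewrite map_polyC hornerC (rmorphD (map_poly (meval v))) !(rmorphM (map_poly (meval v))) /=.
by rewrite hornerD !hornerM Px Qx !mulr0 addr0 => ->.
Qed.

(* Nullstellensatz for a principal prime ideal. *)
Lemma prime_vanish n (p s : {mpoly F[n]}) : prime_elt p ->
  (forall v, p.@[v] = 0 -> s.@[v] = 0) -> dvdR p s.
Proof.
elim: n p s => [|n IH] p s pp.
  case: (pp) => p0; rewrite (nvar0_mpolyC p) => /negP[].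
  apply: rmorph_unit; rewrite unitfE; apply: contraNneq p0 => E.
  by rewrite (nvar0_mpolyC p) E mpolyC0.
move=> pv; apply: (dvdR_iso (@muniK F n)).
have PP : prime_elt (muni p) := prime_iso (@muniK F n) (@mjoinK F n) pp.
change (dvdR (muni p) (muni s)); set P := muni p in PP *; set Q := muni s.
(* If [p] does not involve the last variable, induction applies to each coefficient of [s].
   Otherwise a failure of divisibility makes [P] and [Q] coprime, which yields a zero of [p] outside
   the zeros of [s]. *)
have [sP|sP] := leqP (size P) 1.
  have PE := size1_polyC sP; set c := P`_0 in PE.
  have cp : prime_elt c.
    move: PP; rewrite /= PE => -[c0 cu cP]; split; first by rewrite -polyC_eq0.
      by apply: contraNN cu => cu; apply: rmorph_unit.
    move=> a b [k E]; have [||] := cP a%:P b%:P.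
    - by exists k%:P; rewrite -!polyCM E.
    - case=> q /(congr1 (fun q : {poly _} => q`_0)); rewrite coefMC !coefC /= => ->.
      by left; exists q`_0.
    case=> q /(congr1 (fun q : {poly _} => q`_0)); rewrite coefMC !coefC /= => ->.
    by right; exists q`_0.
  have [|q QE] := @dvd_coefP _ c Q; last by rewrite QE PE; exists q; rewrite mulrC mul_polyC.
  move=> i; apply: IH => // v cv.
  suff E : map_poly (meval v) Q = 0.
    by have := congr1 (fun q : {poly F} => q`_i) E; rewrite coef_map coef0.
  apply/eqP; apply: contraT => /poly_nonroot[x /eqP[]].
  have [w [wx wv]] := extend_point v x; rewrite -wx -(meval_muni_ext _ wv).
  by apply: pv; rewrite (meval_muni_ext _ wv) -/P PE map_polyC /= cv polyC0 horner0.
apply: NNPP => nPQ; have cop := prime_coprimep PP sP nPQ.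
have [v [x [Px /eqP[]]]] := coprimep_separate cop sP.
have [w [wx wv]] := extend_point v x.
by rewrite -wx -(meval_muni_ext _ wv) pv // (meval_muni_ext _ wv) wx.
Qed.

End Closed.

(** * Congruences modulo a polynomial and integral fractions *)

Section Congruence.
Variables (R : idomainType) (h : R).
Implicit Types a b c : R.

Definition eqm a b := dvdR h (a - b).

Lemma eqm_refl a : eqm a a. Proof. by rewrite /eqm subrr; apply: dvdR0. Qed.
Lemma eqm_sym a b : eqm a b -> eqm b a.
Proof. by rewrite /eqm -[b - a]opprB; apply: dvdR_opp. Qed.
Lemma eqm_trans b a c : eqm a b -> eqm b c -> eqm a c.
Proof. by move=> /dvdR_add H /H; rewrite addrA subrK. Qed.
Lemma eqmD a b c d : eqm a b -> eqm c d -> eqm (a + c) (b + d).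
Proof. by move=> H1 H2; rewrite /eqm opprD addrACA; apply: dvdR_add. Qed.
Lemma eqmM a b c d : eqm a b -> eqm c d -> eqm (a * c) (b * d).
Proof.
move=> H1 H2; rewrite /eqm (_ : a * c - b * d = (a - b) * c + b * (c - d)).
  by apply: dvdR_add; [apply: dvdR_mulr|apply: dvdR_mull].
by ring.
Qed.
Lemma eqmMl a c d : eqm c d -> eqm (a * c) (a * d).
Proof. by apply: eqmM; apply: eqm_refl. Qed.
Lemma eqmMr a c d : eqm c d -> eqm (c * a) (d * a).
Proof. by move=> H; apply: eqmM => //; apply: eqm_refl. Qed.
Lemma eqmX a b k : eqm a b -> eqm (a ^+ k) (b ^+ k).
Proof.
by move=> H; elim: k => [|k IH]; rewrite ?expr0 ?exprS; [apply: eqm_refl|apply: eqmM].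
Qed.
Lemma eqm_sum (I : Type) (r : seq I) (P : pred I) (E E' : I -> R) :
  (forall i, P i -> eqm (E i) (E' i)) ->
  eqm (\sum_(i <- r | P i) E i) (\sum_(i <- r | P i) E' i).
Proof. by move=> H; rewrite /eqm -sumrB; apply: dvdR_sum. Qed.
Lemma eqm_prod (I : Type) (r : seq I) (P : pred I) (E E' : I -> R) :
  (forall i, P i -> eqm (E i) (E' i)) ->
  eqm (\prod_(i <- r | P i) E i) (\prod_(i <- r | P i) E' i).
Proof.
move=> H; elim/big_rec2: _ => [|i x y Pi IH]; first exact: eqm_refl.
by apply: eqmM => //; apply: H.
Qed.
Lemma eqm0 a : eqm a 0 <-> dvdR h a. Proof. by rewrite /eqm subr0. Qed.
Lemma eqm_dvd a : eqm (a * h) 0.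
Proof. by apply/eqm0; exists a. Qed.
Lemma eqm_cancel c a b : prime_elt h -> ~ dvdR h c -> eqm (c * a) (c * b) -> eqm a b.
Proof. by move=> [_ _ hP] nc; rewrite /eqm -mulrBr => /hP[]. Qed.

(** When [s] is a nonzerodivisor modulo [h], this says that the fraction [a / s] is integral over
    the quotient by [h]: a monic equation cleared of its denominators. *)
Definition integ a s := exists N (c : nat -> R),
  eqm (a ^+ N + \sum_(j < N) c j * a ^+ j * s ^+ (N - j)) 0.

End Congruence.

Lemma resultant_morph (aR rR : comNzRingType) (f : {rmorphism aR -> rR}) p q :
    f (lead_coef p) != 0 -> f (lead_coef q) != 0 ->
  f (resultant p q) = resultant (map_poly f p) (map_poly f q).
Proof.
move=> p0 q0; rewrite /resultant /Sylvester_mx !size_map_poly_id0 //.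
rewrite -det_map_mx map_col_mx; congr (\det (col_mx _ _));
  by apply: map_lin1_mx => v; rewrite map_poly_rV rmorphM /= map_rVpoly.
Qed.

(* Induction on a root [x] of [h]: if [h = (X - x) h1] and [a = (X - x) a1], then
   [h' a = h a1 + (X - x) (h1' a)]. *)
Lemma dvdp_deriv_mul (F : closedFieldType) (h a : {poly F}) N : h != 0 ->
  h %| a ^+ N -> h %| h^`() * a.
Proof.
have [m le_m] := ubnP (size h); elim: m => // m IH in h le_m *.
move=> h0 ha; have [sz|sz] := eqVneq (size h) 1.
  by move/eqP: sz; rewrite size_poly_eq1 => /eqp_dvdl ->; rewrite dvd1p.
have /closed_rootP[x] := sz; rewrite -dvdp_XsubCl => /dvdpP[h1 hE].
have [N0|N0] := eqVneq N 0; first by move: ha; rewrite N0 expr0 dvdp1 (negPf sz).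
have : root (a ^+ N) x.
  by rewrite -dvdp_XsubCl; apply: dvdp_trans ha; rewrite hE dvdp_mull ?dvdpp.
move/rootP; rewrite horner_exp => /eqP; rewrite expf_eq0 => /andP[_].
rewrite -[_ == 0]/(root a x) -dvdp_XsubCl => /dvdpP[a1 aE].
have h10 : h1 != 0 by apply: contraNneq h0 => E; rewrite hE E mul0r.
have h1a : h1 %| h1^`() * a.
  apply: IH => //; last by apply: dvdp_trans ha; rewrite hE dvdp_mulr ?dvdpp.
  by move: le_m; rewrite hE size_mul ?polyXsubC_eq0 // size_XsubC addn2 /= ltnS.
rewrite (_ : _ * a = a1 * h + (h1^`() * a) * ('X - x%:P)).
  apply: dvdp_add; first by apply: dvdp_mull; apply: dvdpp.
  by rewrite hE; apply: dvdp_mul.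
rewrite hE {1 2}aE derivM derivXsubC; ring.
Qed.

(** * Zeros on coordinate planes and factors of forms *)

Section PolyTools.
Variable F : closedFieldType.

Lemma horner_mmap n (q : 'I_n -> {poly F}) (p : {mpoly F[n]}) t :
  (mmap polyC q p).[t] = p.@[fun i => (q i).[t]].
Proof.
elim/mpolyind: p => [|c m p _ _ IH]; first by rewrite !raddf0 horner0.
rewrite mmapD mevalD hornerD IH mmapZ mevalZ hornerM hornerC; congr (_ * _ + _).
rewrite mmapX mevalX /mmap1 horner_prod; apply: eq_bigr => i _.
by rewrite horner_exp.
Qed.

(** On the plane with coordinates [(x, t)], either some line [t = const] with [t != 0] meets the
    zeros of [p], or [p] is constant along each of these lines. In the second case it is constant
    along [t = 0] too, so it vanishes at [(1, 0)] because it vanishes at the origin. *)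
Lemma plane_zero n (p : {mpoly F[n]}) (i j : 'I_n) : i != j -> p.@[fun _ => 0] = 0 ->
  exists v, [/\ p.@[v] = 0, (v i != 0) || (v j != 0) &
     forall k, k != i -> k != j -> v k = 0].
Proof.
move=> ij p0.
pose vv (x t : F) k := if k == i then x else if k == j then t else 0.
pose Q t : {poly F} := mmap polyC (fun k => if k == i then 'X else
   if k == j then t%:P else 0) p.
have QE x t : (Q t).[x] = p.@[vv x t].
  rewrite horner_mmap; apply: meval_eq => k; rewrite /vv.
  by case: ifP => _; rewrite ?hornerX //; case: ifP => _; rewrite ?hornerC.
have vvP x t : (x != 0) || (t != 0) -> p.@[vv x t] = 0 -> exists v,
    [/\ p.@[v] = 0, (v i != 0) || (v j != 0) & forall k, k != i -> k != j -> v k = 0].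
  move=> xt px; exists (vv x t); split=> //; rewrite /vv.
    by rewrite eqxx [j == i]eq_sym (negPf ij) eqxx.
  by move=> k /negPf-> /negPf->.
have [[t [x [t0 Qx]]]|nex] := classic (exists t x, t != 0 /\ (Q t).[x] = 0).
  by apply: (vvP x t); rewrite ?t0 ?orbT // -QE.
have Qc t x : t != 0 -> (Q t).[x] = (Q t).[0].
  move=> t0; have /eqP/eq_leq sz : size (Q t) == 1.
    apply: contraT => /closed_rootP[y /rootP Qy]; case: nex; by exists t, y.
  by rewrite (size1_polyC sz) !hornerC.
pose P x : {poly F} := mmap polyC (fun k => if k == i then x%:P else
   if k == j then 'X else 0) p.
have PE t x : (P x).[t] = p.@[vv x t].
  rewrite horner_mmap; apply: meval_eq => k; rewrite /vv.
  by case: ifP => _; rewrite ?hornerC //; case: ifP => _; rewrite ?hornerX ?hornerC.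
have : (P 1 - P 0) * 'X == 0.
  apply: contraT => /poly_nonroot[t]; rewrite !hornerE !PE -!QE.
  by have [->|/Qc->] := eqVneq t 0; rewrite ?mulr0 ?subrr ?mul0r eqxx.
rewrite mulf_eq0 polyX_eq0 orbF subr_eq0 => /eqP/(congr1 (fun q : {poly F} => q.[0])).
rewrite !PE => E; apply: (vvP 1 0); rewrite ?oner_eq0 // E -[RHS]p0.
by apply: meval_eq => k; rewrite /vv !if_same.
Qed.

(** On a line through the origin where [s] is nonzero, [p] divides a power of the parameter. If [p]
    were nonzero at the origin it would be coprime to the parameter, hence constant on the line; as
    this holds on almost all lines, [p] would be a unit. *)
Lemma homog_factor n (s p : {mpoly F[n]}) m : s \is m.-homog -> s != 0 ->
  p \isn't a GRing.unit -> dvdR p s -> p.@[fun _ => 0] = 0.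
Proof.
move=> sm s0 pu [w sE]; apply/eqP; apply: contraT => p0; case/negP: pu.
have scale x t : s.@[fun i => t * x i] = t ^+ m * s.@[x].
  rewrite !mevalE mulr_sumr; apply: eq_big_seq => b bs.
  have /dhomogP/(_ b bs) /= mb := sm.
  rewrite mulrCA; congr (_ * _); rewrite -mb mdegE -prodrXr -big_split /=.
  by apply: eq_bigr => i _; rewrite exprMn.
have pc : (p - (p.@[fun _ => 0])%:MP) * s == 0.
  apply: contraT => /mpoly_nonroot[x]; rewrite mevalM mulf_eq0 negb_or => /andP[pc sx].
  case/eqP: pc; rewrite mevalB mevalC.
  pose P : {poly F} := mmap polyC (fun i => x i *: 'X) p.
  pose W : {poly F} := mmap polyC (fun i => x i *: 'X) w.
  have PW : P * W = s.@[x] *: 'X^m.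
    apply/eqP; rewrite -subr_eq0; apply: contraT => /poly_nonroot[t].
    rewrite hornerD hornerN hornerZ hornerXn hornerM !horner_mmap -mevalM [p * w]mulrC -sE.
    rewrite [s.@[x] * _]mulrC -scale => /eqP[].
    apply/eqP; rewrite subr_eq0; apply/eqP/meval_eq => i.
    by rewrite hornerZ hornerX mulrC.
  have P0' : P.[0] = p.@[fun _ => 0].
    by rewrite horner_mmap; apply: meval_eq => i; rewrite hornerZ hornerX mulr0.
  have P0 : P.[0] != 0 by rewrite P0'.
  have cP : coprimep P ('X^m).
    by rewrite coprimep_expr // -['X]subr0 -polyC0 coprimep_XsubC.
  have : P %| 1.
    rewrite -(Gauss_dvdpr _ cP) mulr1.
    by rewrite -(dvdpZr _ _ sx) -PW dvdp_mulr ?dvdpp.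
  rewrite dvdp1 => /eqP/eq_leq/size1_polyC PC.
  have P1 : P.[1] = p.@[x] by rewrite horner_mmap; apply: meval_eq => i; rewrite hornerZ hornerX mulr1.
  by rewrite -P1 -P0' PC !hornerC subrr.
move: pc; rewrite mulf_eq0 (negPf s0) orbF subr_eq0 => /eqP ->.
by apply: rmorph_unit; rewrite unitfE.
Qed.

End PolyTools.

Lemma eq_eqm (R : idomainType) (h a b : R) : a = b -> eqm h a b.
Proof. by move->; apply: eqm_refl. Qed.

(** Multiply the equation of [Q] over [p * s] by [D ^+ N], replace each [D * Q] by [p * a], and
    cancel [p ^+ N]. *)
Lemma integ_div (R : idomainType) (h p a D Q s : R) : prime_elt h -> ~ dvdR h p ->
  eqm h (p * a) (D * Q) -> integ h Q (p * s) -> integ h a s.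
Proof.
move=> hp np paE [N [c cE]]; exists N, (fun j => c j * D ^+ (N - j)).
apply: (@eqm_cancel _ _ (p ^+ N)) => //; first by move=> H; apply: np; apply: prime_exp H.
rewrite mulr0; apply: (@eqm_trans _ _ (D ^+ N * 0)); last first.
  by rewrite mulr0; apply: eqm_refl.
apply: eqm_trans (eqmMl _ cE); rewrite mulrDr [X in eqm _ _ X]mulrDr; apply: eqmD.
  by rewrite -!exprMn; apply: eqmX.
rewrite !mulr_sumr; apply: eqm_sum => j _; have jN := subnKC (ltnW (ltn_ord j)).
have eqN x : x ^+ N = x ^+ j * x ^+ (N - j) by rewrite -exprD jN.
rewrite !eqN.
apply: (@eqm_trans _ _ (c j * D ^+ (N - j) * (p * a) ^+ j * (p * s) ^+ (N - j))).
  by rewrite !exprMn; apply: eq_eqm; ring.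
apply: (@eqm_trans _ _ (c j * D ^+ (N - j) * (D * Q) ^+ j * (p * s) ^+ (N - j))).
  by apply/eqmMr/eqmMl/eqmX.
by rewrite !exprMn; apply: eq_eqm; ring.
Qed.

(** * Two membership criteria for ideals generated by a lower-dimensional prime and [P] *)

Section PolyKeys.
Variables (F : closedFieldType) (n : nat).
Implicit Types (P Q D : {poly {mpoly F[n]}}) (p : {mpoly F[n]}).

(** As [r] is smaller than [P], the quotient of [P] by its gcd with [r] is nonconstant. It is
    coprime to the corresponding quotient of [r], hence divides each [D ^+ M], and any root of it
    will do. *)
Lemma dvdp_common_root (P r D0 D1 D2 : {poly F}) M :
  r != 0 -> (size r < size P)%N ->
  P %| D0 ^+ M * r -> P %| D1 ^+ M * r -> P %| D2 ^+ M * r ->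
  exists x, [/\ root P x, root D0 x, root D1 x & root D2 x].
Proof.
move=> r0 szr d0 d1 d2; have P0 : P != 0 by rewrite -size_poly_gt0 (leq_trans _ szr).
have := coprimep_div_gcd (p := P) (q := r); rewrite P0 => /(_ isT).
have : gcdp P r %| P /\ gcdp P r %| r by rewrite dvdp_gcdl dvdp_gcdr.
have : gcdp P r != 0 by rewrite gcdp_eq0 negb_and P0.
move: (gcdp P r) => g g0 [/dvdpP[E PE] /dvdpP[r' rE]].
have -> : P %/ g = E by rewrite PE mulpK.
have -> : r %/ g = r' by rewrite rE mulpK.
move=> cop.
have sE : size E != 1.
  apply: contraL szr => /eqP sE; rewrite -leqNgt.
  have E0 : E != 0 by rewrite -size_poly_gt0 sE.
  rewrite PE size_mul // sE add1n /=.
  by apply: dvdp_leq => //; rewrite rE dvdp_mull ?dvdpp.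
have Ed (D : {poly F}) : P %| D ^+ M * r -> E %| D ^+ M.
  rewrite PE rE mulrA dvdp_mul2r // mulrC => H.
  by rewrite (Gauss_dvdpr _ cop) in H.
have /closed_rootP[x Ex] := sE; exists x.
have rt (D : {poly F}) : P %| D ^+ M * r -> root D x.
  move=> /Ed /dvdpP[k DE]; have := congr1 (horner^~ x) DE.
  rewrite horner_exp hornerM (rootP Ex) mulr0 => /eqP.
  by rewrite expf_eq0 => /andP[_].
split; [by rewrite PE rootM Ex|exact: rt|exact: rt|exact: rt].
Qed.

Lemma unit_lead_map P v : lead_coef P \is a GRing.unit ->
  (meval v) (lead_coef P) != 0 /\ size (map_poly (meval v) P) = size P.
Proof.
move=> lu; have l0 : (meval v) (lead_coef P) != 0.
  by rewrite -unitfE; apply: rmorph_unit.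
by rewrite size_map_poly_id0.
Qed.

Lemma dvdp_modp_map P Q v : lead_coef P \is a GRing.unit ->
  map_poly (meval v) P %| map_poly (meval v) Q ->
  map_poly (meval v) (Q %% P) = 0.
Proof.
move=> lu; have [l0 sz] := unit_lead_map v lu.
have P0 : P != 0 by apply: contraTneq lu => ->; rewrite lead_coef0 unitr0.
have E := Pdiv.IdomainUnit.divp_eq lu Q.
rewrite {1}E (rmorphD (map_poly (meval v))) (rmorphM (map_poly (meval v))) /=.
rewrite dvdp_addr ?dvdp_mull ?dvdpp // => dv; apply/eqP; apply: contraT => r0.
have := dvdp_leq r0 dv; rewrite sz leqNgt => /negP[].
by apply: leq_ltn_trans (size_poly _ _) _; rewrite ltn_modp.
Qed.

(* [h' a] lies in [(p, h)] because it does so at every zero of [p]. *)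
Lemma euler_key p P Q N : prime_elt p -> lead_coef P \is a GRing.unit ->
  (exists a b, Q ^+ N = a * p%:P + b * P) ->
  exists a b, P^`() * Q = a * p%:P + b * P.
Proof.
move=> pp lu [a [b QN]].
have [|r rE] := @dvd_coefP _ p ((P^`() * Q) %% P); last first.
  exists r, ((P^`() * Q) %/ P); rewrite {1}(Pdiv.IdomainUnit.divp_eq lu (P^`() * Q)).
  by rewrite rE -mul_polyC addrC mulrC [r * _]mulrC.
move=> i; apply: prime_vanish => // v pv.
suff E : map_poly (meval v) ((P^`() * Q) %% P) = 0.
  by rewrite -[LHS]/(meval v _) -coef_map E coef0.
apply: dvdp_modp_map => //; rewrite (rmorphM (map_poly (meval v))) /= -deriv_map.
have [l0 sz] := unit_lead_map v lu.
apply: (dvdp_deriv_mul (N := N)).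
  by rewrite -size_poly_gt0 sz size_poly_gt0; apply: contraTneq lu => ->; rewrite lead_coef0 unitr0.
rewrite -(rmorphXn (map_poly (meval v))) /= QN (rmorphD (map_poly (meval v))).
rewrite !(rmorphM (map_poly (meval v))) /= map_polyC /= pv polyC0 mulr0 add0r.
by rewrite dvdp_mull ?dvdpp.
Qed.

(** Unmixedness made explicit. If [Q] were outside [(p, P)], then wherever a suitable coefficient of
    its remainder is nonzero on the zeros of [p], the polynomials [P], [D0], [D1], [D2] would share
    a root. A resultant spreads this to all zeros of [p], in particular to [v0]. *)
Lemma strip_key p P D0 D1 D2 Q M (v0 : 'I_n -> F) : prime_elt p ->
  lead_coef P \is a GRing.unit ->
  (exists a b, D0 ^+ M * Q = a * p%:P + b * P) ->
  (exists a b, D1 ^+ M * Q = a * p%:P + b * P) ->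
  (exists a b, D2 ^+ M * Q = a * p%:P + b * P) ->
  p.@[v0] = 0 ->
  (forall x, ~ [/\ root (map_poly (meval v0) P) x, root (map_poly (meval v0) D0) x,
     root (map_poly (meval v0) D1) x & root (map_poly (meval v0) D2) x]) ->
  exists a b, Q = a * p%:P + b * P.
Proof.
move=> pp lu H0 H1 H2 pv0 nocom.
have P0 : P != 0 by apply: contraTneq lu => ->; rewrite lead_coef0 unitr0.
have QE := Pdiv.IdomainUnit.divp_eq lu Q.
have [/dvd_coefP[r rE]|/not_all_ex_not[j nj]] := classic (forall i, dvdR p (Q %% P)`_i).
  exists r, (Q %/ P); rewrite {1}QE rE -mul_polyC addrC; congr (_ + _).
  by rewrite mulrC.
exfalso; set r := Q %% P in QE nj.
have szr : (size r < size P)%N by rewrite ltn_modp.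
pose K := (size D0 + size D1 + size D2)%N.
(* One resultant per [t] replaces a condition on three polynomials: a value of [q t] that vanishes
   for all [t] makes all three vanish. *)
pose q t := D0 + t%:MP *: D1 + (t ^+ 2)%:MP *: D2.
(* Adding a multiple of [P] changes no value at the roots of [P], and gives a unit leading
   coefficient, so that the resultant commutes with evaluation of the coefficients. *)
pose q' t := P * 'X^K + q t.
have szq t : (size (q t) <= K)%N.
  rewrite /q /K; apply: leq_trans (size_polyD _ _) _; rewrite geq_max; apply/andP; split.
    apply: leq_trans (size_polyD _ _) _; rewrite geq_max; apply/andP; split.
      by rewrite -addnA leq_addr.
    by apply: leq_trans (size_scale_leq _ _) _; rewrite -addnA addnCA leq_addr.
  by apply: leq_trans (size_scale_leq _ _) _; rewrite leq_addl.
have lq t : lead_coef (q' t) = lead_coef P.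
  rewrite lead_coefDl ?lead_coef_Mmonic ?monicXn // size_mulXn // (leq_ltn_trans (szq t)) //.
  by rewrite -[X in (X < _)%N]addn0 ltn_add2l size_poly_gt0.
have qE v t x : (map_poly (meval v) P).[x] = 0 -> (map_poly (meval v) (q' t)).[x] =
    (map_poly (meval v) D0).[x] + t * (map_poly (meval v) D1).[x] +
    t ^+ 2 * (map_poly (meval v) D2).[x].
  move=> Px; rewrite /q' /q -!mul_polyC !(rmorphD (map_poly (meval v))) /=.
  rewrite !(rmorphM (map_poly (meval v))) /= !map_polyC /= !mevalC.
  by rewrite !hornerD !hornerM !hornerC Px mul0r add0r.
have resE v t : (resultant P (q' t)).@[v] =
    resultant (map_poly (meval v) P) (map_poly (meval v) (q' t)).
  by rewrite -[LHS]/(meval v _) resultant_morph ?lq //; case: (unit_lead_map v lu).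
have pres t : dvdR p (resultant P (q' t)).
  have [_ _ /(_ r`_j (resultant P (q' t)))[]//] := pp.
  apply: prime_vanish => // v pv; rewrite mevalM.
  have [rv|rv] := eqVneq (r`_j).@[v] 0; first by rewrite rv mul0r.
  have fr0 : map_poly (meval v) r != 0.
    apply: contraNneq rv => E; rewrite -[_.@[v]]/(meval v _) -coef_map E coef0 //.
  have [l0 sz] := unit_lead_map v lu.
  have dv D : (exists a b, D ^+ M * Q = a * p%:P + b * P) ->
      map_poly (meval v) P %| map_poly (meval v) D ^+ M * map_poly (meval v) r.
    case=> a [b /(congr1 (map_poly (meval v)))].
    rewrite QE mulrDr (rmorphD (map_poly (meval v))) [RHS](rmorphD (map_poly (meval v))).
    rewrite !(rmorphM (map_poly (meval v))) /= map_polyC /= pv polyC0 mulr0 add0r.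
    rewrite (rmorphXn (map_poly (meval v))) /= => E.
    have -> : map_poly (meval v) D ^+ M * map_poly (meval v) r =
      (map_poly (meval v) b - map_poly (meval v) D ^+ M * map_poly (meval v) (Q %/ P)) *
      map_poly (meval v) P.
      by rewrite mulrBl -E; ring.
    by rewrite dvdp_mull ?dvdpp.
  have [|x [Px x0 x1 x2]] := dvdp_common_root fr0 _ (dv _ H0) (dv _ H1) (dv _ H2).
    by rewrite sz; apply: leq_ltn_trans (size_poly _ _) _.
  suff -> : (resultant P (q' t)).@[v] = 0 by rewrite mulr0.
  rewrite resE; apply/eqP; rewrite resultant_eq0.
  have : 'X - x%:P %| gcdp (map_poly (meval v) P) (map_poly (meval v) (q' t)).
    rewrite dvdp_gcd !dvdp_XsubCl Px /= rootE qE; last exact/rootP.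
    by rewrite (rootP x0) (rootP x1) (rootP x2) !mulr0 !addr0.
  move/dvdp_leq; rewrite size_XsubC; apply.
  rewrite gcdp_eq0 negb_and -size_poly_gt0 sz size_poly_gt0 P0 //.
have [l0 sz] := unit_lead_map v0 lu.
have [rs PvE] := closed_field_poly_normal (map_poly (meval v0) P).
pose ev D (x : F) := (map_poly (meval v0) D).[x].
(* The root at which [q t] vanishes may depend on [t]. The product over all roots of [P] at [v0]
   vanishes for every [t], hence is the zero polynomial, and so is one of its factors. *)
have : \prod_(x <- rs) ((ev D0 x)%:P + ev D1 x *: 'X + ev D2 x *: 'X^2) == 0 :> {poly F}.
  apply: contraT => /poly_nonroot[t]; rewrite horner_prod => /eqP[].
  have : (resultant P (q' t)).@[v0] = 0.
    by have [c ->] := pres t; rewrite mevalM pv0 mulr0.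
  rewrite resE => /eqP; rewrite resultant_eq0 => sg.
  have /closed_rootP[x] : size (gcdp (map_poly (meval v0) P) (map_poly (meval v0) (q' t))) != 1.
    by rewrite neq_ltn sg orbT.
  rewrite root_gcd => /andP[Px /rootP]; rewrite qE; last exact/rootP.
  move=> E; have xrs : x \in rs.
    move: Px; rewrite {1}PvE rootZ ?root_prod_XsubC // lead_coef_eq0 -size_poly_gt0 sz.
    by rewrite size_poly_gt0.
  rewrite (big_rem x) //= hornerD hornerD !hornerZ hornerC hornerX hornerXn.
  rewrite (_ : _ + _ = 0) ?mul0r // -[RHS]E /ev; ring.
rewrite prodf_seq_eq0 => /hasP[x xrs /= /eqP E].
have c k := congr1 (fun q : {poly F} => q`_k) E.
have := c 0; rewrite !coefD !coefZ !coefC coefX coefXn /= !mulr0 !addr0 => e0.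
have := c 1; rewrite !coefD !coefZ !coefC coefX coefXn /= mulr0 mulr1 addr0 add0r => e1.
have := c 2; rewrite !coefD !coefZ !coefC coefX coefXn /= mulr0 mulr1 !add0r => e2.
apply: (nocom x); split; try exact/rootP.
by rewrite PvE rootZ ?root_prod_XsubC // lead_coef_eq0 -size_poly_gt0 sz size_poly_gt0.
Qed.

Lemma polyC_ndvd P p : (1 < size P)%N -> p != 0 -> ~ dvdR P p%:P.
Proof.
move=> sP p0 [q E]; have q0 : q != 0.
  by apply: contraNneq p0 => q0; rewrite -polyC_eq0 E q0 mul0r.
have P0 : P != 0 by rewrite -size_poly_gt0 ltnW.
have := congr1 (fun q : {poly {mpoly F[n]}} => size q) E.
rewrite size_polyC p0 size_mul // -(prednK (n := size q)) ?size_poly_gt0 //.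
by move: sP; case: (size P) => [|[|k]] // _; rewrite !addnS !addSn.
Qed.

Lemma eqm_ideal P Q p a : eqm P Q (p%:P * a) -> exists a b, Q = a * p%:P + b * P.
Proof. by case=> b E; exists a, b; rewrite -E; ring. Qed.

(** Each prime of the denominator costs one factor [P^]()[:]euler_key[puts]P^[() * Q] in the ideal
    [(p, P)], and after division by [p] the new numerator is still integral over the remaining
    product. *)
Lemma euler_all P Q (ps : seq {mpoly F[n]}) : prime_elt P ->
  lead_coef P \is a GRing.unit -> (1 < size P)%N ->
  {in ps, forall p, prime_elt p} -> integ P Q (\prod_(p <- ps) p)%:P ->
  exists b, eqm P (P^`() ^+ size ps * Q) ((\prod_(p <- ps) p)%:P * b).
Proof.
move=> PP lu sP; elim: ps Q => [|p ps IH] Q psP.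
  by rewrite big_nil => _; exists Q; rewrite expr0; apply: eqm_refl.
rewrite big_cons; set s := \prod_(_ <- _) _ => -[N [c cE]].
have pp : prime_elt p by apply: psP; rewrite mem_head.
have [|a [b PQ]] := @euler_key p P Q N pp lu.
  case: cE => k; rewrite subr0 => /(canRL (addrK _)) ->.
  exists (- \sum_(j < N) c j * Q ^+ j * ((p * s)%:P ^+ (N - j).-1 * s%:P)), k.
  rewrite addrC; congr (_ + _); rewrite mulNr mulr_suml; congr (- _).
  apply: eq_bigr => j _; rewrite -{1}(prednK (n := (N - j)%N)) ?subn_gt0 // exprSr.
  by rewrite {2}polyCM -!mulrA [s%:P * p%:P]mulrC.
have paE : eqm P (p%:P * a) (P^`() * Q) by exists (- b); rewrite PQ; ring.
have [||b' E] := IH a.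
- by move=> q qs; apply: psP; rewrite inE qs orbT.
- apply: (integ_div PP _ paE); last by exists N, c; rewrite -polyCM.
  by apply: polyC_ndvd => //; case: pp.
exists b'; rewrite /= exprSr -mulrA PQ.
apply: (@eqm_trans _ _ (p%:P * (P^`() ^+ size ps * a))).
  by exists (P^`() ^+ size ps * b); ring.
by apply: eqm_trans (eqmMl _ E) _; rewrite polyCM mulrA; apply: eqm_refl.
Qed.

Lemma strip_all P D0 D1 D2 Q M (ps : seq {mpoly F[n]}) : prime_elt P ->
  lead_coef P \is a GRing.unit -> (1 < size P)%N ->
  {in ps, forall p, prime_elt p} ->
  {in ps, forall p, exists2 v0, p.@[v0] = 0 &
    forall x, ~ [/\ root (map_poly (meval v0) P) x, root (map_poly (meval v0) D0) x,
     root (map_poly (meval v0) D1) x & root (map_poly (meval v0) D2) x]} ->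
  (exists b, eqm P (D0 ^+ M * Q) ((\prod_(p <- ps) p)%:P * b)) ->
  (exists b, eqm P (D1 ^+ M * Q) ((\prod_(p <- ps) p)%:P * b)) ->
  (exists b, eqm P (D2 ^+ M * Q) ((\prod_(p <- ps) p)%:P * b)) ->
  exists b, eqm P Q ((\prod_(p <- ps) p)%:P * b).
Proof.
move=> PP lu sP; elim: ps Q => [|p ps IH] Q psP vP H0 H1 H2.
  by exists Q; rewrite big_nil polyC1 mul1r; apply: eqm_refl.
have pp : prime_elt p by apply: psP; rewrite mem_head.
have [v0 pv0 nocom] := vP p (mem_head _ _).
have dv D : (exists b, eqm P (D ^+ M * Q) ((\prod_(p <- p :: ps) p)%:P * b)) ->
    exists a b, D ^+ M * Q = a * p%:P + b * P.
  by case=> b; rewrite big_cons polyCM -mulrA => /eqm_ideal.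
have [a [b QE]] := strip_key pp lu (dv _ H0) (dv _ H1) (dv _ H2) pv0 nocom.
have tr D : (exists b, eqm P (D ^+ M * Q) ((\prod_(p <- p :: ps) p)%:P * b)) ->
    exists b, eqm P (D ^+ M * a) ((\prod_(p <- ps) p)%:P * b).
  case=> b' E; exists b'; apply: (@eqm_cancel _ _ p%:P) => //.
    by apply: polyC_ndvd => //; case: pp.
  rewrite [X in eqm _ _ X]mulrA -polyCM; apply: eqm_trans (_ : eqm _ _ (D ^+ M * Q)) _.
    by rewrite QE; exists (- (D ^+ M * b)); ring.
  by move: E; rewrite big_cons.
have [||b' E] := IH a _ _ (tr _ H0) (tr _ H1) (tr _ H2).
- by move=> q qs; apply: psP; rewrite inE qs orbT.
- by move=> q qs; apply: vP; rewrite inE qs orbT.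
exists b'; rewrite big_cons polyCM -mulrA.
apply: (@eqm_trans _ _ (p%:P * a)); last exact: eqmMl.
by rewrite QE; exists b; ring.
Qed.

End PolyKeys.

(** * Homogeneous components and substitution of forms *)

Section Homogeneous.
Variables (F : fieldType) (n : nat).
Implicit Types (p q a : {mpoly F[n]}) (m : 'X_{1..n}).

Lemma mcoeff_pihomog w p m : (pihomog mdeg w p)@_m = if mdeg m == w then p@_m else 0.
Proof.
rewrite (pihomogwE _ _ (leqnn (msize p))).
case: ifP => [/eqP mw|mw]; last first.
  apply: dhomog_nemf_coeff (negbT mw); apply: rpred_sum => k /eqP kw.
  by apply: dhomogZ; rewrite dhomogX kw.
have [pm|pm] := boolP (m \in msupp p); last first.
  rewrite raddf_sum /= (memN_msupp_eq0 pm) big1 // => k _; rewrite mcoeffZ mcoeffX.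
  by case: eqP => [->|]; rewrite ?(memN_msupp_eq0 pm) ?mul0r ?mulr0.
rewrite raddf_sum /= (bigD1 (BMultinom (msize_mdeg_lt pm))) /= ?mw //.
rewrite mcoeffZ mcoeffX eqxx mulr1 big1 ?addr0 // => k /andP[_ kE].
rewrite mcoeffZ mcoeffX; case: eqP => [E|]; last by rewrite mulr0.
by case/eqP: kE; apply/val_inj.
Qed.

Lemma homog_eq0 p : (forall w, pihomog mdeg w p = 0) -> p = 0.
Proof.
move=> H; apply/mpolyP => m; rewrite mcoeff0; have := mcoeff_pihomog (mdeg m) p m.
by rewrite eqxx H mcoeff0 => <-.
Qed.

Lemma homog_neq0 p : p != 0 -> exists w, pihomog mdeg w p != 0.
Proof.
move=> p0; apply: NNPP => /not_ex_all_not H; case/eqP: p0.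
by apply: homog_eq0 => w; apply/eqP; apply: contraT => /H.
Qed.

Lemma pihomogMl e a w p : a \is e.-homog ->
  pihomog mdeg (e + w) (a * p) = a * pihomog mdeg w p.
Proof.
move=> ae; have pE := @pihomog_partitionE _ _ mdeg _ p (leqnn _).
have -> : pihomog mdeg w p = \sum_(k < mmeasure mdeg p) pihomog mdeg w (pihomog mdeg k p).
  by rewrite {1}pE raddf_sum.
rewrite {1}pE mulr_sumr raddf_sum /= mulr_sumr; apply: eq_bigr => k _.
have hk := dhomogM ae (pihomogP mdeg k p).
have [<-|ne] := eqVneq (k : nat) w; first by rewrite (pihomog_dE hk) pihomog_id.
rewrite (pihomog_ne0 _ hk) ?eqn_add2l // (pihomog_ne0 ne (pihomogP mdeg k p)) mulr0 //.
Qed.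

Lemma pihomogM_lt e a w p : a \is e.-homog -> (w < e)%N -> pihomog mdeg w (a * p) = 0.
Proof.
move=> ae we; rewrite {1}[p](@pihomog_partitionE _ _ mdeg _ _ (leqnn _)).
rewrite mulr_sumr raddf_sum /=; apply: big1 => k _.
have hk := dhomogM ae (pihomogP mdeg k p).
by rewrite (pihomog_ne0 _ hk) // neq_ltn (leq_trans we) ?leq_addr ?orbT.
Qed.

Lemma homog_dvd e w a b : a \is e.-homog -> b \is w.-homog -> dvdR a b -> b != 0 ->
  exists2 c, c \is (w - e).-homog & b = c * a /\ (e <= w)%N.
Proof.
move=> ae bw [c E] b0; have [lt|le] := ltnP w e.
  by case/eqP: b0; rewrite -(pihomog_dE bw) E mulrC (pihomogM_lt _ ae lt).
exists (pihomog mdeg (w - e) c); first exact: pihomogP.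
by split=> //; rewrite -(pihomog_dE bw) {1}E mulrC -(subnKC le) (pihomogMl _ _ ae) addKn mulrC.
Qed.

Lemma meval_homog d p x t : p \is d.-homog ->
  p.@[fun i => t * x i] = t ^+ d * p.@[x].
Proof.
move=> pd; rewrite !mevalE mulr_sumr; apply: eq_big_seq => b bs.
have /dhomogP/(_ b bs) /= mb := pd.
rewrite mulrCA; congr (_ * _); rewrite -mb mdegE -prodrXr -big_split /=.
by apply: eq_bigr => i _; rewrite exprMn.
Qed.

Lemma mderiv_homog d p i : p \is d.-homog -> mderiv i p \is d.-1.-homog.
Proof.
move=> pd; apply/dhomogP => m; rewrite mcoeff_msupp mcoeff_deriv /= => pm.
apply/eqP; apply: contraNT pm => /eqP md.
rewrite (dhomog_nemf_coeff pd) ?mul0rn //; apply: contra_notN md => /eqP <-.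
by rewrite /= mdegD mdeg1 addn1.
Qed.

Lemma homog_prod (I : eqType) (r : seq I) (P : pred I) (E : I -> {mpoly F[n]}) (w : I -> nat) :
  (forall i, P i -> E i \is (w i).-homog) ->
  \prod_(i <- r | P i) E i \is (\sum_(i <- r | P i) w i).-homog.
Proof.
move=> H; elim/big_rec2: _ => [|i x y Pi yx]; first by rewrite dhomog1.
by apply: dhomogM => //; apply: H.
Qed.

End Homogeneous.

Section Composition.
Variables (F : fieldType) (k n : nat).
Implicit Types (g : 'I_k -> {mpoly F[n]}) (p q : {mpoly F[k]}).

Definition cmp g p : {mpoly F[n]} := mmap (@mpolyC n F) g p.
HB.instance Definition _ g := GRing.RMorphism.copy (cmp g) (mmap (@mpolyC n F) g).

Lemma cmpD g p q : cmp g (p + q) = cmp g p + cmp g q. Proof. exact: rmorphD. Qed.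
Lemma cmpB g p q : cmp g (p - q) = cmp g p - cmp g q. Proof. exact: rmorphB. Qed.
Lemma cmpM g p q : cmp g (p * q) = cmp g p * cmp g q. Proof. exact: rmorphM. Qed.
Lemma cmpXn g p e : cmp g (p ^+ e) = cmp g p ^+ e. Proof. exact: rmorphXn. Qed.
Lemma cmp0 g : cmp g 0 = 0. Proof. exact: rmorph0. Qed.
Lemma cmp1 g : cmp g 1 = 1. Proof. exact: rmorph1. Qed.
Lemma cmpC g c : cmp g c%:MP = c%:MP. Proof. exact: mmapC. Qed.
Lemma cmpX g i : cmp g 'X_i = g i. Proof. by rewrite /cmp mmapX mmap1U. Qed.
Lemma cmpZ g c p : cmp g (c *: p) = c *: cmp g p.
Proof. by rewrite /cmp mmapZ mul_mpolyC. Qed.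
Lemma cmpXm g m : cmp g 'X_[m] = \prod_i g i ^+ m i.
Proof. by rewrite /cmp mmapX. Qed.
Lemma cmp_sum g (I : Type) (r : seq I) (P : pred I) E :
  cmp g (\sum_(i <- r | P i) E i) = \sum_(i <- r | P i) cmp g (E i).
Proof. exact: rmorph_sum. Qed.

Lemma meval_cmp g p v : (cmp g p).@[v] = p.@[fun i => (g i).@[v]].
Proof.
elim/mpolyind: p => [|c m p _ _ IH]; first by rewrite cmp0 !meval0.
rewrite cmpD !mevalD IH cmpZ !mevalZ cmpXm mevalX; congr (_ * _ + _).
by rewrite rmorph_prod; apply: eq_bigr => i _; rewrite rmorphXn.
Qed.

Lemma cmp_homog g p e w : (forall i, g i \is e.-homog) -> p \is w.-homog ->
  cmp g p \is (e * w).-homog.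
Proof.
move=> ge pw; rewrite (mpolyE p) cmp_sum big_seq; apply: rpred_sum => m mp.
rewrite cmpZ cmpXm; apply: dhomogZ; rewrite -(dhomog_mf pw mp) [(mdeg : measure k) m]mdegE big_distrr /=.
by apply: homog_prod => i _; apply: dhomogMn.
Qed.

End Composition.

Lemma cmp_cmp (F : fieldType) k n l (g : 'I_n -> {mpoly F[l]})
    (f : 'I_k -> {mpoly F[n]}) p :
  cmp g (cmp f p) = cmp (fun i => cmp g (f i)) p.
Proof.
elim/mpolyind: p => [|c m p _ _ IH]; first by rewrite !cmp0.
rewrite !cmpD !cmpZ !cmpXm IH rmorph_prod; congr (_ *: _ + _).
by apply: eq_bigr => i _; rewrite rmorphXn.
Qed.

Lemma cmp_id (F : fieldType) n (p : {mpoly F[n]}) : cmp (fun i => 'X_i) p = p.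
Proof.
elim/mpolyind: p => [|c m p _ _ IH]; first by rewrite !cmp0.
by rewrite cmpD cmpZ cmpXm IH -mpolyXE_id.
Qed.

#[global] Opaque cmp.

(** * Normality of a hypersurface with few singularities *)

Section IntegLemmas.
Variables (R : idomainType) (h : R).

Lemma integ_scale v a s : integ h a s -> integ h (v * a) (v * s).
Proof.
case=> N [c E]; exists N, c; apply: (@eqm_trans _ _ (v ^+ N * 0)); last first.
  by rewrite mulr0; apply: eqm_refl.
apply: eqm_trans (eqmMl _ E); apply: eq_eqm; rewrite mulrDr exprMn; congr (_ + _).
rewrite mulr_sumr; apply: eq_bigr => j _; have jN := subnKC (ltnW (ltn_ord j)).
have -> : v ^+ N = v ^+ j * v ^+ (N - j) by rewrite -exprD jN.
by rewrite !exprMn; ring.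
Qed.

Lemma integ_eqm a s s' : eqm h s s' -> integ h a s -> integ h a s'.
Proof.
move=> ss [N [c E]]; exists N, c; apply: eqm_trans E.
apply: eqmD; first exact: eqm_refl.
by apply: eqm_sum => j _; apply/eqmMl/eqmX/eqm_sym.
Qed.

Lemma bezout_eqm s u v c x : c = u * h + v * s -> eqm h (x * v * s) (x * c).
Proof. by move=> ->; exists (- (x * u)); ring. Qed.

Lemma bezout_dvd s u v c x w : c = u * h + v * s -> w * x = 1 -> dvdR h (x * v) -> dvdR h c.
Proof.
move=> -> wx [k kE]; exists (u + w * k * s).
have -> : v = w * (x * v) by rewrite mulrA wx mul1r.
by rewrite kE; ring.
Qed.

Lemma eqm_combine V D D' a s b : eqm h (D * a) (s * b) ->
  eqm h (D' * D * (V * a)) (V * s * (D' * b)).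
Proof.
case=> k E; exists (D' * V * k); rewrite -[D' * V * k * h]mulrA -E; ring.
Qed.

Lemma eqm_uncombine v c D a s b : prime_elt h -> ~ dvdR h v ->
  eqm h (D * (v * a)) (c * b) -> eqm h (v * s) c -> eqm h (D * a) (s * b).
Proof.
move=> hp nv E vE; apply: (eqm_cancel hp nv); rewrite mulrCA [X in eqm _ _ X]mulrA.
by apply: eqm_trans E _; apply/eqmMr/eqm_sym.
Qed.

End IntegLemmas.

Lemma integ_morph (R S : idomainType) (f : {rmorphism R -> S}) h a s :
  integ h a s -> integ (f h) (f a) (f s).
Proof.
case=> N [c [k]]; rewrite subr0 => E; exists N, (f \o c), (f k); rewrite subr0.
rewrite -rmorphM -E rmorphD rmorphXn rmorph_sum; congr (_ + _).
by apply: eq_bigr => j _; rewrite !rmorphM !rmorphXn.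
Qed.

Section Muni.
Variables (F : fieldType) (n : nat).
Local Notation wd := (widen_ord (leqnSn n)).

Lemma muni_deriv (p : {mpoly F[n.+1]}) : muni (mderiv ord_max p) = (muni p)^`().
Proof.
elim/mpolyind: p => [|c m p _ _ IH]; first by rewrite mderiv0 muni0 deriv0.
have E : muni (mderiv ord_max (c *: 'X_[m])) = (muni (c *: 'X_[m] : {mpoly F[n.+1]}))^`().
  rewrite mderivZ mderivX !muniZ !muniX !derivZ derivXn.
  have -> : [multinom (m - U_(ord_max))%MM (wd i) | i < n] = [multinom m (wd i) | i < n].
    apply/mnmP => i; rewrite !mnmE; case: eqP => [/(congr1 val) /= E|_]; last by rewrite subn0.
    by have := ltn_ord i; rewrite -E ltnn.
  rewrite mnmBE mnm1E eqxx subn1 /= -!mul_polyC -mulr_natr mulr_natr.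
  rewrite -[X in _ = _ * (_ * X)]mulr_natr.
  by rewrite [in LHS]mpolyCMn mpolyC1 polyCMn; ring.
rewrite mderivD !muniD derivD; exact: (f_equal2 +%R E IH).
Qed.

Lemma mdeg_max e (m : 'X_{1..n.+1}) i : mdeg m = e -> (e <= m i)%N -> m = (U_(i) *+ e)%MM.
Proof.
rewrite mdegE (bigD1 i) //= => me le; apply/mnmP => j; rewrite mulmnE mnm1E.
have r0 : (\sum_(k < n.+1 | k != i) m k = 0)%N.
  by apply/eqP; rewrite -leqn0 -(leq_add2l (m i)) me addn0.
have [<-|ij] := eqVneq i j; first by rewrite mul1n -me r0 addn0.
by rewrite mul0n; apply/eqP; move/eqP: r0; rewrite sum_nat_eq0 => /forallP/(_ j);
  rewrite eq_sym ij.
Qed.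

Lemma muni_lead e (h : {mpoly F[n.+1]}) : h \is e.-homog -> h@_(U_(ord_max) *+ e) != 0 ->
  size (muni h) = e.+1 /\ lead_coef (muni h) \is a GRing.unit.
Proof.
move=> hh h0.
have ce : (muni h)`_e = (h@_(U_(ord_max) *+ e))%:MP.
  rewrite muniE coef_sum (bigD1_seq (U_(ord_max) *+ e)%MM) ?msupp_uniq ?mcoeff_msupp //=.
  rewrite big_seq_cond big1 ?addr0 => [|m /andP[mh mU]].
    rewrite coefZ coefXn mulmnE mnm1E eqxx mul1n eqxx mulr1.
    rewrite (_ : [multinom _ | _ < _] = 0%MM) ?mpolyX0 ?alg_mpolyC //.
    apply/mnmP=> i; rewrite !mnmE mulmnE mnm1E; case: eqP => // /(congr1 val) /= E.
    by have := ltn_ord i; rewrite -E ltnn.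
  rewrite coefZ coefXn; case: eqP => [E|]; last by rewrite mulr0.
  by case/eqP: mU; apply: mdeg_max; [exact: (dhomog_mf hh mh)|rewrite E].
have se : (size (muni h) <= e.+1)%N.
  rewrite muniE big_seq; apply: (big_ind (fun q : {poly _} => (size q <= e.+1)%N)).
  - by rewrite size_poly0.
  - by move=> p q sp sq; rewrite (leq_trans (size_polyD _ _)) // geq_max sp.
  move=> m mh; rewrite (leq_trans (size_scale_leq _ _)) // size_polyXn ltnS.
  by rewrite -[e](dhomog_mf hh mh) /= mdegE (bigD1 ord_max) //= leq_addr.
have sz : size (muni h) = e.+1.
  apply/eqP; rewrite eqn_leq se ltnNge; apply: contra h0 => sl.
  by rewrite -(mpolyC_eq n) -ce nth_default // mpolyC0.
by rewrite lead_coefE sz /= ce; split=> //; apply: rmorph_unit; rewrite unitfE.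
Qed.

Lemma pihomog_mwiden w (c : {mpoly F[n]}) :
  pihomog mdeg w (mwiden c) = mwiden (pihomog mdeg w c).
Proof.
elim/mpolyind: c => [|c m p _ _ IH]; first by rewrite mwiden0 !pihomog0 mwiden0.
have mw : mdeg (mnmwiden m) = mdeg m.
  rewrite !mdegE big_ord_recr /= mnmwiden_ordmax addn0.
  by apply: eq_bigr => i _; rewrite mnmwiden_widen.
have E : pihomog mdeg w (mwiden (c *: 'X_[m])) = mwiden (pihomog mdeg w (c *: 'X_[m])).
  rewrite mwidenZ mwidenX !linearZ /= mwidenZ.
  have H : ('X_[mnmwiden m] : {mpoly F[n.+1]}) \is (mdeg m).-homog by rewrite dhomogX; apply/eqP.
  have H' : ('X_[m] : {mpoly F[n]}) \is (mdeg m).-homog by rewrite dhomogX.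
  have [<-|ne] := eqVneq (mdeg m) w; first by rewrite !pihomog_dE // mwidenX.
  by rewrite (pihomog_ne0 ne H) (pihomog_ne0 ne H') mwiden0.
rewrite mwidenD !pihomogD mwidenD; exact: (f_equal2 +%R E IH).
Qed.

End Muni.

Section Swap.
Variables (F : fieldType) (n : nat) (i j : 'I_n).
Local Notation sw := (@msym n F (tperm i j)).

Lemma swapK : involutive sw.
Proof.
move=> p; apply/mpolyP => m; rewrite !mcoeff_sym; congr mcoeff.
by apply/mnmP => k; rewrite !mnmE tpermK.
Qed.

Lemma swap_deriv p : mderiv j (sw p) = sw (mderiv i p).
Proof.
apply/mpolyP => m; rewrite mcoeff_deriv !mcoeff_sym mcoeff_deriv mnmE tpermL.
congr (_ *+ _); congr mcoeff; apply/mnmP => k; rewrite !mnmE; congr (_ + (_ : bool))%N.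
by rewrite -{1}(tpermL i j) (inj_eq perm_inj).
Qed.

Lemma swap_homog e p : p \is e.-homog -> sw p \is e.-homog.
Proof.
move=> pe; apply/dhomogP => m; rewrite mcoeff_msupp mcoeff_sym => pm.
apply/eqP; apply: contraNT pm => /eqP me; rewrite (dhomog_nemf_coeff pe) //.
apply: contra_notN me => /eqP <-; rewrite /= !mdegE [LHS](reindex_perm (tperm i j)) /=.
by apply: eq_bigr => k _; rewrite mnmE.
Qed.

Lemma swap_coef e p : (sw p)@_(U_(j) *+ e) = p@_(U_(i) *+ e).
Proof.
rewrite mcoeff_sym; congr mcoeff; apply/mnmP => k; rewrite mnmE !mulmnE !mnm1E.
by rewrite -{1}(tpermL i j) (inj_eq perm_inj).
Qed.

End Swap.

Section Normal.
Variables (F : closedFieldType) (n : nat).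
Local Notation wd := (widen_ord (leqnSn n)).
Implicit Types (h s a : {mpoly F[n.+1]}).

Lemma prime_muni h : prime_elt h -> prime_elt (muni h).
Proof. exact: (prime_iso (@muniK F n) (@mjoinK F n)). Qed.

Lemma eqm_muni h a b : eqm h a b -> eqm (muni h) (muni a) (muni b).
Proof. by case=> c E; exists (muni c); rewrite -muniB E muniM. Qed.

Lemma eqm_mjoin h a b : eqm (muni h) (muni a) (muni b) -> eqm h a b.
Proof. by move=> E; apply: (dvdR_iso (@muniK F n)); rewrite /= muniB. Qed.

Lemma dvdR_muni a b : dvdR a b -> dvdR (muni a) (muni b).
Proof. by case=> c ->; exists (muni c); rewrite muniM. Qed.

Lemma muni_exp k a : muni (a ^+ k) = muni a ^+ k. Proof. exact: rmorphXn. Qed.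

Lemma integ_muni h a s : integ h a s -> integ (muni h) (muni a) (muni s).
Proof. exact: integ_morph. Qed.

Lemma mjoin_bezout h s c u v : c%:P = u * muni h + v * muni s ->
  mwiden c = mjoin u * h + mjoin v * s.
Proof.
move=> E; rewrite -mjoinC E mjoinD; apply: (f_equal2 +%R); rewrite mjoinM.
  by rewrite (muniK h).
by rewrite (muniK s).
Qed.

Lemma ndvd_muni h a : ~ dvdR h a -> ~ dvdR (muni h) (muni a).
Proof. by move=> H /(dvdR_iso (@muniK F n)). Qed.

(** A Bezout relation in the last variable multiplies [s] into a denominator without that variable,
    which then splits into primes. *)
Lemma elim_last h s : prime_elt h -> (1 < size (muni h))%N -> ~ dvdR h s ->
  exists ps v, [/\ {in ps, forall p, prime_elt p},
     eqm (muni h) (muni v * muni s) (\prod_(p <- ps) p)%:P & ~ dvdR h v].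
Proof.
move=> hp sz hs; have PP := prime_muni hp.
have [c [u [v [c0 cE]]]] := coprimep_const (prime_coprimep PP sz (ndvd_muni hs)).
have [w [ps [wu psP cF]]] := factorial_mpoly c0.
exists ps, (mjoin (w^-1%:P * v)); split=> //.
  have -> : \prod_(p <- ps) p = w^-1 * c by rewrite cF mulrA mulVr ?mul1r.
  rewrite mjoinK polyCM; exact: bezout_eqm cE.
move/dvdR_muni; rewrite mjoinK => H.
apply: (@polyC_ndvd _ _ (muni h) c sz c0); apply: (bezout_dvd (w := w%:P) cE _ H).
by rewrite -polyCM divrr // polyC1.
Qed.

Lemma euler_last e h s a : prime_elt h -> h \is e.-homog -> (0 < e)%N ->
  h@_(U_(ord_max) *+ e) != 0 -> ~ dvdR h s -> integ h a s ->
  exists M b, eqm h (mderiv ord_max h ^+ M * a) (s * b).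
Proof.
move=> hp hh e0 h0 hs ia; have [sz lu] := muni_lead hh h0.
have [|ps [v [psP vE nv]]] := elim_last hp _ hs; first by rewrite sz ltnS.
have PP := prime_muni hp.
have [|||b bE] := @euler_all _ _ (muni h) (muni v * muni a) ps PP lu; rewrite ?sz //.
  by apply: (integ_eqm vE); apply: integ_scale; apply: integ_muni.
exists (size ps), (mjoin b); apply: eqm_mjoin; rewrite !muniM mjoinK muni_exp muni_deriv.
exact: (eqm_uncombine PP (ndvd_muni nv) bE vE).
Qed.

Lemma euler_dir i e h s a : prime_elt h -> h \is e.-homog -> (0 < e)%N ->
  h@_(U_(i) *+ e) != 0 -> ~ dvdR h s -> integ h a s ->
  exists M b, eqm h (mderiv i h ^+ M * a) (s * b).
Proof.
move=> hp hh e0 h0 hs ia; pose sw := @msym n.+1 F (tperm i ord_max).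
have swK : involutive sw := @swapK _ _ _ _.
have [||||||M [b [k E]]] := @euler_last e (sw h) (sw s) (sw a).
- exact: (prime_iso swK swK).
- exact: swap_homog.
- by [].
- by rewrite swap_coef.
- by move/(dvdR_iso swK).
- exact: (integ_morph (@msym n.+1 F (tperm i ord_max)) ia).
exists M, (sw b), (sw k); have := congr1 sw E.
rewrite /sw swap_deriv rmorphB !rmorphM rmorphXn /= !swapK; exact.
Qed.

(** Serre's criterion by hand: powers of three partial derivatives of [h] clear the denominator of
    [a / s], and they can be stripped off again because every prime of the denominator has a zero
    above which [h] and the three partials do not meet. *)
Theorem normal_integ e m h s a (j1 j2 : 'I_n) : prime_elt h -> h \is e.-homog -> (0 < e)%N ->
  h@_(U_(ord_max) *+ e) != 0 -> h@_(U_(wd j1) *+ e) != 0 -> h@_(U_(wd j2) *+ e) != 0 ->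
  j1 != j2 ->
  (forall x : 'I_n.+1 -> F, (forall i, i != ord_max -> i != wd j1 -> i != wd j2 -> x i = 0) ->
     h.@[x] = 0 -> (mderiv ord_max h).@[x] = 0 -> (mderiv (wd j1) h).@[x] = 0 ->
     (mderiv (wd j2) h).@[x] = 0 -> forall i, x i = 0) ->
  s \is m.-homog -> ~ dvdR h s -> integ h a s -> exists b, eqm h a (s * b).
Proof.
move=> hp hh e0 c0 c1 c2 j12 plane sm hs ia; have [sz lu] := muni_lead hh c0.
have PP := prime_muni hp; have sz1 : (1 < size (muni h))%N by rewrite sz ltnS.
have [M0 [b0 E0]] := euler_dir hp hh e0 c0 hs ia.
have [M1 [b1 E1]] := euler_dir hp hh e0 c1 hs ia.
have [M2 [b2 E2]] := euler_dir hp hh e0 c2 hs ia.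
have [c [u [v [cn0 cE]]]] := coprimep_const (prime_coprimep PP sz1 (ndvd_muni hs)).
have [w cw0] := homog_neq0 cn0; set cw := pihomog mdeg w c in cw0.
(* Passing to one homogeneous component of the Bezout relation makes the denominator [cw] a form,
   which is what forces its prime factors to vanish at the origin. *)
have [V VE] : exists V, eqm h (V * s) (mwiden cw).
  have /(congr1 (pihomog mdeg w)) := mjoin_bezout cE.
  rewrite pihomog_mwiden pihomogD -/cw => ->.
  have [lt|le] := ltnP w m.
    exists 0; rewrite mul0r [mjoin v * s]mulrC (pihomogM_lt _ sm lt) addr0.
    apply/eqm_sym/eqm0; have [lt'|le'] := ltnP w e.
      by rewrite mulrC (pihomogM_lt _ hh lt'); apply: dvdR0.
    by rewrite mulrC -(subnKC le') (pihomogMl _ _ hh); apply/dvdR_mulr/dvdR_refl.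
  exists (pihomog mdeg (w - m) (mjoin v)); apply: eqm_sym; rewrite /eqm.
  rewrite [mjoin v * s]mulrC -{2}(subnKC le) (pihomogMl _ _ sm) [s * _]mulrC addrK.
  have [lt'|le'] := ltnP w e.
    by rewrite mulrC (pihomogM_lt _ hh lt'); apply: dvdR0.
  by rewrite mulrC -(subnKC le') (pihomogMl _ _ hh); apply/dvdR_mulr/dvdR_refl.
have [wu [ps [wuu psP cF]]] := factorial_mpoly cw0.
have ncw : ~ dvdR h (mwiden cw).
  by move=> /dvdR_muni; rewrite muni_mwiden; apply: polyC_ndvd.
have nV : ~ dvdR h V.
  move=> [k kE]; apply: ncw; apply/eqm0; apply: eqm_trans (eqm_sym VE) _.
  by rewrite kE mulrAC; apply: eqm_dvd.
pose M := (M0 + M1 + M2)%N.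
have up D Mk b : eqm h (D ^+ Mk * a) (s * b) -> (Mk <= M)%N ->
    exists b, eqm (muni h) (muni D ^+ M * muni (V * a)) ((\prod_(p <- ps) p)%:P * b).
  move=> E le; exists (wu%:P * muni (D ^+ (M - Mk) * b)).
  have := eqm_muni (eqm_trans (eqm_combine V (D ^+ (M - Mk)) E) (eqmMr _ VE)).
  have -> : muni (D ^+ (M - Mk) * D ^+ Mk * (V * a)) = muni D ^+ M * muni (V * a).
    by rewrite -exprD subnK // muniM muni_exp.
  suff -> : muni (mwiden cw * (D ^+ (M - Mk) * b)) =
    (\prod_(p <- ps) p)%:P * (wu%:P * muni (D ^+ (M - Mk) * b)) by [].
  by rewrite muniM muni_mwiden cF polyCM -mulrA mulrCA.
(* A prime factor of [cw] vanishes at the origin, hence at a nonzero [v0] of the plane of [j1] and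
   [j2]. A common root above [v0] would be a nonzero point excluded by [plane]. *)
have vP : {in ps, forall p, exists2 v0, p.@[v0] = 0 &
    forall x, ~ [/\ root (map_poly (meval v0) (muni h)) x,
     root (map_poly (meval v0) (muni (mderiv ord_max h))) x,
     root (map_poly (meval v0) (muni (mderiv (wd j1) h))) x &
     root (map_poly (meval v0) (muni (mderiv (wd j2) h))) x]}.
  move=> p pps; have [_ pu _] := psP p pps.
  have p0 : p.@[fun _ => 0] = 0.
    apply: (homog_factor (pihomogP mdeg w c)) => //; rewrite -/cw cF (big_rem p) //=.
    by apply/dvdR_mull/dvdR_mulr/dvdR_refl.
  have [v0 [pv0 v0n v0s]] := plane_zero j12 p0; exists v0 => // x [].
  have [y [yx yv]] := extend_point v0 x.
  have H (p' : {mpoly F[n.+1]}) : root (map_poly (meval v0) (muni p')) x -> p'.@[y] = 0.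
    by move/rootP; rewrite (meval_muni_ext p' yv) yx.
  move=> /H z0 /H z1 /H z2 /H z3.
  have y0 : forall i, y i = 0.
    apply: plane => // i i0 i1 i2; have [lt|ge] := ltnP i n.
      have iE : i = wd (Ordinal lt) by apply/val_inj.
      rewrite iE -[y _]/((y \o wd) _) yv; apply: v0s.
        by apply: contraNneq i1 => E; rewrite iE E.
      by apply: contraNneq i2 => E; rewrite iE E.
    by case/eqP: i0; apply/val_inj/eqP; rewrite eqn_leq ge -ltnS ltn_ord.
  by case/orP: v0n => /eqP[]; rewrite -yv /= y0.
have [b bE] := strip_all PP lu sz1 psP vP
  (up _ _ _ E0 (leq_trans (leq_addr _ _) (leq_addr _ _)))
  (up _ _ _ E1 (leq_trans (leq_addl _ _) (leq_addr _ _)))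
  (up _ _ _ E2 (leq_addl _ _)).
exists (mjoin (wu^-1%:P * b)); apply: (@eqm_cancel _ _ V) => //.
rewrite mulrA; apply: eqm_trans (eqmMr _ (eqm_sym VE)); apply: eqm_mjoin.
apply: eqm_trans bE _; rewrite muniM muni_mwiden mjoinK mulrA -polyCM cF mulrAC divrr //.
by rewrite mul1r; apply: eqm_refl.
Qed.

End Normal.

(** * Free extensions: coordinates, norms, duality *)

Section Weights.
Variables (F : fieldType) (N G : nat).
Implicit Types (p q : {mpoly F[N]}) (w : int).

(* [p] is zero or homogeneous of weight [w] when each variable has weight [G]. *)
Definition wt w p := p = 0 \/ exists2 j : nat, Posz (G * j) = w & p \is j.-homog.

Lemma wt0 w : wt w 0. Proof. by left. Qed.
Lemma wtD w p q : wt w p -> wt w q -> (0 < G)%N -> wt w (p + q).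
Proof.
move=> [->|[j jw pj]] [->|[k kw qk]] G0; rewrite ?addr0 ?add0r; try (by left);
  try (by right; eexists; eauto).
right; exists j => //; apply: rpredD => //.
have <- // : k = j by apply/eqP; rewrite -(eqn_pmul2l G0); apply/eqP; lia.
Qed.
Lemma wt_sum w (I : Type) (r : seq I) (P : pred I) (E : I -> {mpoly F[N]}) : (0 < G)%N ->
  (forall i, P i -> wt w (E i)) -> wt w (\sum_(i <- r | P i) E i).
Proof.
move=> G0 H; elim/big_rec: _ => [|i x Pi Hx]; first exact: wt0.
by apply: wtD => //; apply: H.
Qed.
Lemma wtM w w' p q : wt w p -> wt w' q -> wt (w + w') (p * q).
Proof.
move=> [->|[j jw pj]] [->|[k kw qk]]; rewrite ?mulr0 ?mul0r; try (by left).
right; exists (j + k)%N; last exact: dhomogM.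
by rewrite mulnDr PoszD jw kw.
Qed.
Lemma wt_deriv w p i : wt w p -> wt (w - Posz G) (mderiv i p).
Proof.
move=> [->|[[|j] jw pj]]; first by rewrite mderiv0; left.
  left; suff -> : p = (p@_0%MM)%:MP by rewrite mderivC.
  apply/mpolyP => m; rewrite mcoeffC; have [->|m0] := eqVneq m 0%MM; rewrite ?mulr1 // mulr0.
  by apply: (dhomog_nemf_coeff pj); rewrite /= mdeg_eq0.
right; exists j; last exact: (mderiv_homog i pj).
rewrite -jw mulnS PoszD; lia.
Qed.
Lemma wt_homog w j p : wt w p -> w = Posz (G * j) -> (0 < G)%N -> p \is j.-homog.
Proof.
move=> [->|[k kw pk]] wj G0; first exact: dhomog0.
by have <- // : k = j by apply/eqP; rewrite -(eqn_pmul2l G0); apply/eqP; lia.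
Qed.

End Weights.

Section Free.
Variables (F : fieldType) (N : nat).
Local Notation R := {mpoly F[N]}.

(* [R] is free over its subring [F[g]], with a homogeneous basis, and the coordinate
   of top degree induces a perfect pairing. *)
Record fstruct (g : 'I_N -> R) (G : nat) := FStruct {
  frank : nat;
  fbas : 'I_frank -> R;
  fdeg : 'I_frank -> nat;
  fco : R -> 'I_frank -> R;
  ftop : 'I_frank;
  fs_gt0 : (0 < G)%N;
  fs_homog : forall i, g i \is G.-homog;
  fs_bas : forall s, fbas s \is (fdeg s).-homog;
  fs_expand : forall a, a = \sum_s cmp g (fco a s) * fbas s;
  fs_free : forall c, \sum_s cmp g (c s) * fbas s = 0 -> forall s, c s = 0;
  fs_top : fdeg ftop = (N * G.-1)%N;
  fs_nondeg : forall a, (forall c, fco (a * c) ftop = 0) -> a = 0;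
  fs_rep : forall th : R -> R,
    (forall p a b, th (cmp g p * a + b) = p * th a + th b) ->
    exists t, forall a, th a = fco (t * a) ftop }.

Arguments fbas [g G] f s.
Arguments fdeg [g G] f s.
Arguments fco [g G] f a s.
Arguments fs_bas [g G] f s.

Variables (g : 'I_N -> R) (G : nat) (S : fstruct g G).
Local Notation r := (frank S).
Local Notation b := (fbas S).
Local Notation co := (fco S).

Lemma fco_eq a (c : 'I_r -> R) : a = \sum_s cmp g (c s) * b s -> forall s, co a s = c s.
Proof.
move=> aE s; apply/eqP; rewrite -subr_eq0; apply/eqP.
apply: (fs_free (f := S) (c := fun s => co a s - c s)).
rewrite -[RHS](subrr a) {3}aE {2}[a](fs_expand S) -sumrB.
by apply: eq_bigr => t _; rewrite cmpB mulrBl.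
Qed.

Lemma fco_lin p a a' s : co (cmp g p * a + a') s = p * co a s + co a' s.
Proof.
apply: (fco_eq (c := fun s => p * co a s + co a' s)).
rewrite {1}[a](fs_expand S) {1}[a'](fs_expand S) mulr_sumr -big_split /=.
by apply: eq_bigr => t _; rewrite cmpD cmpM mulrDl mulrA.
Qed.

Lemma fco0 s : co 0 s = 0.
Proof. by have := fco_lin (-1) 0 0 s; rewrite mulr0 addr0 mulN1r addNr. Qed.

Lemma fcoM p a s : co (cmp g p * a) s = p * co a s.
Proof. by rewrite -[cmp g p * a]addr0 fco_lin fco0 addr0. Qed.

Lemma fcoD a a' s : co (a + a') s = co a s + co a' s.
Proof. by rewrite -[a]mul1r -(cmp1 g) fco_lin cmp1 !mul1r. Qed.

Lemma fco_sum (I : Type) (q : seq I) (P : pred I) (E : I -> R) s :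
  co (\sum_(i <- q | P i) E i) s = \sum_(i <- q | P i) co (E i) s.
Proof. by elim/big_rec2: _ => [|i x y Pi <-]; rewrite ?fco0 ?fcoD. Qed.

Lemma fcoB a a' s : co (a - a') s = co a s - co a' s.
Proof.
rewrite fcoD; congr (_ + _); rewrite -mulN1r -[RHS]mulN1r -(fcoM (-1)).
by congr (co (_ * _) _); rewrite -mpolyC1 -mpolyCN cmpC.
Qed.

(** By uniqueness of coordinates, discarding the components of wrong degree does not change them.
    The weight is an integer, so that a negative one simply means that the coordinate is zero. *)
Lemma fco_wt w a s : a \is w.-homog -> wt G (Posz w - Posz (fdeg S s)) (co a s).
Proof.
move=> aw; have G0 := fs_gt0 S.
have hc (j : nat) : (G * j + fdeg S s != w)%N -> pihomog mdeg j (co a s) = 0.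
  move=> jw; pose c t := \sum_(k < msize (co a t) | (G * k + fdeg S t == w)%N)
    pihomog mdeg k (co a t).
  suff cE : co a s = c s.
    rewrite cE raddf_sum /=; apply: big1 => k /eqP kw.
    apply: (pihomog_ne0 (d := k)); last exact: pihomogP.
    by apply: contraNneq jw => <-; rewrite kw.
  apply: fco_eq; rewrite -{1}(pihomog_dE aw) {1}[a](fs_expand S) raddf_sum /=.
  apply: eq_bigr => t _; have pE := @pihomog_partitionE _ _ mdeg _ (co a t) (leqnn _).
  rewrite {1}pE cmp_sum mulr_suml raddf_sum /= /c cmp_sum mulr_suml [RHS]big_mkcond /=.
  apply: eq_bigr => k _; have hk := dhomogM (cmp_homog (fs_homog S) (pihomogP mdeg k (co a t)))
    (fs_bas S t).
  case: eqP => [E|/eqP ne]; first by rewrite pihomog_dE // -E.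
  exact: (pihomog_ne0 ne hk).
have [le|lt] := leqP (fdeg S s) w; last first.
  by left; apply: homog_eq0 => j; apply: hc; lia.
have [/dvdnP[j jE]|ndv] := boolP (G %| w - fdeg S s)%N; last first.
  left; apply: homog_eq0 => j; apply: hc; apply: contraNneq ndv => E.
  by apply/dvdnP; exists j; lia.
right; exists j; first by lia.
have -> // : co a s = pihomog mdeg j (co a s); last exact: pihomogP.
apply/eqP; rewrite -subr_eq0; apply/eqP/homog_eq0 => k; rewrite raddfB /=.
have [->|ne] := eqVneq k j; first by rewrite pihomog_id subrr.
rewrite (pihomog_ne0 _ (pihomogP mdeg j _)) 1?eq_sym // subr0; apply: hc.
apply: contraNneq ne => E; apply/eqP; have /eqP : (G * k = G * j)%N by lia.
by rewrite eqn_pmul2l // => /eqP.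
Qed.

Definition fth a := co a (ftop S).

Lemma fth_wt w a : a \is w.-homog -> wt G (Posz w - Posz (N * G.-1)%N) (fth a).
Proof. by move/fco_wt => /(_ (ftop S)); rewrite fs_top. Qed.

Definition mulm a : 'M[R]_r := \matrix_(s, t) co (a * b t) s.

Lemma mulmE a c s : co (a * c) s = \sum_t mulm a s t * co c t.
Proof.
rewrite {1}[c](fs_expand S) mulr_sumr fco_sum; apply: eq_bigr => t _.
by rewrite mulrCA fcoM mxE mulrC.
Qed.

Lemma mulmM a c : mulm (a * c) = mulm a *m mulm c.
Proof.
apply/matrixP => s t; rewrite !mxE -mulrA mulmE.
by apply: eq_bigr => k _; rewrite !mxE.
Qed.

Lemma mulm_cmp p : mulm (cmp g p) = p%:M.
Proof.
apply/matrixP => s t; rewrite !mxE fcoM -mulr_natr; congr (_ * _).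
rewrite (fco_eq (c := fun s => (s == t)%:R)) // (bigD1 t) //= eqxx cmp1 mul1r.
by rewrite big1 ?addr0 // => k /negPf->; rewrite cmp0 mul0r.
Qed.

Lemma mulmC a c : mulm a *m mulm c = mulm c *m mulm a.
Proof. by rewrite -!mulmM mulrC. Qed.

Definition fnorm a := \det (mulm a).

Lemma fnormM a c : fnorm (a * c) = fnorm a * fnorm c.
Proof. by rewrite /fnorm mulmM det_mulmx. Qed.

Lemma fnorm_cmp p : fnorm (cmp g p) = p ^+ r.
Proof. by rewrite /fnorm mulm_cmp det_scalar. Qed.

Lemma fnorm_dvd a p : dvdR a (cmp g p) -> dvdR (fnorm a) (p ^+ r).
Proof. by case=> c E; exists (fnorm c); rewrite -fnorm_cmp E fnormM. Qed.

(** The cofactor has as coordinates the adjugate of [mulm a] applied to the coordinates of [1]. *)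
Lemma dvd_fnorm a : dvdR a (cmp g (fnorm a)).
Proof.
pose v t := co 1 t; pose c s := \sum_t (\adj (mulm a)) s t * v t.
exists (\sum_s cmp g (c s) * b s); rewrite [RHS](fs_expand S) [LHS](fs_expand S).
apply: eq_bigr => s _; congr (cmp g _ * _); rewrite mulrC mulmE.
have -> : \sum_t mulm a s t * co (\sum_s cmp g (c s) * b s) t =
    \sum_t mulm a s t * c t.
  by apply: eq_bigr => t _; rewrite (fco_eq (c := c)).
rewrite -[cmp g _]mulr1 fcoM /c.
under eq_bigr do rewrite mulr_sumr.
rewrite exchange_big /=.
have E t : \sum_k mulm a s k * (\adj (mulm a) k t * v t) = (fnorm a *+ (s == t)) * v t.
  have := congr1 (fun M : 'M_r => M s t) (mul_mx_adj (mulm a)); rewrite !mxE => <-.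
  by rewrite mulr_suml; apply: eq_bigr => k _; rewrite mulrA.
rewrite (eq_bigr _ (fun t _ => E t)) (bigD1 s) //= eqxx mulr1n big1 ?addr0 // => t ts.
by rewrite eq_sym (negPf ts) mulr0n mul0r.
Qed.

Lemma cmp_inj p : cmp g p = 0 -> p = 0.
Proof.
move=> E; apply: (fs_free (f := S) (c := fun=> p)) (ftop S).
by rewrite big1 // => s _; rewrite E mul0r.
Qed.

Lemma fnorm_neq0 a : a != 0 -> fnorm a != 0.
Proof.
move=> a0; apply/negP; rewrite /fnorm -det_tr => /det0P[v v0 vE]; case/eqP: v0.
pose x := \sum_s cmp g (v 0 s) * b s.
have xE s : co x s = v 0 s by apply: fco_eq.
have : a * x = 0.
  rewrite [LHS](fs_expand S) big1 // => s _; rewrite mulmE.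
  have := congr1 (fun M : 'rV_r => M 0 s) vE; rewrite !mxE => E.
  rewrite (eq_bigr (fun t => v 0 t * (mulm a)^T t s)) => [|t _].
    by rewrite E cmp0 mul0r.
  by rewrite xE [_^T t s]mxE mulrC.
move/eqP; rewrite mulf_eq0 (negPf a0) /= => /eqP x0.
by apply/rowP => s; rewrite -xE x0 fco0 mxE.
Qed.

(* If all [Theta (q c a)] are divisible by [H], the quotients form a linear functional,
   which the pairing represents. *)
Lemma dual_dvd h q H c : h * q = cmp g H -> H != 0 ->
  (forall a, dvdR H (fth (q * c * a))) -> dvdR h c.
Proof.
move=> hq H0 dv.
have ex a : exists x, fth (q * c * a) == x * H by have [x ->] := dv a; exists x.
pose th a := xchoose (ex a).
have thE a : fth (q * c * a) = th a * H by apply/eqP/(xchooseP (ex a)).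
have [|t tE] := @fs_rep _ _ S th.
  move=> p a a'; apply: (mulIf H0); rewrite mulrDl -mulrA -!thE /fth -fcoM -fcoD.
  by congr (co _ _); ring.
have : q * c - cmp g H * t = 0.
  apply: (@fs_nondeg _ _ S) => a; rewrite mulrBl fcoB -[co _ _]/(fth _) thE tE.
  by rewrite -mulrA fcoM mulrC subrr.
move/eqP; rewrite subr_eq0 -hq => /eqP E.
have q0 : q != 0.
  by apply: contraNneq H0 => q0; apply/eqP/cmp_inj; rewrite -hq q0 mulr0.
by exists t; apply: (mulfI q0); rewrite E; ring.
Qed.

End Free.

Arguments fbas [F N g G] f s.
Arguments fdeg [F N g G] f s.
Arguments fco [F N g G] f a s.
Arguments fs_bas [F N g G] f s.
Arguments fth [F N g G] S a.
Arguments mulm [F N g G] S a.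
Arguments fnorm [F N g G] S a.

(** Jacobi's formula, obtained by differentiating one row at a time and expanding along that row. *)
Lemma mderiv_det (F : fieldType) n r (i : 'I_n) (M : 'M[{mpoly F[n]}]_r) :
  mderiv i (\det M) = \tr (map_mx (mderiv i) M *m \adj M).
Proof.
have derP (I : eqType) (s : seq I) (E : I -> {mpoly F[n]}) : uniq s ->
    mderiv i (\prod_(k <- s) E k) =
    \sum_(k <- s) mderiv i (E k) * \prod_(l <- s | l != k) E l.
  elim: s => [|k s IH] /=; first by rewrite !big_nil -mpolyC1 mderivC.
  case/andP=> ks us; rewrite !big_cons mderivM eqxx /= IH //; congr (_ + _).
    congr (_ * _); rewrite big_seq [RHS]big_seq_cond; apply: eq_bigl => l.
    by have [ls|//] := boolP (l \in s); apply/esym/(contraNneq _ ks) => <-.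
  rewrite mulr_sumr; apply: eq_big_seq => l ls.
  have kl : k != l by apply: contraNneq ks => ->.
  rewrite big_cons kl; exact: mulrCA.
rewrite /determinant raddf_sum /= /mxtrace.
transitivity (\sum_(k < r) \sum_(s : 'S_r) (-1) ^+ s *
    (mderiv i (M k (s k)) * \prod_(l < r | l != k) M l (s l))).
  rewrite exchange_big; apply: eq_bigr => s _; rewrite -signr_odd -mulr_sumr.
  rewrite -(derP _ (index_enum _)) ?index_enum_uniq //.
  by case: (odd s); rewrite ?expr0 ?mul1r // expr1 !mulN1r mderivN.
apply: eq_bigr => k _; rewrite !mxE.
pose M' := \matrix_(a, c) if a == k then mderiv i (M k c) else M a c.
transitivity (\det M').
  apply: eq_bigr => s _; congr (_ * _); rewrite [RHS](bigD1 k) //= !mxE eqxx; congr (_ * _).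
  by apply: eq_bigr => l lk; rewrite mxE (negPf lk).
rewrite (expand_det_row _ k); apply: eq_bigr => c _; rewrite [M' k c]mxE eqxx ![in RHS]mxE.
apply: (f_equal2 *%R); first by [].
rewrite /cofactor; apply: (f_equal2 *%R); first by [].
congr (\det _); apply/matrixP => a d; rewrite !mxE.
by rewrite eq_sym (negPf (neq_lift _ _)).
Qed.

(** * Integrality of the trace on an invariant subspace *)

Section TensorSum.
Variables (R : comNzRingType) (r : nat).

Fixpoint tdim m : nat := if m is m'.+1 then tdim m' * r else 1.

(* The derivation induced by [M] on the [m]-th tensor power: its eigenvalues are
   the sums of [m] eigenvalues of [M]. *)
Fixpoint tsum (M : 'M[R]_r) m : 'M[R]_(tdim m) :=
  if m is m'.+1 then tsum M m' *t 1%:M + 1%:M *t M else 0.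

(** A monic polynomial, with coefficients polynomial in the entries of [M], that vanishes at every
    sum of at most [r] eigenvalues. It is thus an equation for the trace of [M] on any invariant
    subspace, independent of the subspace. *)
Definition tpoly M : {poly R} := \prod_(m < r.+1) char_poly (tsum M m).

Lemma tpoly_monic M : tpoly M \is monic.
Proof. by apply: monic_prod => m _; apply: char_poly_monic. Qed.

End TensorSum.

Lemma map_tsum (R S : comNzRingType) (f : {rmorphism R -> S}) r (M : 'M[R]_r) m :
  map_mx f (tsum M m) = tsum (map_mx f M) m.
Proof.
elim: m => [|m IH] /=; first by rewrite map_mx0.
by rewrite map_mxD !map_mxT IH !map_mx1.
Qed.

Lemma map_tpoly (R S : comNzRingType) (f : {rmorphism R -> S}) r (M : 'M[R]_r) :
  map_poly f (tpoly M) = tpoly (map_mx f M).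
Proof.
rewrite /tpoly rmorph_prod; apply: eq_bigr => m _.
by rewrite [LHS]map_char_poly map_tsum.
Qed.

Section TraceIntegral.
Variable F : closedFieldType.

Lemma tens_eigen m k (K : 'M[F]_m) (M : 'M[F]_k) (v : 'rV_m) (w : 'rV_k) a c :
  v *m K = a *: v -> w *m M = c *: w -> v != 0 -> w != 0 ->
  (v *t w) *m (K *t 1%:M + 1%:M *t M) = (c + a) *: (v *t w) /\ v *t w != 0.
Proof.
move=> vE wE v0 w0; split.
  rewrite mulmxDr !tensmx_mul !mulmx1 vE wE scalerDl addrC.
  by congr (_ + _); apply/matrixP => i j; rewrite !mxE; ring.
have /rV0Pn[i vi] := v0; have /rV0Pn[j wj] := w0.
apply/eqP => /matrixP /(_ (mxtens_index (0, 0)) (mxtens_index (i, j))).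
by rewrite tensmxE mxE => /eqP; rewrite mulf_eq0 (negPf vi) (negPf wj).
Qed.

Lemma tsum_eigen r (M : 'M[F]_r) (ls : seq F) :
  (forall l, l \in ls -> exists2 v : 'rV_r, v *m M = l *: v & v != 0) ->
  exists2 v : 'rV_(tdim r (size ls)),
    v *m tsum M (size ls) = (\sum_(l <- ls) l) *: v & v != 0.
Proof.
elim: ls => [|l ls IH] H /=.
  by exists 1%:M; rewrite ?mulmx0 ?big_nil ?scale0r // oner_neq0.
have [|v vE v0] := IH; first by move=> k kl; apply: H; rewrite inE kl orbT.
have [w wE w0] := H l (mem_head _ _).
have [E nz] := tens_eigen vE wE v0 w0.
by exists (v *t w : 'M_(1 * 1, _)); rewrite ?big_cons.
Qed.

Lemma trace_roots r (B : 'M[F]_r) : exists2 ls : seq F,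
  (forall l, l \in ls -> eigenvalue B l) & size ls = r /\ \tr B = \sum_(l <- ls) l.
Proof.
have [ls lsE] := closed_field_poly_normal (char_poly B).
move: lsE; rewrite (monicP (char_poly_monic B)) scale1r => lsE.
have sz : size ls = r.
  by have := size_char_poly B; rewrite lsE size_prod_XsubC => -[].
exists ls; first by move=> l ll; rewrite eigenvalue_root_char lsE root_prod_XsubC.
split=> //; have [r0|r0] := posnP r.
  have /size0nil -> : size ls = 0 by rewrite sz.
  rewrite big_nil /mxtrace big1 // => i.
  by have := ltn_ord i; rewrite {2}r0.
apply: oppr_inj; rewrite -char_poly_trace // lsE -sz coefPn_prod_XsubC //.
by rewrite sz -lt0n.
Qed.

(** The second hypothesis says that the row space of [P] is stable under [M]. The trace is that of
    the restriction [B], whose eigenvalues are eigenvalues of [M], at most [r] in number. *)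
Lemma idempotent_trace r (P M : 'M[F]_r) : P *m P = P -> P *m M *m P = P *m M ->
  root (tpoly M) (\tr (P *m M)).
Proof.
move=> PP PM; pose D := row_base P; pose C := col_base P.
have CD : C *m D = P by apply: mulmx_base.
have DC : D *m C = 1%:M.
  apply: (row_full_inj (col_base_full P)); apply: (row_free_inj (row_base_free P)).
  by rewrite mulmx1 -/C -/D mulmxA CD -mulmxA CD PP.
pose B := D *m M *m C.
have BD : B *m D = D *m M.
  have DP : D *m P = D by rewrite -[X in D *m X]CD mulmxA DC mul1mx.
  rewrite /B -[LHS]mulmxA CD; transitivity (D *m (P *m M *m P)).
    by rewrite !mulmxA DP.
  by rewrite PM mulmxA DP.
have tE : \tr (P *m M) = \tr B by rewrite -[X in X *m M]CD -mulmxA mxtrace_mulC.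
have [ls lsB [sz ltr]] := trace_roots B.
have [|v vE v0] := @tsum_eigen r M ls.
  move=> l /lsB /eigenvalueP[v vE v0]; exists (v *m D).
    by rewrite -mulmxA -BD mulmxA vE -scalemxAl.
  by apply: contraNneq v0 => E; rewrite -[v]mulmx1 -DC mulmxA E mul0mx.
have lr : (size ls < r.+1)%N by rewrite ltnS sz rank_leq_row.
rewrite tE ltr /tpoly /root horner_prod; apply/eqP.
rewrite (bigD1 (Ordinal lr)) //=; apply/eqP; rewrite mulf_eq0; apply/orP; left.
by rewrite -[_ == 0]/(root _ _) -eigenvalue_root_char; apply/eigenvalueP; exists v.
Qed.

Variable n : nat.
Implicit Types H K : {mpoly F[n]}.

(** At a zero of [H] where [K] is nonzero, [P / K] is an idempotent with [M]-stable row space, so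
    [tpoly M] homogenized by [K] vanishes there; [prime_vanish] makes this a congruence. *)
Lemma trace_integ H K r (P M : 'M[{mpoly F[n]}]_r) : prime_elt H -> ~ dvdR H K ->
  (forall s t, eqm H ((P *m P) s t) (K * P s t)) ->
  (forall s t, eqm H ((P *m M *m P) s t) (K * (P *m M) s t)) ->
  integ H (\tr (P *m M)) K.
Proof.
move=> HP HK PP PM; set x := \tr _; have [_ _ pH] := HP.
have mon := tpoly_monic M; set Q := tpoly M in mon *; set L := (size Q).-1.
exists L, (fun j => Q`_j); apply/eqm0.
have -> : x ^+ L = Q`_L * x ^+ L * K ^+ (L - L).
  by rewrite subnn mulr1 /L -lead_coefE (monicP mon) mul1r.
rewrite addrC; pose E j := Q`_j * x ^+ j * K ^+ (L - j).
have -> : \sum_(j < L) Q`_j * x ^+ j * K ^+ (L - j) + Q`_L * x ^+ L * K ^+ (L - L) =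
  \sum_(j < L.+1) E j by rewrite big_ord_recr.
(* The extra factor [K] disposes of the zeros of [H] at which [K] vanishes. *)
have [|/HK//|//] := pH K (\sum_(j < L.+1) E j).
apply: prime_vanish => // y Hy; rewrite mevalM.
have [->|Ky] := eqVneq K.@[y] 0; first by rewrite mul0r.
pose ev := @meval n F y; pose P' := (ev K)^-1 *: map_mx ev P; pose M' := map_mx ev M.
have ev_eqm a b : eqm H a b -> ev a = ev b.
  case=> c /(congr1 ev); rewrite /ev mevalB mevalM Hy mulr0 => /eqP.
  by rewrite subr_eq0 => /eqP.
have PPE : map_mx ev P *m map_mx ev P = ev K *: map_mx ev P.
  rewrite -map_mxM; apply/matrixP => s t; rewrite !mxE.
  by have := ev_eqm _ _ (PP s t); rewrite /ev mevalM mxE.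
have PME : map_mx ev P *m M' *m map_mx ev P = ev K *: (map_mx ev P *m M').
  rewrite -!map_mxM; apply/matrixP => s t.
  by have := ev_eqm _ _ (PM s t); rewrite /ev mevalM !mxE.
have : root (tpoly M') (\tr (P' *m M')).
  apply: idempotent_trace.
    by rewrite -scalemxAl -scalemxAr PPE !scalerA; congr (_ *: _); field.
  by rewrite -!scalemxAl -scalemxAr PME !scalerA; congr (_ *: _); field.
have -> : \tr (P' *m M') = ev x / ev K.
  by rewrite -scalemxAl mxtraceZ -map_mxM trace_map_mx mulrC.
rewrite /M' -map_tpoly -/Q /root => /eqP rE.
have -> : (\sum_(j < L.+1) E j).@[y] = ev K ^+ L * (map_poly ev Q).[ev x / ev K].
  have sQ : size (map_poly ev Q) = L.+1.
    rewrite size_map_poly_id0; last by rewrite (monicP mon) /ev rmorph1 oner_neq0.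
    by rewrite prednK // size_poly_gt0 monic_neq0.
  rewrite horner_coef sQ mulr_sumr [LHS](rmorph_sum (meval y)); apply: eq_bigr => j _.
  have -> : ev K ^+ L = ev K ^+ (L - j) * ev K ^+ j by rewrite -exprD subnK // leq_ord.
  have evX a k : (a ^+ k).@[y] = a.@[y] ^+ k by exact: rmorphXn.
  rewrite -[LHS]/((Q`_j * x ^+ j * K ^+ (L - j)).@[y]) mevalM mevalM !evX coef_map expr_div_n.
  have fin (c X k : F) i l : k != 0 -> c * X ^+ i * k ^+ l = k ^+ l * k ^+ i * (c * (X ^+ i / k ^+ i)).
    by move=> k0; field; rewrite expf_neq0.
  exact: fin.
by rewrite rE !mulr0.
Qed.

End TraceIntegral.

(** * Auxiliary congruences, dual functionals and a depth argument for monomials *)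

Section Aux.
Variables (F : fieldType) (N : nat).
Local Notation R := {mpoly F[N]}.
Implicit Types (h H q a b p : R).

Lemma dvd_homog_comp e h p w : h \is e.-homog -> dvdR h p -> dvdR h (pihomog mdeg w p).
Proof.
move=> hh [c ->]; rewrite mulrC; have [lt|le] := ltnP w e.
  by rewrite (pihomogM_lt _ hh lt); apply: dvdR0.
by rewrite -(subnKC le) (pihomogMl _ _ hh); apply/dvdR_mulr/dvdR_refl.
Qed.

Lemma homog0C p : p \is 0.-homog -> p = (p@_0%MM)%:MP.
Proof.
move=> p0; apply/mpolyP => m; rewrite mcoeffC.
have [->|m0] := eqVneq m 0%MM; rewrite ?mulr1 // mulr0.
by apply: (dhomog_nemf_coeff p0); rewrite /= mdeg_eq0.
Qed.

Lemma cmp_pihomog g G p w : (0 < G)%N -> (forall i : 'I_N, g i \is G.-homog) ->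
  pihomog mdeg (G * w) (cmp g p : R) = cmp g (pihomog mdeg w p : R).
Proof.
move=> G0 gG; have pE := @pihomog_partitionE _ _ mdeg _ p (leqnn _).
have -> : pihomog mdeg w p = \sum_(k < mmeasure mdeg p) pihomog mdeg w (pihomog mdeg k p).
  by rewrite {1}pE raddf_sum.
rewrite {1}pE !cmp_sum raddf_sum; apply: eq_bigr => k _ /=.
have hk := cmp_homog gG (pihomogP mdeg k p).
have [<-|ne] := eqVneq (k : nat) w; first by rewrite (pihomog_dE hk) pihomog_id.
by rewrite (pihomog_ne0 _ hk) ?eqn_pmul2l // (pihomog_ne0 ne (pihomogP mdeg k p)) cmp0.
Qed.

Lemma eqm_cmp g H h a b : dvdR h (cmp g H) -> eqm H a b -> eqm h (cmp g a) (cmp g b : R).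
Proof.
by move=> hH [c E]; rewrite /eqm -cmpB E cmpM; apply: dvdR_mull.
Qed.

Lemma cmp2_lin (g f : 'I_N -> R) c p q : cmp g (cmp f (c *: p + q)) =
  c%:MP * cmp g (cmp f p) + cmp g (cmp f q).
Proof. by rewrite -mul_mpolyC cmpD cmpM cmpC cmpD cmpM cmpC. Qed.

Lemma fthM g G (S : fstruct g G) p a : fth S (cmp g p * a) = p * fth S a.
Proof. exact: fcoM. Qed.

Lemma fth_eqm g G (S : fstruct g G) h q H a b : h * q = cmp g H ->
  eqm h a b -> eqm H (fth S (q * a)) (fth S (q * b)).
Proof.
move=> hq [c E]; exists (fth S c); rewrite [fth S c * H]mulrC -fthM -hq /fth -fcoB.
by congr (fco _ _ _); rewrite -mulrBr E; ring.
Qed.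

Lemma eqm_homog_cmp w h (X B : 'I_N -> R) k p :
  (forall j, eqm h (B k * X j) (B j * X k)) -> p \is w.-homog ->
  eqm h (B k ^+ w * cmp X p) (X k ^+ w * cmp B p).
Proof.
move=> XB pw; rewrite (mpolyE p) !cmp_sum !mulr_sumr big_seq [X in eqm _ _ X]big_seq.
apply: eqm_sum => m mp; rewrite !cmpZ -!scalerAr -!mul_mpolyC; apply: eqmMl.
rewrite !cmpXm -(dhomog_mf pw mp) /= mdegE -!prodrXr -!big_split /=.
apply: eqm_prod => i _; rewrite -!exprMn; apply: eqmX.
by rewrite [X in eqm _ _ X]mulrC; apply: XB.
Qed.

End Aux.

Lemma natr_neq0 (F : fieldType) k : [pchar F] =i pred0 -> (0 < k)%N -> k%:R != 0 :> F.
Proof. by move=> /pcharf0P ->; rewrite lt0n. Qed.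

Section Aux2.
Variables (F : fieldType) (N G : nat).
Local Notation R := {mpoly F[N]}.

Lemma wt_pihomog w (p : R) j : wt G w p -> (0 < G)%N ->
  pihomog mdeg j p = if Posz (G * j) == w then p else 0.
Proof.
move=> [->|[k kw pk]] G0; first by rewrite pihomog0 if_same.
case: eqP => [E|ne]; last first.
  by apply: pihomog_ne0 pk; apply/eqP => E; apply: ne; rewrite -E.
by rewrite pihomog_dE //; have <- // : k = j by apply/eqP; rewrite -(eqn_pmul2l G0); apply/eqP; lia.
Qed.

Lemma wt_component K (x : nat -> R) (y : R) (c : int) k : (0 < G)%N ->
  (forall i, wt G (c + Posz i) (x i)) -> wt G (c + Posz k) y -> (k < K)%N ->
  y = \sum_(i < K) x i -> y = x k.
Proof.
move=> G0 xw yw kK yE.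
have key j : Posz (G * j) = c + Posz k -> y = x k.
  move=> jE; have := congr1 (pihomog mdeg j) yE.
  rewrite (wt_pihomog _ yw) // jE eqxx => ->; rewrite raddf_sum /=.
  rewrite (bigD1 (Ordinal kK)) //= (wt_pihomog _ (xw k)) // jE eqxx big1 ?addr0 // => i ik.
  rewrite (wt_pihomog _ (xw i)) // jE; case: eqP => // E; case/eqP: ik.
  by apply/val_inj => /=; lia.
have [y0|[j jE _]] := yw; last exact: key jE.
have [x0|[j jE _]] := xw k; last exact: key jE.
by rewrite y0 x0.
Qed.

(** The functional [a -> th (h * a) / H] is represented by some [t] through the perfect pairing, and
    [h * q = H(g)] converts this back to [th]. So [q] generates the dual of the quotient by [h],
    which is its canonical module. *)
Lemma dual_rep (g : 'I_N -> R) (S : fstruct g G) h q H (th : R -> R) :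
  h * q = cmp g H -> H != 0 ->
  (forall p a b, th (cmp g p * a + b) = p * th a + th b) ->
  (forall a, dvdR H (th (h * a))) -> exists t, forall a, th a = fth S (t * (q * a)).
Proof.
move=> hq H0 lin dv.
have ex a : exists x, th (h * a) == x * H by have [x ->] := dv a; exists x.
pose xi a := xchoose (ex a).
have xiE a : th (h * a) = xi a * H by apply/eqP/(xchooseP (ex a)).
have th0 : th 0 = 0 by have := lin (-1) 0 0; rewrite mulr0 addr0 mulN1r addNr.
have [|t tE] := @fs_rep _ _ _ _ S xi.
  move=> p a b; apply: (mulIf H0); rewrite mulrDl -mulrA -!xiE -lin.
  by congr (th _); rewrite mulrDr mulrCA.
exists t => a; apply: (mulIf H0); rewrite /fth -tE -xiE mulrA hq mulrC.
by rewrite -[cmp g H * a]addr0 lin th0 addr0.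
Qed.

Lemma coef_monM (k : 'X_{1..N}) (q : R) m : ('X_[k] * q)@_(m + k) = q@_m.
Proof.
by rewrite mulrC addmC mcoeffMX.
Qed.

Lemma coef_monM_lt (i : 'I_N) k (q : R) (m : 'X_{1..N}) : (m i < k)%N -> ('X_[U_(i) *+ k] * q)@_m = 0.
Proof.
move=> lt; rewrite [q]mpolyE mulr_sumr raddf_sum /=; apply: big1 => m' _.
rewrite -scalerAr -mpolyXD mcoeffZ mcoeffX; case: eqP => [E|]; last by rewrite mulr0.
by move: lt; rewrite -E mnmDE mulmnE mnm1E eqxx mul1n ltnNge leq_addr.
Qed.

Lemma dvd_mon i k (q : R) : (forall m, m \in msupp q -> (k <= m i)%N) ->
  dvdR ('X_[U_(i) *+ k]) q.
Proof.
move=> H; rewrite [q]mpolyE big_seq; apply: dvdR_sum => m mq.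
rewrite -mul_mpolyC; apply: dvdR_mull; exists 'X_[m - U_(i) *+ k]; rewrite -mpolyXD.
congr 'X_[_]; apply/mnmP => j; rewrite mnmDE mnmBE mulmnE mnm1E.
have [<-|_] := eqVneq i j; last by rewrite mul0n subn0 addn0.
by rewrite mul1n subnK // H.
Qed.

Lemma mon_cancel i1 i2 k (a b : R) : i1 != i2 ->
  'X_[U_(i2) *+ k] * a = 'X_[U_(i1) *+ k] * b -> dvdR 'X_[U_(i1) *+ k] a.
Proof.
move=> i12 E; apply: dvd_mon => m; rewrite mcoeff_msupp; apply: contraNleq => lt.
rewrite -(coef_monM (U_(i2) *+ k)) E coef_monM_lt // mnmDE mulmnE mnm1E eq_sym.
by rewrite (negPf i12) mul0n addn0.
Qed.

(** Powers of three distinct variables form a regular sequence: a monomial of [c] not divisible by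
    the power of [x_i1] must, by comparing coefficients, be divisible by that of [x_i2]. *)
Lemma mon_regular i1 i2 j k (a b c : R) : i1 != i2 -> i1 != j -> i2 != j ->
  'X_[U_(j) *+ k] * c = 'X_[U_(i2) *+ k] * a - 'X_[U_(i1) *+ k] * b ->
  exists c1 c2, c = 'X_[U_(i2) *+ k] * c1 - 'X_[U_(i1) *+ k] * c2.
Proof.
move=> i12 i1j i2j E.
pose c' := \sum_(m <- msupp c | (k <= m i1)%N) c@_m *: 'X_[m].
pose c'' := \sum_(m <- msupp c | ~~ (k <= m i1)%N) c@_m *: 'X_[m].
have cE : c = c' + c'' by rewrite [LHS]mpolyE (bigID (fun m : 'X_{1..N} => k <= m i1)%N).
have mdv i (m : 'X_{1..N}) : (k <= m i)%N -> dvdR 'X_[U_(i) *+ k] ('X_[m] : R).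
  move=> le; apply: dvd_mon => m'; rewrite msuppX inE => /eqP -> //.
have [d1 E1] : dvdR 'X_[U_(i1) *+ k] c'.
  by apply: dvdR_sum => m le; rewrite -mul_mpolyC; apply/dvdR_mull/mdv.
have [d2 E2] : dvdR 'X_[U_(i2) *+ k] c''.
  rewrite /c'' big_seq_cond; apply: dvdR_sum => m /andP[mc lt].
  rewrite -mul_mpolyC; apply/dvdR_mull/mdv.
  move: mc; rewrite mcoeff_msupp; apply: contraNleq => lt2.
  rewrite -(coef_monM (U_(j) *+ k)) E mcoeffB !coef_monM_lt ?subrr //.
    by rewrite mnmDE mulmnE mnm1E eq_sym (negPf i1j) mul0n addn0 ltnNge.
  by rewrite mnmDE mulmnE mnm1E eq_sym (negPf i2j) mul0n addn0.
by exists d2, (- d1); rewrite cE E1 E2 mulrN opprK addrC mulrC [d1 * _]mulrC.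
Qed.

(** A depth statement: modulo [H] and [x_j ^ k] nothing nonzero is killed by powers of two further
    variables. The two expressions give a syzygy between [H] and [x_j ^ k]; regularity of the three
    powers rewrites its coefficients, and a factor cancels. *)
Lemma mon_ideal i1 i2 j k (H C a1 b1 a2 b2 : R) : i1 != i2 -> i1 != j -> i2 != j ->
  prime_elt H -> ~ dvdR H 'X_[U_(j) *+ k] ->
  C * 'X_[U_(i1) *+ k] = H * a1 + 'X_[U_(j) *+ k] * b1 ->
  C * 'X_[U_(i2) *+ k] = H * a2 + 'X_[U_(j) *+ k] * b2 ->
  exists m v, C = H * m + 'X_[U_(j) *+ k] * v.
Proof.
move=> i12 i1j i2j HP.
have reg a b c := @mon_regular i1 i2 j k a b c i12 i1j i2j.
have can a b := @mon_cancel i1 i2 k a b i12.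
have : ('X_[U_(i1) *+ k] : R) != 0.
  by apply/eqP => /(congr1 (mcoeff (U_(i1) *+ k))); rewrite mcoeffX eqxx mcoeff0 => /eqP; rewrite oner_eq0.
move: ('X_[U_(i1) *+ k] : R) ('X_[U_(i2) *+ k] : R) ('X_[U_(j) *+ k] : R) reg can.
move=> x1 x2 y reg can x10 Hy E1 E2; have [H0 _ pH] := HP.
have E3 : H * (x2 * a1 - x1 * a2) = y * (x1 * b2 - x2 * b1).
  apply/eqP; rewrite -subr_eq0; apply/eqP; transitivity (x2 * (C * x1) - x1 * (C * x2)).
    by rewrite E1 E2; ring.
  by ring.
have [/Hy//|[c cE]] : dvdR H y \/ dvdR H (x1 * b2 - x2 * b1).
  by apply: pH; rewrite -E3; apply/dvdR_mulr/dvdR_refl.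
have E4 : y * c = x2 * a1 - x1 * a2.
  by apply: (mulfI H0); rewrite E3 cE; ring.
have [c1 [c2 cE2]] := reg _ _ _ E4.
have [m mE] : dvdR x1 (a1 - y * c1).
  apply: (can _ (a2 - y * c2)); apply/eqP; rewrite -subr_eq0; apply/eqP.
  transitivity (x2 * a1 - x1 * a2 - y * (x2 * c1 - x1 * c2)); first by ring.
  by rewrite -cE2 E4 subrr.
have [v vE] : dvdR x1 (b1 + H * c1).
  apply: (can _ (b2 + H * c2)); apply/eqP; rewrite -subr_eq0; apply/eqP.
  transitivity (H * (x2 * c1 - x1 * c2) - (x1 * b2 - x2 * b1)); first by ring.
  by rewrite -cE2 cE mulrC subrr.
exists m, v; apply: (mulIf x10); rewrite E1 mulrDl -!mulrA -mE -vE; ring.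
Qed.

Lemma mon_split ka dl (M : 'X_{1..N}) : mdeg M = (ka * dl)%N ->
  exists2 ms : seq 'X_{1..N}, size ms = dl /\ (forall m, m \in ms -> mdeg m = ka) &
    M = (\sum_(m <- ms) m)%MM.
Proof.
have sub k : forall M' : 'X_{1..N}, (k <= mdeg M')%N -> exists2 m, mdeg m = k & exists m', M' = (m + m')%MM.
  elim: k => [|k IH] M' le; first by exists 0%MM; [exact: mdeg0|exists M'; rewrite add0m].
  have [m mk [m' mE]] := IH M' (ltnW le).
  have [i mi] : exists i, (0 < m' i)%N.
    apply: NNPP => /not_ex_all_not nm; move: le; rewrite mE mdegD mk.
    rewrite (_ : mdeg m' = 0%N) ?addn0 ?ltnn // mdegE big1 // => i _.
    by apply/eqP; rewrite -leqn0 leqNgt; apply/negP.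
  exists (m + U_(i))%MM; first by rewrite mdegD mdeg1 mk addn1.
  exists (m' - U_(i))%MM; rewrite mE; apply/mnmP => j; rewrite !mnmDE mnmBE mnm1E.
  by have [<-|_] := eqVneq i j; [rewrite -addnA subnKC|rewrite subn0 addn0].
elim: dl M => [|dl IH] M ME.
  exists [::]; first by []. 
  by rewrite big_nil; apply/eqP; rewrite -mdeg_eq0 ME muln0.
have [|m mk [m' mE]] := sub ka M; first by rewrite ME mulnS leq_addr.
have [|ms [sz msP] m'E] := IH m'; first by move: ME; rewrite mE mdegD mk mulnS; lia.
exists (m :: ms); last by rewrite big_cons -m'E.
split; first by rewrite /= sz.
by move=> k; rewrite inE => /predU1P[->|/msP].
Qed.

End Aux2.

Section EqmCombos.
Variables (R : idomainType) (h : R).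

Lemma eqm_cross d x x' r r' t : eqm h (d * x) (r * t) -> eqm h (d * x') (r' * t) ->
  dvdR h (d * (r' * x - r * x')).
Proof.
move=> [c E] [c' E']; exists (r' * c - r * c').
rewrite mulrBl -!mulrA -E -E'; ring.
Qed.

Lemma eqm_exchange t t' r r' a a' : eqm h (t * r') (t' * r) -> eqm h (a' * r) (a * r') ->
  eqm h (r * (t * a')) (r * (t' * a)).
Proof.
move=> E1 E2; apply: (@eqm_trans _ _ (t * (a * r'))).
  by apply: (@eqm_trans _ _ (t * (a' * r))); [apply: eq_eqm; ring|exact: eqmMl].
apply: (@eqm_trans _ _ (a * (t * r'))); first by apply: eq_eqm; ring.
by apply: eqm_trans (eqmMl _ E1) _; apply: eq_eqm; ring.
Qed.

Lemma dual_shape (q t r t' r' a : R) :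
  q * (t * r' - t' * r) * a = r' * (t * (q * a)) - r * (t' * (q * a)).
Proof. by ring. Qed.

End EqmCombos.

Section EqmCombos2.
Variables (R : idomainType) (h : R).

Lemma eqm_extend t U B t0 a b k : eqm h (t * B) (t0 * a) -> eqm h (U * B ^+ k) (t0 ^+ k * b) ->
  eqm h (t * U * B ^+ k.+1) (t0 ^+ k.+1 * (a * b)).
Proof.
move=> E1 E2; apply: (@eqm_trans _ _ (t * B * (U * B ^+ k))).
  by apply: eq_eqm; rewrite exprS; ring.
by apply: eqm_trans (eqmM E1 E2) _; apply: eq_eqm; rewrite exprS; ring.
Qed.

Lemma eqm_addU U U' B t b b' c : eqm h (U * B) (t * b) -> eqm h (U' * B) (t * b') ->
  eqm h ((c * U + U') * B) (t * (c * b + b')).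
Proof.
move=> E1 E2; rewrite mulrDl mulrDr -mulrA [t * (c * b)]mulrCA.
by apply: eqmD => //; apply: eqmMl.
Qed.

Lemma eqm_prop U U' B t a a' x x' k : prime_elt h -> ~ dvdR h B ->
  eqm h (U * B) (t * a ^+ k) -> eqm h (U' * B) (t * a' ^+ k) -> eqm h (a * x') (a' * x) ->
  eqm h (U * x' ^+ k) (U' * x ^+ k).
Proof.
move=> hp nB E1 E2 E3; apply: (eqm_cancel hp nB).
apply: (@eqm_trans _ _ (U * B * x' ^+ k)); first by apply: eq_eqm; ring.
apply: eqm_trans (eqmMr _ E1) _; apply: (@eqm_trans _ _ (t * (a * x') ^+ k)).
  by apply: eq_eqm; rewrite exprMn; ring.
apply: eqm_trans (eqmMl _ (eqmX k E3)) _; apply: (@eqm_trans _ _ (t * a' ^+ k * x ^+ k)).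
  by apply: eq_eqm; rewrite exprMn; ring.
by apply: eqm_trans (eqmMr _ (eqm_sym E2)) _; apply: eq_eqm; ring.
Qed.

Lemma coord_shape U V x y q k : U * x - V * y = k * h ->
  x * (q * U) - y * (q * V) = h * q * k.
Proof. by move=> E; transitivity (q * (U * x - V * y)); [|rewrite E]; ring. Qed.

Lemma quot_shape q U m v y H : h * q = H -> q * U = H * m + y * v -> h * q * (U - h * m) = y * (h * v).
Proof. by move=> <- E; rewrite mulrBr -mulrA E; ring. Qed.

End EqmCombos2.

Lemma deriv_exists (F : fieldType) N (H : {mpoly F[N]}) E : [pchar F] =i pred0 ->
  prime_elt H -> H \is E.-homog -> (0 < E)%N /\ exists i, ~ dvdR H (mderiv i H).
Proof.
move=> ch [H0 Hu _] Hh; have E0 : (0 < E)%N.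
  rewrite lt0n; apply: contraNneq Hu => E0; rewrite E0 in Hh; rewrite (homog0C Hh).
  apply: rmorph_unit; rewrite unitfE; apply: contraNneq H0 => c0.
  by rewrite (homog0C Hh) c0 mpolyC0.
split=> //; have [m mH] : exists m, m \in msupp H.
  apply: NNPP => /not_ex_all_not nm; case/eqP: H0; apply/mpolyP => m; rewrite mcoeff0.
  by apply/eqP; rewrite mcoeff_eq0; apply/negP.
have mE : mdeg m = E := dhomog_mf Hh mH.
have [i mi] : exists i, (0 < m i)%N.
  apply: NNPP => /not_ex_all_not nm; move: E0; rewrite -mE mdegE big1 // => i _.
  by apply/eqP; rewrite -leqn0 leqNgt; apply/negP.
exists i => dv; have d0 : mderiv i H != 0.
  apply/eqP => /(congr1 (mcoeff (m - U_(i)))); rewrite mcoeff_deriv mcoeff0.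
  rewrite submK; last by rewrite lep1mP -lt0n.
  rewrite mnmBE mnm1E eqxx subn1 prednK // -mulr_natr => /eqP.
  by rewrite mulf_eq0 mcoeff_eq0 mH /= (negPf (natr_neq0 ch mi)).
have [c _ [_ le]] := homog_dvd Hh (mderiv_homog i Hh) dv d0.
by move: le; rewrite -{1}(prednK E0) ltnn.
Qed.

Lemma power_rule_step (R : comNzRingType) (x y : R) j :
  y * x ^+ j.+1 + x * (x ^+ j * (y *+ j.+1)) = x ^+ j.+1 * (y *+ j.+2).
Proof. by rewrite [x * _]mulrA -exprS [y * _]mulrC -mulrDr -mulrS. Qed.

Lemma power_factor (R : comNzRingType) (x d v w : R) j : (0 < j)%N ->
  x * (x ^+ j.-1 * d * v + x ^+ j * w) = x ^+ j * (d * v + x * w).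
Proof. by case: j => // j _; rewrite exprS; ring. Qed.

Lemma prime_power_part (F : fieldType) N (H v : {mpoly F[N]}) : prime_elt H -> v != 0 ->
  exists j w, v = H ^+ j * w /\ ~ dvdR H w.
Proof.
move=> [H0 Hu _]; have [k] := ubnP (msize v); elim: k v => // k IH v le v0.
have [[w wE]|nd] := classic (dvdR H v); last by exists 0%N, v; rewrite mul1r.
have w0 : w != 0 by apply: contraNneq v0 => w0; rewrite wE w0 mul0r.
have [|j [w' [w'E nw]]] := IH w _ w0; last first.
  by exists j.+1, w'; split=> //; rewrite wE w'E exprS mulrC mulrA.
have sH : (1 < msize H)%N.
  rewrite ltnNge; apply: contra Hu => /msize1_polyC HE; rewrite HE.
  by apply: rmorph_unit; rewrite unitfE; apply: contraNneq H0 => c0; rewrite HE c0 mpolyC0.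
move: le sH; rewrite wE (msizeM w0 H0) ltnS; move: (mmeasure _ w) (mmeasure _ H) => x y.
by case: y => [|[|y]] //; rewrite !addnS /= => le _; apply: leq_trans le; rewrite ltnS leq_addr.
Qed.

(** * The trace form of the hypersurface over its image *)

Section TraceForm.
Variables (F : closedFieldType) (charF0 : [pchar F] =i pred0).
Variables (N G e E : nat).
Local Notation R := {mpoly F[N]}.
Variables (g : 'I_N -> R) (S : fstruct g G) (h q H : R) (i : 'I_N).
Hypotheses (HP : prime_elt H) (hq : h * q = cmp g H) (h1 : ~ dvdR h 1).
Hypothesis (Hi : ~ dvdR H (mderiv i H)).
Local Notation dM := (map_mx (mderiv i) : 'M[R]_(frank S) -> 'M[R]_(frank S)).
Local Notation M := (mulm S).

(** Differentiating [M h *m M q = H] shows that modulo [H] the square of [tpi] is [mderiv i H] times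
    [tpi]: up to that factor it is a projector attached to the quotient by [h]. *)
Definition tpi := dM (M h) *m M q.
(** Modulo [H] this is [mderiv i H] times the trace of multiplication by [a] on the quotient by [h],
    as an algebra over the coordinate ring of the image. *)
Definition tre a := \tr (tpi *m M a).

Lemma mhq : M h *m M q = H%:M. Proof. by rewrite -mulmM hq mulm_cmp. Qed.
Lemma mqh : M q *m M h = H%:M. Proof. by rewrite mulmC mhq. Qed.

Lemma dMM (X Y : 'M[R]_(frank S)) : dM (X *m Y) = dM X *m Y + X *m dM Y.
Proof.
apply/matrixP => s t; rewrite !mxE raddf_sum -big_split; apply: eq_bigr => k _ /=.
by rewrite !mxE mderivM.
Qed.

Lemma mq_tpi : M q *m tpi = mderiv i H *: M q - H *: (dM (M q)).
Proof.
have E1 : dM (M h) *m M q = (mderiv i H)%:M - M h *m dM (M q).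
  apply/eqP; rewrite eq_sym subr_eq -dMM mhq; apply/eqP/matrixP => s t; rewrite !mxE.
  by rewrite raddfMn.
by rewrite /tpi E1 mulmxBr mul_mx_scalar mulmxA mqh mul_scalar_mx.
Qed.

Lemma tre_integ a : integ H (tre a) (mderiv i H).
Proof.
apply: trace_integ => // s t.
  exists (- (dM (M h) *m dM (M q)) s t).
  rewrite /tpi -mulmxA mq_tpi mulmxBr -!scalemxAr !mxE; ring.
exists (- (dM (M h) *m M a *m dM (M q)) s t).
have -> : tpi *m M a *m tpi = mderiv i H *: (tpi *m M a) - H *: (dM (M h) *m M a *m dM (M q)).
  have E2 : tpi *m M a = dM (M h) *m M a *m M q.
    by rewrite /tpi -[LHS]mulmxA (mulmC S q a) mulmxA.
  by rewrite E2 -[LHS]mulmxA mq_tpi mulmxBr -!scalemxAr.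
by rewrite !mxE; ring.
Qed.

Lemma tre_lin p a a' : tre (cmp g p * a + a') = p * tre a + tre a'.
Proof.
have ME : M (cmp g p * a + a') = p *: M a + M a'.
  by apply/matrixP => s t; rewrite !mxE mulrDl -mulrA fco_lin.
by rewrite /tre ME mulmxDr -scalemxAr mxtraceD mxtraceZ.
Qed.

Lemma tre_h a : dvdR H (tre (h * a)).
Proof.
rewrite /tre mulmM mulmxA -[tpi *m M h]mulmxA mqh mul_mx_scalar -scalemxAl mxtraceZ.
exact/dvdR_mulr/dvdR_refl.
Qed.

(** Write the norm of [h] as [H ^+ j * v] with [v] prime to [H]. Jacobi's formula gives
    [tre 1 = j * mderiv i H] modulo [H], and [j] is invertible in characteristic 0. *)
Lemma tre1 : ~ dvdR H (tre 1).
Proof.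
have h0 : h != 0.
  apply/negP => /eqP h0; case: HP => /negP[]; apply/eqP/(cmp_inj S).
  by rewrite -hq h0 mul0r.
have nE : fnorm S h * tre 1 = H * mderiv i (fnorm S h).
  rewrite /tre -(cmp1 g) mulm_cmp mulmx1 /tpi -mxtraceZ scalemxAr.
  have -> : fnorm S h *: M q = H *: \adj (M h).
    by rewrite -mul_mx_scalar -mul_mx_adj mulmxA mqh mul_scalar_mx.
  by rewrite -scalemxAr mxtraceZ mderiv_det.
have [j [v [vE nv]]] := prime_power_part HP (fnorm_neq0 S h0).
(* The norm of [h] divides a power of [H]; were it prime to [H] it would be a unit, and then [h]
   too. *)
have j0 : (0 < j)%N.
  rewrite lt0n; apply/eqP => j0; rewrite j0 expr0 mul1r in vE.
  have hH : dvdR h (cmp g H) by exists q; rewrite mulrC.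
  have [nu|] := dvd_prime_exp HP (fnorm_dvd S hH); last by rewrite vE.
  apply: h1; have := dvd_fnorm S h; rewrite -[cmp g _]mulr1.
  by apply: dvdR_unitl; apply: (rmorph_unit (cmp g)).
have [H0 _ pH] := HP.
have dE : mderiv i (H ^+ j) = H ^+ j.-1 * (mderiv i H *+ j).
  elim: j {vE} j0 => // -[|j] IH _; first by rewrite expr1 mul1r.
  by rewrite exprS mderivM IH //= power_rule_step.
have : v * tre 1 = (mderiv i H *+ j) * v + H * mderiv i v.
  apply: (mulfI (expf_neq0 j H0)); rewrite mulrA -vE nE vE mderivM dE.
  exact: power_factor.
move=> vtE /(dvdR_mull v); rewrite vtE => dv.
have : dvdR H ((mderiv i H *+ j) * v).
  rewrite -[X in dvdR _ X](addrK (H * mderiv i v)).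
  by apply: dvdR_sub => //; apply/dvdR_mulr/dvdR_refl.
case/pH => [|//]; rewrite -mulr_natr => /pH[//|].
rewrite -[j%:R](rmorph_nat (@mpolyC N F)) => -[k kE].
case: HP => _ /negP Hu _; apply: Hu; apply/unitrPr; exists (k * (j%:R^-1)%:MP).
by rewrite mulrA [H * k]mulrC -kE -mpolyCM divff ?mpolyC1 // natr_neq0.
Qed.

Hypotheses (hh : h \is e.-homog) (Hh : H \is E.-homog) (qh : q \is (G * E - e).-homog).
Hypotheses (eg : (e <= G * E)%N) (E0 : (0 < E)%N).

Lemma tre_wt w a : a \is w.-homog -> wt G (Posz w + Posz (G * E.-1)) (tre a).
Proof.
move=> aw; have G0 := fs_gt0 S.
have Mw x k s t : x \is k.-homog -> wt G (Posz k + Posz (fdeg S t) - Posz (fdeg S s)) (M x s t).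
  by move=> xk; rewrite mxE -PoszD; apply/fco_wt/dhomogM => //; apply: fs_bas.
rewrite /tre /mxtrace; apply: wt_sum => // s _; rewrite mxE; apply: wt_sum => // k _.
rewrite mxE mulr_suml; apply: wt_sum => // t _; rewrite mxE.
have := wtM (wtM (wt_deriv i (Mw _ _ s t hh)) (Mw _ _ t k qh)) (Mw _ _ k s aw).
congr (wt _ _ _); have -> : (G * E = G * E.-1 + G)%N by rewrite addnC -mulnS prednK.
move: eg; have -> : (G * E = G * E.-1 + G)%N by rewrite addnC -mulnS prednK.
lia.
Qed.

End TraceForm.

(** * Why the second map cannot factor through the first on the hypersurface *)

Section Core.
Variables (F : closedFieldType) (charF0 : [pchar F] =i pred0).
Variables (N dl G D ka e : nat).
Local Notation R := {mpoly F[N]}.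
Variables (u g : 'I_N -> R) (Su : fstruct u dl) (Sg : fstruct g G).
Hypotheses (GE : G = (dl * D)%N) (D1 : (1 < D)%N) (eE : e = (N + ka)%N)
  (ka0 : (0 < ka)%N) (N3 : (2 < N)%N).
Variables (h : R).
Hypotheses (hp : prime_elt h) (hh : h \is e.-homog).
Hypothesis normal : forall m (s a : R), s \is m.-homog -> ~ dvdR h s ->
  integ h a s -> exists b, eqm h a (s * b).
Variable (A : 'I_N -> R).
Hypothesis AE : forall j k, eqm h (cmp u (A k) * 'X_j) (cmp u (A j) * 'X_k).
Hypothesis An : forall k, ~ dvdR h (cmp u (A k)).
Hypothesis pcf : forall x, h.@[x] = 0 ->
  exists z c, [/\ h.@[z] = 0, c != 0 & forall i, (g i).@[x] = c * (u i).@[z]].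

(** The equation [H] of the image under [u] is found among the prime factors of the norm of [h]. The
    lifting hypothesis [pcf] makes it vanish on the image under [g]; the norm for [g] then shows
    that it generates the equations of that image too. *)
Lemma image_equation : exists H E, [/\ prime_elt H /\ H \is E.-homog,
   dvdR h (cmp u H), forall P, dvdR h (cmp u P) -> dvdR H P,
   dvdR h (cmp g H) & forall P, dvdR h (cmp g P) -> dvdR H P].
Proof.
have h0 : h != 0 by case: hp.
have nunit (S : R) (v : 'I_N -> R) : S \is a GRing.unit -> ~ dvdR h (cmp v S).
  move=> Su' hS; case: hp => _ /negP nu _; apply: nu.
  have [c cE] : dvdR h 1 by apply: dvdR_unitl (rmorph_unit (cmp v) Su') _; rewrite mulr1.
  by apply/unitrPr; exists c; rewrite mulrC.
have [w [ps [wu psP nE]]] := factorial_mpoly (fnorm_neq0 Su h0).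
have [H [Hps hH]] : exists H, H \in ps /\ dvdR h (cmp u H).
  have := dvd_fnorm Su h; rewrite nE cmpM rmorph_prod /=.
  move/(dvdR_unitl (rmorph_unit (cmp u) wu)) => /(prime_prod hp)[s1 [H [s2 [psE hH]]]].
  by exists H; split=> //; rewrite psE mem_cat mem_head orbT.
have HP := psP H Hps; have [H0 Hu HPP] := HP.
have star P : dvdR h (cmp u P) -> dvdR H P.
  move=> /(fnorm_dvd Su); rewrite nE => dv; apply: prime_exp HP (dvdR_trans _ dv).
  by rewrite (big_rem H) //=; apply/dvdR_mull/dvdR_mulr/dvdR_refl.
(* A nonzero component of [H] again vanishes on the image, so it is a multiple of [H]; its size
   leaves only scalar multiples. *)
have [E Hh] : exists E, H \is E.-homog.
  have [E HE0] := homog_neq0 H0; exists E.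
  have [c cE] : dvdR H (pihomog mdeg E H).
    apply: star; rewrite -(cmp_pihomog _ _ (fs_gt0 Su) (fs_homog Su)).
    exact: dvd_homog_comp hh hH.
  have c0 : c != 0 by apply: contraNneq HE0 => c0; rewrite cE c0 mul0r.
  have le : (msize (pihomog mdeg E H) <= msize H)%N.
    rewrite {1}msizeE; apply/bigmax_leqP_seq => m; rewrite mcoeff_msupp mcoeff_pihomog.
    by case: ifP => _; rewrite ?eqxx // -mcoeff_msupp => mH _; apply: msize_mdeg_lt.
  have := le; rewrite cE msizeM // => le'.
  have cs : (msize c <= 1)%N.
    have := msize_poly_eq0 H; rewrite (negPf H0) => /negbT; lia.
  have c1E := msize1_polyC cs; set c1 := c@_0%MM in c1E; rewrite c1E in cE c0.
  have -> : H = c1^-1 *: pihomog mdeg E H.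
    rewrite cE mul_mpolyC scalerA mulVf ?scale1r //.
    by apply: contraNneq c0 => ->; rewrite mpolyC0.
  by apply: dhomogZ; apply: pihomogP.
have hgH : dvdR h (cmp g H).
  apply: prime_vanish => // x hx; rewrite meval_cmp; have [z [c [hz c0 gE]]] := pcf hx.
  have -> : H.@[fun i => (g i).@[x]] = H.@[fun i => c * (u i).@[z]] by apply: meval_eq.
  rewrite (meval_homog _ _ Hh) -meval_cmp; have [k ->] := hH.
  by rewrite mevalM hz mulr0 mulr0.
exists H, E; split=> // P /(fnorm_dvd Sg) dv; apply: (prime_exp HP (dvdR_trans _ dv)).
have [nu|//] := dvd_prime_exp HP (fnorm_dvd Sg hgH).
by case: (nunit _ g nu); apply: dvd_fnorm.
Qed.

Variables (H : R) (E : nat).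
Hypotheses (HP : prime_elt H) (Hh : H \is E.-homog).
Hypotheses (huH : dvdR h (cmp u H)) (starU : forall P, dvdR h (cmp u P) -> dvdR H P).
Hypotheses (hgH : dvdR h (cmp g H)) (starG : forall P, dvdR h (cmp g P) -> dvdR H P).
Variables (qu qg : R).
Hypotheses (quE : h * qu = cmp u H) (qgE : h * qg = cmp g H).
Hypotheses (quh : qu \is (dl * E - e).-homog) (eu : (e <= dl * E)%N).
Hypotheses (qgh : qg \is (G * E - e).-homog) (eg : (e <= G * E)%N).

Lemma var_exists : exists j, ~ dvdR H 'X_j.
Proof.
apply: NNPP => /not_ex_all_not nj; have {}nj j : dvdR H 'X_j by apply: NNPP.
have lt0 : (0 < N)%N by rewrite (leq_trans _ N3).
have lt1 : (1 < N)%N by rewrite (leq_trans _ N3).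
have [H0 Hu _] := HP.
have X1 i : ('X_i : R) \is 1.-homog by rewrite dhomogX /= mdeg1.
have X0 i : ('X_i : R) != 0.
  by apply/eqP => /(congr1 (mcoeff U_(i))); rewrite mcoeffX eqxx mcoeff0 => /eqP; rewrite oner_eq0.
have [a' a'h [a'E E1]] := homog_dvd Hh (X1 _) (nj (Ordinal lt0)) (X0 _).
have [b' b'h [b'E _]] := homog_dvd Hh (X1 _) (nj (Ordinal lt1)) (X0 _).
have E1' : E = 1%N.
  case: (E) E1 Hh => [|[|k]] //= _ H0h; case/negP: Hu; rewrite (homog0C H0h).
  apply: rmorph_unit; rewrite unitfE; apply: contraNneq H0 => c0.
  by rewrite (homog0C H0h) c0 mpolyC0.
rewrite E1' subnn in a'h b'h; rewrite (homog0C a'h) in a'E; rewrite (homog0C b'h) in b'E.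
pose v (i : 'I_N) : F := (i == Ordinal lt1)%:R.
have := congr1 (meval v) a'E; rewrite /= mevalM mevalXU mevalC /v /= => /esym/eqP.
rewrite mulf_eq0 => /orP[/eqP c0|/eqP Hv].
  by have := X0 (Ordinal lt0); rewrite a'E c0 mpolyC0 mul0r eqxx.
have := congr1 (meval v) b'E; rewrite /= mevalM mevalXU Hv mulr0 /v eqxx => /eqP.
by rewrite oner_eq0.
Qed.

Lemma ndvdA k : ~ dvdR H (A k).
Proof. by move=> [c E']; apply: (An (k := k)); rewrite E' cmpM; apply: dvdR_mull. Qed.

(** Values on monomials of the generator of the dual of the quotient by [h] over [F[u]]; in degree
    [ka] they represent the canonical forms on the image. *)
Definition rho m := fth Su (qu * 'X_[m]).

Lemma homA w k p : p \is w.-homog ->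
  eqm h (cmp u (A k) ^+ w * p) ('X_k ^+ w * cmp u (cmp A p)).
Proof.
move=> pw; have := @eqm_homog_cmp _ _ w h (fun j => 'X_j) (fun j => cmp u (A j)) k p.
by rewrite cmp_id -cmp_cmp; apply.
Qed.

Lemma cancelA k w a b : eqm h (cmp u (A k) ^+ w * a) (cmp u (A k) ^+ w * b) -> eqm h a b.
Proof. by apply: eqm_cancel => // /(prime_exp hp); apply: An. Qed.

Lemma monA w p p' : p \is w.-homog -> p' \is w.-homog ->
  eqm h (cmp u (cmp A p') * p) (cmp u (cmp A p) * p').
Proof.
move=> pw pw'; have N0 : (0 < N)%N by rewrite (leq_trans _ N3).
apply: (@cancelA (Ordinal N0) w); set a := cmp u (A _) ^+ w.
apply: (@eqm_trans _ _ (cmp u (cmp A p') * (a * p))); first by apply: eq_eqm; rewrite mulrCA.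
apply: eqm_trans (eqmMl _ (homA _ pw)) _.
apply: (@eqm_trans _ _ (cmp u (cmp A p) * ('X_(Ordinal N0) ^+ w * cmp u (cmp A p')))).
  by apply: eq_eqm; rewrite mulrC -mulrA mulrC -mulrA; congr (_ * _); rewrite mulrC.
apply: eqm_trans (eqmMl _ (eqm_sym (homA _ pw'))) _.
by apply: eq_eqm; rewrite mulrCA.
Qed.

Lemma rho_rel m m' : mdeg m = mdeg m' ->
  eqm H (cmp A 'X_[m'] * rho m) (cmp A 'X_[m] * rho m').
Proof.
move=> mm; rewrite /rho -!fthM.
have E1 p x : cmp u p * (qu * x) = qu * (cmp u p * x) by rewrite mulrCA.
rewrite !E1; apply: fth_eqm quE _; apply: (@monA (mdeg m)); rewrite dhomogX //=.
by apply/eqP.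
Qed.

Lemma not_dvdh1 : ~ dvdR h 1.
Proof.
case=> c cE; case: hp => _ /negP nu _; apply: nu.
by apply/unitrPr; exists c; rewrite mulrC.
Qed.

Lemma ndvdAm m : ~ dvdR H (cmp A 'X_[m]).
Proof.
rewrite cmpXm => /(prime_prod HP)[s1 [i [s2 [_ /(prime_exp HP)]]]].
exact: ndvdA.
Qed.

Lemma rho_swap m m' : mdeg m = mdeg m' -> ~ dvdR H (rho m) -> ~ dvdR H (rho m').
Proof.
move=> mm nm dm'; have [k E'] := rho_rel mm; have [_ _ pH] := HP.
have : dvdR H (cmp A 'X_[m'] * rho m).
  by rewrite -[X in dvdR _ X](subrK (cmp A 'X_[m] * rho m')) E'; apply: dvdR_add;
    [apply/dvdR_mull/dvdR_refl|apply: dvdR_mull].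
by move/pH => [/ndvdAm|].
Qed.

Lemma uA_rel k i : eqm h (cmp u (A k) ^+ dl * u i) ('X_k ^+ dl * cmp u (cmp A (u i))).
Proof. exact/homA/(fs_homog Su). Qed.

Lemma ndvd_uA i : ~ dvdR H 'X_i -> ~ dvdR H (cmp A (u i)).
Proof.
move=> ni [c cE]; have N0 : (0 < N)%N by rewrite (leq_trans _ N3).
have [k kE] := uA_rel (Ordinal N0) i.
have : dvdR h (cmp u (A (Ordinal N0)) ^+ dl * u i).
  rewrite -[X in dvdR _ X](subrK ('X_(Ordinal N0) ^+ dl * cmp u (cmp A (u i)))) kE.
  apply: dvdR_add; first exact/dvdR_mull/dvdR_refl.
  by rewrite cE cmpM; do 2!apply: dvdR_mull.
have [_ _ ph] := hp; case/ph => [/(prime_exp hp)/An//|].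
by rewrite -(cmpX u) => /starU.
Qed.

(** On the hypersurface [x_k ^ dl] is proportional to [u_i] with factors in [F[u]], and such factors
    pass through [fth Su]. *)
Lemma rho_shift i k m : eqm H (A k ^+ dl * 'X_i * rho m)
  (cmp A (u i) * rho (m + U_(k) *+ dl)%MM).
Proof.
rewrite /rho -!fthM.
have E1 p x : cmp u p * (qu * x) = qu * (cmp u p * x) by rewrite mulrCA.
rewrite !E1; apply: fth_eqm quE _; rewrite cmpM cmpXn cmpX.
apply: eqm_trans (eqmMr _ (uA_rel k i)) _; apply: eq_eqm.
rewrite mpolyXD mpolyXn -mulrA mulrC -!mulrA; congr (_ * _).
Qed.

Lemma rho_shiftP k m : ~ dvdR H (rho m) <-> ~ dvdR H (rho (m + U_(k) *+ dl)%MM).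
Proof.
have [i ni] := var_exists; have [c cE] := rho_shift i k m; have [_ _ pH] := HP.
have nAX : ~ dvdR H (A k ^+ dl * 'X_i).
  by case/pH => [/(prime_exp HP)/ndvdA|].
have nuA := ndvd_uA ni.
split=> n1 d1; apply: n1.
  have : dvdR H (A k ^+ dl * 'X_i * rho m).
    rewrite -[X in dvdR _ X](subrK (cmp A (u i) * rho (m + U_(k) *+ dl)%MM)) cE.
    by apply: dvdR_add; [apply/dvdR_mull/dvdR_refl|apply: dvdR_mull].
  by case/pH.
have : dvdR H (cmp A (u i) * rho (m + U_(k) *+ dl)%MM).
  rewrite -[X in dvdR _ X](subKr (A k ^+ dl * 'X_i * rho m)) cE.
  by apply: dvdR_sub; [apply: dvdR_mull|apply/dvdR_mull/dvdR_refl].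
by case/pH.
Qed.

Lemma rho_shiftn k m s : ~ dvdR H (rho m) <-> ~ dvdR H (rho (m + U_(k) *+ (dl * s))%MM).
Proof.
elim: s => [|s IH].
  by rewrite muln0 (_ : (m + _)%MM = m) //; apply/mnmP => i; rewrite mnmDE mulmnE muln0 addn0.
rewrite IH (rho_shiftP k) (_ : (m + _ + _)%MM = (m + U_(k) *+ (dl * s.+1))%MM) //.
by apply/mnmP => i; rewrite !mnmDE !mulmnE mulnS mulnDr addnCA addnA addnC addnA.
Qed.

(** Nondegeneracy of the pairing gives one nonzero [rho m0]. Weights force [mdeg m0] to agree with
    [ka] modulo [dl]; shifts by multiples of [dl] and an exchange of monomials of equal degree carry
    the non-vanishing over to [m]. *)
Lemma rho_neq0 m : mdeg m = ka -> ~ dvdR H (rho m).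
Proof.
move=> mk; have [m0 n0] : exists m0, ~ dvdR H (rho m0).
  apply: NNPP => /not_ex_all_not nr; apply: not_dvdh1.
  apply: (dual_dvd (S := Su) quE); first by case: HP.
  move=> a; rewrite mulr1 (mpolyE a) mulr_sumr /fth fco_sum; apply: dvdR_sum => m1 _.
  rewrite -mul_mpolyC -(cmpC u) mulrCA fcoM; apply: dvdR_mull.
  by apply: NNPP; apply: nr.
have N0 : (0 < N)%N by rewrite (leq_trans _ N3).
have : wt dl (Posz (dl * E - e + mdeg m0) - Posz (N * dl.-1)) (rho m0).
  by apply: fth_wt; apply: dhomogM => //; rewrite dhomogX.
case=> [r0|[j jE _]]; first by case: n0; rewrite r0; apply: dvdR0.
have dl0 := fs_gt0 Su.
(* The value has degree [dl * E - e + mdeg m0] minus the top degree [N * (dl - 1)], and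
   [e = N + ka]. *)
have jE' : (dl * (j + N) + ka = dl * E + mdeg m0)%N.
  have dE : (N * dl.-1 + N = dl * N)%N by rewrite addnC -mulnS prednK // mulnC.
  move: jE eu dE; rewrite eE mulnDr; move: (N * dl.-1)%N (dl * E)%N (dl * N)%N (dl * j)%N.
  by lia.
have [le|lt] := leqP E (j + N).
  have mE : (mdeg m0 = ka + dl * (j + N - E))%N by nia.
  apply/(rho_shiftn (Ordinal N0) m (j + N - E)); apply: rho_swap n0.
  by rewrite mdegD mk mdegMn mdeg1 mul1n.
have mE : (ka = mdeg m0 + dl * (E - (j + N)))%N by nia.
move/(rho_shiftn (Ordinal N0) m0 (E - (j + N))): n0; apply: rho_swap.
by rewrite mdegD mk mdegMn mdeg1 mul1n.
Qed.

Variable i0 : 'I_N.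
Hypotheses (Hi : ~ dvdR H (mderiv i0 H)) (E0 : (0 < E)%N).
Local Notation tr := (tre Sg h qg i0).
Local Notation dH := (mderiv i0 H).

Lemma GD x : (G * x = D * (dl * x))%N.
Proof. by rewrite GE [(dl * D)%N]mulnC mulnA. Qed.

(** Here normality enters. The trace over [F[g]] divided by [dH] is integral over the image; its
    pull-back by [u] is then integral over the quotient by [h], hence polynomial. The form [b] is
    the trace of the basis element along the lift [z], which divides degrees by [D]. *)
Lemma beta_exists s : exists b, eqm h (cmp u (tr (fbas Sg s))) (cmp u dH * b) /\
  (b = 0 \/ exists2 j, (D * j = fdeg Sg s)%N & b \is j.-homog).
Proof.
have x_int := tre_integ Sg HP qgE Hi (fbas Sg s).
have x_wt := tre_wt Sg i0 hh Hh qgh eg E0 (fs_bas Sg s).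
set x := tr _ in x_int x_wt *; have dl0 := fs_gt0 Su.
have ix : integ h (cmp u x) (cmp u dH).
  have [k [c [r rE]]] := integ_morph (cmp u) x_int.
  exists k, c; apply/eqm0; move: rE; rewrite subr0 => ->.
  exact: dvdR_mull.
have hd : cmp u dH \is (dl * E.-1).-homog := cmp_homog (fs_homog Su) (mderiv_homog i0 Hh).
have [|b0 b0E] := normal hd _ ix; first by move/starU.
case: x_wt => [x0|[j jE xj]].
  by exists 0; rewrite x0 cmp0 mulr0; split; [exact: eqm_refl|left].
have le : (E.-1 <= j)%N.
  by rewrite -(leq_pmul2l (fs_gt0 Sg)); lia.
exists (pihomog mdeg (dl * (j - E.-1)) b0); split; last first.
  right; exists (dl * (j - E.-1))%N; last exact: pihomogP.
  move: jE; rewrite !GD -{1}(subnK le) 2!mulnDr; move: (fdeg Sg s) => w; lia.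
have := dvd_homog_comp (dl * j) hh b0E.
rewrite pihomogB (pihomog_dE (cmp_homog (fs_homog Su) xj)).
by rewrite -{1}(subnKC le) mulnDr (pihomogMl _ _ hd).
Qed.

Section Theta.
Variable be : 'I_(frank Sg) -> R.
Hypothesis beE : forall s, eqm h (cmp u (tr (fbas Sg s))) (cmp u dH * be s).
Hypothesis beh : forall s, be s = 0 \/
  exists2 j, (D * j = fdeg Sg s)%N & be s \is j.-homog.

Definition TT m s := fth Su (qu * ('X_[m] * be s)).
(** The functional sending [a] to the canonical form [x^m] paired with the trace of [a] along [z].
    Prescribing it on the basis makes it linear over [F[g]] exactly, not only modulo [H]. *)
Definition thm m a := \sum_s fco Sg a s * TT m s.

Lemma TT_rel m s : eqm H (dH * TT m s) (rho m * tr (fbas Sg s)).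
Proof.
rewrite [rho m * _]mulrC /TT /rho -!fthM.
have E1 p x : cmp u p * (qu * x) = qu * (x * cmp u p) by rewrite mulrCA [x * _]mulrC.
rewrite !E1; apply: fth_eqm quE _; rewrite -mulrA; apply: eqmMl.
by rewrite mulrC; apply/eqm_sym/beE.
Qed.

Lemma TT_wt m s : mdeg m = ka ->
  wt G (Posz (G * E) - Posz (G * N) + Posz (fdeg Sg s)) (TT m s).
Proof.
move=> mk; rewrite /TT; have [->|[j jE bj]] := beh s.
  by rewrite mulr0 mulr0 /fth fco0; left.
have dl0 := fs_gt0 Su.
have : wt dl (Posz (dl * E - e + (ka + j)) - Posz (N * dl.-1)) (fth Su (qu * ('X_[m] * be s))).
  by apply: fth_wt; do 2!apply: dhomogM => //; rewrite dhomogX -mk.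
case=> [->|[j' j'E hj']]; first by left.
right; exists j' => //; rewrite -jE.
have j'E' : (dl * j' + dl * N = dl * E + j)%N.
  have dE : (N * dl.-1 + N = dl * N)%N by rewrite addnC -mulnS prednK // mulnC.
  move: j'E eu dE; rewrite eE; move: (N * dl.-1)%N (dl * E)%N (dl * N)%N (dl * j')%N.
  by lia.
have : (D * (dl * j') + D * (dl * N) = D * (dl * E) + D * j)%N by rewrite -[LHS]mulnDr -[RHS]mulnDr j'E'.
by rewrite !GD; lia.
Qed.

Lemma thm_lin m p a b : thm m (cmp g p * a + b) = p * thm m a + thm m b.
Proof.
rewrite /thm mulr_sumr -big_split; apply: eq_bigr => s _ /=.
by rewrite fco_lin mulrDl mulrA.
Qed.

Lemma tr_expand a : tr a = \sum_s fco Sg a s * tr (fbas Sg s).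
Proof.
have tr0 : tr 0 = 0 by have := tre_lin Sg h qg i0 (-1) 0 0; rewrite mulr0 addr0 mulN1r addNr.
rewrite {1}[a](fs_expand Sg); elim/big_rec2: _ => // s x y _ <-.
by rewrite tre_lin.
Qed.

Lemma thm_rel m a : eqm H (dH * thm m a) (rho m * tr a).
Proof.
rewrite tr_expand /thm !mulr_sumr; apply: eqm_sum => s _.
by rewrite mulrCA [rho m * _]mulrCA; apply/eqmMl/TT_rel.
Qed.

Lemma thm_h m a : dvdR H (thm m (h * a)).
Proof.
have [_ _ pH] := HP; have [k kE] := thm_rel m (h * a).
have [|//|//] := pH dH (thm m (h * a)).
rewrite -[X in dvdR _ X](subrK (rho m * tr (h * a))) kE; apply: dvdR_add.
  exact/dvdR_mull/dvdR_refl.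
by apply/dvdR_mull/tre_h.
Qed.

Lemma thm_wt m w a : mdeg m = ka -> a \is w.-homog ->
  wt G (Posz (G * E) - Posz (G * N) + Posz w) (thm m a).
Proof.
move=> mk aw; apply: wt_sum => [|s _]; first exact: fs_gt0 Sg.
have := wtM (fco_wt (S := Sg) s aw) (TT_wt s mk); congr (wt _ _ _); lia.
Qed.

Lemma thm0 m : thm m 0 = 0.
Proof. by rewrite /thm big1 // => s _; rewrite fco0 mul0r. Qed.

Lemma thmD m a b : thm m (a + b) = thm m a + thm m b.
Proof. by rewrite -[a]mul1r -(cmp1 g) thm_lin cmp1 !mul1r. Qed.

(** Pull-back of the canonical form [x^m] along [z], defined as adjoint to the trace. *)
Definition is_tform m t := t \is ka.-homog /\ forall a, thm m a = fth Sg (t * (qg * a)).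

(** [dual_rep] gives a representing polynomial, perhaps not homogeneous. Comparing weights, only its
    component of degree [e - N = ka] contributes, whatever the degrees of [u] and [g]: this is the
    invariance of degree under pull-back. *)
Lemma t_exists m : mdeg m = ka -> exists t, is_tform m t.
Proof.
move=> mk; have [H0 _ _] := HP; have G0 := fs_gt0 Sg.
have [t tE] := dual_rep Sg qgE H0 (thm_lin m) (thm_h m).
exists (pihomog mdeg ka t); split=> [|a]; first exact: pihomogP.
rewrite [a](@pihomog_partitionE _ _ mdeg _ _ (leqnn _)).
have hom w (b : R) : b \is w.-homog -> thm m b = fth Sg (pihomog mdeg ka t * (qg * b)).
  move=> bw; pose K := maxn (msize t) ka.+1.
  pose x i := fth Sg (pihomog mdeg i t * (qg * b)).
  apply: (@wt_component F N G K x _ (Posz (G * E - e + w) - Posz (N * G.-1)) ka) => //.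
  - move=> i; have := fth_wt Sg (dhomogM (pihomogP mdeg i t) (dhomogM qgh bw)).
    by congr (wt _ _ _); lia.
  - have := thm_wt mk bw; congr (wt _ _ _).
    have dE : (N * G.-1 + N = G * N)%N by rewrite addnC -mulnS prednK // mulnC.
    by move: eg; rewrite eE; lia.
  - by rewrite leq_max ltnSn orbT.
  rewrite tE {1}(@pihomog_partitionE _ _ mdeg K t) ?leq_maxl // mulr_suml /fth fco_sum.
  by [].
rewrite !mulr_sumr /fth fco_sum.
elim/big_rec2: _ => [|i x y _ <-]; first exact: thm0.
by rewrite thmD (hom i) //; apply: pihomogP.
Qed.

(** Modulo [H] and up to [dH], [thm m] is [rho m] times the trace form, so [t] and [t'] are in the
    ratio of [rho m] and [rho m'] taken at [g]; [rho_rel] rewrites this ratio through [A(g)], the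
    coordinates of [z]. *)
Lemma t_rel m m' t t' : mdeg m = ka -> mdeg m' = ka -> is_tform m t -> is_tform m' t' ->
  eqm h (t * cmp g (cmp A 'X_[m'])) (t' * cmp g (cmp A 'X_[m])).
Proof.
move=> mk mk' [_ tE] [_ tE']; have [H0 _ pH] := HP.
have rel1 : eqm h (t * cmp g (rho m')) (t' * cmp g (rho m)).
  apply: (dual_dvd (S := Sg) qgE H0) => a.
  have -> : fth Sg (qg * (t * cmp g (rho m') - t' * cmp g (rho m)) * a) =
      rho m' * thm m a - rho m * thm m' a.
    by rewrite tE tE' -!fthM /fth -fcoB dual_shape.
  have [|//|//] := pH dH (rho m' * thm m a - rho m * thm m' a).
  exact: eqm_cross (thm_rel m a) (thm_rel m' a).
have nr : ~ dvdR h (cmp g (rho m)) by move/starG; apply: rho_neq0.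
apply: (eqm_cancel hp nr).
have := eqm_cmp hgH (rho_rel (m := m) (m' := m') (etrans mk (esym mk'))).
by rewrite !cmpM; apply: eqm_exchange.
Qed.

(** If [h] divided [t], then [thm m 1] would vanish modulo [H], and with it [rho m * tr 1], a
    product of two elements prime to [H]. *)
Lemma isT_ndvd m t : mdeg m = ka -> is_tform m t -> ~ dvdR h t.
Proof.
move=> mk [_ tE] [c cE]; have [_ _ pH] := HP.
have th1 : dvdR H (thm m 1).
  rewrite tE cE (_ : c * h * (qg * 1) = cmp g H * c); last first.
    by rewrite -qgE mulr1 -mulrA mulrC.
  by rewrite fthM; apply/dvdR_mulr/dvdR_refl.
have [k kE] := thm_rel m 1.
have : dvdR H (rho m * tr 1).
  rewrite -[X in dvdR _ X](subKr (dH * thm m 1)) kE.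
  by apply: dvdR_sub; [apply: dvdR_mull|apply/dvdR_mull/dvdR_refl].
case/pH; first exact: rho_neq0.
exact: (tre1 charF0 HP qgE not_dvdh1 Hi).
Qed.

Section FixedMonomial.
Variables (m0 : 'X_{1..N}) (t0 : R).
Hypotheses (m0k : mdeg m0 = ka) (t0P : is_tform m0 t0).
Local Notation B := (cmp g (cmp A 'X_[m0])).

Lemma U_mon (ms : seq 'X_{1..N}) : (forall m, m \in ms -> mdeg m = ka) ->
  exists2 U, U \is (ka * size ms).-homog &
   eqm h (U * B ^+ size ms) (t0 ^+ size ms * cmp g (cmp A 'X_[\sum_(m <- ms) m])).
Proof.
elim: ms => [|m ms IH] msP.
  exists 1; first by rewrite muln0 dhomog1.
  by rewrite big_nil mpolyX0 !cmp1 !expr0; apply: eqm_refl.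
have [|U Uh UE] := IH; first by move=> k km; apply: msP; rewrite inE km orbT.
have mk := msP m (mem_head _ _); have [t tP] := t_exists mk.
exists (t * U); first by rewrite mulnS; apply: dhomogM => //; case: tP.
rewrite big_cons mpolyXD !cmpM; apply: eqm_extend UE.
exact: (t_rel mk m0k tP t0P).
Qed.

(** Every monomial of degree [dl * ka] is a product of [dl] monomials of degree [ka]. Replacing each
    by its [t] expresses a form in the coordinates of [z], up to a common factor, by a form of the
    same degree in [x]. *)
Lemma U_exists p : p \is (dl * ka).-homog ->
  exists2 U, U \is (dl * ka).-homog &
   eqm h (U * B ^+ dl) (t0 ^+ dl * cmp g (cmp A p)).
Proof.
move=> pw; rewrite (mpolyE p).
have sub M : M \in msupp p -> mdeg M = (ka * dl)%N.
  by move=> Mp; rewrite mulnC; apply: (dhomog_mf pw Mp).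
elim: (msupp p) sub => [|M s IH] sub.
  exists 0; first exact: dhomog0.
  by rewrite big_nil !cmp0 mul0r mulr0; apply: eqm_refl.
have [|U Uh UE] := IH; first by move=> k ks; apply: sub; rewrite inE ks orbT.
have [ms [sz msP] ME] := mon_split (sub M (mem_head _ _)).
have [V Vh VE] := U_mon msP; rewrite sz -ME in Vh VE.
exists ((p@_M)%:MP * V + U).
  by rewrite mul_mpolyC; apply: rpredD => //; apply: dhomogZ; rewrite mulnC.
by rewrite big_cons cmp2_lin; exact: (eqm_addU _ VE UE).
Qed.

Lemma aprop i j : eqm h (cmp g (cmp A (u i)) * g j) (cmp g (cmp A (u j)) * g i).
Proof.
have /(eqm_cmp hgH) : eqm H (cmp A (u i) * 'X_j) (cmp A (u j) * 'X_i).
  apply: starU; rewrite (cmpB u) (cmpM u) (cmpM u) !(cmpX u).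
  by apply: (@monA dl); apply: fs_homog Su _.
by rewrite (cmpM g) (cmpM g) !(cmpX g).
Qed.

Lemma UP i : exists2 U, U \is (dl * ka).-homog &
   eqm h (U * B ^+ dl) (t0 ^+ dl * cmp g (cmp A (u i)) ^+ ka).
Proof.
have [|U Uh UE] := @U_exists (u i ^+ ka); first exact/dhomogMn/(fs_homog Su).
by rewrite (cmpXn A) (cmpXn g) in UE; exists U.
Qed.

(** The forms [U] attached to [u_i ^ ka] have degree [dl * ka] and are proportional on the
    hypersurface to [g_i ^ ka], of larger degree [G * ka]. A depth argument makes [Uj] a multiple of
    [g_j ^ ka] modulo [h], so that [h] divides [Uj], against the non-vanishing of [t0]. *)
Lemma final_contradiction : False.
Proof.
have [_ _ pH] := HP; have [h0 _ ph] := hp.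
have [j nj] := var_exists.
have [i1 [i2 [i12 i1j i2j]]] : exists i1 i2 : 'I_N, [/\ i1 != i2, i1 != j & i2 != j].
  have [i1 i1P] : exists i1, i1 \notin [:: j].
    apply: NNPP => /not_ex_all_not nx; have := max_card (mem [:: j]).
    have /eq_card -> : [:: j] =i 'I_N by move=> x; apply/idP; apply: contraT => /nx.
    rewrite card_ord => _; have := card_size [:: j].
    have /eq_card -> : [:: j] =i 'I_N by move=> x; apply/idP; apply: contraT => /nx.
    by rewrite card_ord /=; lia.
  have [i2 i2P] : exists i2, i2 \notin [:: i1; j].
    apply: NNPP => /not_ex_all_not nx; have := card_size [:: i1; j].
    have /eq_card -> : [:: i1; j] =i 'I_N by move=> x; apply/idP; apply: contraT => /nx.
    by rewrite card_ord /=; lia.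
  exists i1, i2; move: i1P i2P; rewrite !inE negb_or => -> /andP[i21 ->].
  by rewrite eq_sym i21.
have nB : ~ dvdR h (B ^+ dl) by move/(prime_exp hp)/starG/ndvdAm.
have [Uj Ujh UjE] := UP j.
pose xx i : R := 'X_[U_(i) *+ ka].
have xE i : cmp g (xx i) = g i ^+ ka by rewrite /xx -mpolyXn cmpXn cmpX.
have xj : ~ dvdR H (xx j) by rewrite /xx -mpolyXn => /(prime_exp HP).
(* Multiplication by [qg] turns the proportionality modulo [h] into a relation modulo [H(g)], which
   can be read in each coordinate over [F[g]]. *)
have coord i s : exists a b, fco Sg (qg * Uj) s * xx i = H * a + xx j * b.
  have [Ui Uih UiE] := UP i.
  have [k kE] := eqm_prop hp nB UjE UiE (aprop j i).
  exists (fco Sg k s), (fco Sg (qg * Ui) s).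
  apply/eqP; rewrite -subr_eq; apply/eqP; rewrite [_ * xx i]mulrC -!fcoM -fcoB.
  rewrite !xE -qgE; congr (fco Sg _ s).
  exact: coord_shape kE.
have [mm mmE] : exists mm : 'I_(frank Sg) -> R, forall s, exists v,
    fco Sg (qg * Uj) s = H * mm s + xx j * v.
  apply: (fin_all_exists (P := fun s m => exists v, fco Sg (qg * Uj) s = H * m + xx j * v)) => s.
  have [a1 [b1 E1]] := coord i1 s; have [a2 [b2 E2]] := coord i2 s.
  have [m [v E']] := mon_ideal i12 i1j i2j HP xj E1 E2.
  by exists m, v.
have [vv vvE] : exists vv : 'I_(frank Sg) -> R, forall s,
    fco Sg (qg * Uj) s = H * mm s + xx j * vv s.
  exact: (fin_all_exists (P := fun s v => fco Sg (qg * Uj) s = H * mm s + xx j * v)).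
pose mu := \sum_s cmp g (mm s) * fbas Sg s; pose nu := \sum_s cmp g (vv s) * fbas Sg s.
have qUE : qg * Uj = cmp g H * mu + g j ^+ ka * nu.
  rewrite [LHS](fs_expand Sg) /mu /nu !mulr_sumr -big_split; apply: eq_bigr => s _ /=.
  by rewrite vvE cmpD !cmpM xE mulrDl !mulrA.
have qs := quot_shape qgE qUE; rewrite qgE -xE in qs.
(* The relation [qs] equates a multiple of [H(g)] with [g_j ^ ka] times [h * nu], and [H] is prime
   to [x_j ^ ka]. *)
have hnu s : dvdR H (fco Sg (h * nu) s).
  have := congr1 (fun a => fco Sg a s) qs; rewrite !fcoM => E'.
  by case: (pH (xx j) (fco Sg (h * nu) s)) => [|/xj//|//]; rewrite -E'; apply/dvdR_mulr/dvdR_refl.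
have [w wE] : exists w, h * nu = cmp g H * w.
  have [w wE] : exists w : 'I_(frank Sg) -> R, forall s, fco Sg (h * nu) s = w s * H.
    exact: (fin_all_exists (P := fun s w => fco Sg (h * nu) s = w * H)).
  exists (\sum_s cmp g (w s) * fbas Sg s); rewrite [LHS](fs_expand Sg) mulr_sumr.
  by apply: eq_bigr => s _; rewrite wE cmpM [cmp g (w s) * _]mulrC mulrA.
have q0 : cmp g H != 0.
  by apply/eqP => /(cmp_inj Sg) H0; case: HP; rewrite H0 eqxx.
(* In degree [dl * ka] the right side has no component, because [dl < G]; only a multiple of [h]
   remains to match [Uj]. *)
have UjE' : Uj - h * mu = g j ^+ ka * w.
  by apply: (mulfI q0); rewrite qs wE xE mulrCA.
have hUj : dvdR h Uj.
  have gh : g j ^+ ka \is (G * ka).-homog by apply/dhomogMn/(fs_homog Sg).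
  have lt : (dl * ka < G * ka)%N.
    rewrite ltn_pmul2r // GE -[X in (X < _)%N]muln1 ltn_pmul2l //; exact: fs_gt0 Su.
  have := congr1 (pihomog mdeg (dl * ka)) UjE'.
  rewrite pihomogB (pihomog_dE Ujh) (pihomogM_lt _ gh lt) => /eqP; rewrite subr_eq0 => /eqP ->.
  by apply: (dvd_homog_comp _ hh); apply/dvdR_mulr/dvdR_refl.
have [k kE] := UjE.
have : dvdR h (t0 ^+ dl * cmp g (cmp A (u j)) ^+ ka).
  rewrite -[X in dvdR _ X](subKr (Uj * B ^+ dl)) kE.
  by apply: dvdR_sub; [apply: dvdR_mulr|apply/dvdR_mull/dvdR_refl].
case/ph => [/(prime_exp hp)|/(prime_exp hp)/starG]; first exact: (isT_ndvd m0k t0P).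
exact: ndvd_uA.
Qed.

End FixedMonomial.

Lemma theta_contradiction : False.
Proof.
have N0 : (0 < N)%N by rewrite (leq_trans _ N3).
have mk : mdeg (U_(Ordinal N0) *+ ka)%MM = ka by rewrite mdegMn mdeg1 mul1n.
have [t tP] := t_exists mk; exact: (final_contradiction mk tP).
Qed.

End Theta.

End Core.

(** [A] is the rational inverse of [u] on the hypersurface, and [D] the degree that a polynomial
    lift would have. *)
Theorem no_lift (F : closedFieldType) (charF0 : [pchar F] =i pred0) (N dl G D ka e : nat)
  (u g : 'I_N -> {mpoly F[N]}) (Su : fstruct u dl) (Sg : fstruct g G)
  (h : {mpoly F[N]}) (A : 'I_N -> {mpoly F[N]}) :
  G = (dl * D)%N -> (1 < D)%N -> e = (N + ka)%N -> (0 < ka)%N -> (2 < N)%N ->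
  prime_elt h -> h \is e.-homog ->
  (forall m (s a : {mpoly F[N]}), s \is m.-homog -> ~ dvdR h s ->
    integ h a s -> exists b, eqm h a (s * b)) ->
  (forall j k, eqm h (cmp u (A k) * 'X_j) (cmp u (A j) * 'X_k)) ->
  (forall k, ~ dvdR h (cmp u (A k))) ->
  ~ (forall x, h.@[x] = 0 ->
      exists z c, [/\ h.@[z] = 0, c != 0 & forall i, (g i).@[x] = c * (u i).@[z]]).
Proof.
move=> GE D1 eE ka0 N3 hp hh normal AE An pcf.
have [H [E [[HP Hh] huH starU hgH starG]]] : exists H E, [/\ prime_elt H /\ H \is E.-homog,
   dvdR h (cmp u H), forall P, dvdR h (cmp u P) -> dvdR H P,
   dvdR h (cmp g H) & forall P, dvdR h (cmp g P) -> dvdR H P].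
  by eapply image_equation; eassumption.
have [E0 [i Hi]] := deriv_exists charF0 HP Hh.
have H0 : H != 0 by case: HP.
have cu0 : cmp u H != 0 by apply: contraNneq H0 => /(cmp_inj Su) ->.
have cg0 : cmp g H != 0 by apply: contraNneq H0 => /(cmp_inj Sg) ->.
have [qu quh [quE eu]] := homog_dvd hh (cmp_homog (fs_homog Su) Hh) huH cu0.
have [qg qgh [qgE eg]] := homog_dvd hh (cmp_homog (fs_homog Sg) Hh) hgH cg0.
have {}quE : h * qu = cmp u H by rewrite mulrC.
have {}qgE : h * qg = cmp g H by rewrite mulrC.
have [be beP] : exists be : 'I_(frank Sg) -> {mpoly F[N]}, forall s,
    eqm h (cmp u (tre Sg h qg i (fbas Sg s))) (cmp u (mderiv i H) * be s) /\
    (be s = 0 \/ exists2 j, (D * j = fdeg Sg s)%N & be s \is j.-homog).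
  apply: (fin_all_exists (P := fun s b =>
    eqm h (cmp u (tre Sg h qg i (fbas Sg s))) (cmp u (mderiv i H) * b) /\
    (b = 0 \/ exists2 j, (D * j = fdeg Sg s)%N & b \is j.-homog))) => s.
  by eapply beta_exists; eassumption.
have [beE beh] : (forall s, eqm h (cmp u (tre Sg h qg i (fbas Sg s))) (cmp u (mderiv i H) * be s)) /\
    (forall s, be s = 0 \/ exists2 j, (D * j = fdeg Sg s)%N & be s \is j.-homog).
  by split=> s; case: (beP s).
exact: (theta_contradiction charF0 Su GE D1 eE ka0 N3 hp hh AE An HP Hh huH starU hgH starG quE qgE quh eu qgh eg Hi E0 beE beh).
Qed.

(** * Free structures for the identity, for composites and for maps near the power map *)

Section Build.
Variables (F : fieldType) (N : nat).
Local Notation R := {mpoly F[N]}.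

Lemma sum_enum_val (I : finType) (E : I -> R) : \sum_(s < #|I|) E (enum_val s) = \sum_i E i.
Proof. by rewrite [RHS](reindex (@enum_val I I)) //; apply/onW_bij/enum_val_bij. Qed.

Lemma fstruct_fin (I : finType) (g : 'I_N -> R) G (b : I -> R) (dg : I -> nat)
    (co : R -> I -> R) (top : I) :
  (0 < G)%N -> (forall i, g i \is G.-homog) -> (forall s, b s \is (dg s).-homog) ->
  (forall a, a = \sum_s cmp g (co a s) * b s) ->
  (forall c, \sum_s cmp g (c s) * b s = 0 -> forall s, c s = 0) ->
  dg top = (N * G.-1)%N ->
  (forall a, (forall c, co (a * c) top = 0) -> a = 0) ->
  (forall th : R -> R, (forall p a b, th (cmp g p * a + b) = p * th a + th b) ->
    exists t, forall a, th a = co (t * a) top) ->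
  inhabited (fstruct g G).
Proof.
move=> G0 gG bh ex fr tp nd rp.
pose b' (s : 'I_#|I|) := b (enum_val s).
pose co' a (s : 'I_#|I|) := co a (enum_val s).
have E0 : enum_val (enum_rank top) = top := enum_rankK top.
constructor; apply: (@FStruct F N g G #|I| b' (fun s => dg (enum_val s)) co' (enum_rank top)).
- by [].
- by [].
- by move=> s; apply: bh.
- by move=> a; rewrite {1}(ex a) -sum_enum_val.
- move=> c E s; rewrite -(enum_valK s); move: (enum_val s) => i.
  apply: (fr (fun i => c (enum_rank i))); rewrite -sum_enum_val -[RHS]E.
  by apply: eq_bigr => t _; rewrite enum_valK.
- by rewrite E0.
- by move=> a; rewrite /co' E0; apply: nd.
by move=> th; rewrite /co' E0; apply: rp.
Qed.

Lemma fstruct_id : inhabited (fstruct (fun i => 'X_i : R) 1).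
Proof.
apply: (@fstruct_fin unit _ 1 (fun=> 1) (fun=> 0%N) (fun a _ => a) tt) => //.
- by move=> i; rewrite dhomogX /= mdeg1.
- by move=> s; rewrite dhomog1.
- by move=> a; rewrite (big_pred1 tt) ?cmp_id ?mulr1 // => -[].
- by move=> c; rewrite (big_pred1 tt) ?cmp_id ?mulr1 => [E []|[]].
- by rewrite muln0.
- by move=> a /(_ 1); rewrite mulr1.
move=> th lin; exists (th 1) => a.
have th0 : th 0 = 0 by have := lin (-1) 0 0; rewrite mulr0 addr0 mulN1r addNr.
by rewrite -[a in LHS]mulr1 -{1}(cmp_id a) -[_ * 1]addr0 lin th0 addr0 mulrC.
Qed.

(** The basis consists of products of the two bases. The top coordinate is the composite of the two
    top coordinates, so a functional is represented in two stages. *)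
Lemma fstruct_comp (f v : 'I_N -> R) d w : fstruct f d -> fstruct v w ->
  inhabited (fstruct (fun i => cmp f (v i)) (d * w)).
Proof.
move=> S1 S2; set g := fun i => cmp f (v i).
have gE p : cmp g p = cmp f (cmp v p) by rewrite cmp_cmp.
have d0 := fs_gt0 S1; have w0 := fs_gt0 S2.
apply: (@fstruct_fin ('I_(frank S1) * 'I_(frank S2))%type g _
  (fun st => cmp f (fbas S2 st.2) * fbas S1 st.1)
  (fun st => (d * fdeg S2 st.2 + fdeg S1 st.1)%N)
  (fun a st => fco S2 (fco S1 a st.1) st.2) (ftop S1, ftop S2)) => /=.
- by rewrite muln_gt0 d0.
- by move=> i; apply: cmp_homog; [apply: fs_homog|apply: fs_homog].
- move=> st; apply: dhomogM; last exact: fs_bas.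
  by apply: cmp_homog; [apply: fs_homog|apply: fs_bas].
- move=> a; rewrite -(pair_bigA _ (fun s t => cmp g (fco S2 (fco S1 a s) t) *
     (cmp f (fbas S2 t) * fbas S1 s))) /= {1}[a](fs_expand S1).
  apply: eq_bigr => s _; rewrite {1}[fco S1 a s](fs_expand S2) cmp_sum mulr_suml.
  by apply: eq_bigr => t _; rewrite cmpM gE mulrA.
- move=> c E [s t] /=.
  have E1 : \sum_s cmp f (\sum_t cmp v (c (s, t)) * fbas S2 t) * fbas S1 s = 0.
    rewrite -[RHS]E [RHS](eq_bigr (fun p => cmp g (c (p.1, p.2)) *
      (cmp f (fbas S2 p.2) * fbas S1 p.1))); last by case.
    rewrite -(pair_bigA _ (fun s t => cmp g (c (s, t)) *
     (cmp f (fbas S2 t) * fbas S1 s))) /=.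
    apply: eq_bigr => s' _; rewrite cmp_sum mulr_suml.
    by apply: eq_bigr => t' _; rewrite cmpM gE mulrA.
  exact: (fs_free (fs_free (f := S1) E1 s) t).
- rewrite !fs_top; have -> : ((d * w).-1 = d * w.-1 + d.-1)%N.
    by rewrite -{1}(prednK w0) mulnS; move: d0; move: (d * w.-1)%N => x; case: (d) => // k; lia.
  by rewrite mulnDr mulnCA.
- move=> a aE; apply: (@fs_nondeg _ _ _ _ S1) => c; apply: (@fs_nondeg _ _ _ _ S2) => p.
  by rewrite mulrC -fcoM mulrCA aE.
move=> th lin.
have th0 : th 0 = 0 by have := lin (-1) 0 0; rewrite mulr0 addr0 mulN1r addNr.
have thD a b : th (a + b) = th a + th b by rewrite -[a]mul1r -(cmp1 g) lin cmp1 !mul1r.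
have th_sum (I : finType) (X : I -> R) : th (\sum_i X i) = \sum_i th (X i).
  by elim/big_rec2: _ => // i x y _ <-; rewrite thD.
(* For a fixed basis element over [F[f]], [th] is a functional in [p] alone and the inner structure
   represents it; [psi] then collects these for the outer one. *)
have exT s : exists t, forall p, th (cmp f p * fbas S1 s) = fco S2 (t * p) (ftop S2).
  apply: (@fs_rep _ _ _ _ S2 (fun p => th (cmp f p * fbas S1 s))) => p a b.
  by rewrite -lin gE cmpD cmpM mulrDl mulrA.
have [T TE] := fin_all_exists exT.
pose psi a := \sum_s fco S1 a s * T s.
have [|t tE] := @fs_rep _ _ _ _ S1 psi.
  move=> p a b; rewrite /psi mulr_sumr -big_split; apply: eq_bigr => s _ /=.
  by rewrite fco_lin mulrDl mulrA.
exists t => a; rewrite -tE {1}[a](fs_expand S1) th_sum /psi fco_sum.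
by apply: eq_bigr => s _; rewrite TE mulrC.
Qed.

End Build.

Section Leading.
Variables (F : fieldType) (N d : nat) (f : 'I_N -> {mpoly F[N]}).
Local Notation R := {mpoly F[N]}.
Hypotheses (d0 : (0 < d)%N) (fd : forall i, f i \is d.-homog).

Definition mquo (m : 'X_{1..N}) : 'X_{1..N} := [multinom (m i %/ d)%N | i < N].
Definition mrem (m : 'X_{1..N}) : 'X_{1..N} := [multinom (m i %% d)%N | i < N].
Definition fmon m : R := 'X_[mrem m] * cmp f 'X_[mquo m].
(** The linear map that divides exponents by [d] and puts [f_i] for [x_i ^ d]; for the power map it
    is the identity. It is bijective exactly when the monomials with exponents below [d] form a
    basis over [F[f]]. *)
Definition fsub (p : R) : R := \sum_(m <- msupp p) p@_m *: fmon m.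

Lemma mdivE (m : 'X_{1..N}) : m = (mrem m + mquo m *+ d)%MM.
Proof. by apply/mnmP => i; rewrite mnmDE mulmnE !mnmE addnC -divn_eq. Qed.

Lemma fmon_homog m : fmon m \is (mdeg m).-homog.
Proof.
rewrite {2}(mdivE m) mdegD mdegMn; apply: dhomogM; first by rewrite dhomogX.
by rewrite mulnC; apply: cmp_homog => //; rewrite dhomogX.
Qed.

Lemma fsubE (s : seq 'X_{1..N}) (p : R) : uniq s -> {subset msupp p <= s} ->
  fsub p = \sum_(m <- s) p@_m *: fmon m.
Proof.
move=> us sub; rewrite /fsub [RHS](bigID (fun m => m \in msupp p)) /=.
rewrite [X in _ + X]big1 ?addr0 => [|m mp]; last by rewrite (memN_msupp_eq0 mp) scale0r.
rewrite -[RHS]big_filter; apply: perm_big; apply: uniq_perm; rewrite ?msupp_uniq ?filter_uniq //.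
by move=> m; rewrite mem_filter; case: (boolP (m \in msupp p)) => //= /sub.
Qed.

Lemma fsub_lin c p q : fsub (c *: p + q) = c *: fsub p + fsub q.
Proof.
pose s := undup (msupp p ++ msupp q ++ msupp (c *: p + q)).
have us : uniq s by apply: undup_uniq.
rewrite !(fsubE us); first last.
- by move=> m mm; rewrite mem_undup !mem_cat mm !orbT.
- by move=> m mm; rewrite mem_undup !mem_cat mm.
- by move=> m mm; rewrite mem_undup !mem_cat mm orbT.
rewrite scaler_sumr -big_split; apply: eq_bigr => m _ /=.
by rewrite mcoeffD mcoeffZ scalerDl scalerA.
Qed.

Lemma fsub0 : fsub 0 = 0.
Proof. by have := fsub_lin (-1) 0 0; rewrite scaler0 addr0 scaleN1r addNr. Qed.
Lemma fsubZ c p : fsub (c *: p) = c *: fsub p.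
Proof. by rewrite -[c *: p]addr0 fsub_lin fsub0 addr0. Qed.
Lemma fsubD p q : fsub (p + q) = fsub p + fsub q.
Proof. by rewrite -[p]scale1r fsub_lin !scale1r. Qed.
Lemma fsub_sum (I : Type) (r : seq I) (P : pred I) (E : I -> R) :
  fsub (\sum_(i <- r | P i) E i) = \sum_(i <- r | P i) fsub (E i).
Proof. by elim/big_rec2: _ => [|i x y _ <-]; rewrite ?fsub0 ?fsubD. Qed.
Lemma fsubX m : fsub 'X_[m] = fmon m.
Proof. by rewrite /fsub msuppX big_seq1 mcoeffX eqxx scale1r. Qed.

Lemma fsub_pihomog w p : fsub (pihomog mdeg w p) = pihomog mdeg w (fsub p).
Proof.
elim/mpolyind: p => [|c m p _ _ IH]; first by rewrite !pihomog0 fsub0 pihomog0.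
rewrite pihomogD !fsubD pihomogD IH; congr (_ + _).
rewrite !linearZ /= !fsubZ linearZ /=; congr (_ *: _); rewrite fsubX.
have Xh : ('X_[m] : R) \is (mdeg m).-homog by rewrite dhomogX.
have [<-|ne] := eqVneq (mdeg m) w.
  by rewrite !pihomog_dE ?fsubX ?fmon_homog.
by rewrite (pihomog_ne0 ne Xh) (pihomog_ne0 ne (fmon_homog m)) fsub0.
Qed.

Lemma fmon_shift m i : f i * fmon m = fmon (m + U_(i) *+ d).
Proof.
have q : mquo (m + U_(i) *+ d) = (mquo m + U_(i))%MM.
  apply/mnmP => j; rewrite mnmDE !mnmE mulmnE mnm1E.
  by have [_|_] := eqVneq i j; rewrite ?mul1n ?mul0n ?addn0 // divnDr ?dvdnn // divnn d0.
have r : mrem (m + U_(i) *+ d) = mrem m.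
  apply/mnmP => j; rewrite !mnmE mulmnE mnm1E.
  by have [_|_] := eqVneq i j; rewrite ?mul1n ?mul0n ?addn0 // modnDr.
by rewrite /fmon q r mpolyXD cmpM cmpX mulrCA [f i * _]mulrC.
Qed.

Lemma fmon_fold (m : 'X_{1..N}) i : (d <= m i)%N -> fmon m = f i * fmon (m - U_(i) *+ d).
Proof.
move=> le; rewrite fmon_shift; congr fmon; apply/mnmP => j.
rewrite mnmDE mnmBE mulmnE mnm1E; have [<-|_] := eqVneq i j; last by rewrite mul0n subn0 addn0.
by rewrite mul1n subnK.
Qed.

(** The bound is the least degree in which every monomial has some exponent at least [d]. *)
Hypothesis surj_low : forall m, (mdeg m <= (N * d.-1).+1)%N -> exists p, fsub p = 'X_[m].

Lemma fsub_mulf i a : (exists p, fsub p = a) -> exists p, fsub p = f i * a.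
Proof.
case=> p <-; exists (\sum_(m <- msupp p) p@_m *: 'X_[m + U_(i) *+ d]).
rewrite fsub_sum {2}/fsub mulr_sumr; apply: eq_bigr => m _.
by rewrite fsubZ fsubX -fmon_shift scalerAr.
Qed.

Lemma fsub_surj_span (I : eqType) (s : seq I) (c : I -> F) (a : I -> R) :
  (forall i, i \in s -> exists p, fsub p = a i) ->
  exists p, fsub p = \sum_(i <- s) c i *: a i.
Proof.
elim: s => [|i s IH] H; first by exists 0; rewrite big_nil fsub0.
have [p pE] := H i (mem_head _ _).
have [|q qE] := IH; first by move=> j js; apply: H; rewrite inE js orbT.
by exists (c i *: p + q); rewrite fsub_lin big_cons pE qE.
Qed.

Lemma fsub_surj_homog w a : a \is w.-homog -> exists p, fsub p = a.
Proof.
elim/ltn_ind: w a => w IH a aw; rewrite (mpolyE a); apply: fsub_surj_span => m ma.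
have mw : mdeg m = w := dhomog_mf aw ma.
have [le|lt] := leqP w (N * d.-1).+1; first by apply: surj_low; rewrite mw.
have [m1 m1E [m2 mE]] : exists2 m1, mdeg m1 = (N * d.-1).+1 & exists m2, m = (m1 + m2)%MM.
  have le : ((N * d.-1).+1 <= mdeg m)%N by rewrite mw ltnW.
  have [ms [sz msP] msE] := mon_split (ka := 1) (dl := mdeg m) (M := m) (esym (mul1n _)).
  exists (\sum_(k <- take (N * d.-1).+1 ms) k)%MM.
    rewrite mdeg_sum big_seq (eq_bigr (fun=> 1%N)) => [|k kt]; last by apply: msP; apply: mem_take kt.
    by rewrite -big_seq sum1_size size_take sz; case: ltnP => //; lia.
  by exists (\sum_(k <- drop (N * d.-1).+1 ms) k)%MM; rewrite {1}msE -{1}(cat_take_drop (N * d.-1).+1 ms) big_cat.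
(* In degree [N * (d - 1) + 1] every [fmon k] has a factor [f_i]. Splitting off a monomial [m1] of
   that degree thus writes [x^m] as a combination of [f_i] times forms of lower degree. *)
have [p pE] := surj_low (eq_leq m1E).
have X1 : ('X_[m1] : R) \is (N * d.-1).+1.-homog by rewrite dhomogX; apply/eqP.
have := fsub_pihomog (N * d.-1).+1 p; rewrite pE (pihomog_dE X1) => E.
rewrite mE mpolyXD -E {1}/fsub mulr_suml.
rewrite (eq_bigr (fun k => (pihomog mdeg (N * d.-1).+1 p)@_k *: (fmon k * 'X_[m2]))); last first.
  by move=> k _; rewrite -scalerAl.
apply: fsub_surj_span => k; rewrite mcoeff_msupp mcoeff_pihomog; case: ifP => [/eqP kE _|_]; last by rewrite eqxx.
have [i ki] : exists i, (d <= k i)%N.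
  apply: NNPP => /not_ex_all_not nk; have : (mdeg k <= N * d.-1)%N.
    rewrite mdegE -[N in (_ <= N * _)%N]card_ord -sum_nat_const; apply: leq_sum => i _.
    by rewrite -ltnS prednK // ltnNge; apply/negP.
  by rewrite kE ltnn.
rewrite (fmon_fold ki) -mulrA; apply: fsub_mulf.
apply: (IH (mdeg (k - U_(i) *+ d)%MM + mdeg m2)%N); last first.
  by apply: dhomogM; [apply: fmon_homog|rewrite dhomogX].
have kE' : (mdeg (k - U_(i) *+ d)%MM + d = mdeg k)%N.
  have -> : mdeg k = mdeg ((k - U_(i) *+ d) + U_(i) *+ d)%MM.
    congr mdeg; apply/mnmP => j; rewrite mnmDE mnmBE mulmnE mnm1E.
    by have [<-|_] := eqVneq i j; [rewrite mul1n subnK|rewrite mul0n subn0 addn0].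
  by rewrite mdegD mdegMn mdeg1 mul1n.
by rewrite -mw mE mdegD m1E -kE -kE'; lia.
Qed.

Lemma fsub_surj a : exists p, fsub p = a.
Proof.
rewrite (mpolyE a); apply: fsub_surj_span => m _.
by apply: (@fsub_surj_homog (mdeg m)); rewrite dhomogX.
Qed.

(* In each bounded degree [fsub] is a square system, hence surjectivity gives injectivity. *)
Lemma fsub_inj p : fsub p = 0 -> p = 0.
Proof.
move=> p0; pose K := msize p; pose I : finType := 'X_{1..N < K}.
pose ev (i : 'I_#|I|) : 'X_{1..N} := (enum_val i : 'X_{1..N < K}).
pose M : 'M[F]_#|I| := \matrix_(i, j) (fmon (ev i))@_(ev j).
have exq (j : 'I_#|I|) : exists q, fsub q = 'X_[ev j] /\ (msize q <= K)%N.
  have [q qE] := fsub_surj 'X_[ev j]; set w := mdeg (ev j).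
  exists (pihomog mdeg w q); rewrite fsub_pihomog qE pihomog_dE ?dhomogX //; split=> //.
  rewrite msizeE; apply/bigmax_leqP_seq => m; rewrite mcoeff_msupp mcoeff_pihomog.
  case: ifP => [/eqP -> _ _|_]; last by rewrite eqxx.
  exact: (bmdeg (enum_val j)).
have [q qP] := fin_all_exists exq.
have fsubI r : (msize r <= K)%N -> fsub r = \sum_(i < #|I|) r@_(ev i) *: fmon (ev i).
  move=> le; rewrite (fsubE (s := [seq (x : 'X_{1..N < K}) : 'X_{1..N} | x <- enum I])); first last.
  - move=> m mr; apply/mapP.
    have lt := leq_trans (msize_mdeg_lt mr) le.
    by exists (BMultinom lt); rewrite ?mem_enum.
  - by rewrite map_inj_uniq ?enum_uniq //; apply: val_inj.
  rewrite big_map big_enum /= [RHS](reindex (@enum_rank I)); last exact/onW_bij/enum_rank_bij.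
  by apply: eq_bigr => x _; rewrite /ev enum_rankK.
pose C : 'M[F]_#|I| := \matrix_(j, i) (q j)@_(ev i).
have CM : C *m M = 1%:M.
  apply/matrixP => j k; rewrite !mxE.
  have [qE le] := qP j; have := congr1 (mcoeff (ev k)) qE.
  rewrite fsubI // raddf_sum /= mcoeffX => E.
  transitivity ((ev j == ev k)%:R : F).
    by rewrite -E; apply: eq_bigr => i _; rewrite !mxE mcoeffZ.
  by congr (_%:R); congr nat_of_bool; rewrite -bmeqP (inj_eq enum_val_inj).
have MC := mulmx1C CM.
pose r : 'rV[F]_#|I| := \row_i p@_(ev i).
have r0 : r *m M = 0.
  apply/rowP => k; rewrite !mxE; have := congr1 (mcoeff (ev k)) p0.
  rewrite (fsubI p (leqnn _)) raddf_sum mcoeff0 /= => E; rewrite -[RHS]E.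
  by apply: eq_bigr => i _; rewrite !mxE mcoeffZ.
have : r = 0 by rewrite -[r]mulmx1 -MC mulmxA r0 mul0mx.
move=> r00; apply/mpolyP => m; rewrite mcoeff0.
have [mp|/memN_msupp_eq0 //] := boolP (m \in msupp p).
have := congr1 (fun v : 'rV_#|I| => v 0 (enum_rank (BMultinom (msize_mdeg_lt mp)))) r00.
by rewrite !mxE /ev enum_rankK.
Qed.

End Leading.

Section Basis.
Variables (F : fieldType) (N d : nat) (f : 'I_N -> {mpoly F[N]}).
Local Notation R := {mpoly F[N]}.
Hypotheses (d0 : (0 < d)%N) (fd : forall i, f i \is d.-homog).
Hypothesis surj_low : forall m, (mdeg m <= (N * d.-1).+1)%N -> exists p, fsub d f p = 'X_[m].
Local Notation B := {ffun 'I_N -> 'I_d}.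

Definition mexp (s : B) : 'X_{1..N} := [multinom (s i : nat) | i < N].

Definition fext (s : B) (p : R) : R :=
  \sum_(m <- msupp p | mrem d m == mexp s) p@_m *: 'X_[mquo d m].

Lemma mrem_mexp s c : mrem d (mexp s + c *+ d) = mexp s.
Proof.
by apply/mnmP => i; rewrite !mnmE mulmnE addnC modnMDl modn_small.
Qed.
Lemma mquo_mexp s c : mquo d (mexp s + c *+ d) = c.
Proof.
by apply/mnmP => i; rewrite !mnmE mulmnE divnDMl // divn_small.
Qed.

Lemma mexp_inj : injective mexp.
Proof.
move=> s t /mnmP E; apply/ffunP => i; apply/val_inj.
by have := E i; rewrite !mnmE.
Qed.

Lemma mexp_ex m : exists s, mrem d m = mexp s.
Proof.
exists [ffun i => Ordinal (ltn_pmod (m i) d0)].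
by apply/mnmP => i; rewrite !mnmE ffunE.
Qed.

Lemma coef_fext s p c : (fext s p)@_c = p@_(mexp s + c *+ d).
Proof.
rewrite /fext raddf_sum /= big_mkcond /=.
have key m : m != (mexp s + c *+ d)%MM ->
    (if mrem d m == mexp s then (p@_m *: 'X_[mquo d m])@_c else 0) = 0.
  move=> mn; case: eqP => // E1; rewrite mcoeffZ mcoeffX; case: eqP => [E2|]; last by rewrite mulr0.
  by case/eqP: mn; rewrite {1}(mdivE d m) E1 E2.
have [mp|mp] := boolP ((mexp s + c *+ d)%MM \in msupp p).
  rewrite (bigD1_seq (mexp s + c *+ d)%MM) ?msupp_uniq //= mrem_mexp eqxx.
  by rewrite mcoeffZ mcoeffX mquo_mexp eqxx mulr1 big1 ?addr0 // => m /key.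
rewrite (memN_msupp_eq0 mp) big_seq; apply: big1 => m mm; apply: key.
by apply: contraNneq mp => <-.
Qed.

Lemma fsub_fext p : fsub d f p = \sum_s cmp f (fext s p) * 'X_[mexp s].
Proof.
rewrite /fsub /fext.
under [RHS]eq_bigr do rewrite cmp_sum mulr_suml.
rewrite (exchange_big_dep predT) //=; apply: eq_bigr => m _.
have [s sE] := mexp_ex m; rewrite (big_pred1 s) => [|t]; last first.
  by rewrite sE eq_sym (inj_eq mexp_inj).
by rewrite /fmon sE cmpZ -scalerAl mulrC.
Qed.

Lemma finv_ex a : exists p, fsub d f p == a.
Proof. by have [p <-] := fsub_surj d0 fd surj_low a; exists p. Qed.
Definition finv a := xchoose (finv_ex a).
Lemma finvK a : fsub d f (finv a) = a.
Proof. exact/eqP/(xchooseP (finv_ex a)). Qed.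
Lemma fsubK p : finv (fsub d f p) = p.
Proof.
apply/eqP; rewrite -subr_eq0; apply/eqP/(fsub_inj d0 fd surj_low).
by rewrite fsubD -scaleN1r fsubZ finvK scaleN1r subrr.
Qed.

Definition fcoo a s := fext s (finv a).

Lemma fcoo_expand a : a = \sum_s cmp f (fcoo a s) * 'X_[mexp s].
Proof. by rewrite -fsub_fext finvK. Qed.

Lemma fcoo_free (c : B -> R) : \sum_s cmp f (c s) * 'X_[mexp s] = 0 -> forall s, c s = 0.
Proof.
move=> E s; pose p := \sum_s \sum_(k <- msupp (c s)) (c s)@_k *: 'X_[mexp s + k *+ d].
have pE : fsub d f p = 0.
  rewrite -[RHS]E fsub_sum; apply: eq_bigr => t _; rewrite fsub_sum.
  rewrite {3}[c t]mpolyE cmp_sum mulr_suml; apply: eq_bigr => k _.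
  by rewrite fsubZ fsubX /fmon mrem_mexp mquo_mexp cmpZ -scalerAl mulrC.
have p0 := fsub_inj d0 fd surj_low pE.
apply/mpolyP => k; rewrite mcoeff0 -[RHS](mcoeff0 F (mexp s + k *+ d)%MM) -p0 /p raddf_sum /=.
rewrite (bigD1 s) //= [X in _ = _ + X]big1 ?addr0 => [|t ts].
  rewrite {1}[c s]mpolyE !raddf_sum; apply: eq_bigr => l _ /=; rewrite !mcoeffZ !mcoeffX.
  congr (_ * _%:R); congr nat_of_bool; apply/eqP/eqP => [->//|E1].
  by rewrite -(mquo_mexp s l) E1 mquo_mexp.
rewrite raddf_sum; apply: big1 => l _ /=; rewrite mcoeffZ mcoeffX.
case: eqP => [E1|]; last by rewrite mulr0.
by case/eqP: ts; apply: mexp_inj; rewrite -(mrem_mexp t l) E1 mrem_mexp.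
Qed.

Lemma fcoo_eq a (c : B -> R) : a = \sum_s cmp f (c s) * 'X_[mexp s] -> forall s, fcoo a s = c s.
Proof.
move=> aE s; apply/eqP; rewrite -subr_eq0; apply/eqP.
apply: (fcoo_free (c := fun s => fcoo a s - c s)).
rewrite -[RHS](subrr a) {3}aE {2}[a]fcoo_expand -sumrB.
by apply: eq_bigr => t _; rewrite cmpB mulrBl.
Qed.

Lemma fcoo_lin p a a' s : fcoo (cmp f p * a + a') s = p * fcoo a s + fcoo a' s.
Proof.
apply: (fcoo_eq (c := fun s => p * fcoo a s + fcoo a' s)).
rewrite {1}[a]fcoo_expand {1}[a']fcoo_expand mulr_sumr -big_split /=.
by apply: eq_bigr => t _; rewrite cmpD cmpM mulrDl mulrA.
Qed.

Lemma fcoo_wt w a s : a \is w.-homog -> wt d (Posz w - Posz (mdeg (mexp s))) (fcoo a s).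
Proof.
move=> aw; have ih : finv a \is w.-homog.
  by rewrite -(fsubK (finv a)) finvK -(pihomog_dE aw) -[a]finvK -fsub_pihomog // fsubK pihomogP.
apply: wt_sum => // m /eqP mE; have [m0|m0] := eqVneq (finv a)@_m 0.
  by rewrite m0 scale0r; left.
have mw : mdeg m = w by apply: (dhomog_mf ih); rewrite mcoeff_msupp.
right; exists (mdeg (mquo d m)); last by apply: dhomogZ; rewrite dhomogX.
by rewrite -mw {2}(mdivE d m) mdegD mdegMn mE; lia.
Qed.

Lemma pred_lt : (d.-1 < d)%N. Proof. by rewrite ltn_predL. Qed.
Definition ftopi : B := [ffun=> Ordinal pred_lt].

Lemma mdeg_top : mdeg (mexp ftopi) = (N * d.-1)%N.
Proof.
rewrite mdegE (eq_bigr (fun=> d.-1)) => [|i _]; last by rewrite mnmE ffunE.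
by rewrite sum_nat_const card_ord.
Qed.

Definition frevi (s : B) : B := [ffun i => rev_ord (s i)].
Lemma freviK : involutive frevi.
Proof. by move=> s; apply/ffunP => i; rewrite !ffunE rev_ordK. Qed.
Lemma mexp_rev s : (mdeg (mexp s) + mdeg (mexp (frevi s)) = N * d.-1)%N.
Proof.
rewrite !mdegE -big_split (eq_bigr (fun=> d.-1)) => [|i _].
  by rewrite sum_nat_const card_ord.
by rewrite !mnmE ffunE /=; have := ltn_ord (s i); lia.
Qed.

Definition fgram : 'M[R]_#|{: B}| :=
  \matrix_(s, t) fcoo ('X_[mexp (enum_val s)] * 'X_[mexp (enum_val t)]) ftopi.

Lemma sum_mdeg : (\sum_(s < #|{: B}|) mdeg (mexp (enum_val s)) * 2 = #|{: B}| * (N * d.-1))%N.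
Proof.
have E : (\sum_(s < #|{: B}|) mdeg (mexp (enum_val s)) = \sum_(s : B) mdeg (mexp s))%N.
  by rewrite [RHS](reindex (@enum_val _ {: B})) //; apply/onW_bij/enum_val_bij.
rewrite -big_distrl /= E muln2 -addnn {2}(reindex frevi) /=; last exact/onW_bij/inv_bij/freviK.
by rewrite -big_split (eq_bigr _ (fun s _ => mexp_rev s)) sum_nat_const.
Qed.

Lemma wt_prod (I : Type) (r : seq I) (w : I -> int) (E : I -> R) :
  (forall i, wt d (w i) (E i)) -> wt d (\sum_(i <- r) w i) (\prod_(i <- r) E i).
Proof.
move=> H; elim/big_rec2: _ => [|i x y _ H']; last exact: wtM.
by right; exists 0%N; rewrite ?muln0 ?dhomog1.
Qed.

(** Complementary exponents show that the basis degrees average to half of [N * (d - 1)], so along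
    any permutation the weights of the entries add up to zero. *)
Lemma fgram_const : \det fgram \is 0.-homog.
Proof.
apply: (@wt_homog F N d 0) => //; last by rewrite muln0.
apply: wt_sum => // s _; rewrite -[0]add0r; apply: wtM.
  right; exists 0%N; rewrite ?muln0 // -signr_odd; case: (odd _); rewrite ?dhomog1 //.
  by rewrite expr1 dhomogN dhomog1.
pose dg (i : 'I_#|{: B}|) := Posz (mdeg (mexp (enum_val i))).
have -> : 0 = \sum_i (dg i + dg (s i) - Posz (N * d.-1)).
  have E1 : \sum_i dg (s i) = \sum_i dg i by rewrite [RHS](reindex_inj (@perm_inj _ s)).
  rewrite sumrB big_split /= E1 -!(big_morph Posz PoszD (erefl _)) sum_nat_const card_ord.
  by have := sum_mdeg; rewrite -big_distrl /=; lia.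
apply: wt_prod => i; rewrite mxE.
have hm := @dhomogM _ F mdeg _ 'X_[mexp (enum_val i)] _ 'X_[mexp (enum_val (s i))].
have := fcoo_wt ftopi (hm _ _ (etrans (dhomogX _ _ _ _) (eqxx _)) (etrans (dhomogX _ _ _ _) (eqxx _))).
by rewrite mdeg_top PoszD.
Qed.

Hypothesis fgram0 : \det fgram != 0.

(** A nonzero constant determinant makes the Gram matrix invertible over the polynomial ring, and
    its adjugate produces the representing element. *)
Theorem fstruct_power : inhabited (fstruct f d).
Proof.
have co0 s : fcoo 0 s = 0 by have := fcoo_lin (-1) 0 0 s; rewrite mulr0 addr0 mulN1r addNr.
have coM p a s : fcoo (cmp f p * a) s = p * fcoo a s.
  by rewrite -[cmp f p * a]addr0 fcoo_lin co0 addr0.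
have coD a b s : fcoo (a + b) s = fcoo a s + fcoo b s.
  by rewrite -[a]mul1r -(cmp1 f) fcoo_lin cmp1 !mul1r.
have co_sum (E : 'I_#|{: B}| -> R) s : fcoo (\sum_i E i) s = \sum_i fcoo (E i) s.
  by elim/big_rec2: _ => [|i x y _ <-]; rewrite ?co0 ?coD.
have exE a : a = \sum_(s < #|{: B}|) cmp f (fcoo a (enum_val s)) * 'X_[mexp (enum_val s)].
  rewrite {1}[a]fcoo_expand [LHS](reindex (@enum_val _ {: B})) //; exact/onW_bij/enum_val_bij.
have gramE (v : 'rV[R]_#|{: B}|) t :
    fcoo ((\sum_s cmp f (v 0 s) * 'X_[mexp (enum_val s)]) * 'X_[mexp (enum_val t)]) ftopi =
    (v *m fgram) 0 t.
  rewrite mulr_suml co_sum mxE; apply: eq_bigr => s _; rewrite -mulrA coM; congr (_ * _).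
  by rewrite mxE.
apply: (@fstruct_fin F N _ f d (fun s : B => 'X_[mexp s]) (fun s => mdeg (mexp s)) fcoo ftopi) => //.
- by move=> s; rewrite dhomogX.
- exact: fcoo_expand.
- exact: fcoo_free.
- exact: mdeg_top.
- move=> a aE; pose v : 'rV[R]_#|{: B}| := \row_s fcoo a (enum_val s).
  have v0 : v *m fgram = 0.
    have sE : \sum_s cmp f (v 0 s) * 'X_[mexp (enum_val s)] = a.
      by rewrite [RHS]exE; apply: eq_bigr => s _; rewrite mxE.
    by apply/rowP => t; rewrite -gramE sE aE mxE.
  have : v = 0.
    have : \det fgram *: v = 0 by rewrite -mul_mx_scalar -mul_mx_adj mulmxA v0 mul0mx.
    by move/eqP; rewrite scalemx_eq0 (negPf fgram0) => /eqP.
  move=> vz; rewrite [a]exE big1 // => s _.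
  have := congr1 (fun w : 'rV_#|{: B}| => w 0 s) vz; rewrite !mxE => ->.
  by rewrite cmp0 mul0r.
move=> th lin.
have th0 : th 0 = 0 by have := lin (-1) 0 0; rewrite mulr0 addr0 mulN1r addNr.
have th_sum (X : 'I_#|{: B}| -> R) (Y : 'I_#|{: B}| -> R) :
    th (\sum_i cmp f (X i) * Y i) = \sum_i X i * th (Y i).
  by elim/big_rec2: _ => // i x y _ <-; rewrite lin.
have [c cE] : exists c : R, c * \det fgram = 1.
  have := homog0C fgram_const; set k := _@_0%MM => kE; rewrite kE.
  exists (k^-1)%:MP; rewrite -mpolyCM mulVf ?mpolyC1 //.
  by apply: contraNneq fgram0 => k0; rewrite kE k0 mpolyC0.
pose w : 'rV[R]_#|{: B}| := \row_t th 'X_[mexp (enum_val t)].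
pose v := c *: (w *m \adj fgram).
have vE : v *m fgram = w.
  by rewrite /v -scalemxAl -mulmxA mul_adj_mx mul_mx_scalar scalerA cE scale1r.
exists (\sum_s cmp f (v 0 s) * 'X_[mexp (enum_val s)]) => a.
set t := \sum_s _; rewrite [a]exE th_sum mulr_sumr co_sum; apply: eq_bigr => s _.
by rewrite mulrCA coM gramE vE [w 0 s]mxE.
Qed.

End Basis.

(** * Functions rational in parameters and the dimension count *)

Section Pf.
Variables (F : fieldType) (Z : Type) (M : nat).
Variables (dom : Z -> Prop) (th : Z -> 'I_M -> F) (c : Z -> F).
Hypothesis cP : exists C : {mpoly F[M]}, forall z, dom z -> c z = C.@[th z].

(* [phi] is a polynomial in the parameters, up to a power of the denominator [c]. *)
Definition pf (phi : Z -> F) := exists E (P : {mpoly F[M]}),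
  forall z, dom z -> c z ^+ E * phi z = P.@[th z].

Lemma pf_ext phi psi : (forall z, dom z -> phi z = psi z) -> pf phi -> pf psi.
Proof. by move=> E [k [P H]]; exists k, P => z dz; rewrite -E // H. Qed.

Lemma pf_up phi E P k : (forall z, dom z -> c z ^+ E * phi z = P.@[th z]) ->
  exists Q, forall z, dom z -> c z ^+ (k + E) * phi z = Q.@[th z].
Proof.
case: cP => C CE H; exists (C ^+ k * P) => z dz.
by rewrite exprD -mulrA H // mevalM CE // rmorphXn.
Qed.

Lemma pf_const a : pf (fun=> a).
Proof. by exists 0%N, a%:MP => z _; rewrite expr0 mul1r mevalC. Qed.

Lemma pf_param i : pf (fun z => th z i).
Proof. by exists 0%N, 'X_i => z _; rewrite expr0 mul1r mevalXU. Qed.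

Lemma pfD phi psi : pf phi -> pf psi -> pf (fun z => phi z + psi z).
Proof.
move=> [E [P H]] [E' [P' H']]; have [Q QE] := pf_up E' H; have [Q' QE'] := pf_up E H'.
exists (E' + E)%N, (Q + Q') => z dz; rewrite mulrDr mevalD QE //; congr (_ + _).
by rewrite addnC QE'.
Qed.

Lemma pfM phi psi : pf phi -> pf psi -> pf (fun z => phi z * psi z).
Proof.
move=> [E [P H]] [E' [P' H']]; exists (E + E')%N, (P * P') => z dz.
by rewrite exprD mulrACA H // H' // mevalM.
Qed.

Lemma pfN phi : pf phi -> pf (fun z => - phi z).
Proof. by case=> E [P H]; exists E, (- P) => z dz; rewrite mulrN H // mevalN. Qed.

Lemma pf_sum (I : Type) (r : seq I) (Q : pred I) (phi : I -> Z -> F) :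
  (forall i, pf (phi i)) -> pf (fun z => \sum_(i <- r | Q i) phi i z).
Proof.
move=> H; elim: r => [|i r IH].
  by apply: pf_ext (pf_const 0) => z _; rewrite big_nil.
case Qi: (Q i).
  by apply: pf_ext (pfD (H i) IH) => z _; rewrite big_cons Qi.
by apply: pf_ext IH => z _; rewrite big_cons Qi.
Qed.

Lemma pf_prod (I : Type) (r : seq I) (Q : pred I) (phi : I -> Z -> F) :
  (forall i, pf (phi i)) -> pf (fun z => \prod_(i <- r | Q i) phi i z).
Proof.
move=> H; elim: r => [|i r IH].
  by apply: pf_ext (pf_const 1) => z _; rewrite big_nil.
case Qi: (Q i).
  by apply: pf_ext (pfM (H i) IH) => z _; rewrite big_cons Qi.
by apply: pf_ext IH => z _; rewrite big_cons Qi.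
Qed.

Lemma pfX phi k : pf phi -> pf (fun z => phi z ^+ k).
Proof.
move=> H; elim: k => [|k IH]; first by apply: pf_ext (pf_const 1).
by apply: pf_ext (pfM H IH) => z _; rewrite exprS.
Qed.

Lemma pf_det r (A : Z -> 'M[F]_r) : (forall i j, pf (fun z => A z i j)) ->
  pf (fun z => \det (A z)).
Proof.
by move=> H; apply: pf_sum => s; apply: pfM (pf_const _) _; apply: pf_prod => i; apply: H.
Qed.

Lemma pf_cofactor r (A : Z -> 'M[F]_r) i j : (forall i j, pf (fun z => A z i j)) ->
  pf (fun z => cofactor (A z) i j).
Proof.
move=> H; apply: pfM (pf_const _) _; apply: pf_det => k l.
by apply: pf_ext (H (lift i k) (lift j l)) => z _; rewrite !mxE.
Qed.

Lemma pf_div phi : (forall z, dom z -> c z != 0) -> pf phi -> pf (fun z => phi z / c z).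
Proof.
move=> c0 [E [P H]]; exists E.+1, P => z dz.
by rewrite exprSr mulrACA mulfV ?c0 // mulr1 H.
Qed.

Variable n : nat.
Local Notation R := {mpoly F[n]}.

Definition pfp (p : Z -> R) := forall m, pf (fun z => (p z)@_m).

Lemma pfp_ext p q : (forall z, dom z -> p z = q z) -> pfp p -> pfp q.
Proof. by move=> E H m; apply: pf_ext (H m) => z dz; rewrite E. Qed.
Lemma pfp_const p : pfp (fun=> p). Proof. by move=> m; apply: pf_const. Qed.
Lemma pfpD p q : pfp p -> pfp q -> pfp (fun z => p z + q z).
Proof. by move=> Hp Hq m; apply: pf_ext (pfD (Hp m) (Hq m)) => z _; rewrite mcoeffD. Qed.
Lemma pfpN p : pfp p -> pfp (fun z => - p z).
Proof. by move=> Hp m; apply: pf_ext (pfN (Hp m)) => z _; rewrite mcoeffN. Qed.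
Lemma pfpZ phi p : pf phi -> pfp p -> pfp (fun z => phi z *: p z).
Proof. by move=> Hf Hp m; apply: pf_ext (pfM Hf (Hp m)) => z _; rewrite mcoeffZ. Qed.
Lemma pfpM p q : pfp p -> pfp q -> pfp (fun z => p z * q z).
Proof.
move=> Hp Hq m.
apply: (@pf_ext (fun z => \sum_(k : 'X_{1..n < (mdeg m).+1, (mdeg m).+1} |
   m == (k.1 + k.2)%MM) (p z)@_(k.1) * (q z)@_(k.2))).
  by move=> z _; rewrite mcoeffM.
by apply: pf_sum => k; apply: pfM; [apply: Hp|apply: Hq].
Qed.
Lemma pfp_sum (I : Type) (r : seq I) (Q : pred I) (p : I -> Z -> R) :
  (forall i, pfp (p i)) -> pfp (fun z => \sum_(i <- r | Q i) p i z).
Proof.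
move=> H m; apply: (@pf_ext (fun z => \sum_(i <- r | Q i) (p i z)@_m)).
  by move=> z _; rewrite raddf_sum.
by apply: pf_sum => i; apply: H.
Qed.
Lemma pfp_prod (I : Type) (r : seq I) (Q : pred I) (p : I -> Z -> R) :
  (forall i, pfp (p i)) -> pfp (fun z => \prod_(i <- r | Q i) p i z).
Proof.
move=> H; elim: r => [|i r IH].
  by apply: pfp_ext (pfp_const 1) => z _; rewrite big_nil.
case Qi: (Q i).
  by apply: pfp_ext (pfpM (H i) IH) => z _; rewrite big_cons Qi.
by apply: pfp_ext IH => z _; rewrite big_cons Qi.
Qed.
Lemma pfpX p k : pfp p -> pfp (fun z => p z ^+ k).
Proof.
move=> H; elim: k => [|k IH]; first by apply: pfp_ext (pfp_const 1).
by apply: pfp_ext (pfpM H IH) => z _; rewrite exprS.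
Qed.
Lemma pfp_deriv p i : pfp p -> pfp (fun z => mderiv i (p z)).
Proof.
move=> H m; apply: pf_ext (pfM (H (m + U_(i))%MM) (pf_const ((m i).+1%:R))) => z _.
by rewrite mcoeff_deriv mulr_natr.
Qed.
Lemma pfp_det r (A : Z -> 'M[R]_r) : (forall i j, pfp (fun z => A z i j)) ->
  pfp (fun z => \det (A z)).
Proof.
by move=> H; apply: pfp_sum => s; apply: pfpM (pfp_const _) _; apply: pfp_prod => i; apply: H.
Qed.

Lemma homog_sum w (p : R) : p \is w.-homog ->
  p = \sum_(m : 'X_{1..n < w.+1}) p@_m *: 'X_[m].
Proof.
move=> pw; apply: mpolywE; rewrite msizeE; apply/bigmax_leqP_seq => m mp _.
by rewrite ltnS (dhomog_mf pw mp).
Qed.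

Lemma pfp_cmp w (g : Z -> 'I_n -> R) (p : Z -> R) :
  (forall z, dom z -> p z \is w.-homog) -> (forall i, pfp (fun z => g z i)) -> pfp p ->
  pfp (fun z => cmp (g z) (p z)).
Proof.
move=> ph Hg Hp.
apply: (@pfp_ext (fun z => \sum_(m : 'X_{1..n < w.+1}) (p z)@_m *: \prod_i g z i ^+ m i)).
  move=> z dz; rewrite [in RHS](homog_sum (ph z dz)) cmp_sum.
  by apply: eq_bigr => m _; rewrite cmpZ cmpXm.
apply: pfp_sum => m; apply: pfpZ; first exact: Hp.
by apply: pfp_prod => i; apply/pfpX/Hg.
Qed.

Lemma pf_meval w (x : Z -> 'I_n -> F) (p : Z -> R) :
  (forall z, dom z -> p z \is w.-homog) -> (forall i, pf (fun z => x z i)) -> pfp p ->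
  pf (fun z => (p z).@[x z]).
Proof.
move=> ph Hx Hp.
apply: (@pf_ext (fun z => \sum_(m : 'X_{1..n < w.+1}) (p z)@_m * \prod_i x z i ^+ m i)).
  move=> z dz; rewrite [in RHS](homog_sum (ph z dz)) [RHS](rmorph_sum (meval (x z))).
  by apply: eq_bigr => m _; rewrite /= mevalZ mevalX.
apply: pf_sum => m; apply: pfM; first exact: Hp.
by apply: pf_prod => i; apply/pfX/Hx.
Qed.

End Pf.

Section DimensionCount.
Variables (F : fieldType) (Z : Type) (M K : nat).
Variables (dom : Z -> Prop) (th : Z -> 'I_M -> F) (c : Z -> F).
Hypothesis cP : exists C : {mpoly F[M]}, forall z, dom z -> c z = C.@[th z].
Hypothesis c0 : forall z, dom z -> c z != 0.
Hypothesis MK : (M < K)%N.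

Lemma msizeM_pred n (p q : {mpoly F[n]}) : (msize (p * q) <= (msize p + msize q).-1)%N.
Proof.
have [->|p0] := eqVneq p 0; first by rewrite mul0r mmeasure0.
have [->|q0] := eqVneq q 0; first by rewrite mulr0 mmeasure0.
by rewrite msizeM.
Qed.

Lemma msize_exp n (P : {mpoly F[n]}) D k : (msize P <= D.+1)%N -> (msize (P ^+ k) <= (k * D).+1)%N.
Proof.
move=> le; elim: k => [|k IH]; first by rewrite expr0 msize1.
rewrite exprS; apply: leq_trans (msizeM_pred _ _) _; rewrite mulSn.
by move: le IH; move: (mmeasure _ _) (mmeasure _ _); lia.
Qed.

Lemma msize_prod n (I : finType) (E : I -> {mpoly F[n]}) (b : I -> nat) :
  (forall i, msize (E i) <= (b i).+1)%N -> (msize (\prod_i E i) <= (\sum_i b i).+1)%N.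
Proof.
move=> H; elim/big_rec2: _ => [|i x y _ IH]; first by rewrite msize1.
apply: leq_trans (msizeM_pred _ _) _; have := H i.
by move: IH; move: (mmeasure _ _) (mmeasure _ _); lia.
Qed.

Lemma card_bmultinom n L : (#|{: 'X_{1..n < L}}| <= L ^ n)%N.
Proof.
case: L => [|L].
  rewrite (eq_card0 (A := {: 'X_{1..n < 0}})) // => m; by have := bmdeg m.
pose inj (m : 'X_{1..n < L.+1}) : {ffun 'I_n -> 'I_L.+1} := [ffun i => inord (m i)].
have : injective inj.
  move=> m m' /ffunP E; apply/eqP; rewrite bmeqP; apply/eqP/mnmP => i.
  have := congr1 val (E i); rewrite !ffunE /= !inordK //.
    by apply: leq_ltn_trans (bmdeg m'); rewrite mdegE (bigD1 i) //= leq_addr.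
  by apply: leq_ltn_trans (bmdeg m); rewrite mdegE (bigD1 i) //= leq_addr.
by move/leq_card; rewrite card_ffun !card_ord.
Qed.

(** Cleared of denominators, the [B ^ K] monomials in [v] with exponents below [B] are polynomials
    of degree at most [a * B] in [M < K] parameters. For large [B] there are too many of them to be
    linearly independent, and a dependence is the relation [G]. *)
Theorem dimension_count (v : Z -> 'I_K -> F) : (forall k, pf dom th c (fun z => v z k)) ->
  exists G : {mpoly F[K]}, G != 0 /\ forall z, dom z -> G.@[v z] = 0.
Proof.
move=> vP.
have [E1 E1P] := fin_all_exists vP.
have [P1 PE1] := fin_all_exists E1P.
pose E := (\sum_k E1 k)%N.
have /fin_all_exists[P PE] k : exists Q, forall z, dom z -> c z ^+ E * v z k = Q.@[th z].
  have := pf_up cP (E - E1 k) (PE1 k); rewrite subnK // /E (bigD1 k) //= leq_addr //.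
have [C CE] := cP.
pose D := (msize C + \sum_k msize (P k))%N.
have PD k : (msize (P k) <= D.+1)%N.
  by rewrite /D (bigD1 k) //= leqW // addnCA leq_addr.
have CD : (msize C <= D.+1)%N by rewrite leqW // leq_addr.
(* With [B > (a + 1) ^ M] one has [((a + 1) * B) ^ M < B ^ (M + 1) <= B ^ K]. *)
pose a := (E * K * D + K * D)%N.
pose B := ((a.+1) ^ M).+1.
pose I : finType := {ffun 'I_K -> 'I_B}.
(* All monomials are brought to the common denominator [c ^ (E * K * B)]. *)
pose Q (s : I) := C ^+ (E * (K * B - \sum_k s k)) * \prod_k P k ^+ s k.
pose L := (a * B).+1.
have sB (s : I) : (\sum_k s k <= K * B)%N.
  rewrite -[K in (_ <= K * _)%N]card_ord -sum_nat_const; apply: leq_sum => k _; exact: ltnW.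
have QL s : (msize (Q s) <= L)%N.
  apply: leq_trans (msizeM_pred _ _) _.
  have h1 := msize_exp (E * (K * B - \sum_k s k)) CD.
  have h2 : (msize (\prod_k P k ^+ s k) <= (\sum_k s k * D).+1)%N.
    by apply: msize_prod => k; apply: msize_exp.
  have h3 : (\sum_k s k * D <= K * B * D)%N by rewrite -big_distrl /= leq_mul2r sB orbT.
  have h4 : (E * (K * B - \sum_k s k) * D <= E * (K * B) * D)%N.
    by rewrite leq_mul2r leq_mul2l leq_subr !orbT.
  have : (L = (E * (K * B) * D + K * B * D).+1)%N by rewrite /L /a; nia.
  by move: h1 h2 h3 h4; move: (mmeasure _ _) (mmeasure _ _); lia.
pose J : finType := 'X_{1..M < L}.
have lt : (#|J| < #|I|)%N.
  apply: leq_ltn_trans (card_bmultinom _ _) _; rewrite card_ffun !card_ord.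
  apply: (@leq_ltn_trans ((a.+1 * B) ^ M)).
    by case: (M) => // k; rewrite leq_exp2r // /L; rewrite mulSn addnC -[X in (X < _)%N]addn0 ltn_add2l.
  rewrite expnMn; apply: (@leq_trans (B ^ M.+1)); last by rewrite leq_pexp2l.
  by rewrite expnS ltn_pmul2r ?expn_gt0.
pose A : 'M[F]_(#|I|, #|J|) := \matrix_(s, m) (Q (enum_val s))@_(enum_val m : 'X_{1..M < L}).
have [s0 rs0] : exists s0, row s0 (kermx A) != 0.
  apply: NNPP => /not_ex_all_not nr.
  have k0 : kermx A = 0.
    by apply/row_matrixP => s; rewrite row0; apply/eqP; apply: contraT => /nr.
  have : row_free A by rewrite -kermx_eq0 k0.
  rewrite /row_free => /eqP rA; have := rank_leq_col A; rewrite rA.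
  by rewrite leqNgt lt.
pose la := row s0 (kermx A).
have laA : la *m A = 0 by rewrite -row_mul mulmx_ker row0.
pose mon (s : I) : 'X_{1..K} := [multinom (s k : nat) | k < K].
exists (\sum_s la 0 s *: 'X_[mon (enum_val s)]); split.
  have /rV0Pn[s ls] := rs0; apply: contraNneq ls => G0.
  have := congr1 (mcoeff (mon (enum_val s))) G0; rewrite raddf_sum mcoeff0 /= => E0.
  apply/eqP; rewrite -[LHS]/(la 0 s) -[RHS]E0 (bigD1 s) //= mcoeffZ mcoeffX eqxx mulr1 big1 ?addr0 // => t ts.
  rewrite mcoeffZ mcoeffX; case: eqP => [/mnmP Em|]; last by rewrite mulr0.
  case/eqP: ts; apply: enum_val_inj; apply/ffunP => k; apply/val_inj.
  by have := Em k; rewrite !mnmE.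
move=> z dz; apply: (mulfI (expf_neq0 (E * (K * B)) (c0 dz))); rewrite mulr0.
have QE s : c z ^+ (E * (K * B)) * \prod_k v z k ^+ (s : I) k = (Q s).@[th z].
  rewrite /Q mevalM rmorphXn rmorph_prod /= -CE //.
  have -> : (E * (K * B) = E * (K * B - \sum_k s k) + \sum_k E * s k)%N.
    by rewrite -big_distrr /= -mulnDr subnK.
  rewrite exprD -mulrA; congr (_ * _); rewrite -prodrXr -big_split; apply: eq_bigr => k _ /=.
  by rewrite rmorphXn /= -PE // exprMn exprM.
rewrite [X in _ * X](rmorph_sum (meval (v z))) mulr_sumr.
transitivity ((\sum_s la 0 s *: Q (enum_val s)).@[th z]).
  rewrite [RHS](rmorph_sum (meval (th z))); apply: eq_bigr => s _ /=.
  rewrite !mevalZ mevalX mulrCA -QE; congr (_ * (_ * _)).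
  by apply: eq_bigr => k _; rewrite mnmE.
suff -> : \sum_s la 0 s *: Q (enum_val s) = 0 by rewrite meval0.
apply/mpolyP => m; rewrite mcoeff0 raddf_sum /=.
have [mL|mL] := ltnP (mdeg m) L.
  have := congr1 (fun w : 'rV_#|J| => w 0 (enum_rank (BMultinom mL : J))) laA; rewrite !mxE => E0.
  by rewrite -[RHS]E0; apply: eq_bigr => s _; rewrite mcoeffZ [A s _]mxE enum_rankK.
apply: big1 => s _; rewrite mcoeffZ memN_msupp_eq0 ?mulr0 //; apply: msize_mdeg_ge.
exact: leq_trans (QL _) mL.
Qed.

End DimensionCount.

(** * Generic conditions on the coefficients; generic freeness *)

Section Generic.
Variables (F : closedFieldType) (n d : nat).
Local Notation N := n.+1.
Local Notation R := {mpoly F[n.+1]}.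
Local Notation M := #|coef_index n d|.

Definition hom (f : polymap F n) := forall i, f i \is d.-homog.
Definition pfun := @pf F (polymap F n) M hom (@coeffs F n d) (fun=> 1).
Definition pfam := @pfp F (polymap F n) M hom (@coeffs F n d) (fun=> 1) n.+1.

Lemma one_param : exists C : {mpoly F[M]}, forall z : polymap F n, hom z -> 1 = C.@[@coeffs F n d z].
Proof. by exists 1 => z _; rewrite meval1. Qed.

Lemma coeffs_rank f (i : 'I_N) (m : {m : 'X_{1..N < d.+1} | mdeg m == d}) :
  @coeffs F n d f (enum_rank (i, m)) = (f i)@_(val (val m) : 'X_{1..N}).
Proof. by rewrite /coeffs enum_rankK. Qed.

Lemma coef_index_ex (m : 'X_{1..N}) : mdeg m = d ->
  exists m' : {m : 'X_{1..N < d.+1} | mdeg m == d}, val (val m') = m :> 'X_{1..N}.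
Proof.
move=> md; have lt : (mdeg m < d.+1)%N by rewrite md.
have e : mdeg (BMultinom lt) == d by apply/eqP.
by exists (exist _ (BMultinom lt) e).
Qed.

Lemma pfam_var i : pfam (fun f => f i).
Proof.
move=> m; have [md|md] := eqVneq (mdeg m) d.
  have [m' m'E] := coef_index_ex md.
  apply: pf_ext (pf_param _ _ _ (enum_rank (i, m'))) => f _.
  by rewrite coeffs_rank m'E.
by apply: pf_ext (pf_const _ _ _ 0) => f fh; rewrite (dhomog_nemf_coeff (fh i)).
Qed.

Definition gen (Q : polymap F n -> Prop) := exists G : {mpoly F[M]}, G != 0 /\
  forall f, hom f -> G.@[@coeffs F n d f] != 0 -> Q f.

Lemma gen_pfun phi f0 : pfun phi -> hom f0 -> phi f0 != 0 -> gen (fun f => phi f != 0).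
Proof.
move=> [E [P PE]] h0 p0; exists P; split.
  by apply: contraNneq p0 => P0; have := PE f0 h0; rewrite P0 meval0 expr1n mul1r => ->.
by move=> f fh; rewrite -PE // expr1n mul1r.
Qed.

Lemma gen_imp Q Q' : (forall f, hom f -> Q f -> Q' f) -> gen Q -> gen Q'.
Proof. by move=> QQ [G [G0 H]]; exists G; split=> // f fh Gf; apply: QQ => //; apply: H. Qed.

Lemma gen_and Q Q' : gen Q -> gen Q' -> gen (fun f => Q f /\ Q' f).
Proof.
move=> [G [G0 H]] [G' [G0' H']]; exists (G * G'); split; first by rewrite mulf_neq0.
by move=> f fh; rewrite mevalM mulf_eq0 negb_or => /andP[g g']; split; [apply: H|apply: H'].
Qed.

Hypothesis d0 : (0 < d)%N.

Section Free.
(** Room for the degree [N * (d - 1) + 1] of [surj_low] and for products of two basis monomials, of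
    degree at most [2 * N * (d - 1)]. *)
Let K := ((N * d.-1) * 2).+2.
Let I : finType := 'X_{1..N < K}.
Let ev (i : 'I_#|I|) : 'X_{1..N} := (enum_val i : 'X_{1..N < K}).
Let MK (f : polymap F n) : 'M[F]_#|I| := \matrix_(i, j) (fmon d f (ev i))@_(ev j).
Let B := {ffun 'I_N -> 'I_d}.

Lemma ltK a : (a <= (N * d.-1).+1)%N -> (a < K)%N.
Proof. by rewrite /K; move: (N * d.-1)%N => x; lia. Qed.
Lemma ltK2 a b : (a <= N * d.-1)%N -> (b <= N * d.-1)%N -> (a + b < K)%N.
Proof. by rewrite /K; move: (N * d.-1)%N => x; lia. Qed.

Lemma ev_ex m : (mdeg m < K)%N -> exists i, ev i = m.
Proof. by move=> lt; exists (enum_rank (BMultinom lt : I)); rewrite /ev enum_rankK. Qed.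
Lemma ev_inj : injective ev.
Proof. by move=> i j E; apply: enum_val_inj; apply/eqP; rewrite bmeqP; apply/eqP. Qed.

Lemma mdeg0_lt : (mdeg (0%MM : 'X_{1..N}) < K)%N. Proof. by rewrite mdeg0. Qed.
Let ix m : 'I_#|I| := odflt (enum_rank (BMultinom mdeg0_lt : I))
  [pick i | ev i == m].
Lemma ixE m : (mdeg m < K)%N -> ev (ix m) = m.
Proof.
move=> lt; rewrite /ix; case: pickP => [i /eqP //|ni].
by have [i iE] := ev_ex lt; have := ni i; rewrite iE eqxx.
Qed.

Lemma pfam_fmon m : pfam (fun f => fmon d f m).
Proof.
apply: (pfpM one_param); first exact: pfp_const.
apply: (@pfp_cmp _ _ _ _ _ _ one_param _ (mdeg (mquo d m))).
- by move=> z _; rewrite dhomogX.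
- exact: pfam_var.
exact: pfp_const.
Qed.

Lemma pfun_MK i j : pfun (fun f => MK f i j).
Proof. by apply: pf_ext (pfam_fmon (ev i) (ev j)) => f _; rewrite mxE. Qed.

Lemma fsub_MK f i : hom f -> \det (MK f) != 0 ->
  fsub d f (\sum_j invmx (MK f) i j *: 'X_[ev j]) = 'X_[ev i].
Proof.
move=> fh Mu; rewrite fsub_sum; apply/mpolyP => m; rewrite raddf_sum /=.
have [lt|ge] := ltnP (mdeg m) K.
  have [k <-] := ev_ex lt; rewrite mcoeffX (inj_eq ev_inj).
  have := congr1 (fun X : 'M_#|I| => X i k) (@mulVmx _ _ (MK f) _).
  rewrite unitmxE unitfE Mu => /(_ isT); rewrite !mxE => <-.
  by apply: eq_bigr => j _; rewrite fsubZ fsubX mcoeffZ mxE.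
rewrite mcoeffX; have ne x : (mdeg x < K)%N -> x != m.
  by move=> lx; apply: contraTneq ge => <-; rewrite -ltnNge.
rewrite (negPf (ne _ (bmdeg _))); apply: big1 => j _.
rewrite fsubZ fsubX mcoeffZ (dhomog_nemf_coeff (fmon_homog fh _)) ?mulr0 //=.
by apply: contraTneq ge => ->; rewrite -ltnNge bmdeg.
Qed.

(** The adjugate, in place of the inverse, keeps this polynomial in the coefficients; up to a power
    of [\det (MK f)] it is the determinant of the constant terms of the Gram matrix. *)
Let phi f := \det (\matrix_(s < #|{: B}|, t < #|{: B}|)
  (\adj (MK f)) (ix (mexp (enum_val s) + mexp (enum_val t))%MM) (ix (mexp (ftopi N d0)))).

Lemma mdeg_mexp (s : B) : (mdeg (mexp s) <= N * d.-1)%N.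
Proof. by rewrite -(mexp_rev d0 s) leq_addr. Qed.

Lemma fstruct_cond f : hom f -> \det (MK f) != 0 -> phi f != 0 -> inhabited (fstruct f d).
Proof.
move=> fh Mu pu.
have sl m : (mdeg m <= (N * d.-1).+1)%N -> exists p, fsub d f p = 'X_[m].
  move=> le; have [|i <-] := @ev_ex m; first exact: ltK.
  by eexists; apply: fsub_MK.
refine (@fstruct_power _ _ _ _ d0 fh sl _).
apply: contraNneq pu => g0.
have E : \matrix_(s < #|{: B}|, t < #|{: B}|)
    (\adj (MK f)) (ix (mexp (enum_val s) + mexp (enum_val t))%MM) (ix (mexp (ftopi N d0))) =
    \det (MK f) *: map_mx (mcoeff 0%MM) (fgram d0 fh sl).
  apply/matrixP => s t; rewrite !mxE /fcoo (coef_fext d0) (_ : (mexp (ftopi N d0) + 0 *+ d)%MM = mexp (ftopi N d0)); last first.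
    by apply/mnmP => i; rewrite mnmDE mulmnE mnm0E mul0n addn0.
  set m := (mexp (enum_val s) + mexp (enum_val t))%MM.
  have lt : (mdeg m < K)%N.
    by rewrite /m mdegD ltK2 ?mdeg_mexp.
  have <- : fsub d f (\sum_j invmx (MK f) (ix m) j *: 'X_[ev j]) = 'X_[mexp (enum_val s)] * 'X_[mexp (enum_val t)].
    by rewrite fsub_MK // ixE // mpolyXD.
  rewrite fsubK raddf_sum /= (bigD1 (ix (mexp (ftopi N d0)))) //= big1 => [|j ji].
    rewrite mcoeffZ mcoeffX ixE ?eqxx ?mulr1 ?addr0; last first.
      by apply: ltK; rewrite leqW ?mdeg_mexp.
    by rewrite /invmx unitmxE unitfE Mu !mxE mulrA mulfV // mul1r.
  rewrite mcoeffZ mcoeffX; case: eqP => [E|]; last by rewrite mulr0.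
  case/eqP: ji; apply: ev_inj; rewrite E ixE //.
  by apply: ltK; rewrite leqW ?mdeg_mexp.
by rewrite /phi E detZ det_map_mx g0 rmorph0 mulr0.
Qed.

(** The witness is the power map: there [MK] is the identity and the Gram matrix is the permutation
    matrix exchanging complementary exponents. *)
Lemma gen_fstruct : gen (fun f => inhabited (fstruct f d)).
Proof.
pose f0 : polymap F n := fun i => 'X_i ^+ d.
have h0 : hom f0.
  by move=> i; rewrite -[d]mul1n; apply: dhomogMn; rewrite dhomogX /= mdeg1.
have M0 : MK f0 = 1%:M.
  apply/matrixP => i j; rewrite !mxE /fmon cmpXm.
  have -> : \prod_k f0 k ^+ mquo d (ev i) k = 'X_[mquo d (ev i) *+ d].
    rewrite [RHS]mpolyXE_id; apply: eq_bigr => k _; rewrite mulmnE mulnC exprM //.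
  by rewrite -mpolyXD -mdivE mcoeffX (inj_eq ev_inj).
have adj1 : \adj (1%:M : 'M[F]_#|I|) = 1%:M.
  by rewrite -[LHS]mulmx1 mul_adj_mx det1.
apply: (@gen_imp (fun f => \det (MK f) != 0 /\ phi f != 0)).
  by move=> f fh [a b]; apply: fstruct_cond.
apply: gen_and.
  by apply: (gen_pfun (f0 := f0)) => //; [apply: (pf_det one_param); exact: pfun_MK|rewrite M0 det1 oner_eq0].
apply: (gen_pfun (f0 := f0)) => //.
  apply: (pf_det one_param) => s t.
  pose i := ix (mexp (enum_val s) + mexp (enum_val t))%MM; pose j := ix (mexp (ftopi N d0)).
  apply: pf_ext (pf_cofactor one_param j i pfun_MK) => f _.
  by rewrite !mxE.
rewrite /phi M0 adj1.
have rinj : injective (fun s : 'I_#|{: B}| => enum_rank (frevi (enum_val s))).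
  by move=> s t /enum_rank_inj /(inv_inj (@freviK N d)) /enum_val_inj.
have -> : (\matrix_(s < #|{: B}|, t < #|{: B}|)
   1%:M (ix (mexp (enum_val s) + mexp (enum_val t))%MM) (ix (mexp (ftopi N d0)))) =
   perm_mx (perm rinj) :> 'M[F]__.
  apply/matrixP => s t; rewrite !mxE permE; congr (_%:R); congr nat_of_bool.
  rewrite -(inj_eq ev_inj) !ixE; first last.
  - by rewrite mdegD ltK2 ?mdeg_mexp.
  - by apply: ltK; rewrite leqW ?mdeg_mexp.
  have topE (x : B) : mexp (ftopi N d0) = (mexp x + mexp (frevi x))%MM.
    by apply/mnmP => i; rewrite !mnmE !ffunE /=; have := ltn_ord (x i); lia.
  rewrite (topE (enum_val s)) -(inj_eq enum_val_inj) enum_rankK.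
  apply/eqP/eqP => [/mnmP E|<-//]; apply: mexp_inj; apply/mnmP => i.
  by have := E i; rewrite !mnmDE => /addnI.
by rewrite det_perm signr_eq0.
Qed.

End Free.

End Generic.

(** * The Jacobian determinant: leading coefficients and irreducibility *)

Section HomogTools.
Variables (F : fieldType) (N : nat).
Local Notation R := {mpoly F[N]}.

Lemma det_homog r w (A : 'M[R]_r) : (forall i j, A i j \is w.-homog) ->
  \det A \is (r * w).-homog.
Proof.
move=> H; apply: rpred_sum => s _.
have P : \prod_i A i (s i) \is (r * w).-homog.
  have -> : (r * w = \sum_(i < r) w)%N by rewrite sum_nat_const card_ord.
  by apply: homog_prod.
by rewrite -signr_odd; case: (odd _); rewrite ?expr0 ?mul1r // expr1 mulN1r dhomogN.
Qed.

Lemma euler_homog w (p : R) x : p \is w.-homog ->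
  \sum_i x i * (mderiv i p).@[x] = w%:R * p.@[x].
Proof.
move=> pw; rewrite [p in LHS](homog_sum pw) [p in RHS](homog_sum pw).
rewrite [in RHS](rmorph_sum (meval x)) /= mulr_sumr.
under eq_bigr do rewrite (raddf_sum (mderiv _)) [X in _ * X](rmorph_sum (meval x)) mulr_sumr /=.
rewrite exchange_big /=; apply: eq_bigr => m _.
have [m0|m0] := eqVneq p@_m 0.
  by rewrite m0 scale0r meval0 mulr0 big1 // => i _; rewrite mderiv0 meval0 mulr0.
have mw : mdeg m = w by apply: (dhomog_mf pw); rewrite mcoeff_msupp.
rewrite -[w in w%:R]mw mevalZ mevalX mdegE natr_sum mulr_suml; apply: eq_bigr => i _.
rewrite mderivZ mderivX !mevalZ mevalX mulrCA [RHS]mulrCA; congr (_ * _).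
have [mi|mi] := posnP (m i); first by rewrite mi !mul0r mulr0.
rewrite mulrCA; congr (_ * _); rewrite (bigD1 i) //= [RHS](bigD1 i) //=.
rewrite mnmBE mnm1E eqxx subn1 mulrA -exprS prednK //; congr (_ * _).
by apply: eq_bigr => j ji; rewrite mnmBE mnm1E eq_sym (negPf ji) subn0.
Qed.

Lemma eval_axis w (p : R) i : p \is w.-homog ->
  p.@[fun j => (j == i)%:R] = p@_(U_(i) *+ w).
Proof.
move=> pw; rewrite [p in LHS]mpolyE [LHS](rmorph_sum (meval _)) /=.
have E m : m \in msupp p -> (p@_m *: 'X_[m]).@[fun j => (j == i)%:R] =
    p@_m * (m == (U_(i) *+ w)%MM)%:R.
  move=> mp; rewrite mevalZ mevalX; congr (_ * _); case: eqP => [->|ne].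
    apply: big1 => j _; rewrite mulmnE mnm1E eq_sym.
    by case: eqP => _; rewrite ?expr1n // mul0n expr0.
  have [j /andP[ji mj]] : exists j, (j != i) && (0 < m j)%N.
    apply: NNPP => /not_ex_all_not nj; apply: ne; apply/mnmP => j; rewrite mulmnE mnm1E.
    have z k : k != i -> m k = 0%N.
      by move=> ki; apply/eqP; rewrite -leqn0 leqNgt; apply/negP => mk; apply: (nj k); rewrite ki.
    have [->|ij] := eqVneq j i; last by rewrite mul0n z.
    rewrite mul1n -(dhomog_mf pw mp) /= mdegE (bigD1 i) //= big1 ?addn0 //.
  by rewrite (bigD1 j) //= (negPf ji) expr0n eqn0Ngt mj mul0r.
rewrite (eq_big_seq _ E).
have [mp|mp] := boolP ((U_(i) *+ w)%MM \in msupp p).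
  rewrite (bigD1_seq (U_(i) *+ w)%MM) ?msupp_uniq //= eqxx mulr1 big1 ?addr0 // => m /negPf->.
  by rewrite mulr0.
rewrite (memN_msupp_eq0 mp) big_seq big1 // => m mm; case: eqP => [E'|]; rewrite ?mulr0 //.
by rewrite -E' mm in mp.
Qed.

End HomogTools.

(** The resultant vanishes at the origin, hence by [plane_zero] at a nonzero point of the plane; the
    unit leading coefficients let it specialize. *)
Lemma plane_common_root (F : closedFieldType) n (P Q : {poly {mpoly F[n]}}) (j1 j2 : 'I_n) :
  lead_coef P \is a GRing.unit -> lead_coef Q \is a GRing.unit -> j1 != j2 ->
  root (map_poly (meval (fun=> 0)) P) 0 -> root (map_poly (meval (fun=> 0)) Q) 0 ->
  exists v t, [/\ (v j1 != 0) || (v j2 != 0), forall k, k != j1 -> k != j2 -> v k = 0,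
    root (map_poly (meval v) P) t & root (map_poly (meval v) Q) t].
Proof.
move=> lp lq j12 P0 Q0.
have rE v : (resultant P Q).@[v] = resultant (map_poly (meval v) P) (map_poly (meval v) Q).
  have [l1 _] := unit_lead_map v lp; have [l2 _] := unit_lead_map v lq.
  exact: (resultant_morph l1 l2).
have nz v : map_poly (meval v) P != 0.
  have [l1 sz] := unit_lead_map v lp; rewrite -size_poly_gt0 sz size_poly_gt0.
  by apply: contraTneq lp => ->; rewrite lead_coef0 unitr0.
have r0 : (resultant P Q).@[fun _ => 0] = 0.
  rewrite rE; apply/eqP; rewrite resultant_eq0.
  have : 'X - 0%:P %| gcdp (map_poly (meval (fun=> 0)) P) (map_poly (meval (fun=> 0)) Q).
    by rewrite dvdp_gcd !dvdp_XsubCl P0 Q0.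
  by move/dvdp_leq; rewrite size_XsubC; apply; rewrite gcdp_eq0 negb_and nz.
have [v [rv vn vs]] := plane_zero j12 r0.
move: rv; rewrite rE => /eqP; rewrite resultant_eq0 => sg.
have /closed_rootP[t] : size (gcdp (map_poly (meval v) P) (map_poly (meval v) Q)) != 1.
  by rewrite neq_ltn sg orbT.
by rewrite root_gcd => /andP[pt qt]; exists v, t.
Qed.

Section JacobianPoly.
Variables (F : closedFieldType) (n : nat).
Local Notation N := n.+1.
Local Notation R := {mpoly F[n.+1]}.

Definition jmat (f : polymap F n) : 'M[R]_N := \matrix_(i, j) mderiv j (f i).
Definition hJ f := \det (jmat f).

Lemma hJ_eval f x : (hJ f).@[x] = jac_det f x.
Proof.
rewrite /hJ /jac_det -[LHS]/(meval x _) -det_map_mx; congr (\det _).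
by apply/matrixP => i j; rewrite !mxE.
Qed.

Lemma hJ_homog d f : hom d f -> hJ f \is (N * d.-1).-homog.
Proof. by move=> fh; apply: det_homog => i j; rewrite mxE; apply: mderiv_homog. Qed.

Lemma pfam_hJ d : pfam d hJ.
Proof.
apply: (pfp_det (one_param F n d)) => i j.
by apply: pfp_ext (pfp_deriv j (@pfam_var F n d i)) => f _; rewrite mxE.
Qed.

(** For the witness [x_i ^ (d - 1) * x_k] the Jacobian matrix at the [i]-th unit vector is diagonal,
    with entries [d] and [1]. *)
Lemma gen_axis d i : [pchar F] =i pred0 -> (0 < d)%N ->
  gen d (fun f => (hJ f)@_(U_(i) *+ (N * d.-1)) != 0).
Proof.
move=> ch d0; pose f0 : polymap F n := fun k => 'X_i ^+ d.-1 * 'X_k.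
have h0 : hom d f0.
  move=> k; suff : f0 k \is (d.-1 + 1).-homog by rewrite addn1 prednK.
  apply: dhomogM; last by rewrite dhomogX /= mdeg1.
  suff : ('X_i ^+ d.-1 : R) \is (1 * d.-1).-homog by rewrite mul1n.
  by apply: dhomogMn; rewrite dhomogX /= mdeg1.
apply: (gen_pfun (f0 := f0)) => //; first exact: pfam_hJ.
rewrite -(eval_axis _ (hJ_homog h0)) hJ_eval /jac_det.
have -> : \matrix_(k, j) (mderiv j (f0 k)).@[fun j => (j == i)%:R] =
    diag_mx (\row_k (if k == i then d%:R else 1)) :> 'M[F]_N.
  apply/matrixP => k j; rewrite !mxE mderivM mevalD !mevalM.
  have X1 (l : 'I_N) : (mderiv j 'X_l : R) = (j == l)%:R.
    rewrite mderivX mnm1E eq_sym; case: eqP => [->|_]; last by rewrite scale0r.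
    by rewrite scale1r (_ : (_ - _)%MM = 0%MM) ?mpolyX0 //; apply/mnmP => t; rewrite mnmBE subnn mnm0E.
  have Xp : (mderiv j ('X_i ^+ d.-1) : R).@[fun j => (j == i)%:R] = (j == i)%:R * (d.-1)%:R.
    elim: d.-1 => [|e IH]; first by rewrite expr0 -mpolyC1 mderivC meval0 mulr0.
    rewrite exprS mderivM mevalD !mevalM IH X1 mevalXU eqxx mul1r rmorphXn /= mevalXU eqxx expr1n mulr1.
    by rewrite rmorph_nat -natr1; ring.
  rewrite Xp X1 rmorphXn /= !mevalXU eqxx expr1n mul1r rmorph_nat.
  case: (eqVneq k j) => [->|kj]; last first.
    rewrite /= ?mulr0n ?addr0.
    by case: (eqVneq j i) => [ji|]; case: (eqVneq k i) => [ki|]; rewrite ?mul0r ?mulr0 //; case/eqP: kj; rewrite ki ji.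
  rewrite ?eqxx /= ?mulr1n; case: (eqVneq j i) => _; last by rewrite !mul0r add0r.
  by rewrite /= mul1r mulr1 natr1 prednK.
rewrite det_diag; apply/prodf_neq0 => k _; rewrite mxE; case: ifP => _; last exact: oner_neq0.
exact: natr_neq0.
Qed.

(* Two factors of a homogeneous polynomial would meet on the coordinate plane. *)
Lemma plane_prime e (h : R) (j1 j2 : 'I_n) (i0 := ord_max : 'I_N)
   (i1 := widen_ord (leqnSn n) j1) (i2 := widen_ord (leqnSn n) j2) :
  h \is e.-homog -> (0 < e)%N -> h@_(U_(i0) *+ e) != 0 -> j1 != j2 ->
  (forall x : 'I_N -> F, (forall i, i != i0 -> i != i1 -> i != i2 -> x i = 0) ->
     h.@[x] = 0 -> (mderiv i0 h).@[x] = 0 -> (mderiv i1 h).@[x] = 0 ->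
     (mderiv i2 h).@[x] = 0 -> forall i, x i = 0) -> prime_elt h.
Proof.
move=> hh e0 c0 j12 plane; have [sz lu] := muni_lead hh c0.
have h0 : h != 0 by apply: contraNneq c0 => ->; rewrite mcoeff0.
have [w [ps [wu psP hE]]] := factorial_mpoly h0.
have hnu : h \isn't a GRing.unit.
  apply/negP => /unitrPr[k kE]; have := congr1 (meval (fun=> 0 * 0)) kE.
  rewrite /= mevalM (meval_homog (fun=> 0) 0 hh) expr0n eqn0Ngt e0 mul0r mul0r meval1.
  by move/eqP; rewrite eq_sym oner_eq0.
case: ps psP hE => [|p [|p' ps]] psP hE.
- by case/negP: hnu; rewrite hE big_nil mulr1.
- rewrite big_seq1 in hE; have [p0 pu pP] := psP p (mem_head _ _); rewrite hE; split.
  + by rewrite mulf_neq0 //; apply: contraTneq wu => ->; rewrite unitr0.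
  + by rewrite unitrMr.
  move=> a b [k kE]; have [|[x xE]|[x xE]] := pP a b; first by exists (k * w); rewrite kE mulrA.
    by left; exists (x * w^-1); rewrite xE mulrA divrK.
  by right; exists (x * w^-1); rewrite xE mulrA divrK.
exfalso; rewrite !big_cons in hE; set q := w * (p' * \prod_(j <- ps) j).
have hpq : h = p * q by rewrite hE /q mulrCA.
have [_ pu _] := psP p (mem_head _ _).
have [_ p'u _] : prime_elt p' by apply: psP; rewrite !inE eqxx orbT.
have qu : q \isn't a GRing.unit.
  apply: contra p'u; rewrite /q unitrMr // => /unitrPr[k kE].
  by apply/unitrPr; exists (\prod_(j <- ps) j * k); rewrite mulrA.
have p00 : p.@[fun _ => 0] = 0.
  by apply: (homog_factor hh h0 pu); exists q; rewrite hpq mulrC.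
have q00 : q.@[fun _ => 0] = 0.
  by apply: (homog_factor hh h0 qu); exists p.
have [lp lq] : lead_coef (muni p) \is a GRing.unit /\ lead_coef (muni q) \is a GRing.unit.
  by move: lu; rewrite {1}hpq muniM lead_coefM unitrM => /andP.
clearbody q.
have root0 (p1 : R) : p1.@[fun _ => 0] = 0 -> root (map_poly (meval (fun=> 0)) (muni p1)) 0.
  by move=> E; apply/rootP; rewrite -[RHS]E (@meval_muni_ext F n p1 (fun=> 0) (fun=> 0)).
have [v [t [vn vs pt qt]]] := plane_common_root lp lq j12 (root0 p p00) (root0 q q00).
have [y [yt yv]] := extend_point v t.
have H (p1 : R) : root (map_poly (meval v) (muni p1)) t -> p1.@[y] = 0.
  by move/rootP; rewrite (meval_muni_ext p1 yv) yt.
have py := H _ pt; have qy := H _ qt.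
have dz i : (mderiv i h).@[y] = 0.
  by rewrite hpq mderivM mevalD !mevalM py qy mulr0 mul0r addr0.
have y0 : forall i, y i = 0.
  apply: plane => //; last by rewrite hpq mevalM py mul0r.
  move=> i ii0 ii1 ii2; have [lt|ge] := ltnP i n.
    have iE : i = widen_ord (leqnSn n) (Ordinal lt) by apply/val_inj.
    rewrite iE -[y _]/((y \o widen_ord (leqnSn n)) _) yv; apply: vs.
      by apply: contraNneq ii1 => E; rewrite iE E.
    by apply: contraNneq ii2 => E; rewrite iE E.
  by case/eqP: ii0; apply/val_inj/eqP; rewrite eqn_leq ge -ltnS ltn_ord.
by case/orP: vn => /eqP[]; rewrite -yv /= y0.
Qed.

End JacobianPoly.

Lemma mderiv2_eval (F : fieldType) N (a1 a2 b : {mpoly F[N]}) x i j :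
  a1.@[x] = 0 -> a2.@[x] = 0 -> (mderiv i (mderiv j (a1 * a2 * b))).@[x] =
  b.@[x] * ((mderiv i a1).@[x] * (mderiv j a2).@[x] + (mderiv j a1).@[x] * (mderiv i a2).@[x]).
Proof.
move=> e1 e2; rewrite !(mderivM, mderivD) !(mevalD, mevalM) e1 e2; ring.
Qed.

Lemma mderiv1_eval (F : fieldType) N (a1 a2 b : {mpoly F[N]}) x j :
  a1.@[x] = 0 -> a2.@[x] = 0 -> (mderiv j (a1 * a2 * b)).@[x] = 0.
Proof. by move=> e1 e2; rewrite !mderivM !(mevalD, mevalM) e1 e2; ring. Qed.

(** * Parameter counts for singular critical points on a coordinate plane *)

Section SecondOrder.
Variables (F : fieldType) (charF0 : [pchar F] =i pred0) (N d : nat).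
Local Notation R := {mpoly F[N]}.
Hypothesis d2 : (1 < d)%N.
Variables (x v c : 'I_N -> F) (D : 'I_N -> 'I_N -> F) (a : 'I_N) (w : nat).
Hypotheses (xa : x a = 1) (De : forall j, \sum_i x i * D i j = w%:R * c j).
Hypothesis cx : ~ exists k, forall j, c j = k * x j.

(** The derivative at [x], in the direction [v], of the gradient of [p] paired with a vector field
    whose value is [c] and whose derivatives are [D]. *)
Let L (p : R) := \sum_i v i * \sum_j ((mderiv i (mderiv j p)).@[x] * c j +
  (mderiv j p).@[x] * D i j).
Hypothesis L0 : forall p, p \is d.-homog -> L p = 0.

Let ell k : R := 'X_k - x k *: 'X_a.

Lemma ell_homog k : ell k \is 1.-homog.
Proof. by apply: rpredB; [|apply: dhomogZ]; rewrite dhomogX /= mdeg1. Qed.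

Lemma ell_x k : (ell k).@[x] = 0.
Proof. by rewrite mevalB mevalZ !mevalXU xa mulr1 subrr. Qed.

Let el k j : F := (k == j)%:R - x k * (a == j)%:R.

Lemma derX k j : (mderiv j ('X_k : R)) = ((k == j)%:R)%:MP.
Proof.
rewrite mderivX mnm1E; case: eqP => [->|_]; last by rewrite scale0r mpolyC0.
rewrite scale1r (_ : (_ - _)%MM = 0%MM) ?mpolyX0 //.
by apply/mnmP => t; rewrite mnmBE subnn mnm0E.
Qed.

Lemma ell_der k j : mderiv j (ell k) = (el k j)%:MP.
Proof. by rewrite mderivB mderivZ !derX -mul_mpolyC -mpolyCM -mpolyCB. Qed.

Lemma Xa_homog k : ('X_a ^+ k : R) \is k.-homog.
Proof.
suff : ('X_a ^+ k : R) \is (1 * k).-homog by rewrite mul1n.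
by apply: dhomogMn; rewrite dhomogX /= mdeg1.
Qed.

Lemma Xa_x k : ('X_a ^+ k : R).@[x] = 1.
Proof. by rewrite (rmorphXn (meval x)) /= mevalXU xa expr1n. Qed.

Let dv k := \sum_i v i * el k i.
Let dc k := \sum_j c j * el k j.

Lemma dvE k : dv k = v k - x k * v a.
Proof.
rewrite /dv /el; under eq_bigr do rewrite mulrBr.
rewrite sumrB (bigD1 k) //= eqxx mulr1 big1 ?addr0 => [|i ik]; last first.
  by rewrite eq_sym (negPf ik) mulr0.
rewrite (bigD1 a) //= eqxx mulr1 big1 ?addr0 1?[v a * _]mulrC // => i ik.
by rewrite eq_sym (negPf ik) !mulr0.
Qed.

Lemma dcE k : dc k = c k - x k * c a.
Proof.
rewrite /dc /el; under eq_bigr do rewrite mulrBr.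
rewrite sumrB (bigD1 k) //= eqxx mulr1 big1 ?addr0 => [|i ik]; last first.
  by rewrite eq_sym (negPf ik) mulr0.
rewrite (bigD1 a) //= eqxx mulr1 big1 ?addr0 1?[c a * _]mulrC // => i ik.
by rewrite eq_sym (negPf ik) !mulr0.
Qed.

Lemma quad_test k l : dv k * dc l + dc k * dv l = 0.
Proof.
have ph : ell k * ell l * 'X_a ^+ d.-2 \is d.-homog.
  suff : ell k * ell l * 'X_a ^+ d.-2 \is (1 + 1 + d.-2).-homog.
    by rewrite (_ : (1 + 1 + d.-2)%N = d) //; lia.
  by apply: dhomogM; [apply: dhomogM; apply: ell_homog|apply: Xa_homog].
rewrite -[RHS](L0 ph) /L.
have D1 j : (mderiv j (ell k * ell l * 'X_a ^+ d.-2)).@[x] = 0.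
  by rewrite mderiv1_eval ?ell_x.
have D2 i j : (mderiv i (mderiv j (ell k * ell l * 'X_a ^+ d.-2))).@[x] =
    el k i * el l j + el k j * el l i.
  by rewrite mderiv2_eval ?ell_x // Xa_x mul1r !ell_der !mevalC.
transitivity (\sum_i v i * (el k i * dc l + dc k * el l i)).
  rewrite /dv; move: (dc l) (dc k) => y z; rewrite mulr_suml mulr_sumr -big_split; apply: eq_bigr => i _ /=.
  by ring.
apply: eq_bigr => i _; congr (_ * _); rewrite /dc mulr_sumr mulr_suml -big_split.
by apply: eq_bigr => j _ /=; rewrite D1 D2; ring.
Qed.

(** Products of two forms [ell], which vanish at [x], see only second derivatives; since [c] is not
    radial they force [v] to be radial. A single [ell] and Euler's identity then give
    [(d - 1 + w) * v a * dc k0 = 0]. *)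
Lemma second_order_indep : forall i, v i = 0.
Proof.
have [k0 k0n] : exists k, dc k != 0.
  apply: NNPP => /not_ex_all_not nk; apply: cx; exists (c a) => j.
  have : dc j = 0 by apply/eqP; apply: contraT => /nk.
  by rewrite dcE => /eqP; rewrite subr_eq0 mulrC => /eqP.
have v0 : dv k0 = 0.
  have := quad_test k0 k0; rewrite [dc k0 * _]mulrC -mulr2n -mulr_natr => /eqP.
  rewrite !mulf_eq0 (negPf k0n) (negPf (natr_neq0 charF0 (isT : 0 < 2)%N)) !orbF.
  by move/eqP.
have vk k : dv k = 0.
  have := quad_test k k0; rewrite v0 mulr0 addr0 => /eqP.
  by rewrite mulf_eq0 (negPf k0n) orbF => /eqP.
have vE k : v k = v a * x k.
  by have := vk k; rewrite dvE => /eqP; rewrite subr_eq0 mulrC => /eqP.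
suff va : v a = 0 by move=> i; rewrite vE va mul0r.
have ph : ell k0 * 'X_a ^+ d.-1 \is d.-homog.
  suff : ell k0 * 'X_a ^+ d.-1 \is (1 + d.-1).-homog.
    by rewrite (_ : (1 + d.-1)%N = d) //; lia.
  by apply: dhomogM; [apply: ell_homog|apply: Xa_homog].
have := L0 ph; rewrite /L; set p := ell k0 * _.
have pd j : mderiv j p \is d.-1.-homog by apply: mderiv_homog.
have D1 j : (mderiv j p).@[x] = el k0 j.
  by rewrite mderivM mevalD !mevalM ell_x mul0r addr0 ell_der mevalC Xa_x mulr1.
have -> : \sum_i v i * (\sum_j ((mderiv i (mderiv j p)).@[x] * c j + (mderiv j p).@[x] * D i j)) =
    v a * ((d.-1 + w)%:R * dc k0).
  transitivity (v a * \sum_j ((\sum_i x i * (mderiv i (mderiv j p)).@[x]) * c j +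
     (mderiv j p).@[x] * (\sum_i x i * D i j))).
    under [in RHS]eq_bigr do rewrite mulr_suml mulr_sumr -big_split /=.
    rewrite exchange_big /= mulr_sumr; apply: eq_bigr => i _.
    rewrite vE -mulrA; congr (_ * _); rewrite mulr_sumr; apply: eq_bigr => j _.
    by rewrite mulrDr mulrA; congr (_ + _); rewrite mulrCA.
  congr (_ * _); rewrite /dc mulr_sumr; apply: eq_bigr => j _.
  by rewrite (euler_homog x (pd j)) De D1 natrD; ring.
move/eqP; rewrite !mulf_eq0 (negPf k0n) orbF => /orP[/eqP//|].
by rewrite (negPf (natr_neq0 charF0 _)) // addn_gt0 -subn1 subn_gt0 d2.
Qed.

End SecondOrder.

Lemma pf_of_one (F : fieldType) Z M dom th c (phi : Z -> F) :
  @pf F Z M dom th (fun=> 1) phi -> pf dom th c phi.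
Proof. by case=> E [P H]; exists 0%N, P => z dz; rewrite expr0 mul1r -H // expr1n mul1r. Qed.

Section Small.
Variables (F : closedFieldType) (n d : nat).
Local Notation N := n.+1.

Definition small (B : polymap F n -> Prop) := exists G : {mpoly F[#|coef_index n d|]},
  G != 0 /\ forall f, B f -> G.@[@coeffs F n d f] = 0.

Lemma small_union (I : finType) (B : I -> polymap F n -> Prop) :
  (forall i, small (B i)) -> small (fun f => exists i, B i f).
Proof.
move=> /fin_all_exists[G GP]; exists (\prod_i G i); split.
  by apply/prodf_neq0 => i _; case: (GP i).
move=> f [i Bi]; rewrite rmorph_prod (bigD1 i) //=.
by have [_ ->] := GP i; rewrite ?mul0r.
Qed.

Lemma small_sub (B B' : polymap F n -> Prop) : (forall f, B f -> B' f) -> small B' -> small B.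
Proof. by move=> H [G [G0 GE]]; exists G; split=> // f /H; apply: GE. Qed.

Lemma small0 : small (fun=> False).
Proof. by exists 1; rewrite oner_neq0. Qed.

Lemma small_gen B : small B -> gen d (fun f => ~ B f).
Proof.
by case=> G [G0 GE]; exists G; split=> // f _ /eqP nG Bf; apply: nG; apply: GE.
Qed.

End Small.

Section CaseA.
Variables (F : closedFieldType) (charF0 : [pchar F] =i pred0) (n d : nat).
Local Notation N := n.+1.
Local Notation R := {mpoly F[n.+1]}.
Local Notation Tm := {m : 'X_{1..n.+1 < d.+1} | mdeg m == d}.
Hypothesis d2 : (1 < d)%N.
Variables (sp : 'I_3 -> 'I_N).
Hypothesis sp_inj : injective sp.

Definition tmon (m : Tm) : 'X_{1..n.+1} := val (val m).

Lemma tmon_inj : injective tmon.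
Proof. by move=> m m' E; apply/val_inj/eqP; rewrite bmeqP; apply/eqP. Qed.

Lemma homog_sumT (p : R) : p \is d.-homog -> p = \sum_(m : Tm) p@_(tmon m) *: 'X_[tmon m].
Proof.
move=> pd; apply/mpolyP => m; rewrite raddf_sum /=.
have E t : (p@_(tmon t) *: 'X_[tmon t])@_m = p@_(tmon t) * (tmon t == m)%:R.
  by rewrite mcoeffZ mcoeffX.
rewrite (eq_bigr _ (fun t _ => E t)).
have [md|md] := eqVneq (mdeg m) d.
  have [m' m'E] := coef_index_ex md; have {}m'E : tmon m' = m := m'E.
  rewrite (bigD1 m') //= m'E eqxx mulr1 big1 ?addr0 // => t tm.
  by rewrite -m'E (inj_eq tmon_inj) (negPf tm) mulr0.
rewrite (dhomog_nemf_coeff pd md) big1 // => t _.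
case: eqP => [E'|]; last by rewrite mulr0.
by case/eqP: md; rewrite -E'; apply/eqP; exact: (valP t).
Qed.

Definition cofp (f : polymap F n) r j : R := cofactor (jmat f) r j.

(** The partial derivative in direction [b], at the point [z.2], of the Jacobian determinant with
    row [r] replaced by the gradient of [p]. Being linear in [p], it makes the singularity equations
    linear in the component [r] of the map. *)
Definition Lam (z : polymap F n * ('I_N -> F)) r b (p : R) : F :=
  \sum_j ((mderiv b (mderiv j p)).@[z.2] * (cofp z.1 r j).@[z.2] +
          (mderiv j p).@[z.2] * (mderiv b (cofp z.1 r j)).@[z.2]).

Lemma Lam_h z r b : (mderiv b (hJ z.1)).@[z.2] = Lam z r b (z.1 r).
Proof.
rewrite /hJ (expand_det_row _ r) (raddf_sum (mderiv b)) [LHS](rmorph_sum (meval z.2)).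
by apply: eq_bigr => j _ /=; rewrite mxE mderivM mevalD !mevalM.
Qed.

Lemma Lam_lin z r b c p q : Lam z r b (c *: p + q) = c * Lam z r b p + Lam z r b q.
Proof.
rewrite /Lam mulr_sumr -big_split; apply: eq_bigr => j _ /=.
by rewrite !(mderivD, mderivZ) !(mevalD, mevalZ); ring.
Qed.

Lemma Lam0 z r b : Lam z r b 0 = 0.
Proof. by rewrite /Lam big1 // => j _; rewrite !mderiv0 !meval0 !mul0r addr0. Qed.

Lemma Lam_expand z r b p : p \is d.-homog ->
  Lam z r b p = \sum_(m : Tm) p@_(tmon m) * Lam z r b 'X_[tmon m].
Proof.
move=> pd; rewrite {1}(homog_sumT pd); elim/big_rec2: _ => [|m x y _ <-]; first exact: Lam0.
by rewrite Lam_lin.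
Qed.

Section Fixed.
Variables (r : 'I_N) (al : 'I_3) (sg : 'I_3 -> Tm).
Hypothesis sg_inj : injective sg.

Let Z : Type := polymap F n * ('I_N -> F).
Let Del (z : Z) : 'M[F]_3 := \matrix_(b, k) Lam z r (sp b) 'X_[tmon (sg k)].
Let dom (z : Z) := [/\ hom d z.1, z.2 (sp al) = 1, (forall i, i \notin codom sp -> z.2 i = 0),
  (forall b, (mderiv (sp b) (hJ z.1)).@[z.2] = 0) & \det (Del z) != 0].
Let solved (k : coef_index n d) := (k.1 == r) && (k.2 \in codom sg).
(** Three coefficients of component [r] are solved for, and two affine coordinates of the point on
    the plane are added: one parameter fewer than there are coefficients. *)
Let T2 : finType := ({k : coef_index n d | ~~ solved k} + 'I_2)%type.
Let th (z : Z) (t : 'I_#|T2|) : F := match enum_val t with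
  | inl k => (z.1 (val k).1)@_(tmon (val k).2)
  | inr j => z.2 (sp (lift al j)) end.

Let pf1 := @pf F Z #|T2| dom th (fun=> 1).
Let pfp1 := @pfp F Z #|T2| dom th (fun=> 1) n.+1.
Lemma one1 : exists C : {mpoly F[#|T2|]}, forall z, dom z -> 1 = C.@[th z].
Proof. by exists 1 => z _; rewrite meval1. Qed.

Lemma pf_free k : ~~ solved k -> pf1 (fun z => (z.1 k.1)@_(tmon k.2)).
Proof.
move=> nk; apply: pf_ext (pf_param _ _ _ (enum_rank (inl (Sub k nk) : T2))) => z _.
by rewrite /th enum_rankK SubK.
Qed.

Lemma pf_x i : pf1 (fun z => z.2 i).
Proof.
have [/codomP[b ->]|ni] := boolP (i \in codom sp); last first.
  by apply: pf_ext (pf_const _ _ _ 0) => z [_ _ H _ _]; rewrite H.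
have [j ->|->] := unliftP al b; last first.
  by apply: pf_ext (pf_const _ _ _ 1) => z [].
apply: pf_ext (pf_param _ _ _ (enum_rank (inr j : T2))) => z _.
by rewrite /th enum_rankK.
Qed.

Lemma pfp_row i : i != r -> pfp1 (fun z => z.1 i).
Proof.
move=> ir m; have [md|md] := eqVneq (mdeg m) d.
  have [m' m'E] := coef_index_ex md.
  apply: pf_ext (pf_free (k := (i, m')) _) => [z _|]; first by rewrite /tmon m'E.
  by rewrite /solved (negPf ir).
by apply: pf_ext (pf_const _ _ _ 0) => z [zh _ _ _ _]; rewrite (dhomog_nemf_coeff (zh i)).
Qed.

Lemma cofp_homog f j : hom d f -> cofp f r j \is (n * d.-1).-homog.
Proof.
move=> fh; rewrite /cofp /cofactor -signr_odd.
have H : \det (row' r (col' j (jmat f))) \is (n * d.-1).-homog.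
  by apply: det_homog => k l; rewrite !mxE; apply: mderiv_homog.
by case: (odd _); rewrite ?expr0 ?mul1r // expr1 mulN1r dhomogN.
Qed.

Lemma pfp_cof j : pfp1 (fun z => cofp z.1 r j).
Proof.
apply: (pfpM one1); first exact: pfp_const.
apply: (pfp_det one1) => k l.
apply: pfp_ext (pfp_deriv (lift j l) (pfp_row (i := lift r k) _)) => [z _|]; first by rewrite !mxE.
by rewrite eq_sym neq_lift.
Qed.

Lemma pf_Lam b m : pf1 (fun z => Lam z r b 'X_[tmon m]).
Proof.
have md : ('X_[tmon m] : R) \is d.-homog by rewrite dhomogX; exact: (valP m).
apply: (pf_sum one1) => j; apply: (pfD one1); apply: pfM.
- apply: (pf_meval one1 (w := d.-2)) => [z _|i|]; [|exact: pf_x|exact: pfp_const].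
  by apply: mderiv_homog; apply: mderiv_homog.
- apply: (pf_meval one1 (w := (n * d.-1)%N)) => [z [zh _ _ _ _]|i|]; [|exact: pf_x|exact: pfp_cof].
  exact: cofp_homog.
- apply: (pf_meval one1 (w := d.-1)) => [z _|i|]; [|exact: pf_x|exact: pfp_const].
  exact: mderiv_homog.
apply: (pf_meval one1 (w := (n * d.-1).-1%N)) => [z [zh _ _ _ _]|i|]; [|exact: pf_x|].
  by apply: mderiv_homog; apply: cofp_homog.
by apply: pfp_deriv; apply: pfp_cof.
Qed.

Lemma caseA_fixed : small d (fun f => exists x, dom (f, x)).
Proof.
pose c (z : Z) := \det (Del z).
have c1 : pf1 c by apply: (pf_det one1) => b k; apply: pf_ext (pf_Lam (sp b) (sg k)) => z _; rewrite mxE.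
have cP : exists C : {mpoly F[#|T2|]}, forall z, dom z -> c z = C.@[th z].
  by have [E [P PE]] := c1; exists P => z dz; rewrite -PE // expr1n mul1r.
have c0 z : dom z -> c z != 0 by case.
have lt : (#|T2| < #|coef_index n d|)%N.
  pose tau k : coef_index n d := (r, sg k).
  have tau_inj : injective tau by move=> k l [/sg_inj].
  have s3 : (3 <= #|solved|)%N.
    rewrite -[X in (X <= _)%N](card_ord 3) -(card_codom tau_inj); apply: subset_leq_card.
    by apply/subsetP => _ /codomP[k ->]; rewrite unfold_in /solved /= eqxx codom_f.
  have cT : #|T2| = (#|[predC solved]| + 2)%N.
    by rewrite card_sum card_ord card_sig; congr (_ + _)%N; apply: eq_card.
  by rewrite cT -(cardC solved) addnC ltn_add2r.
have vP k : pf dom th c (fun z : Z => @coeffs F n d z.1 k).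
  rewrite /coeffs; move: (enum_val k) => {}k.
  have [|nk] := boolP (solved k); last exact: pf_of_one (pf_free nk).
  case: k => k1 k2 /andP[/eqP /= -> /codomP[l ->]].
  pose g b (z : Z) := \sum_(m : Tm | m \notin codom sg) (z.1 r)@_(tmon m) * Lam z r (sp b) 'X_[tmon m].
  (* Cramer's rule for the three equations; the remaining coefficients of component [r] are gathered
     in [g b]. *)
  apply: (@pf_ext _ _ _ _ _ _ (fun z => (- \sum_b cofactor (Del z) b l * g b z) / c z)).
    move=> z dz; have [zh _ _ hz _] := dz.
    have eqb b : \sum_k Del z b k * (z.1 r)@_(tmon (sg k)) = - g b z.
      have := Lam_h z r (sp b); rewrite hz (Lam_expand _ _ _ (zh r)).
      rewrite (bigID (fun m => m \in codom sg)) /= => /esym/eqP; rewrite addr_eq0 => /eqP <-.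
      rewrite -big_uniq /=; last by rewrite map_inj_uniq ?enum_uniq.
      rewrite big_map big_enum; apply: eq_bigr => k _.
      by rewrite mxE mulrC.
    pose av : 'cV[F]_3 := \col_k (z.1 r)@_(tmon (sg k)).
    have Da : Del z *m av = \col_b (- g b z).
      by apply/colP => b; rewrite !mxE -eqb; apply: eq_bigr => k _; rewrite [av k _]mxE.
    have : \adj (Del z) *m (\col_b (- g b z)) = c z *: av.
      by rewrite -Da mulmxA mul_adj_mx mul_scalar_mx.
    move/(congr1 (fun M : 'cV_3 => M l 0)); rewrite !mxE => E'.
    apply: (mulIf (c0 z dz)); rewrite divfK ?c0 // [RHS]mulrC -E' -sumrN.
    by apply: eq_bigr => b _; rewrite !mxE mulrN.
  apply: pf_div => //; apply: pfN; apply: (pf_sum cP) => b; apply: pfM.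
    apply: pf_of_one; apply: (pf_cofactor one1) => b' k'.
    by apply: pf_ext (pf_Lam (sp b') (sg k')) => z _; rewrite mxE.
  apply: (@pf_ext _ _ _ _ _ _ (fun z : Z => \sum_(m : Tm) if m \notin codom sg then
      (z.1 r)@_(tmon m) * Lam z r (sp b) 'X_[tmon m] else 0)).
    by move=> z _; rewrite /g [RHS]big_mkcond.
  apply: (pf_sum cP) => m; case: (boolP (m \in codom sg)) => ms; first exact: pf_const.
  apply: pfM; last exact: pf_of_one (pf_Lam _ _).
  by apply: pf_of_one; apply: (pf_free (k := (r, m))); rewrite /solved /= eqxx.
have [G [G0 GE]] := dimension_count cP c0 lt vP.
by exists G; split=> // f [x dx]; apply: (GE (f, x)).
Qed.

End Fixed.

End CaseA.

(** If the rank were [n], replacing a row that depends on the others by a unit vector outside the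
    row space would give an invertible matrix with the same, vanishing, cofactors along that row. *)
Lemma cofactor0_rank (F : fieldType) n (A : 'M[F]_n.+1) :
  (forall r j, cofactor A r j = 0) -> (\rank A < n)%N \/ n = 0%N.
Proof.
move=> c0; have [n0|n0] := eqVneq n 0%N; [by right|left; rewrite ltnNge; apply/negP => rk].
have d0 : \det A = 0.
  by rewrite (expand_det_row _ ord0) big1 // => j _; rewrite c0 mulr0.
have /eqP/det0P[v vn vA] := d0.
have /rV0Pn[r vr] := vn.
have [k nk] : exists k, ~~ ((delta_mx 0 k : 'rV[F]_n.+1) <= A)%MS.
  apply: NNPP => /not_ex_all_not nk; have : (1%:M <= A)%MS.
    by apply/row_subP => k; rewrite row1; apply: NNPP => /negP; apply: nk.
  rewrite sub1mx row_full_unit unitmxE unitfE d0 eqxx //.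
pose A' := \matrix_(i, j) if i == r then (j == k)%:R else A i j.
have rE : (A <= A')%MS.
  apply/row_subP => i; have [->|ir] := eqVneq i r; last first.
    have -> : row i A = row i A' by apply/rowP => j; rewrite !mxE (negPf ir).
    exact: row_sub.
  have -> : row r A = - (v 0 r)^-1 *: \sum_(i | i != r) v 0 i *: row i A'.
    apply/rowP => j; rewrite !mxE summxE.
    have := congr1 (fun M : 'rV_n.+1 => M 0 j) vA; rewrite !mxE (bigD1 r) //= => E.
    apply: (mulfI vr); rewrite mulrA mulrN mulfV // mulN1r.
    move/eqP: E; rewrite addr_eq0 => /eqP ->; congr (- _); apply: eq_bigr => i' ir'.
    by rewrite !mxE (negPf ir').
  apply: scalemx_sub; apply: summx_sub => i' _; apply: scalemx_sub.
  exact: row_sub.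
have dE : ((delta_mx 0 k : 'rV[F]_n.+1) <= A')%MS.
  have -> : (delta_mx 0 k : 'rV[F]_n.+1) = row r A' by apply/rowP => j; rewrite !mxE !eqxx /=.
  exact: row_sub.
have lt : (A < A')%MS.
  by rewrite ltmxE rE; apply: contra nk; apply: submx_trans.
have full : row_full A'.
  rewrite /row_full eqn_leq rank_leq_col /=.
  exact: leq_ltn_trans rk (rank_ltmx lt).
have : \det A' != 0 by rewrite -unitfE -unitmxE -row_full_unit.
rewrite (expand_det_row _ r) big1 ?eqxx // => j _.
suff -> : cofactor A' r j = cofactor A r j by rewrite c0 mulr0.
rewrite /cofactor; congr (_ * \det _); apply/matrixP => a b; rewrite !mxE.
by rewrite eq_sym (negPf (neq_lift _ _)).
Qed.

Lemma two_dependent_rows (F : fieldType) m N (A : 'M[F]_(m, N)) : (\rank A + 1 < m)%N ->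
  exists r s, [/\ r != s, exists la : 'I_m -> F, row r A = \sum_(i | (i != r) && (i != s)) la i *: row i A
    & exists mu : 'I_m -> F, row s A = \sum_(i | (i != r) && (i != s)) mu i *: row i A].
Proof.
move=> rk; pose g := maxrankfun A.
have cg : #|codom g| = \rank A by rewrite card_codom ?card_ord //; apply: maxrankfun_inj.
have [r rn] : exists r, r \notin codom g.
  apply: NNPP => /not_ex_all_not nr.
  have : #|'I_m| = #|codom g| by apply: eq_card => x; apply/esym; apply: NNPP => /negP; apply: nr.
  by rewrite cg card_ord => E; lia.
have [s sn] : exists s, s \notin r :: codom g.
  apply: NNPP => /not_ex_all_not nr.
  have : #|'I_m| = #|r :: codom g| by apply: eq_card => x; apply/esym; apply: NNPP => /negP; apply: nr.
  rewrite card_ord cardU1 rn cg /= => E; lia.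
exists r, s; move: sn; rewrite inE negb_or => /andP[sr sn].
have key t : exists la : 'I_m -> F, row t A = \sum_(i | (i != r) && (i != s)) la i *: row i A.
  have : (row t A <= rowsub g A)%MS by rewrite eq_maxrowsub row_sub.
  case/submxP => D DE; exists (fun i => \sum_(k | g k == i) D 0 k).
  rewrite DE mulmx_sum_row (partition_big g (fun i => (i != r) && (i != s))) /=; last first.
    move=> k _; apply/andP; split.
      by apply: contraNneq rn => <-; apply: codom_f.
    by apply: contraNneq sn => <-; apply: codom_f.
  apply: eq_bigr => i _; rewrite scaler_suml; apply: eq_bigr => k /eqP <-.
  by congr (_ *: _); apply/rowP => j; rewrite !mxE.
by split; [rewrite eq_sym|apply: key|apply: key].
Qed.

Section CaseB.
Variables (F : closedFieldType) (charF0 : [pchar F] =i pred0) (n d : nat).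
Local Notation N := n.+1.
Local Notation R := {mpoly F[n.+1]}.
Local Notation Tm := {m : 'X_{1..n.+1 < d.+1} | mdeg m == d}.
Hypothesis d2 : (1 < d)%N.
Variables (sp : 'I_3 -> 'I_N).
Hypothesis sp_inj : injective sp.

Section Fixed.
Variables (r s : 'I_N) (al : 'I_3).
Hypothesis rs : r != s.
Let a := sp al.
Let Z : Type := polymap F n * ('I_N -> F) * (bool -> 'I_N -> F).
Let rw (b : bool) := if b then r else s.
Let dom (z : Z) := [/\ hom d z.1.1, z.1.2 a = 1, (forall i, i \notin codom sp -> z.1.2 i = 0) &
  forall b j, (mderiv j (z.1.1 (rw b))).@[z.1.2] =
    \sum_(i | (i != r) && (i != s)) z.2 b i * (mderiv j (z.1.1 i)).@[z.1.2]].
(** At a point with [x_a = 1] the gradients of these [N] monomials are independent, so a component's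
    coefficients on them are determined by its gradient and its other coefficients. *)
Let base (k : 'I_N) : 'X_{1..N} := (U_(a) *+ d.-1 + U_(k))%MM.
Lemma base_deg k : mdeg (base k) = d.
Proof. by rewrite mdegD mdegMn !mdeg1 mul1n addn1 prednK // ltnW. Qed.
Lemma base_inj : injective base.
Proof.
move=> k l /mnmP E; apply/eqP; have := E l; rewrite !mnmDE => /addnI.
by rewrite !mnm1E eqxx; case: eqP.
Qed.
Let isb (m : 'X_{1..N}) := [exists k, m == base k].
Let solved (k : coef_index n d) := ((k.1 == r) || (k.1 == s)) && isb (tmon k.2).
(** The [2 * N] solved coefficients of components [r] and [s] are traded for two coordinates of the
    point and [2 * (N - 2)] multipliers. *)
Let T2 : finType := ({k : coef_index n d | ~~ solved k} + ('I_2 + bool * {i : 'I_N | (i != r) && (i != s)}))%type.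
Let th (z : Z) (t : 'I_#|T2|) : F := match enum_val t with
  | inl k => (z.1.1 (val k).1)@_(tmon (val k).2)
  | inr (inl j) => z.1.2 (sp (lift al j))
  | inr (inr bi) => z.2 bi.1 (val bi.2) end.
Let pf1 := @pf F Z #|T2| dom th (fun=> 1).
Let pfp1 := @pfp F Z #|T2| dom th (fun=> 1) n.+1.
Lemma oneB : exists C : {mpoly F[#|T2|]}, forall z, dom z -> 1 = C.@[th z].
Proof. by exists 1 => z _; rewrite meval1. Qed.

Lemma pfB_free i m : mdeg m = d -> ~~ (((i == r) || (i == s)) && isb m) ->
  pf1 (fun z => (z.1.1 i)@_m).
Proof.
move=> md nk; have [m' m'E] := coef_index_ex md.
have nk' : ~~ solved (i, m') by rewrite /solved /= /tmon m'E.
apply: pf_ext (pf_param _ _ _ (enum_rank (inl (Sub (i, m') nk') : T2))) => z _.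
by rewrite /th enum_rankK SubK /= /tmon m'E.
Qed.

Lemma pfB_x i : pf1 (fun z => z.1.2 i).
Proof.
have [/codomP[b ->]|ni] := boolP (i \in codom sp); last first.
  by apply: pf_ext (pf_const _ _ _ 0) => z [_ _ H _]; rewrite H.
have [j ->|->] := unliftP al b; last first.
  by apply: pf_ext (pf_const _ _ _ 1) => z [].
apply: pf_ext (pf_param _ _ _ (enum_rank (inr (inl j) : T2))) => z _.
by rewrite /th enum_rankK.
Qed.

Lemma pfB_row i : (i != r) && (i != s) -> pfp1 (fun z => z.1.1 i).
Proof.
case/andP=> ir is_ m; have [md|md] := eqVneq (mdeg m) d.
  by apply: pfB_free; rewrite // (negPf ir) (negPf is_).
by apply: pf_ext (pf_const _ _ _ 0) => z [zh _ _ _]; rewrite (dhomog_nemf_coeff (zh i)).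
Qed.

Lemma pfB_grad b j : pf1 (fun z => (mderiv j (z.1.1 (rw b))).@[z.1.2]).
Proof.
apply: (@pf_ext _ _ _ _ _ _ (fun z : Z => \sum_i if (i != r) && (i != s) then
    z.2 b i * (mderiv j (z.1.1 i)).@[z.1.2] else 0)).
  by move=> z [_ _ _ H]; rewrite H [RHS]big_mkcond.
apply: (pf_sum oneB) => i; case: (boolP ((i != r) && (i != s))) => irs; last exact: pf_const.
apply: pfM.
  apply: pf_ext (pf_param _ _ _ (enum_rank (inr (inr (b, Sub i irs)) : T2))) => z _.
  by rewrite /th enum_rankK /= ?SubK.
apply: (pf_meval oneB (w := d.-1)) => [z [zh _ _ _]|k|]; [exact: mderiv_homog|exact: pfB_x|].
by apply: pfp_deriv; apply: pfB_row.
Qed.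

Let restp (p : R) : R := p - \sum_k p@_(base k) *: 'X_[base k].

Lemma pfB_rest b : pfp1 (fun z => restp (z.1.1 (rw b))).
Proof.
move=> m; have E p : (restp p)@_m = if isb m then 0 else p@_m.
  rewrite mcoeffB raddf_sum /=; case: (boolP (isb m)) => [/existsP[k /eqP ->]|nb].
    rewrite (bigD1 k) //= mcoeffZ mcoeffX eqxx mulr1 big1 ?addr0 ?subrr // => l lk.
    by rewrite mcoeffZ mcoeffX (inj_eq base_inj) (negPf lk) mulr0.
  rewrite big1 ?subr0 // => k _; rewrite mcoeffZ mcoeffX; case: eqP => [E|]; last by rewrite mulr0.
  by case/existsP: nb; exists k; rewrite E.
case mb: (isb m); first by apply: pf_ext (pf_const _ _ _ 0) => z _; rewrite E mb.
apply: (@pf_ext _ _ _ _ _ _ (fun z : Z => (z.1.1 (rw b))@_m)).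
  by move=> z _; rewrite E mb.
have [md|md] := eqVneq (mdeg m) d; first by apply: pfB_free => //; rewrite mb andbF.
by apply: pf_ext (pf_const _ _ _ 0) => z [zh _ _ _]; rewrite (dhomog_nemf_coeff (zh _)).
Qed.

Lemma restp_homog p : p \is d.-homog -> restp p \is d.-homog.
Proof.
move=> pd; apply: rpredB => //; apply: rpred_sum => k _; apply: dhomogZ.
by rewrite dhomogX; apply/eqP/base_deg.
Qed.

Lemma base_der (x : 'I_N -> F) k j : x a = 1 -> (mderiv j ('X_[base k] : R)).@[x] =
  (k == j)%:R + (d.-1)%:R * x k * (a == j)%:R.
Proof.
move=> xa; rewrite mpolyXD -mpolyXn mderivM mevalD !mevalM.
have XX e : ('X_a ^+ e : R).@[x] = 1 by rewrite (rmorphXn (meval x)) /= mevalXU xa expr1n.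
have dX e : (mderiv j ('X_a ^+ e : R)).@[x] = e%:R * (a == j)%:R.
  elim: e => [|e IH]; first by rewrite expr0 -mpolyC1 mderivC meval0 mul0r.
  rewrite exprS mderivM mevalD !mevalM IH mevalXU xa XX.
  by rewrite derX mevalC -natr1; ring.
by rewrite dX XX derX mevalC mevalXU; ring.
Qed.

(** The system is triangular: the partial in direction [j != a] gives the coefficient of [base j]
    outright, and the one in direction [a] gives the last coefficient with pivot [d]. *)
Lemma pfB_solved b k : pf1 (fun z => (z.1.1 (rw b))@_(base k)).
Proof.
have dn : d%:R != 0 :> F by apply: natr_neq0 => //; apply: ltnW.
pose G j (z : Z) := (mderiv j (z.1.1 (rw b))).@[z.1.2] - (mderiv j (restp (z.1.1 (rw b)))).@[z.1.2].
have GP j : pf1 (G j).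
  apply: (pfD oneB); first exact: pfB_grad.
  apply: pfN; apply: (pf_meval oneB (w := d.-1)) => [z [zh _ _ _]|i|]; [|exact: pfB_x|].
    by apply: mderiv_homog; apply: restp_homog.
  by apply: pfp_deriv; apply: pfB_rest.
have GE z j : dom z -> G j z = (z.1.1 (rw b))@_(base j) +
    (\sum_k (z.1.1 (rw b))@_(base k) * ((d.-1)%:R * z.1.2 k)) * (a == j)%:R.
  case=> zh xa _ _; rewrite /G -mevalB -mderivB /restp opprB addrCA subrr addr0.
  rewrite (raddf_sum (mderiv j)) [LHS](rmorph_sum (meval z.1.2)) /=.
  under eq_bigr do rewrite mderivZ mevalZ base_der // mulrDr.
  rewrite big_split /= (bigD1 j) //= eqxx mulr1 big1 ?addr0 => [|l lj]; last first.
    by rewrite (negPf lj) mulr0.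
  by congr (_ + _); rewrite mulr_suml; apply: eq_bigr => l _; rewrite !mulrA.
have other k' : k' != a -> pf1 (fun z => (z.1.1 (rw b))@_(base k')).
  move=> ka; apply: pf_ext (GP k') => z dz; rewrite GE // eq_sym (negPf ka) mulr0 addr0 //.
have [->|/other//] := eqVneq k a.
apply: (@pf_ext _ _ _ _ _ _ (fun z : Z => d%:R^-1 * (G a z + - \sum_k if k != a then
   (z.1.1 (rw b))@_(base k) * ((d.-1)%:R * z.1.2 k) else 0))).
  move=> z dz; have [_ xa _ _] := dz; apply: (mulfI dn); rewrite mulrA mulfV // mul1r GE //.
  rewrite eqxx mulr1 (bigD1 a) //= -big_mkcond /= xa mulr1 addrA addrK.
  by rewrite -{1}[_@_(base a)]mulr1 -mulrDr mulrC -{2}[d](@prednK d) ?(ltnW d2) // -natr1 addrC.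
apply: pfM; first exact: pf_const.
apply: (pfD oneB); first exact: GP.
apply: pfN; apply: (pf_sum oneB) => k'; case: (boolP (k' != a)) => ka; last exact: pf_const.
by apply: pfM; [apply: other|apply: pfM; [apply: pf_const|apply: pfB_x]].
Qed.

Lemma caseB_fixed : small d (fun f => exists x la, dom (f, x, la)).
Proof.
have c0 z : dom z -> (1 : F) != 0 by rewrite oner_eq0.
have lt : (#|T2| < #|coef_index n d|)%N.
  have bx k := coef_index_ex (base_deg k).
  have /fin_all_exists[bm bmE] := bx.
  pose tau (bk : bool * 'I_N) : coef_index n d := (rw bk.1, bm bk.2).
  have tau_inj : injective tau.
    move=> [b k] [b' k'] [/= E1 E2]; have -> : k = k'.
      by apply: base_inj; rewrite -!bmE E2.
    by case: b b' E1 => -[] //= E1; move: rs; rewrite /rw E1 eqxx.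
  have s3 : (2 * N <= #|solved|)%N.
    rewrite -[X in (X <= _)%N](_ : #|{: bool * 'I_N}| = _); last by rewrite card_prod card_bool card_ord.
    rewrite -(card_codom tau_inj); apply: subset_leq_card.
    apply/subsetP => _ /codomP[[b k] ->]; rewrite unfold_in /solved /tau /=; apply/andP; split.
      by case: b; rewrite /= eqxx ?orbT.
    by apply/existsP; exists k; rewrite /tmon bmE.
  have N2 : (2 <= N)%N by have := leq_card _ sp_inj; rewrite !card_ord; lia.
  have cT : #|T2| = (#|[predC solved]| + (2 + 2 * (N - 2)))%N.
    rewrite !card_sum card_ord card_sig card_prod card_bool card_sig; congr (_ + (_ + _ * _))%N.
    have := cardC [pred i : 'I_N | (i == r) || (i == s)]; rewrite card_ord.
    have -> : #|[pred i : 'I_N | (i == r) || (i == s)]| = 2%N.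
      have := cards2 r s; rewrite rs /= => <-; by apply: eq_card => i; rewrite !inE.
    have -> : #|[predC [pred i : 'I_N | (i == r) || (i == s)]]| = #|[pred x : 'I_N | (x != r) && (x != s)]|.
      by apply: eq_card => i; rewrite !inE negb_or.
    by move=> E; apply: (@addnI 2%N); rewrite (subnKC N2); exact: E.
  rewrite cT -(cardC solved) addnC ltn_add2r; apply: leq_trans s3; move: N2; lia.
have vP k : pf dom th (fun=> 1) (fun z : Z => @coeffs F n d z.1.1 k).
  rewrite /coeffs; move: (enum_val k) => [k1 k2] /=.
  have kd : mdeg (tmon k2) = d by apply/eqP; exact: (valP k2).
  have [|nk] := boolP (((k1 == r) || (k1 == s)) && isb (tmon k2)); last exact: pfB_free.
  case/andP=> k1E /existsP[j /eqP kE]; rewrite -/(tmon k2) kE.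
  have [b ->] : exists b, k1 = rw b by case/orP: k1E => /eqP ->; [exists true|exists false].
  exact: pfB_solved.
have [G [G0 GE]] := dimension_count oneB c0 lt vP.
by exists G; split=> // f [x [la dx]]; apply: (GE (f, x, la)).
Qed.

End Fixed.

End CaseB.

(** * Ideals with one reduced zero and functionals in large degree *)

Section Ideals.
Variables (F : closedFieldType) (N : nat).
Local Notation R := {mpoly F[N]}.

Definition ideal (I : R -> Prop) :=
  [/\ I 0, forall p q, I p -> I q -> I (p + q) & forall a p, I p -> I (a * p)].

Section Basic.
Variables (I : R -> Prop) (iI : ideal I).

Lemma ideal0 : I 0. Proof. by case: iI. Qed.
Lemma idealD p q : I p -> I q -> I (p + q). Proof. by case: iI => _ H _; apply: H. Qed.
Lemma idealM a p : I p -> I (a * p). Proof. by case: iI => _ _; apply. Qed.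
Lemma idealMr a p : I p -> I (p * a). Proof. by rewrite mulrC; apply: idealM. Qed.
Lemma idealN p : I p -> I (- p). Proof. by rewrite -mulN1r; apply: idealM. Qed.
Lemma idealB p q : I p -> I q -> I (p - q).
Proof. by move=> Ip Iq; apply: idealD => //; apply: idealN. Qed.
Lemma idealZ c p : I p -> I (c *: p). Proof. by rewrite -mul_mpolyC; apply: idealM. Qed.
Lemma idealZK c p : c != 0 -> I (c *: p) -> I p.
Proof. by move=> c0 /(idealZ c^-1); rewrite scalerA mulVf // scale1r. Qed.
Lemma ideal_sum (T : Type) (r : seq T) (P : pred T) (E : T -> R) :
  (forall i, P i -> I (E i)) -> I (\sum_(i <- r | P i) E i).
Proof. by move=> H; elim/big_rec: _ => [|i x Pi Ix]; [apply: ideal0|apply: idealD => //; apply: H]. Qed.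
Lemma ideal_cong p q : I (p - q) -> I q -> I p.
Proof. by move=> pq /(idealD pq); rewrite subrK. Qed.
Lemma ideal_congM p q p' q' : I (p - q) -> I (p' - q') -> I (p * p' - q * q').
Proof.
move=> /(idealMr p') a /(idealM q) b; have := idealD a b.
by rewrite (_ : _ + _ = p * p' - q * q') //; ring.
Qed.
Lemma ideal_congX p q k : I (p - q) -> I (p ^+ k - q ^+ k).
Proof. by move=> pq; rewrite subrXX; apply: idealMr. Qed.
Lemma ideal_cong_prod (T : Type) (r : seq T) (P : pred T) (E E' : T -> R) :
  (forall i, P i -> I (E i - E' i)) -> I (\prod_(i <- r | P i) E i - \prod_(i <- r | P i) E' i).
Proof.
move=> H; elim/big_rec2: _ => [|i x y Pi xy]; first by rewrite subrr; apply: ideal0.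
by apply: ideal_congM => //; apply: H.
Qed.

Lemma ideal_colon q : ideal (fun p => I (p * q)).
Proof.
split=> [|p p' a b|a p b]; first by rewrite mul0r; apply: ideal0.
  by rewrite mulrDl; apply: idealD.
by rewrite -mulrA; apply: idealM.
Qed.

Lemma ideal_rad : ideal (fun p => exists k, I (p ^+ k)).
Proof.
split=> [|p q [a pa] [b qb]|a p [k pk]].
- by exists 1%N; rewrite expr1; apply: ideal0.
- exists (a + b)%N; rewrite exprDn; apply: ideal_sum => i _; rewrite -mulr_natl; apply: idealM.
  have [le|lt] := leqP b i.
    by rewrite -(subnK le) exprD mulrA; apply: idealM.
  apply: idealMr; have le : (a <= a + b - i)%N by lia.
  by rewrite -(subnK le) exprD; apply: idealM.
by exists k; rewrite exprMn; apply: idealM.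
Qed.

Lemma ideal_add_principal t : ideal (fun p => exists a, I (p - a * t)).
Proof.
split=> [|p q [a pa] [b qb]|c p [a pa]].
- by exists 0; rewrite mul0r subr0; apply: ideal0.
- exists (a + b); have := idealD pa qb.
  by rewrite (_ : _ + _ = p + q - (a + b) * t) //; ring.
by exists (c * a); rewrite -mulrA -mulrBr; apply: idealM.
Qed.

Lemma ideal_localize (y : R) : ideal (fun p => exists k, I (y ^+ k * p)).
Proof.
split=> [|p q [a pa] [b qb]|c p [k pk]].
- by exists 0%N; rewrite mulr0; apply: ideal0.
- exists (a + b)%N; rewrite mulrDr; apply: idealD.
    by rewrite addnC exprD -mulrA; apply: idealM.
  by rewrite exprD -mulrA; apply: idealM.
by exists k; rewrite mulrCA; apply: idealM.
Qed.

(** Multiply [q0] by the factors one after the other and stop just before the product falls into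
    [I]: an eigenvector for [x] relative to [y]. *)
Lemma ideal_eigenvalue (x y q0 : R) (rs : seq F) : ~ I q0 ->
  I (\prod_(r <- rs) (x - r *: y) * q0) ->
  exists q r, [/\ r \in rs, ~ I (q * q0) & I ((x - r *: y) * (q * q0))].
Proof.
move=> nq; elim: rs => [|r rs IH]; first by rewrite big_nil mul1r.
rewrite big_cons -mulrA => H; have [Iq|nI] := classic (I (\prod_(r <- rs) (x - r *: y) * q0)).
  by have [q [r' [r'i a b]]] := IH Iq; exists q, r'; split=> //; rewrite inE r'i orbT.
by exists (\prod_(r <- rs) (x - r *: y)), r; split=> //; rewrite inE eqxx.
Qed.

End Basic.

(* Each variable acts as the scalar [z i] times [y], hence so does every form. *)
Lemma ideal_eigen_eval I w (p y q : R) (z : 'I_N -> F) : ideal I ->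
  p \is w.-homog -> (forall i, I (('X_i - z i *: y) * q)) -> I ((p - p.@[z] *: y ^+ w) * q).
Proof.
move=> iI pw H; have iC := ideal_colon iI q.
have mon (m : 'X_{1..N}) : mdeg m = w ->
    I (('X_[m] - ('X_[m] : R).@[z] *: y ^+ w) * q).
  move=> mw.
  have E : ('X_[m] : R).@[z] *: y ^+ w = \prod_i (z i *: y) ^+ m i.
    rewrite mevalX; under [RHS]eq_bigr do rewrite exprZn.
    by rewrite scaler_prod -mw mdegE prodrXr.
  rewrite E {1}mpolyXE_id.
  have K := @ideal_cong_prod _ iC _ (index_enum 'I_N) (fun=> true) (fun i => 'X_i ^+ m i)
    (fun i => (z i *: y) ^+ m i) (fun i _ => @ideal_congX _ iC _ _ _ (H i)).
  exact: K.
rewrite {1 2}(homog_sum pw) (rmorph_sum (meval z)) /= scaler_suml -sumrB mulr_suml.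
apply: ideal_sum => // m _; rewrite mevalZ -scalerA -scalerBr -scalerAl.
have [mw|mw] := eqVneq (mdeg m) w; first by apply: idealZ => //; apply: mon.
by rewrite (dhomog_nemf_coeff pw mw) scale0r; apply: ideal0.
Qed.

Lemma homogenized_roots (rs : seq F) (x y : R) :
  \prod_(r <- rs) (x - r *: y) =
  \sum_(k < (size rs).+1) (\prod_(r <- rs) ('X - r%:P))`_k *: (x ^+ k * y ^+ (size rs - k)).
Proof.
elim: rs => [|r rs IH].
  by rewrite !big_nil big_ord1 coef1 scale1r !expr0 mulr1.
rewrite !big_cons IH /=; set P := \prod_(r0 <- rs) _; set s := size rs.
have Ps : P`_s.+1 = 0 by apply: nth_default; rewrite /P size_prod_XsubC.
have E (k : 'I_s.+2) : (('X - r%:P) * P)`_k *: (x ^+ k * y ^+ (s.+1 - k)) =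
    (if (k : nat) is k'.+1 then P`_k' else 0) *: (x ^+ k * y ^+ (s.+1 - k)) -
    (r * P`_k) *: (x ^+ k * y ^+ (s.+1 - k)).
  by rewrite mulrBl coefB coefXM coefCM scalerBl; case: (nat_of_ord k).
rewrite [RHS](eq_bigr _ (fun k _ => E k)) sumrB [X in _ = X - _]big_ord_recl /= scale0r add0r.
rewrite [X in _ = _ - X]big_ord_recr /= Ps mulr0 scale0r addr0 mulrBl; congr (_ - _).
  rewrite mulr_sumr; apply: eq_bigr => k _; rewrite -scalerAr mulrA -exprS.
  by rewrite /bump /= add1n subSS.
rewrite mulr_sumr; apply: eq_bigr => k _.
rewrite -scalerAl -scalerAr scalerA mulrCA -exprS subSn //.
by rewrite -ltnS ltn_ord.
Qed.

Lemma subXX_factor k (x y : R) : (0 < k)%N ->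
  exists rs : seq F, x ^+ k - y ^+ k = \prod_(r <- rs) (x - r *: y).
Proof.
move=> k0; have mon : ('X^k - 1 : {poly F}) \is monic by apply: monicXnsubC.
have [rs rsE] := closed_field_poly_normal ('X^k - 1 : {poly F}).
rewrite (monicP mon) scale1r in rsE.
have sz : size rs = k.
  by have := size_XnsubC (1 : F) k0; rewrite rsE size_prod_XsubC => -[].
exists rs; rewrite homogenized_roots sz -rsE.
have E (j : 'I_k.+1) : ('X^k - 1 : {poly F})`_j *: (x ^+ j * y ^+ (k - j)) =
   (if j == ord_max then x ^+ k else 0) - (if j == ord0 then y ^+ k else 0).
  rewrite coefB coefXn coef1 scalerBl; congr (_ - _).
    have -> : (j == ord_max) = (j == k :> nat) by [].
    by case: eqP => [->|_]; rewrite ?scale0r // scale1r subnn mulr1.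
  have -> : (j == ord0) = (j == 0%N :> nat) by [].
  by case: eqP => [->|_]; rewrite ?scale0r // scale1r subn0 mul1r.
by rewrite (eq_bigr _ (fun j _ => E j)) sumrB -!big_mkcond /= !big_pred1_eq.
Qed.

Section Local.
Variables (I : R -> Prop) (iI : ideal I) (i0 i1 : 'I_N) (de : nat).
Hypotheses (i10 : i1 != i0) (de0 : (0 < de)%N).
Local Notation y := ('X_i1 : R).
Hypothesis IG : forall i, i != i0 -> I ('X_i ^+ de - y ^+ de).
Let J p := exists k, I (y ^+ k * p).
Lemma iJ : ideal J. Proof. exact: ideal_localize. Qed.
Lemma IJ p : I p -> J p. Proof. by exists 0%N; rewrite mul1r. Qed.
Lemma J_absorb k p : J (y ^+ k * p) -> J p.
Proof. by case=> j; rewrite mulrA -exprD => H; exists (j + k)%N. Qed.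

Variables (a b : nat) (co : 'I_N -> F).
Let L : R := \sum_(i | i != i0) co i *: 'X_i.
Hypothesis IH0 : I ('X_i0 ^+ a * ('X_i0 - L) * \prod_(i | i != i0) 'X_i ^+ b).

Lemma J_line : J ('X_i0 ^+ a * ('X_i0 - L)).
Proof.
have H1 : I ('X_i0 ^+ a * ('X_i0 - L) * \prod_(i | i != i0) ('X_i ^+ de) ^+ b).
  have -> : \prod_(i | i != i0) ('X_i ^+ de) ^+ b =
      \prod_(i | i != i0) 'X_i ^+ b * \prod_(i | i != i0) 'X_i ^+ (de.-1 * b) :> R.
    by rewrite -big_split /=; apply: eq_bigr => i _; rewrite -exprD -exprM -mulSn prednK.
  by rewrite mulrA; apply: idealMr.
have H2 : I (\prod_(i | i != i0) ('X_i ^+ de) ^+ b - \prod_(i | i != i0) (y ^+ de) ^+ b).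
  by apply: ideal_cong_prod => // i ii; apply: ideal_congX => //; apply: IG.
have H3 : I ('X_i0 ^+ a * ('X_i0 - L) * \prod_(i | i != i0) (y ^+ de) ^+ b).
  have := idealB iI H1 (idealM iI ('X_i0 ^+ a * ('X_i0 - L)) H2).
  by rewrite -mulrBr subKr.
move: H3; rewrite prodr_const -!exprM mulrC => H3; eexists; exact: H3.
Qed.

(** A simultaneous eigenvector for all variables. Those other than [x_i0] are handled through
    [x_i ^ de - y ^ de]; then [L] acts as a scalar times [y], and [J_line] splits into linear
    factors for [x_i0]. *)
Lemma local_zero q0 : ~ J q0 -> exists z q, [/\ z i1 = 1, ~ J (q * q0) &
  forall i, J (('X_i - z i *: y) * (q * q0))].
Proof.
move=> nq; have iJ' := iJ.
have step (s : seq 'I_N) : exists (z : 'I_N -> F) q, ~ J (q * q0) /\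
    forall i, i \in s -> i != i0 -> i != i1 -> J (('X_i - z i *: y) * (q * q0)).
  elim: s => [|i s [z [q [nJ H]]]]; first by exists (fun=> 0), 1; rewrite mul1r.
  have [/orP ii|] := boolP ((i == i0) || (i == i1)).
    exists z, q; split=> // j; rewrite inE => /orP[/eqP -> j0 j1|]; last exact: H.
    by case: ii => ii; [rewrite ii in j0|rewrite ii in j1].
  rewrite negb_or => /andP[ii0 ii1].
  have [rs rsE] := subXX_factor 'X_i y de0.
  have [|q' [r [_ nJ' H']]] := ideal_eigenvalue (x := 'X_i) (y := y) (rs := rs) nJ.
    by rewrite -rsE; apply: idealMr => //; apply: IJ; apply: IG.
  exists (fun j => if j == i then r else z j), (q' * q); rewrite -mulrA; split=> //.
  move=> j; rewrite inE; case: eqP => [-> _ _ _ //|_] /= js j0 j1.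
  by rewrite mulrCA; apply: idealM => //; apply: H.
have [z [q [nJ H]]] := step (enum 'I_N).
have {}H i : i != i0 -> i != i1 -> J (('X_i - z i *: y) * (q * q0)).
  by apply: H; rewrite mem_enum.
pose z1 i := if i == i1 then 1 else z i.
have H1 i : i != i0 -> J (('X_i - z1 i *: y) * (q * q0)).
  rewrite /z1; case: (eqVneq i i1) => [-> _|ii1 ii0]; last exact: H.
  by rewrite scale1r subrr mul0r; apply: ideal0.
pose l := \sum_(i | i != i0) co i * z1 i.
have HL : J ((L - l *: y) * (q * q0)).
  rewrite /L /l scaler_suml -sumrB mulr_suml; apply: ideal_sum => // i ii.
  by rewrite -scalerA -scalerBr -scalerAl; apply: idealZ => //; apply: H1.
have [|q' [r [_ nJ' H']]] := ideal_eigenvalue (x := 'X_i0) (y := y) (rs := rcons (nseq a 0) l) nJ.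
  rewrite big_rcons /= big_nseq scale0r subr0 iter_mulr_1.
  have := idealD iJ' (idealMr iJ' (q * q0) J_line) (idealM iJ' ('X_i0 ^+ a) HL).
  by rewrite [X in J (_ + X) -> _]mulrA -mulrDl -mulrDr addrA subrK.
exists (fun i => if i == i0 then r else z1 i), (q' * q); rewrite -mulrA; split=> //.
  by rewrite (negPf i10) /z1 eqxx.
move=> i; case: eqP => [-> //|/eqP ii0]; rewrite mulrCA; apply: idealM => //; exact: H1.
Qed.

Variable x0 : 'I_N -> F.
Hypothesis zero_uniq : forall z : 'I_N -> F, z i1 = 1 ->
  (forall p w, I p -> p \is w.-homog -> p.@[z] = 0) -> z =1 x0.

(* At a reduced point the annihilator of [g] cannot contain a form [w] with [w(x0) != 0]. *)
Lemma local_gen g w v : I (g * w) -> w \is v.-homog -> w.@[x0] != 0 -> J g.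
Proof.
move=> Igw wv w0; apply: NNPP => nJ; have iJ' := iJ.
have [z [q [z1 nq H]]] := local_zero nJ.
have ev p k : p \is k.-homog -> J (p * (q * g)) -> p.@[z] = 0.
  move=> pk Jp; apply: NNPP => /eqP pz; apply: nq.
  have := idealB iJ' Jp (ideal_eigen_eval iJ' pk H).
  by rewrite -mulrBl subKr -scalerAl => /(idealZK iJ' pz) /J_absorb.
have zx : z =1 x0.
  by apply: zero_uniq => // p k Ip pk; apply: (ev p k pk); apply: idealMr => //; apply: IJ.
case/eqP: w0; rewrite -(ev w v wv); first by apply: meval_eq => i; rewrite zx.
by rewrite mulrCA; apply: idealM => //; rewrite mulrC; apply: IJ.
Qed.

End Local.

Lemma ideal_axis I w (p : R) i0 : ideal I -> p \is w.-homog ->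
  (forall i, i != i0 -> I ('X_i)) -> I (p - p@_(U_(i0) *+ w) *: 'X_i0 ^+ w).
Proof.
move=> iI pw H; pose m0 := (U_(i0) *+ w)%MM.
have -> : p - p@_m0 *: 'X_i0 ^+ w = \sum_(m : 'X_{1..N < w.+1}) (if (m : 'X_{1..N}) == m0 then 0 else p@_m *: 'X_[m]).
  have lt : (mdeg m0 < w.+1)%N by rewrite mdegMn mdeg1 mul1n.
  rewrite {1}(homog_sum pw) (bigD1 (BMultinom lt)) //= mpolyXn addrAC subrr add0r.
  rewrite [RHS](bigD1 (BMultinom lt)) //= eqxx add0r; apply: eq_bigr => m mm.
  by rewrite ifN //; rewrite bmeqP in mm.
apply: ideal_sum => // m _; case: eqP => [_|/eqP mm]; first exact: ideal0.
have [mw|mw] := eqVneq (mdeg m) w; last first.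
  by rewrite (dhomog_nemf_coeff pw mw) scale0r; apply: ideal0.
apply: idealZ => //.
have [i ii mi] : exists2 i, i != i0 & (0 < m i)%N.
  apply: NNPP => nx; case/eqP: mm; apply/mnmP => j.
  have z i : i != i0 -> m i = 0%N.
    by move=> ii; apply/eqP; rewrite -leqn0 leqNgt; apply/negP => mi; apply: nx; exists i.
  rewrite mulmnE mnm1E; have [<-|ji] := eqVneq i0 j; last by rewrite z // eq_sym.
  by rewrite mul1n; move: mw; rewrite mdegE (bigD1 i0) //= big1 ?addn0 // => k /z.
have -> : (m : 'X_{1..N}) = ((m - U_(i)) + U_(i))%MM.
  by rewrite submK //; apply/mnm_lepP => j; rewrite mnm1E; case: eqP => [<-|].
by rewrite mpolyXD; apply: idealM => //; apply: H.
Qed.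

Section Macaulay.
Variables (I : R -> Prop) (iI : ideal I) (i0 i1 : 'I_N) (de : nat) (x0 : 'I_N -> F).
Hypothesis de0 : (0 < de)%N.
Local Notation y := ('X_i1 : R).
Hypothesis IG : forall i, i != i0 -> I ('X_i ^+ de - y ^+ de).
Hypothesis Jx : forall i, exists k, I (y ^+ k * ('X_i - x0 i *: y)).
Variables (u0 : R) (y0 : F).
Hypotheses (u0h : u0 \is de.-homog) (u0a : u0@_(U_(i0) *+ de) = 1) (Iu : I (u0 - y0 *: y ^+ de)).

Lemma uniform_power : exists k0, forall i, I (y ^+ k0 * ('X_i - x0 i *: y)).
Proof.
have /fin_all_exists[k kP] := Jx; exists (\sum_i k i)%N => i.
by rewrite (bigD1 i) //= addnC exprD -mulrA; apply: idealM.
Qed.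

Lemma nilpotent_vars k0 i : exists k a, I ('X_i ^+ k - a * y ^+ k0).
Proof.
pose K p := exists a, I (p - a * y ^+ k0); have iK : ideal K by apply: ideal_add_principal.
have iR := ideal_rad iK; pose Rd p := exists k, K (p ^+ k).
have IR p : I p -> Rd p by move=> Ip; exists 1%N, 0; rewrite mul0r subr0 expr1.
have root p k : Rd (p ^+ k) -> Rd p by case=> j; rewrite -exprM => H; exists (k * j)%N.
have Ry : Rd y by exists k0, 1; rewrite mul1r subrr; apply: ideal0.
have Ryd : Rd (y ^+ de) by rewrite -(prednK de0) exprS; apply: (idealMr iR).
have Rx j : j != i0 -> Rd 'X_j.
  by move=> /IG /IR H; apply: (root _ de); apply: (ideal_cong iR H).
suff : Rd 'X_i by [].
have [->|/Rx//] := eqVneq i i0.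
apply: (root _ de); have := ideal_axis iR u0h Rx; rewrite u0a scale1r => H.
have Ru : Rd u0 by apply: (ideal_cong iR (IR _ Iu)); apply: (idealZ iR).
by have := idealB iR Ru H; rewrite subKr.
Qed.

Lemma large_monomials k0 : exists2 m, (0 < m)%N &
  forall mu : 'X_{1..N}, mdeg mu = m -> exists a, I ('X_[mu] - a * y ^+ k0).
Proof.
have /fin_all_exists[k kP] := nilpotent_vars k0; pose E := (\sum_i k i)%N.
have iK := ideal_add_principal iI (y ^+ k0).
exists (N * E).+1 => // mu muE.
have [i le] : exists i, (E <= mu i)%N.
  apply: NNPP => /not_ex_all_not nx; suff : (mdeg mu <= N * E)%N by rewrite muE ltnn.
  rewrite mdegE -[N in (_ <= N * _)%N]card_ord -sum_nat_const; apply: leq_sum => j _.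
  by rewrite leqNgt; apply/negP => lt; apply: (nx j); apply: ltnW.
have le' : (k i <= mu i)%N by apply: leq_trans le; rewrite /E (bigD1 i) //= leq_addr.
have -> : mu = ((mu - U_(i) *+ k i) + U_(i) *+ k i)%MM.
  by rewrite submK //; apply/mnm_lepP => j; rewrite mulmnE mnm1E; case: eqP => [<-|]; rewrite ?mul1n ?mul0n.
by rewrite mpolyXD -mpolyXn; apply: (idealM iK); apply: kP.
Qed.

(** In large degree every monomial is congruent to a multiple of [y ^ k0], and modulo [I] each
    monomial times [y ^ k0] is a scalar times a power of [y]. So [I] has codimension at most one in
    degree [m]. *)
Lemma macaulay_functional : exists2 m, (0 < m)%N & forall la : R -> F,
  (forall c p q, la (c *: p + q) = c * la p + la q) -> (forall p, I p -> la p = 0) ->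
  (forall j, la (y ^+ j) = 0) -> forall mu : 'X_{1..N}, mdeg mu = m -> la 'X_[mu] = 0.
Proof.
have [k0 k0P] := uniform_power; have [m m0 mP] := large_monomials k0.
exists m => // la lin laI lay mu /mP[a aP].
have la0 : la 0 = 0 by apply: laI; apply: ideal0.
have laZ c p : la (c *: p) = c * la p by rewrite -[c *: p]addr0 lin la0 addr0.
have laD p q : la (p + q) = la p + la q by have := lin 1 p q; rewrite scale1r mul1r.
have la_sum (T : Type) (r : seq T) (P : pred T) (E : T -> R) :
    (forall i, P i -> la (E i) = 0) -> la (\sum_(i <- r | P i) E i) = 0.
  by move=> H; elim/big_rec: _ => // i x Pi lx; rewrite laD H // lx addr0.
have := laI _ aP; rewrite -[- _]scaleN1r addrC lin mulN1r => /eqP; rewrite addrC subr_eq0 => /eqP ->.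
rewrite [a]mpolyE mulr_suml; apply: la_sum => nu _; rewrite -scalerAl laZ.
suff -> : la ('X_[nu] * y ^+ k0) = 0 by rewrite mulr0.
have H i : I (('X_i - x0 i *: y) * y ^+ k0) by rewrite mulrC.
have nuh : ('X_[nu] : R) \is (mdeg nu).-homog by rewrite dhomogX.
have := laI _ (ideal_eigen_eval iI nuh H).
rewrite mulrBl -scalerAl -exprD -scaleNr addrC lin lay mulr0 add0r //.
Qed.

End Macaulay.

End Ideals.

Lemma row_free_minor (F : fieldType) m n (L : 'M[F]_(m, n)) : row_free L ->
  exists sg : 'I_m -> 'I_n, \det (\matrix_(i, j) L i (sg j)) != 0.
Proof.
move=> fL; have fA : row_full L^T by rewrite /row_full mxrank_tr.
exists (fullrankfun fA); have := fullrowsub_unit fA; rewrite unitmxE unitfE -det_tr.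
by congr (\det _ != 0); apply/matrixP => i j; rewrite !mxE.
Qed.

(** Put in column [k0] the vector with entry [be t] at [s] and [- be s] at [t]. Then [be] kills
    every column, and the vanishing determinant, expanded along that column, is the claim. *)
Lemma cofactor_null_prop (F : fieldType) r (P : 'M[F]_r) (be : 'I_r -> F) k0 s t :
  (forall k, k != k0 -> \sum_i be i * P i k = 0) ->
  cofactor P s k0 * be t = cofactor P t k0 * be s.
Proof.
move=> H; have [|nz] := classic (forall i, be i = 0); first by move=> z; rewrite !z !mulr0.
pose P' := \matrix_(i, k) if k == k0 then be t * (i == s)%:R - be s * (i == t)%:R else P i k.
have cE i : cofactor P' i k0 = cofactor P i k0.
  rewrite /cofactor; congr (_ * \det _); apply/matrixP => a b; rewrite !mxE.
  by rewrite eq_sym (negPf (neq_lift _ _)).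
have d0 : \det P' = 0.
  apply/eqP/det0P; exists (\row_i be i).
    by apply/eqP => /rowP E; apply: nz => i; have := E i; rewrite !mxE.
  apply/rowP => k; rewrite !mxE; under eq_bigr do rewrite !mxE.
  case: (eqVneq k k0) => [_|/H//].
  under eq_bigr do rewrite mulrBr.
  rewrite sumrB (bigD1 s) //= eqxx big1 => [|i /negPf ->]; last by rewrite !mulr0.
  rewrite [X in _ - X](bigD1 t) //= eqxx [X in _ - (_ + X)]big1 => [|i /negPf ->]; last by rewrite !mulr0.
  by rewrite !mulr1 !addr0 mulrC subrr.
move: d0; rewrite (expand_det_col _ k0); under eq_bigr do rewrite cE mxE eqxx mulrBl.
rewrite sumrB (bigD1 s) //= eqxx big1 => [|i /negPf ->]; last by rewrite !mulr0 mul0r.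
rewrite [X in _ - X](bigD1 t) //= eqxx [X in _ - (_ + X)]big1 => [|i /negPf ->]; last by rewrite !mulr0 mul0r.
by rewrite !mulr1 !addr0 => /eqP; rewrite subr_eq0 mulrC => /eqP ->; rewrite mulrC.
Qed.

Lemma cmp_cofactor (F : fieldType) n (g : 'I_n -> {mpoly F[n]}) r (A : 'M[{mpoly F[n]}]_r) i j :
  cmp g (cofactor A i j) = cofactor (\matrix_(a, b) cmp g (A a b)) i j.
Proof.
rewrite /cofactor cmpM cmpXn -[-1]sub0r cmpB cmp0 cmp1; congr (_ * _).
rewrite /determinant cmp_sum; apply: eq_bigr => s _; rewrite cmpM cmpXn -[-1]sub0r cmpB cmp0 cmp1.
congr (_ * _); elim/big_rec2: _ => [|k x y _ <-]; first exact: cmp1.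
by rewrite cmpM !mxE.
Qed.

Lemma meval_cofactor (F : fieldType) n (x : 'I_n -> F) r (A : 'M[{mpoly F[n]}]_r) i j :
  (cofactor A i j).@[x] = cofactor (map_mx (meval x) A) i j.
Proof. by rewrite (cofactor_map_mx (meval x)). Qed.

Lemma cofactor_relation (F : closedFieldType) n (h : {mpoly F[n]}) (u : 'I_n -> {mpoly F[n]}) r
    (M : 'M[{mpoly F[n]}]_r) k0 (be : 'I_r -> {mpoly F[n]}) : prime_elt h ->
  (forall x, h.@[x] = 0 -> forall k, k != k0 -> \sum_i (be i).@[x] * (cmp u (M i k)).@[x] = 0) ->
  forall s t, eqm h (cmp u (cofactor M s k0) * be t) (cmp u (cofactor M t k0) * be s).
Proof.
move=> hp H s t; apply: (prime_vanish hp) => x hx.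
have gen (P Q : {mpoly F[n]}) (a b : F) : P.@[x] = a -> Q.@[x] = b ->
    a * (be t).@[x] = b * (be s).@[x] -> (P * be t - Q * be s).@[x] = 0.
  by move=> PE QE E; rewrite mevalB !mevalM PE QE E subrr.
have E i : (cmp u (cofactor M i k0)).@[x] =
    cofactor (map_mx (meval (fun j => (u j).@[x])) M) i k0.
  exact: etrans (meval_cmp _ _ _) (meval_cofactor _ _ _ _).
apply: (gen _ _ _ _ (E s) (E t)).
apply: (cofactor_null_prop (be := fun s => (be s).@[x])) => k kk.
rewrite -[RHS](H x hx k kk); apply: eq_bigr => i _; congr (_ * _).
by rewrite mxE; apply/esym/meval_cmp.
Qed.

(** * Iterates and genericity of non-divisibility *)

Section Iterates.
Variables (F : closedFieldType) (n d : nat).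
Local Notation N := n.+1.
Local Notation R := {mpoly F[n.+1]}.

Fixpoint fmi (f : polymap F n) k : polymap F n :=
  if k is k'.+1 then fun i => cmp f (fmi f k' i) else fun i => 'X_i.

Lemma fmi_homog f k i : hom d f -> fmi f k i \is (d ^ k).-homog.
Proof.
move=> fh; elim: k i => [|k IH] i /=; first by rewrite dhomogX /= mdeg1.
by rewrite expnS; apply: cmp_homog.
Qed.

Lemma fmi_eval f k i x : (fmi f k i).@[x] = iter k (fmap f) x i.
Proof.
elim: k i x => [|k IH] i x /=; first by rewrite mevalXU.
by rewrite meval_cmp IH -iterSr.
Qed.

Lemma pfam_fmi k i : pfam d (fun f => fmi f k i).
Proof.
elim: k i => [|k IH] i /=; first exact: pfp_const.
apply: (@pfp_cmp _ _ _ _ _ _ (one_param F n d) _ (d ^ k)) => [f fh|j|].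
- exact: fmi_homog.
- exact: pfam_var.
exact: IH.
Qed.

(** For one homogeneous component [V] of [W], non-divisibility at [f0] makes [V] and the monomial
    multiples of [h] of bounded degree linearly independent. A nonzero minor persists generically,
    and divisibility would make the rows dependent. *)
Lemma gen_ndvd e (h W : polymap F n -> R) f0 : (forall f, hom d f -> h f \is e.-homog) ->
  pfam d h -> pfam d W -> hom d f0 -> h f0 != 0 -> ~ dvdR (h f0) (W f0) ->
  gen d (fun f => ~ dvdR (h f) (W f)).
Proof.
move=> hh ph pW fh0 h0 nd.
have [w nw] : exists w, ~ dvdR (h f0) (pihomog mdeg w (W f0)).
  apply: NNPP => /not_ex_all_not H; apply: nd.
  rewrite (@pihomog_partitionE _ _ mdeg _ (W f0) (leqnn _)).
  by apply: dvdR_sum => k _; apply: NNPP; apply: H.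
pose V f := pihomog mdeg w (W f).
have pV : pfam d V.
  move=> m; have [mw|mw] := eqVneq (mdeg m) w.
    by apply: pf_ext (pW m) => f _; rewrite mcoeff_pihomog mw eqxx.
  by apply: pf_ext (pf_const _ _ _ 0) => f _; rewrite mcoeff_pihomog (negPf mw).
have Vh f : V f \is w.-homog by apply: pihomogP.
pose T := option 'X_{1..N < w.+1}; pose C := 'X_{1..N < (w + e).+1}.
pose rp f (t : T) : R := if t is Some nu then h f * 'X_[nu] else V f.
pose L f := \matrix_(i < #|{: T}|, j < #|{: C}|) (rp f (enum_val i))@_(enum_val j : C).
have rp_big f t (m : 'X_{1..N}) : hom d f -> (w + e < mdeg m)%N -> (rp f t)@_m = 0.
  move=> fh lt; case: t => [nu|] /=; last by apply: (dhomog_nemf_coeff (Vh f)) => /=; lia.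
  have hX : h f * 'X_[nu] \is (e + mdeg nu).-homog by apply: dhomogM; rewrite ?dhomogX //; apply: hh.
  by apply: (dhomog_nemf_coeff hX) => /=; have := bmdeg nu; lia.
have L0 f (v : 'rV_#|{: T}|) : hom d f -> v *m L f = 0 ->
    \sum_(t : T) v 0 (enum_rank t) *: rp f t = 0.
  move=> fh vL; apply/mpolyP => m; rewrite mcoeff0 raddf_sum /=.
  have [lt|le] := ltnP (w + e) (mdeg m).
    by apply: big1 => t _; rewrite mcoeffZ rp_big ?mulr0.
  have lt : (mdeg m < (w + e).+1)%N by [].
  have := congr1 (fun M : 'rV_ _ => M 0 (enum_rank (BMultinom lt : C))) vL.
  rewrite !mxE => E; rewrite -[RHS]E [RHS](reindex (@enum_rank T)) /=; last first.
    by apply: onW_bij; apply: enum_rank_bij.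
  by apply: eq_bigr => t _; rewrite mcoeffZ !mxE !enum_rankK.
have Lfree : row_free (L f0).
  apply: inj_row_free => v /(L0 _ _ fh0) E.
  pose q : R := \sum_(nu : 'X_{1..N < w.+1}) v 0 (enum_rank (Some nu : T)) *: 'X_[nu].
  have E2 : v 0 (enum_rank (None : T)) *: V f0 + q * h f0 = 0.
    rewrite -[RHS]E (bigD1 None) //=; congr (_ + _); rewrite /q mulr_suml.
    rewrite (reindex_omap (fun nu => Some nu : T) id) /=; last by case.
    rewrite [RHS](eq_bigl predT) => [|nu]; last by rewrite /= eqxx.
    by apply: eq_bigr => nu _; rewrite -scalerAl mulrC.
  have vN : v 0 (enum_rank (None : T)) = 0.
    apply: NNPP => /eqP c0; apply: nw; exists (- (v 0 (enum_rank (None : T)))^-1 *: q).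
    move/eqP: E2; rewrite addr_eq0 => /eqP /(congr1 (fun p => (v 0 (enum_rank (None : T)))^-1 *: p)).
    by rewrite scalerA mulVf // scale1r -/(V f0) => ->; rewrite -scalerAl scaleNr scalerN.
  have q0 : q = 0.
    by move/eqP: E2; rewrite vN scale0r add0r mulf_eq0 (negPf h0) orbF => /eqP.
  apply/rowP => i; rewrite [RHS]mxE -(enum_valK i); case: (enum_val i) => [nu|//].
  have := congr1 (mcoeff nu) q0; rewrite mcoeff0 raddf_sum /= (bigD1 nu) //= big1 => [|k kn].
    by rewrite mcoeffZ mcoeffX eqxx mulr1 addr0.
  by rewrite mcoeffZ mcoeffX -bmeqP (negPf kn) mulr0.
have [sg sg0] := row_free_minor Lfree.
apply: (@gen_imp F n d (fun f => \det (\matrix_(i, j) L f i (sg j)) != 0)); last first.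
  apply: (@gen_pfun F n d (fun f => \det (\matrix_(i, j) L f i (sg j))) f0 _ fh0 sg0).
  apply: (pf_det (one_param F n d)) => i j.
  apply: (@pf_ext _ _ _ _ _ _ (fun f => (rp f (enum_val i))@_(enum_val (sg j) : C))).
    by move=> f _; rewrite !mxE.
  move: (enum_val i) => [nu|] /=; last exact: pV.
  by apply: (pfpM (one_param F n d)) => //; apply: pfp_const.
move=> f fh dn [c cE].
have [c' c'h c'E] : exists2 c' : R, (msize c' <= w.+1)%N & V f = c' * h f.
  have dv : dvdR (h f) (V f) by apply: (dvd_homog_comp _ (hh f fh)); exists c.
  have [->|Vn] := eqVneq (V f) 0; first by exists 0; rewrite ?msize0 ?mul0r.
  have [k kh [kE le]] := homog_dvd (hh f fh) (Vh f) dv Vn; exists k => //.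
  rewrite msizeE; apply/bigmax_leqP_seq => m mk _.
  by rewrite ltnS (dhomog_mf kh mk) leq_subr.
case/eqP: dn; apply/eqP/det0P.
exists (\row_i (if enum_val i is Some nu then - c'@_(nu : 'X_{1..N < w.+1}) else 1)).
  apply/eqP => /rowP /(_ (enum_rank (None : T))); rewrite !mxE enum_rankK => /eqP.
  by rewrite oner_eq0.
apply/rowP => k; rewrite !mxE.
rewrite (reindex (@enum_rank T)) /=; last by apply: onW_bij; apply: enum_rank_bij.
under eq_bigr do rewrite !mxE enum_rankK.
rewrite (bigD1 None) //= mul1r (reindex_omap (fun nu => Some nu : T) id) /=; last by case.
rewrite (eq_bigl predT) => [|nu]; last by rewrite /= eqxx.
rewrite {1}c'E {1}(mpolywE c'h) mulr_suml raddf_sum /= -big_split /=; apply: big1 => nu _.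
by rewrite -scalerAl mcoeffZ mulrC mulNr [h f * _]mulrC mulrC subrr.
Qed.

Lemma pfam_cofactor l r (E : polymap F n -> 'M[R]_r) i j :
  (forall a b, pfam d (fun f => cmp (fmi f l) (E f a b))) ->
  pfam d (fun f => cmp (fmi f l) (cofactor (E f) i j)).
Proof.
move=> H; apply: (@pfp_ext _ _ _ _ _ _ _ (fun f => cofactor (\matrix_(a, b) cmp (fmi f l) (E f a b)) i j)).
  by move=> f _; rewrite cmp_cofactor.
apply: (pfpM (one_param F n d)); first exact: pfp_const.
apply: (pfp_det (one_param F n d)) => a b; apply: pfp_ext (H (lift i a) (lift j b)).
by move=> f _; rewrite !mxE.
Qed.

End Iterates.

Lemma ndvd_var (F : fieldType) n e (h : {mpoly F[n]}) k : h \is e.-homog -> (1 < e)%N -> ~ dvdR h 'X_k.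
Proof.
move=> hh e1 dv; have X1 : ('X_k : {mpoly F[n]}) \is 1.-homog by rewrite dhomogX /= mdeg1.
have X0 : ('X_k : {mpoly F[n]}) != 0 by apply/eqP => /(congr1 (mcoeff U_(k))) /eqP; rewrite mcoeffX eqxx mcoeff0 oner_eq0.
by have [c _ [_]] := homog_dvd hh X1 dv X0; rewrite leqNgt e1.
Qed.

(* [x] is a rational function of [u(x)] on the critical hypersurface [h = 0]. *)
Definition recovers (F : closedFieldType) n (h : {mpoly F[n.+1]}) (u : polymap F n) :=
  exists A : 'I_n.+1 -> {mpoly F[n.+1]},
    (forall j k, eqm h (cmp u (A k) * 'X_j) (cmp u (A j) * 'X_k)) /\
    (forall k, ~ dvdR h (cmp u (A k))).

(** * Recovering a critical point from its image by minors *)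

Section MacaulayMatrix.
Variables (F : closedFieldType) (n d l m : nat).
Local Notation N := n.+1.
Local Notation R := {mpoly F[n.+1]}.
Local Notation S := {mu : 'X_{1..N < m.+1} | mdeg mu == m}.
Local Notation G := (option ('I_N * 'I_N)).

Let mu (s : 'I_#|{: S}|) : 'X_{1..N} := val (val (enum_val s)).

Lemma mu_deg s : mdeg (mu s) = m.
Proof. by apply/eqP; exact: (valP (enum_val s)). Qed.

Lemma mu_inj : injective mu.
Proof. by move=> s t E; apply: enum_val_inj; apply: val_inj; apply/eqP; rewrite bmeqP; apply/eqP. Qed.

Lemma mu_ex k : mdeg k = m -> exists s, mu s = k.
Proof. by move=> /coef_index_ex[k' k'E]; exists (enum_rank k'); rewrite /mu enum_rankK. Qed.

Lemma sum_mu (p : R) : \sum_s p@_(mu s) *: 'X_[mu s] = pihomog mdeg m p.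
Proof.
apply/mpolyP => k; rewrite mcoeff_pihomog raddf_sum /=.
case: eqP => [/mu_ex[s <-]|km].
  rewrite (bigD1 s) //= mcoeffZ mcoeffX eqxx mulr1 big1 ?addr0 // => t ts.
  by rewrite mcoeffZ mcoeffX (inj_eq mu_inj) (negPf ts) mulr0.
apply: big1 => s _; rewrite mcoeffZ mcoeffX; case: eqP => [E|]; last by rewrite mulr0.
by case: km; rewrite -E mu_deg.
Qed.

(** Equations in [x] saying that the iterate of [x] is proportional to [y] and that [x] is
    critical. *)
Definition gpol (f : polymap F n) (y : 'I_N -> F) (t : G) : R :=
  if t is Some ij then y ij.2 *: fmi f l ij.1 - y ij.1 *: fmi f l ij.2 else hJ f.

Lemma gpol_homog f y t : hom d f -> exists w, gpol f y t \is w.-homog.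
Proof.
move=> fh; case: t => [ij|] /=; last by eexists; apply: hJ_homog fh.
by exists (d ^ l)%N; apply: rpredB; apply: dhomogZ; apply: fmi_homog.
Qed.

Lemma gpol_mon f y t (nu : 'X_{1..N}) : hom d f -> exists w, gpol f y t * 'X_[nu] \is w.-homog.
Proof.
by move=> /(gpol_homog y t)[w H]; exists (w + mdeg nu)%N; apply: dhomogM; rewrite ?dhomogX.
Qed.

Variables (s0 : 'I_#|{: S}|).

(** Coefficients of the multiples of [gpol] in degree [m], with [y] kept as variables so that it can
    later be replaced by the iterate. The extra column [None], a unit vector at [s0], completes a
    matrix of corank one. *)
Definition ent (f : polymap F n) (t : option (G * 'X_{1..N < m.+1})) s : R := match t with
  | None => (s == s0)%:R
  | Some (None, nu) => ((hJ f * 'X_[nu])@_(mu s))%:MP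
  | Some (Some ij, nu) => (fmi f l ij.1 * 'X_[nu])@_(mu s) *: 'X_(ij.2) -
       (fmi f l ij.2 * 'X_[nu])@_(mu s) *: 'X_(ij.1) end.

Lemma ent_eval f t nu s y : (ent f (Some (t, nu)) s).@[y] = (gpol f y t * 'X_[nu])@_(mu s).
Proof.
case: t => [ij|] /=; last by rewrite mevalC.
by rewrite mevalB !mevalZ !mevalXU mulrBl mcoeffB -!scalerAl !mcoeffZ ![y _ * _]mulrC.
Qed.

Definition entu f t s := cmp (fmi f l) (ent f t s).

Lemma pfam_entu t s : pfam d (fun f => entu f t s).
Proof.
have pM i (nu : 'X_{1..N}) : pfam d (fun f : polymap F n => fmi f l i * 'X_[nu]).
  by apply: (pfpM (one_param F n d)); [apply: pfam_fmi|apply: pfp_const].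
rewrite /entu; case: t => [[[ij|] nu]|] /=.
- apply: (@pfp_ext _ _ _ _ _ _ _ (fun f => (fmi f l ij.1 * 'X_[nu])@_(mu s) *: fmi f l ij.2 +
      - ((fmi f l ij.2 * 'X_[nu])@_(mu s) *: fmi f l ij.1))).
    by move=> f _; rewrite cmpB !cmpZ !cmpX.
  apply: (pfpD (one_param F n d)); last apply: pfpN.
    by apply: pfpZ; [apply: pM|apply: pfam_fmi].
  by apply: pfpZ; [apply: pM|apply: pfam_fmi].
- have pH : pfam d (fun f : polymap F n => hJ f * 'X_[nu]).
    by apply: (pfpM (one_param F n d)); [apply: pfam_hJ|apply: pfp_const].
  apply: (@pfp_ext _ _ _ _ _ _ _ (fun f => (hJ f * 'X_[nu])@_(mu s) *: 1)).
    by move=> f _; rewrite cmpC -[RHS]mulr1 mul_mpolyC.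
  by apply: pfpZ; [apply: pH|apply: pfp_const].
apply: (@pfp_ext _ _ _ _ _ _ _ (fun f => (s == s0)%:R)); last exact: pfp_const.
by move=> f _; case: (s == s0); rewrite ?cmp0 ?cmp1.
Qed.

Lemma entu_null f x t nu : hom d f -> (hJ f).@[x] = 0 ->
  \sum_s ('X_[mu s] : R).@[x] * (entu f (Some (t, nu)) s).@[x] = 0.
Proof.
move=> fh hx; pose y i := (fmi f l i).@[x]; pose p := gpol f y t * 'X_[nu].
have px : p.@[x] = 0.
  rewrite mevalM; case: (t) => [ij|] /=; last by rewrite hx mul0r.
  by rewrite mevalB !mevalZ mulrC [y _ * _]mulrC subrr mulr0.
have E : (pihomog mdeg m p).@[x] = 0.
  have [w pw] := gpol_mon y t nu fh; have [mw|mw] := eqVneq m w.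
    by rewrite mw pihomog_dE.
  by rewrite (pihomog_ne0 _ pw) ?meval0 // eq_sym.
rewrite -[RHS]E -sum_mu (rmorph_sum (meval x)) /=; apply: eq_bigr => s _.
by rewrite mevalZ mulrC meval_cmp ent_eval.
Qed.

Definition Igen f y (p : R) := exists c : G -> R, p = \sum_t c t * gpol f y t.

Lemma Igen_ideal f y : ideal (Igen f y).
Proof.
split=> [|p q [a ->] [b ->]|a p [b ->]].
- by exists (fun=> 0); rewrite big1 // => t _; rewrite mul0r.
- by exists (fun t => a t + b t); rewrite -big_split /=; apply: eq_bigr => t _; rewrite mulrDl.
by exists (fun t => a * b t); rewrite mulr_sumr; apply: eq_bigr => t _; rewrite mulrA.
Qed.

Lemma Igen_mem f y t : Igen f y (gpol f y t).
Proof.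
exists (fun t' => (t' == t)%:R); rewrite (bigD1 t) //= eqxx mul1r big1 ?addr0 // => t' /negPf ->.
by rewrite mul0r.
Qed.

Variables (i1 : 'I_N) (f0 : polymap F n) (x0 : 'I_N -> F).
Hypotheses (mu0 : mu s0 = (U_(i1) *+ m)%MM) (m0 : (0 < m)%N) (fh0 : hom d f0).
Hypotheses (h0n : hJ f0 != 0) (x01 : x0 i1 = 1) (hx0 : (hJ f0).@[x0] = 0).
Hypothesis Hla : forall la : R -> F,
  (forall c p q, la (c *: p + q) = c * la p + la q) ->
  (forall p, Igen f0 (fun i => (fmi f0 l i).@[x0]) p -> la p = 0) ->
  (forall j, la ('X_i1 ^+ j) = 0) -> forall k : 'X_{1..N}, mdeg k = m -> la 'X_[k] = 0.

(** A vector in the left kernel is a functional on forms of degree [m] that kills the ideal and the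
    power of [x_i1]; [Hla] says it is zero. *)
Lemma witness_free : row_free (\matrix_(s < #|{: S}|, t < #|{: option (G * 'X_{1..N < m.+1})}|)
  (entu f0 (enum_val t) s).@[x0]).
Proof.
pose y := fun i => (fmi f0 l i).@[x0].
apply: inj_row_free => v vL.
have col t : \sum_s v 0 s * (entu f0 t s).@[x0] = 0.
  have := congr1 (fun M : 'rV_ _ => M 0 (enum_rank t)) vL; rewrite !mxE => E; rewrite -[RHS]E.
  by apply: eq_bigr => s _; rewrite mxE enum_rankK.
pose la (p : R) := \sum_s v 0 s * p@_(mu s).
have lin c p q : la (c *: p + q) = c * la p + la q.
  rewrite /la mulr_sumr -big_split /=; apply: eq_bigr => s _.
  by rewrite mcoeffD mcoeffZ; ring.
have laX k : la 'X_[mu k] = v 0 k.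
  rewrite /la (bigD1 k) //= mcoeffX eqxx mulr1 big1 ?addr0 // => s sk.
  by rewrite mcoeffX (inj_eq mu_inj) eq_sym (negPf sk) mulr0.
have v0 : v 0 s0 = 0.
  have := col None; rewrite (bigD1 s0) //= big1 => [|s ss]; last first.
    by rewrite /entu /= (negPf ss) cmp0 meval0 mulr0.
  by rewrite /entu /= eqxx cmp1 meval1 mulr1 addr0.
apply/rowP => s; rewrite mxE -laX; apply: Hla => //; last exact: mu_deg.
- have la0 : la 0 = 0 by rewrite /la big1 // => s' _; rewrite mcoeff0 mulr0.
  have laD p q : la (p + q) = la p + la q by have := lin 1 p q; rewrite scale1r mul1r.
  have laZ c p : la (c *: p) = c * la p by have := lin c p 0; rewrite !addr0 la0 addr0.
  have la_sum (T : Type) (q : seq T) (P : pred T) (E : T -> R) :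
      (forall i, P i -> la (E i) = 0) -> la (\sum_(i <- q | P i) E i) = 0.
    by move=> H; elim/big_rec: _ => // i z Pi lz; rewrite laD H // lz addr0.
  move=> p [c ->]; apply: (la_sum) => t _; rewrite [c t]mpolyE mulr_suml.
  apply: (la_sum) => nu _; rewrite -scalerAl laZ mulrC.
  suff -> : la ('X_[nu] * gpol f0 y t) = 0 by rewrite mul0r.
  rewrite mulrC; have [le|lt] := leqP (mdeg nu) m.
    have lt : (mdeg nu < m.+1)%N by [].
    rewrite -[RHS](col (Some (t, BMultinom lt))); apply: eq_bigr => s' _.
    by rewrite meval_cmp ent_eval.
  rewrite /la big1 // => s' _; have [w gw] := gpol_homog y t fh0.
  have gX : gpol f0 y t * 'X_[nu] \is (w + mdeg nu).-homog by apply: dhomogM; rewrite ?dhomogX.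
  by rewrite (dhomog_nemf_coeff gX) ?mulr0 //= mu_deg; lia.
move=> j; rewrite mpolyXn; have [->|jm] := eqVneq j m; first by rewrite -mu0 laX.
rewrite /la big1 // => s' _; rewrite mcoeffX; case: eqP => [E|]; last by rewrite mulr0.
by case/eqP: jm; rewrite -(mu_deg s') -E mdegMn mdeg1 mul1n.
Qed.

(** The vector of monomials at [x0] kills every column except [None], so a nonzero maximal minor
    must use that column, and expansion along it leaves the cofactor at [s0]. *)
Lemma witness_cofactor : exists (sg : 'I_#|{: S}| -> option (G * 'X_{1..N < m.+1})) k0,
  (forall k, k != k0 -> sg k != None) /\
  (cmp (fmi f0 l) (cofactor (\matrix_(s, k) ent f0 (sg k) s) s0 k0)).@[x0] != 0.
Proof.
have [sg' D0] := row_free_minor witness_free; pose sg k := enum_val (sg' k).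
pose yy i := (fmi f0 l i).@[x0].
set P := (\matrix_(s, k) ent f0 (sg k) s : 'M[R]_#|{: S}|).
have PE : \det (map_mx (meval yy) P) != 0.
  rewrite (_ : map_mx _ P = \matrix_(i, j) (\matrix_(s < #|{: S}|, t < #|{: option (G * 'X_{1..N < m.+1})}|)
    (entu f0 (enum_val t) s).@[x0]) i (sg' j)) //.
  by apply/matrixP => i j; rewrite !mxE /entu meval_cmp.
have [k0 k0E] : exists k0, sg k0 = None.
  apply: NNPP => /not_ex_all_not nN; case/eqP: PE; apply/eqP/det0P.
  exists (\row_s ('X_[mu s] : R).@[x0]).
    apply/eqP => /rowP /(_ s0); rewrite !mxE mu0 mevalX.
    rewrite (bigD1 i1) //= x01 expr1n mul1r big1 => [/eqP|i ii]; first by rewrite oner_eq0.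
    by rewrite mulmnE mnm1E eq_sym (negPf ii) mul0n expr0.
  apply/rowP => k; rewrite [RHS]mxE mxE; case E: (sg k) => [[t nu]|]; last by case: (nN k).
  rewrite -[RHS](entu_null t nu fh0 hx0); apply: eq_bigr => s _.
  by rewrite !mxE /entu meval_cmp E.
exists sg, k0; split=> [k kk|].
  apply/eqP => kN; case/eqP: PE; rewrite -det_tr; apply: (determinant_alternate kk) => s.
  by rewrite !mxE kN k0E.
have CE : (cmp (fmi f0 l) (cofactor P s0 k0)).@[x0] = cofactor (map_mx (meval yy) P) s0 k0.
  exact: etrans (meval_cmp _ _ _) (meval_cofactor _ _ _ _).
rewrite CE; apply: contraNneq PE => c0.
rewrite (expand_det_col _ k0); apply/eqP; apply: big1 => s _.
rewrite !mxE k0E /ent; have [->|_] := eqVneq s s0; first by rewrite c0 mulr0.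
by rewrite meval0 mul0r.
Qed.

(** On the critical locus the cofactors of column [None] are proportional to the monomials of degree
    [m]; those at [x_i1 ^ (m - 1) * x_k] are the required [A k]. *)
Lemma gen_recovers : (1 < N * d.-1)%N ->
  gen d (fun f : polymap F n => prime_elt (hJ f) -> recovers (hJ f) (fmi f l)).
Proof.
move=> e1; have [sg [k0 [sgN c0]]] := witness_cofactor.
pose M f := (\matrix_(s, k) ent f (sg k) s : 'M[R]_#|{: S}|).
pose W f := cmp (fmi f l) (cofactor (M f) s0 k0).
have pW : pfam d W.
  apply: pfam_cofactor => a b; apply: pfp_ext (pfam_entu (sg b) a) => f _.
  by rewrite /M mxE.
have nd : ~ dvdR (hJ f0) (W f0).
  by case=> c E; case/eqP: c0; rewrite -/(M f0) -/(W f0) E mevalM hx0 mulr0.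
apply: gen_imp (gen_ndvd (@hJ_homog F n d) (@pfam_hJ F n d) pW fh0 h0n nd) => f fh ndf hp.
have hh := hJ_homog fh.
have rel : forall s t, eqm (hJ f) (cmp (fmi f l) (cofactor (M f) s k0) * 'X_[mu t])
    (cmp (fmi f l) (cofactor (M f) t k0) * 'X_[mu s]).
  apply: (cofactor_relation (be := fun s => 'X_[mu s]) hp) => x hx k kk.
  have := sgN k kk; case E: (sg k) => [[t nu]|//] _.
  by rewrite -[RHS](entu_null t nu fh hx); apply: eq_bigr => s _; rewrite /M mxE E.
have {ndf} := ndf; rewrite /W; move: (cofactor (M f)) rel => cf rel ndf.
move: (hJ f) (fmi f l) hp hh rel ndf => h u hp hh rel ndf.
have kX k : exists s, mu s = (U_(i1) *+ m.-1 + U_(k))%MM.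
  by apply: mu_ex; rewrite mdegD mdegMn !mdeg1 mul1n addn1 prednK.
have /fin_all_exists[ix ixE] := kX.
have ix1 : ix i1 = s0.
  apply: mu_inj; rewrite ixE mu0; apply/mnmP => i; rewrite mnmDE !mulmnE mnm1E.
  by case: (i1 == i); rewrite ?mul1n ?mul0n // addn1 prednK.
have nX k : ~ dvdR h 'X_k by apply: ndvd_var hh e1.
have rel2 j k : eqm h (cmp u (cf (ix k) k0) * 'X_j) (cmp u (cf (ix j) k0) * 'X_k).
  apply: (@eqm_cancel _ h ('X_i1 ^+ m.-1)) => //; first by move/(prime_exp hp)/nX.
  have := rel (ix k) (ix j); rewrite !ixE !mpolyXD -!mpolyXn.
  by rewrite ![cmp u _ * (_ * _)]mulrCA.
exists (fun k => cf (ix k) k0); split=> // k dv.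
have := rel2 k i1; rewrite ix1 => E; apply: ndf.
have [_ _ /(_ (cmp u (cf s0 k0)) 'X_k) [|//|/nX//]] := hp.
by have := dvdR_add E (dvdR_mulr 'X_i1 dv); rewrite subrK.
Qed.

End MacaulayMatrix.

Lemma Xn_homog (F : fieldType) n (i : 'I_n) k : ('X_i ^+ k : {mpoly F[n]}) \is k.-homog.
Proof. by rewrite mpolyXn dhomogX /= mdegMn mdeg1 mul1n. Qed.

Lemma mderiv_Xn (F : fieldType) n (i j : 'I_n) k :
  mderiv j ('X_i ^+ k : {mpoly F[n]}) = (k%:R * (i == j)%:R) *: 'X_i ^+ k.-1.
Proof.
elim: k => [|k IH]; first by rewrite expr0 -mpolyC1 mderivC mul0r scale0r.
rewrite exprS mderivM IH derX mul_mpolyC -scalerAr.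
case: k IH => [|k] _ /=; first by rewrite mul0r scale0r addr0 mul1r.
by rewrite -exprS -scalerDl -[k.+2%:R]natr1; congr (_ *: _); ring.
Qed.

(** * The perturbed power map and the choice of its linear form *)

Section Witness.
Variables (F : closedFieldType) (charF0 : [pchar F] =i pred0) (n d : nat).
Local Notation N := n.+1.
Local Notation R := {mpoly F[n.+1]}.
Hypotheses (d3 : (2 < d)%N) (n0 : (0 < n)%N).
Local Notation i0 := (ord0 : 'I_N).
Local Notation i1 := (ord_max : 'I_N).
(** With this constant the derivative of component [i0] of [wit] along [x_i0] is
    [d * x_i0 ^ (d - 2) * (x_i0 - L)], so the hyperplane [x_i0 = L] is a reduced component of the
    critical locus. *)
Let kp : F := d%:R / (d.-1)%:R.

Lemma dn0 : d%:R != 0 :> F. Proof. by apply: natr_neq0 => //; lia. Qed.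
Lemma dp0 : (d.-1)%:R != 0 :> F. Proof. by apply: natr_neq0 => //; lia. Qed.
Lemma kp1 : 1 - kp != 0.
Proof.
apply/eqP => /eqP; rewrite subr_eq0 => /eqP E.
have : kp * (d.-1)%:R = d%:R by rewrite /kp divfK // dp0.
have dE : d%:R = (d.-1)%:R + 1 :> F by rewrite natr1 prednK //; lia.
rewrite -E mul1r dE => /eqP; rewrite -subr_eq0 opprD addrA subrr add0r oppr_eq0.
by rewrite oner_eq0.
Qed.
Lemma i10 : i1 != i0. Proof. by rewrite -val_eqE /= -lt0n. Qed.

Definition Lz (a z : 'I_N -> F) := \sum_(i | i != i0) a i * z i.
(** Coordinate [i0] of the [k]-th iterate of [wit] at the point with coordinate [w] at [i0] and [z]
    elsewhere. *)
Fixpoint phs (a : 'I_N -> F) (w : F) (z : 'I_N -> F) k : F :=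
  if k is k'.+1 then let p := phs a w z k' in
    p ^+ d.-1 * (p - kp * Lz a (fun i => z i ^+ (d ^ k'))) else w.

Lemma Lz_ext a z z' : (forall i, i != i0 -> z i = z' i) -> Lz a z = Lz a z'.
Proof. by move=> E; apply: eq_bigr => i ii; rewrite E. Qed.

Lemma phs_ext a w z z' k : (forall i, i != i0 -> z i = z' i) -> phs a w z k = phs a w z' k.
Proof.
move=> E; elim: k => //= k ->; congr (_ * (_ - _ * _)); apply: Lz_ext => i ii.
by rewrite E.
Qed.

Lemma phs0 a z k : phs a 0 z k = 0.
Proof.
elim: k => //= k ->; have -> : d.-1 = d.-2.+1 by lia.
by rewrite exprS !mul0r.
Qed.

Section Given.
Variable a : 'I_N -> F.
Let L : R := \sum_(i | i != i0) a i *: 'X_i.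
Definition wit : polymap F n := fun i =>
  if i == i0 then 'X_i0 ^+ d - kp *: ('X_i0 ^+ d.-1 * L) else 'X_i ^+ d.

Lemma L_homog : L \is 1.-homog.
Proof. by apply: rpred_sum => i _; apply: dhomogZ; rewrite dhomogX /= mdeg1. Qed.

Lemma L_eval z : L.@[z] = Lz a z.
Proof. by rewrite /L (rmorph_sum (meval z)) /=; apply: eq_bigr => i _; rewrite mevalZ mevalXU. Qed.

Lemma wit_hom : hom d wit.
Proof.
move=> i; rewrite /wit; case: ifP => _; last exact: Xn_homog.
apply: rpredB; first exact: Xn_homog.
apply: dhomogZ; suff : 'X_i0 ^+ d.-1 * L \is (d.-1 + 1).-homog.
  by rewrite addn1 prednK //; lia.
by apply: dhomogM; [apply: Xn_homog|apply: L_homog].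
Qed.

Lemma L_der : mderiv i0 L = 0.
Proof.
rewrite /L (raddf_sum (mderiv i0)) /=; apply: big1 => i ii.
by rewrite mderivZ derX (negPf ii) mpolyC0 scaler0.
Qed.

Lemma hJ_wit : hJ wit = (d%:R ^+ N) *:
  ('X_i0 ^+ d.-2 * ('X_i0 - L) * \prod_(i | i != i0) 'X_i ^+ d.-1).
Proof.
rewrite /hJ -det_tr det_trig; last first.
  apply/is_trig_mxP => i j ij; rewrite !mxE /wit; have j0 : j != i0.
    by rewrite -val_eqE /= -lt0n; apply: leq_ltn_trans ij.
  by rewrite (negPf j0) mderiv_Xn -val_eqE /= gtn_eqF // mulr0 scale0r.
have E0 : (jmat wit)^T i0 i0 = d%:R *: ('X_i0 ^+ d.-2 * ('X_i0 - L)).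
  rewrite !mxE /wit eqxx mderivB mderivZ mderivM L_der mulr0 addr0 !mderiv_Xn eqxx !mulr1.
  rewrite -scalerAl scalerA /kp divfK ?dp0 // -scalerBr; congr (_ *: _).
  by rewrite mulrBr -exprSr; have -> : (d.-2).+1 = d.-1 by lia.
have Ei i : i != i0 -> (jmat wit)^T i i = d%:R *: 'X_i ^+ d.-1.
  by move=> ii; rewrite !mxE /wit (negPf ii) mderiv_Xn eqxx mulr1.
rewrite (bigD1 i0) //= E0 (eq_bigr _ Ei) scaler_prod prodr_const.
rewrite (_ : #|_| = n); last by rewrite cardC1 card_ord.
by rewrite -scalerAl -scalerAr scalerA -exprS.
Qed.

Lemma fmi_wit k i : i != i0 -> fmi wit k i = 'X_i ^+ (d ^ k).
Proof.
move=> ii; elim: k => [|k IH]; first by rewrite /= expn0 expr1.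
by rewrite /= IH cmpXn cmpX /wit (negPf ii) -exprM expnS.
Qed.

Lemma fmap_wit z : fmap wit z i0 = z i0 ^+ d.-1 * (z i0 - kp * Lz a z) /\
  forall i, i != i0 -> fmap wit z i = z i ^+ d.
Proof.
split=> [|i ii]; rewrite /fmap /wit ?eqxx ?(negPf ii).
  rewrite mevalB mevalZ mevalM L_eval !(rmorphXn (meval z)) /= mevalXU mulrBr -exprSr.
  by rewrite prednK; [ring|lia].
by rewrite (rmorphXn (meval z)) /= mevalXU.
Qed.

Lemma iter_wit z k : iter k (fmap wit) z i0 = phs a (z i0) z k /\
  forall i, i != i0 -> iter k (fmap wit) z i = z i ^+ (d ^ k).
Proof.
elim: k => [|k [IH0 IH]]; first by split=> // i _; rewrite /= expn0 expr1.
have [E0 E] := fmap_wit (iter k (fmap wit) z); split=> [|i ii].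
  by rewrite iterS E0 IH0 /=; congr (_ * (_ - _ * _)); apply: Lz_ext.
by rewrite iterS E // IH // -exprM expnSr.
Qed.

Variable l : nat.
Let de := (d ^ l)%N.
Let one : 'I_N -> F := fun=> 1.
(** Coordinate [i0] of the image of [x0], the point of the hyperplane [x_i0 = L] whose other
    coordinates are [1]. [Ca] keeps this image away from that of [x_i0 = 0], and [Cb] separates [x0]
    from the other points of the hyperplane whose coordinates are roots of unity. *)
Let Y0 := phs a (Lz a one) one l.
Hypothesis Ca : Y0 != 0.
Hypothesis Cb : forall z : 'I_N -> F, z i1 = 1 -> (forall i, i != i0 -> z i ^+ de = 1) ->
  phs a (Lz a z) z l = Y0 -> forall i, i != i0 -> z i = 1.
Let x0 : 'I_N -> F := fun i => if i == i0 then Lz a one else 1.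
Let y i := (fmi wit l i).@[x0].
Let I := Igen l wit y.

Lemma x0E i : i != i0 -> x0 i = 1. Proof. by rewrite /x0 => /negPf ->. Qed.
Lemma L1_neq0 : Lz a one != 0.
Proof. by apply: contraNneq Ca => E; rewrite /Y0 E phs0. Qed.
Lemma yi i : i != i0 -> y i = 1.
Proof. by move=> ii; rewrite /y fmi_wit // (rmorphXn (meval x0)) /= mevalXU x0E // expr1n. Qed.
Lemma y0E : y i0 = Y0.
Proof.
rewrite /y fmi_eval (iter_wit x0 l).1 /x0 eqxx; apply: phs_ext => i ii.
by rewrite (negPf ii).
Qed.
Lemma de_gt0 : (0 < de)%N. Proof. by rewrite expn_gt0; apply/orP; left; lia. Qed.

Lemma I_pair i j : I (y j *: fmi wit l i - y i *: fmi wit l j).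
Proof. exact: (@Igen_mem F n l wit y (Some (i, j))). Qed.

Lemma I_G i : i != i0 -> I ('X_i ^+ de - 'X_i1 ^+ de).
Proof.
move=> ii; have := I_pair i i1; rewrite !yi ?i10 // !scale1r !fmi_wit //; exact: i10.
Qed.

Lemma I_h : I ('X_i0 ^+ d.-2 * ('X_i0 - L) * \prod_(i | i != i0) 'X_i ^+ d.-1).
Proof.
have := @Igen_mem F n l wit y None; rewrite /= hJ_wit.
by apply: (idealZK (Igen_ideal l wit y)); rewrite expf_neq0 // dn0.
Qed.

Lemma I_u : I (fmi wit l i0 - Y0 *: 'X_i1 ^+ de).
Proof. by have := I_pair i0 i1; rewrite yi ?i10 // y0E scale1r (fmi_wit _ i10). Qed.

Lemma wit_zero_uniq z : z i1 = 1 -> (forall p w, I p -> p \is w.-homog -> p.@[z] = 0) -> z =1 x0.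
Proof.
move=> z1 H; have zd i : i != i0 -> z i ^+ de = 1.
  move=> ii; have h1 : ('X_i ^+ de - 'X_i1 ^+ de : R) \is de.-homog by apply: rpredB; apply: Xn_homog.
  have := H _ _ (I_G ii) h1; rewrite mevalB !(rmorphXn (meval z)) /= !mevalXU z1 expr1n.
  by move/eqP; rewrite subr_eq0 => /eqP.
have hz : (hJ wit).@[z] = 0.
  by apply: (H _ _ (@Igen_mem F n l wit y None) (hJ_homog wit_hom)).
have uz : (fmi wit l i0).@[z] = Y0.
  have h1 : fmi wit l i0 - Y0 *: 'X_i1 ^+ de \is de.-homog.
    by apply: rpredB; [apply: fmi_homog wit_hom|apply: dhomogZ; apply: Xn_homog].
  have := H _ _ I_u h1; rewrite mevalB mevalZ !(rmorphXn (meval z)) /= !mevalXU z1 expr1n mulr1.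
  by move/eqP; rewrite subr_eq0 => /eqP.
rewrite fmi_eval (iter_wit z l).1 in uz.
have z0 : z i0 = Lz a z.
  move: hz; rewrite hJ_wit mevalZ !mevalM mevalB mevalXU L_eval (rmorphXn (meval z)) /= mevalXU.
  rewrite (rmorph_prod (meval z)) /= => /eqP; rewrite !mulf_eq0 expf_eq0 (negPf dn0) andbF /=.
  case/orP=> [/orP[]|].
  - rewrite expf_eq0 => /andP[_ /eqP z00]; case/eqP: Ca.
    by rewrite -uz z00 phs0.
  - by rewrite subr_eq0 => /eqP.
  case/prodf_eq0 => i ii; rewrite (rmorphXn (meval z)) /= mevalXU expf_eq0 => /andP[_ /eqP zi].
  have := zd i ii; rewrite zi expr0n eqn0Ngt de_gt0 /= => /eqP.
  by rewrite eq_sym oner_eq0.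
rewrite z0 in uz; have zi := Cb z1 zd uz.
move=> i; rewrite /x0; case: eqP => [->|/eqP ii]; last exact: zi.
by rewrite z0; apply: Lz_ext.
Qed.

(** Each equation is a linear form times a cofactor that is nonzero at [x0]; for
    [x_j ^ de - x_i1 ^ de] the cofactor takes the value [de]. By [local_gen] the linear forms
    themselves lie in the ideal near [x0]. *)
Lemma wit_local i : exists k, I ('X_i1 ^+ k * ('X_i - x0 i *: 'X_i1)).
Proof.
have iI : ideal I by apply: Igen_ideal.
have lg := local_gen iI i10 de_gt0 I_G I_h wit_zero_uniq.
have iJ := ideal_localize iI ('X_i1 : R).
have G1 j : j != i0 -> exists k, I ('X_i1 ^+ k * ('X_j - 1 *: 'X_i1)).
  move=> jj; pose w : R := \sum_(k < de) 'X_j ^+ (de.-1 - k) * 'X_i1 ^+ k.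
  rewrite scale1r; apply: (lg _ w de.-1).
  - by have := I_G jj; rewrite subrXX.
  - apply: rpred_sum => k _; have -> : de.-1 = (de.-1 - k + k)%N.
      by rewrite subnK //; have := ltn_ord k; have := de_gt0; lia.
    by rewrite addnK; apply: dhomogM; apply: Xn_homog.
  rewrite (rmorph_sum (meval x0)) /=; under eq_bigr do rewrite mevalM !(rmorphXn (meval x0)) /= !mevalXU !x0E ?i10 // !expr1n mulr1.
  by rewrite sumr_const card_ord; apply: natr_neq0 => //; apply: de_gt0.
have [ii|ii] := eqVneq i i0; last by rewrite x0E //; apply: G1.
have GL : exists k, I ('X_i1 ^+ k * ('X_i0 - L)).
  apply: (lg _ ('X_i0 ^+ d.-2 * \prod_(i | i != i0) 'X_i ^+ d.-1) (d.-2 + \sum_(i | i != i0) d.-1)%N).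
  - by have := I_h; rewrite mulrA [('X_i0 - L) * _]mulrC.
  - apply: dhomogM; first exact: Xn_homog.
    by apply: homog_prod => j _; apply: Xn_homog.
  rewrite mevalM (rmorphXn (meval x0)) (rmorph_prod (meval x0)) /= mevalXU mulf_neq0 //.
    by rewrite expf_neq0 // /x0 eqxx L1_neq0.
  apply/prodf_neq0 => j jj; rewrite (rmorphXn (meval x0)) /= mevalXU x0E // expr1n oner_eq0 //.
rewrite ii /x0 eqxx.
have -> : 'X_i0 - Lz a one *: 'X_i1 = ('X_i0 - L) + \sum_(j | j != i0) a j *: ('X_j - 1 *: 'X_i1).
  under eq_bigr do rewrite scalerBr scale1r.
  rewrite sumrB -/L -scaler_suml addrA subrK /Lz; congr (_ - _ *: _).
  by apply: eq_bigr => j _; rewrite mulr1.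
apply: (idealD iJ) => //; apply: (ideal_sum iJ) => j jj.
by apply: (idealZ iJ); apply: G1.
Qed.

Lemma wit_axis : (fmi wit l i0)@_(U_(i0) *+ de) = 1.
Proof.
rewrite -(eval_axis i0 (fmi_homog l i0 wit_hom)) fmi_eval.
set e0 := fun j => _; have Lk k : Lz a (fun i => e0 i ^+ (d ^ k)) = 0.
  rewrite /Lz big1 // => i ii; rewrite /e0 (negPf ii) expr0n.
  by rewrite expn_eq0; case: (d) d3 => //= d' _; rewrite mulr0.
rewrite (iter_wit e0 l).1 (_ : e0 i0 = 1); last by rewrite /e0 eqxx.
by elim: (l) => //= k ->; rewrite Lk mulr0 subr0 expr1n mulr1.
Qed.

Lemma gen_recovers_wit : (1 < N * d.-1)%N ->
  gen d (fun f : polymap F n => prime_elt (hJ f) -> recovers (hJ f) (fmi f l)).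
Proof.
move=> e1; have iI : ideal I by apply: Igen_ideal.
have [m m0 Hla] := macaulay_functional iI de_gt0 I_G wit_local (fmi_homog l i0 wit_hom) wit_axis I_u.
have [|s0 s0E] := @mu_ex n m (U_(i1) *+ m)%MM; first by rewrite mdegMn mdeg1 mul1n.
apply: (@gen_recovers F n d l m s0 i1 wit x0) => //.
- exact: wit_hom.
- rewrite hJ_wit scaler_eq0 expf_eq0 (negPf dn0) andbF /= !mulf_neq0 //.
  + by rewrite expf_neq0 //; apply/eqP => /(congr1 (mcoeff U_(i0))) /eqP; rewrite mcoeffX eqxx mcoeff0 oner_eq0.
  + apply/eqP => /(congr1 (meval (fun i => (i == i0)%:R))) /eqP; rewrite mevalB mevalXU L_eval meval0 eqxx.
    by rewrite /Lz big1 ?subr0 ?oner_eq0 // => i /negPf ->; rewrite mulr0.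
  apply/prodf_neq0 => i _; rewrite expf_neq0 //.
  by apply/eqP => /(congr1 (mcoeff U_(i))) /eqP; rewrite mcoeffX eqxx mcoeff0 oner_eq0.
- by rewrite x0E // i10.
rewrite hJ_wit mevalZ !mevalM mevalB mevalXU L_eval [x0 i0]/x0 eqxx (Lz_ext _ x0E) subrr.
by rewrite mulr0 mul0r mulr0.
Qed.

End Given.

Section Choice.
(** [phs] on the hyperplane, for fixed [z], as a polynomial in the coefficients [a] of the linear
    form; [pt] restricts it to a line through the origin. *)
Fixpoint PP (z : 'I_N -> F) k : R :=
  if k is k'.+1 then PP z k' ^+ d.-1 *
    (PP z k' - kp *: \sum_(i | i != i0) (z i ^+ (d ^ k')) *: 'X_i)
  else \sum_(i | i != i0) z i *: 'X_i.

Lemma sum_eval (z a : 'I_N -> F) : (\sum_(i | i != i0) z i *: 'X_i : R).@[a] = Lz a z.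
Proof. by rewrite (rmorph_sum (meval a)) /=; apply: eq_bigr => i _; rewrite mevalZ mevalXU mulrC. Qed.

Lemma PP_eval z k a : (PP z k).@[a] = phs a (Lz a z) z k.
Proof.
elim: k => [|k IH] /=; first exact: sum_eval.
by rewrite mevalM (rmorphXn (meval a)) mevalB mevalZ /= IH sum_eval.
Qed.

Variables (b z : 'I_N -> F).
Hypothesis bz : Lz b z != 0.
Fixpoint pt k : {poly F} := if k is k'.+1 then
  pt k' ^+ d.-1 * (pt k' - (kp * Lz b (fun i => z i ^+ (d ^ k'))) *: 'X) else Lz b z *: 'X.

Lemma Lz_scale t z' : Lz (fun i => t * b i) z' = t * Lz b z'.
Proof. by rewrite /Lz mulr_sumr; apply: eq_bigr => i _; rewrite mulrA. Qed.

Lemma pt_eval t k : (pt k).[t] = phs (fun i => t * b i) (Lz (fun i => t * b i) z) z k.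
Proof.
elim: k => [|k IH] /=; first by rewrite hornerZ hornerX Lz_scale mulrC.
rewrite hornerM horner_exp hornerD hornerN hornerZ hornerX IH; congr (_ * (_ - _)).
by rewrite Lz_scale; ring.
Qed.

(** The top term survives the first step because [kp] is not [1]; afterwards the correction is
    linear, hence of lower degree. *)
Lemma pt_size k : (2 < size (pt k.+1))%N.
Proof.
elim: k => [|k IH].
  rewrite /= (@Lz_ext _ _ z) => [|i _]; last by rewrite expn0 expr1.
  rewrite -scalerBl exprZn -scalerAl -scalerAr scalerA -exprSr prednK; last lia.
  rewrite size_scale; first by rewrite size_polyXn; lia.
  rewrite mulf_neq0 ?expf_neq0 //.
  by rewrite -{1}[Lz b z]mul1r -mulrBl mulf_neq0 // kp1.
have -> : pt k.+2 = pt k.+1 ^+ d.-1 *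
  (pt k.+1 - (kp * Lz b (fun i => z i ^+ (d ^ k.+1))) *: 'X) by [].
move: (pt k.+1) (kp * Lz b _) IH => q c sq.
have sz : size (q - c *: 'X) = size q.
  rewrite size_polyDl // size_polyN; apply: leq_ltn_trans sq.
  by apply: leq_trans (size_scale_leq _ _) _; rewrite size_polyX.
have q0 : q != 0 by rewrite -size_poly_gt0; lia.
have q1 : q - c *: 'X != 0 by rewrite -size_poly_gt0 sz; lia.
have qd : q ^+ d.-1 != 0 by rewrite expf_neq0.
rewrite size_mul // sz; have : (0 < size (q ^+ d.-1))%N by rewrite size_poly_gt0.
by move: (size (q ^+ d.-1)) => x; lia.
Qed.

Lemma phs_nonzero k : (0 < k)%N -> exists a t, a = (fun i => t * b i) /\ phs a (Lz a z) z k != 0.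
Proof.
case: k => // k _; have p0 : pt k.+1 != 0 by rewrite -size_poly_gt0; have := pt_size k; lia.
by have [t tE] := poly_nonroot p0; exists (fun i => t * b i), t; split=> //; rewrite -pt_eval.
Qed.

End Choice.

(** Only finitely many tuples of roots of unity have to be avoided, and each imposes one nonzero
    polynomial condition on [a]. *)
Lemma choose_coeffs l : (0 < l)%N -> exists a : 'I_N -> F,
  phs a (Lz a (fun=> 1)) (fun=> 1) l != 0 /\
  forall z : 'I_N -> F, z i1 = 1 -> (forall i, i != i0 -> z i ^+ (d ^ l) = 1) ->
  phs a (Lz a z) z l = phs a (Lz a (fun=> 1)) (fun=> 1) l -> forall i, i != i0 -> z i = 1.
Proof.
move=> l0; pose de := (d ^ l)%N; have de0 : (0 < de)%N by rewrite expn_gt0; apply/orP; left; lia.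
have [rs rsE] := closed_field_poly_normal ('X^de - 1 : {poly F}).
have monic1 : ('X^de - 1 : {poly F}) \is monic by apply: monicXnsubC.
rewrite (monicP monic1) scale1r in rsE.
have rsP x : x ^+ de = 1 -> x \in rs.
  by move=> xE; rewrite -root_prod_XsubC -rsE; apply/rootP; rewrite !hornerE ?hornerXn xE subrr.
pose T := {ffun 'I_N -> 'I_(size rs)}; pose zt (t : T) i := rs`_(t i).
pose bad (t : T) := (zt t i1 == 1) && [exists i, (i != i0) && (zt t i != 1)].
pose Q (t : T) : R := if bad t then PP (zt t) l - PP (fun=> 1) l else 1.
have P1 : PP (fun=> 1) l != 0.
  have bz : Lz (fun i => (i == i1)%:R) (fun=> 1) != 0.
    rewrite /Lz (bigD1 i1) ?i10 //= eqxx mulr1 big1 ?addr0 ?oner_eq0 // => i /andP[_ /negPf ->].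
    by rewrite mul0r.
  have [a [t [_ aE]]] := phs_nonzero bz l0.
  by apply: contraNneq aE => E; rewrite -PP_eval E meval0.
have Q0 t : Q t != 0.
  rewrite /Q; case: (boolP (bad t)) => [/andP[/eqP z1 /existsP[j /andP[j0 zj]]]|_]; last exact: oner_neq0.
  have j1 : j != i1 by apply: contraNneq zj => ->; rewrite z1.
  (* This direction annihilates the constant tuple [1] but not the tuple of [t], so along it the
     second [PP] vanishes while the first does not. *)
  pose b i : F := (i == j)%:R - (i == i1)%:R.
  have bE z : Lz b z = z j - z i1.
    rewrite /Lz /b; under eq_bigr do rewrite mulrBl.
    rewrite sumrB (bigD1 j) //= eqxx mul1r big1 ?addr0 => [|i /andP[_ /negPf ->]]; last by rewrite mul0r.
    rewrite (bigD1 i1) ?i10 //= eqxx mul1r big1 ?addr0 // => i /andP[_ /negPf ->].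
    by rewrite mul0r.
  have bz : Lz b (zt t) != 0 by rewrite bE z1 subr_eq0.
  have [a [s [aE an]]] := phs_nonzero bz l0.
  apply: contraNneq an => /(congr1 (meval a)); rewrite mevalB !PP_eval meval0.
  have -> : Lz a (fun=> 1) = 0 by rewrite aE Lz_scale bE subrr mulr0.
  by rewrite phs0 subr0 => ->.
have : PP (fun=> 1) l * \prod_t Q t != 0 by rewrite mulf_neq0 //; apply/prodf_neq0 => t _.
move=> /mpoly_nonroot[a]; rewrite mevalM PP_eval mulf_eq0 negb_or => /andP[a1].
rewrite (rmorph_prod (meval a)) /= => /prodf_neq0 aQ; exists a; split=> // z z1 zd zE i ii.
have inx j : (index (if j == i0 then 1%R else z j) rs < size rs)%N.
  by rewrite index_mem; apply: rsP; case: eqP => [_|/eqP jj]; [rewrite expr1n|apply: zd].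
pose t : T := [ffun j => Ordinal (inx j)].
have tE j : j != i0 -> zt t j = z j.
  by move=> jj; rewrite /zt ffunE /= (negPf jj) nth_index // rsP // zd.
have := aQ t isT; rewrite /Q; case: (boolP (bad t)) => [_|].
  rewrite mevalB !PP_eval (@Lz_ext _ _ z) // (@phs_ext _ _ _ z) // zE subrr eqxx //.
rewrite /bad tE ?i10 // z1 eqxx /= => /existsPn /(_ i); rewrite ii /= negbK tE // => /eqP //.
Qed.

Theorem gen_recovers_pos l : (0 < l)%N ->
  gen d (fun f : polymap F n => prime_elt (hJ f) -> recovers (hJ f) (fmi f l)).
Proof.
move=> l0; have [a [Ca Cb]] := choose_coeffs l0.
apply: (gen_recovers_wit Ca Cb); have -> : d.-1 = d.-2.+1 by lia.
by rewrite mulnS; lia.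
Qed.

End Witness.

(** * Generic absence of singular critical points on a coordinate plane *)

Section Plane.
Variables (F : closedFieldType) (charF0 : [pchar F] =i pred0) (n d : nat).
Local Notation N := n.+1.
Local Notation R := {mpoly F[n.+1]}.
Local Notation Tm := {m : 'X_{1..n.+1 < d.+1} | mdeg m == d}.
Hypothesis d2 : (1 < d)%N.
Variables (sp : 'I_3 -> 'I_N).
Hypothesis sp_inj : injective sp.

Lemma plane_hJ0 f (x : 'I_N -> F) : hom d f -> (forall i, i \notin codom sp -> x i = 0) ->
  (forall b, (mderiv (sp b) (hJ f)).@[x] = 0) -> (hJ f).@[x] = 0.
Proof.
move=> fh xs dh; have := euler_homog x (hJ_homog fh); rewrite big1 => [/esym /eqP|i _].
  rewrite mulf_eq0 => /orP[/eqP E|/eqP //]; exfalso.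
  have e0 : (0 < N * d.-1)%N by rewrite muln_gt0 /=; lia.
  by have := natr_neq0 charF0 e0; rewrite E eqxx.
have [/codomP[b ->]|ni] := boolP (i \in codom sp); first by rewrite dh mulr0.
by rewrite xs // mul0r.
Qed.

(** A row of cofactors lies in the kernel of the Jacobian matrix. Were it a nonzero multiple of [x],
    Euler's identity would give [f(x) = 0], which [is_End] excludes. *)
Lemma cofactor_not_radial f (x : 'I_N -> F) r j : is_End d f -> (hJ f).@[x] = 0 ->
  (exists i, x i != 0) -> (cofp f r j).@[x] != 0 ->
  ~ exists k, forall j, (cofp f r j).@[x] = k * x j.
Proof.
move=> [fh fE] hx [i0 xi] cj [k kE].
have k0 : k != 0 by apply: contraNneq cj => k0; rewrite kE k0 mul0r.
have Jc i : \sum_j (mderiv j (f i)).@[x] * (cofp f r j).@[x] = 0.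
  have := congr1 (fun M : 'M[R]_N => (M i r).@[x]) (mul_mx_adj (jmat f)).
  rewrite !mxE (rmorph_sum (meval x)) /= -/(hJ f) => E.
  have E2 : (hJ f *+ (i == r)).@[x] = 0.
    by case: (i == r); rewrite ?mulr1n ?mulr0n ?meval0.
  rewrite -[RHS]E2 -[RHS]E; apply: eq_bigr => j' _.
  have -> : jmat f i j' = mderiv j' (f i) by rewrite mxE.
  have -> : (\adj (jmat f)) j' r = cofp f r j' by rewrite mxE.
  by rewrite [RHS]mevalM.
have f0 i : (f i).@[x] = 0.
  have := euler_homog x (fh i); have := Jc i.
  under eq_bigr do rewrite kE mulrCA.
  rewrite -mulr_sumr => /eqP; rewrite mulf_eq0 (negPf k0) /= => /eqP S0 E.
  have d0 : (0 < d)%N by lia.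
  have dn := natr_neq0 charF0 d0; apply: (mulfI dn); rewrite mulr0 -E -[RHS]S0.
  by apply: eq_bigr => j' _; rewrite mulrC.
by have := fE x f0 => xE; rewrite xE eqxx in xi.
Qed.

(** With a nonzero cofactor, [second_order_indep] makes the three functionals [Lam] independent on
    forms of degree [d]. Hence some triple of monomials gives a nonzero determinant, and
    [caseA_fixed] applies to each of the finitely many triples. *)
Lemma small_plane_corank1 : small d (fun f => exists (x : 'I_N -> F) al r j,
  [/\ is_End d f, x (sp al) = 1, (forall i, i \notin codom sp -> x i = 0),
      (forall b, (mderiv (sp b) (hJ f)).@[x] = 0) & (cofp f r j).@[x] != 0]).
Proof.
pose B (t : 'I_N * 'I_3 * {ffun 'I_3 -> Tm}) (f : polymap F n) := injective t.2 /\
  exists x : 'I_N -> F, [/\ hom d f, x (sp t.1.2) = 1, (forall i, i \notin codom sp -> x i = 0),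
   (forall b, (mderiv (sp b) (hJ f)).@[x] = 0) &
   \det (\matrix_(b, k) Lam (f, x) t.1.1 (sp b) 'X_[tmon (t.2 k)]) != 0].
apply: (@small_sub _ _ _ _ (fun f => exists t, B t f)); last first.
  apply: small_union => -[[r al] sg]; have [inj|ninj] := classic (injective sg); last first.
    by apply: small_sub (small0 _ _ _) => f [].
  by apply: small_sub (@caseA_fixed F n d sp r al sg inj) => f [_ [x H]]; exists x.
move=> f [x [al [r [j [fE xa xs dh cj]]]]]; have [fh _] := fE.
have hx := plane_hJ0 fh xs dh.
have xn : exists i, x i != 0 by exists (sp al); rewrite xa oner_eq0.
have cx := cofactor_not_radial fE hx xn cj.
pose L := \matrix_(b < 3, t < #|{: Tm}|) Lam (f, x) r (sp b) 'X_[tmon (enum_val t)].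
have Lf : row_free L.
  apply: inj_row_free => mu muL.
  have colE (m : Tm) : \sum_b mu 0 b * Lam (f, x) r (sp b) 'X_[tmon m] = 0.
    have := congr1 (fun M : 'rV_ _ => M 0 (enum_rank m)) muL; rewrite !mxE => E; rewrite -[RHS]E.
    by apply: eq_bigr => b _; rewrite mxE enum_rankK.
  have pE p : p \is d.-homog -> \sum_b mu 0 b * Lam (f, x) r (sp b) p = 0.
    move=> ph; under eq_bigr do rewrite (Lam_expand _ _ _ ph) mulr_sumr.
    rewrite exchange_big /=; apply: big1 => m _; under eq_bigr do rewrite mulrCA.
    by rewrite -mulr_sumr colE mulr0.
  pose v i := \sum_b mu 0 b * (sp b == i)%:R.
  have vL p : \sum_i v i * Lam (f, x) r i p = \sum_b mu 0 b * Lam (f, x) r (sp b) p.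
    rewrite /v; under eq_bigr do rewrite mulr_suml.
    rewrite exchange_big /=; apply: eq_bigr => b _; rewrite (bigD1 (sp b)) //= eqxx mulr1.
    by rewrite big1 ?addr0 // => i /negPf ib; rewrite eq_sym ib mulr0 mul0r.
  have v0 : forall i, v i = 0.
    apply: (@second_order_indep F charF0 N d d2 x v (fun j => (cofp f r j).@[x])
      (fun i j => (mderiv i (cofp f r j)).@[x]) (sp al) (n * d.-1)%N xa _ cx) => [j'|p ph].
      exact: euler_homog (cofp_homog r j' fh).
    by rewrite -[RHS](pE p ph) -vL.
  apply/rowP => b; rewrite mxE -[RHS](v0 (sp b)) /v (bigD1 b) //= eqxx mulr1 big1 ?addr0 // => b' bb.
  by rewrite (inj_eq sp_inj) (negPf bb) mulr0.
have [sg' D0] := row_free_minor Lf; pose sg : {ffun 'I_3 -> Tm} := [ffun k => enum_val (sg' k)].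
have DE : \det (\matrix_(b, k) Lam (f, x) r (sp b) 'X_[tmon (sg k)]) != 0.
  rewrite (_ : \matrix_(b, k) _ = \matrix_(i, j) L i (sg' j)) //.
  by apply/matrixP => b k; rewrite !mxE ffunE.
exists (r, al, sg); split; last by exists x.
move=> k k' kk; apply: NNPP => /eqP ne; case/eqP: DE; rewrite -det_tr.
by apply: (determinant_alternate ne) => b; rewrite !mxE kk.
Qed.

(** When all cofactors vanish, two rows of the Jacobian matrix depend on the others; this is the
    codimension that [caseB_fixed] counts. *)
Lemma small_plane_corank2 : (1 < n)%N -> small d (fun f => exists (x : 'I_N -> F) al,
  [/\ is_End d f, x (sp al) = 1, (forall i, i \notin codom sp -> x i = 0) &
      forall r j, (cofp f r j).@[x] = 0]).
Proof.
move=> n1; pose B (t : 'I_N * 'I_N * 'I_3) (f : polymap F n) := t.1.1 != t.1.2 /\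
  exists (x : 'I_N -> F) (la : bool -> 'I_N -> F),
   [/\ hom d f, x (sp t.2) = 1, (forall i, i \notin codom sp -> x i = 0) &
    forall b j, (mderiv j (f (if b then t.1.1 else t.1.2))).@[x] =
    \sum_(i | (i != t.1.1) && (i != t.1.2)) la b i * (mderiv j (f i)).@[x]].
apply: (@small_sub _ _ _ _ (fun f => exists t, B t f)); last first.
  apply: small_union => -[[r s] al]; have [rs|rs] := eqVneq r s.
    by apply: small_sub (small0 _ _ _) => f []; rewrite /= rs eqxx.
  by apply: small_sub (caseB_fixed charF0 d2 sp_inj al rs) => f [_ [x [la H]]]; exists x, la.
move=> f [x [al [[fh _] xa xs c0]]].
pose A := map_mx (meval x) (jmat f).
have cA r j : cofactor A r j = 0 by rewrite -meval_cofactor; apply: c0.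
have [rk|n0] := cofactor0_rank cA; last by rewrite n0 in n1.
have rk' : (\rank A + 1 < N)%N by rewrite addn1 ltnS.
have [r [s [rs [la laE] [mu muE]]]] := two_dependent_rows rk'.
exists (r, s, al); split=> //=; exists x, (fun b => if b then la else mu); split=> // b j.
have RE t (c : 'I_N -> F) : row t A = \sum_(i | (i != r) && (i != s)) c i *: row i A ->
    (mderiv j (f t)).@[x] = \sum_(i | (i != r) && (i != s)) c i * (mderiv j (f i)).@[x].
  move=> E; have := congr1 (fun M : 'rV_N => M 0 j) E; rewrite summxE !mxE => ->.
  by apply: eq_bigr => i _; rewrite !mxE.
by case: b; apply: RE.
Qed.

Lemma small_plane : (1 < n)%N -> small d (fun f => is_End d f /\ exists x : 'I_N -> F,
  [/\ exists i, x i != 0, (forall i, i \notin codom sp -> x i = 0) &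
      forall b, (mderiv (sp b) (hJ f)).@[x] = 0]).
Proof.
move=> n1; pose B (b : bool) (f : polymap F n) := if b then
  exists (x : 'I_N -> F) al r j,
  [/\ is_End d f, x (sp al) = 1, (forall i, i \notin codom sp -> x i = 0),
      (forall b, (mderiv (sp b) (hJ f)).@[x] = 0) & (cofp f r j).@[x] != 0]
  else exists (x : 'I_N -> F) al,
  [/\ is_End d f, x (sp al) = 1, (forall i, i \notin codom sp -> x i = 0) &
      forall r j, (cofp f r j).@[x] = 0].
apply: (@small_sub _ _ _ _ (fun f => exists b, B b f)); last first.
  by apply: small_union => -[]; [apply: small_plane_corank1|apply: small_plane_corank2].
move=> f [fE [x [[i xi] xs dh]]]; have [fh _] := fE.
have [al xal] : exists al, x (sp al) != 0.
  have [/codomP[al iE]|/xs xi0] := boolP (i \in codom sp); last by rewrite xi0 eqxx in xi.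
  by exists al; rewrite -iE.
pose c := (x (sp al))^-1; pose x' i := c * x i.
have xa' : x' (sp al) = 1 by rewrite /x' /c mulVf.
have xs' j : j \notin codom sp -> x' j = 0 by move=> /xs E; rewrite /x' E mulr0.
have dh' b : (mderiv (sp b) (hJ f)).@[x'] = 0.
  by rewrite (meval_homog x c (mderiv_homog (sp b) (hJ_homog fh))) dh mulr0.
have [[r [j cj]]|nc] := classic (exists r j, (cofp f r j).@[x'] != 0).
  by exists true, x', al, r, j.
exists false, x', al; split=> // r j; apply: NNPP => /eqP cj; apply: nc.
by exists r, j.
Qed.

End Plane.

Lemma gen_plane (F : closedFieldType) (n d : nat) (j1 j2 : 'I_n) (i0 := ord_max : 'I_n.+1)
   (i1 := widen_ord (leqnSn n) j1) (i2 := widen_ord (leqnSn n) j2) :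
  [pchar F] =i pred0 -> (1 < d)%N -> (1 < n)%N -> j1 != j2 ->
  gen d (fun f : polymap F n => is_End d f -> forall x : 'I_n.+1 -> F,
    (forall i, i != i0 -> i != i1 -> i != i2 -> x i = 0) ->
    (hJ f).@[x] = 0 -> (mderiv i0 (hJ f)).@[x] = 0 -> (mderiv i1 (hJ f)).@[x] = 0 ->
    (mderiv i2 (hJ f)).@[x] = 0 -> forall i, x i = 0).
Proof.
move=> charF0 d2 n1 j12; pose t := [tuple i0; i1; i2].
have wi (j : 'I_n) : i0 != widen_ord (leqnSn n) j.
  by rewrite -val_eqE /= neq_ltn ltn_ord orbT.
have tu : uniq t.
  by rewrite /= !inE negb_or !wi /= andbT; apply: contraNneq j12 => /(congr1 val) /= /val_inj ->.
have inj : injective (tnth t) by apply/tuple_uniqP.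
apply: gen_imp (small_gen (small_plane charF0 d2 inj n1)) => f fh nB fE x xs hx d0 d1 d2' i.
apply: NNPP => /eqP xi; apply: nB; split=> //; exists x; split; first by exists i.
  move=> j nj; have nt k : j != tnth t k by apply: contraNneq nj => ->; apply: codom_f.
  by apply: xs; [apply: (nt ord0)|apply: (nt (@Ordinal 3 1 isT))|apply: (nt (@Ordinal 3 2 isT))].
by case=> -[|[|[|//]]] lt; [exact: d0|exact: d1|exact: d2'].
Qed.

(** * Critical orbits, scaling and homogeneous components *)

Section Dynamics.
Variables (F : closedFieldType) (n d : nat).
Local Notation N := n.+1.
Local Notation R := {mpoly F[n.+1]}.

Lemma homog_eval0 e (p : R) (x : 'I_N -> F) : p \is e.-homog -> (0 < e)%N ->
  (forall i, x i = 0) -> p.@[x] = 0.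
Proof.
move=> pe e0 x0; have := meval_homog x 0 pe; rewrite expr0n eqn0Ngt e0 mul0r => <-.
by apply: meval_eq => i; rewrite x0 mulr0.
Qed.

Lemma fstruct_fmi (f : polymap F n) k : inhabited (fstruct f d) ->
  inhabited (fstruct (fmi f k) (d ^ k)).
Proof.
move=> [Sf]; elim: k => [|k [Sk]]; first exact: fstruct_id.
by rewrite expnS; apply: fstruct_comp.
Qed.

Lemma crit_iter_orbit (f : polymap F n) m x : crit f x -> crit_iter f m (iter m (fmap f) x).
Proof.
move=> cx; elim: m => [//|m IH]; rewrite /crit_iter iterS -/(crit_iter f m).
exists (iter m (fmap f) x); split=> //; exists 1; split; first exact: oner_neq0.
by apply: functional_extensionality => i; rewrite mul1r iterS.
Qed.

Lemma crit_iter_ex (f : polymap F n) m y : hom d f -> crit_iter f m y ->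
  exists x c, [/\ crit f x, c != 0 & forall i, y i = c * iter m (fmap f) x i].
Proof.
move=> fh; elim: m y => [|m IH] y.
  by move=> cy; exists y, 1; split=> // [|i]; rewrite ?oner_eq0 ?mul1r.
rewrite /crit_iter iterS -/(crit_iter f m) => -[x' [/IH[x [c [cx c0 E]]] [c' [c'0 ->]]]].
exists x, (c' * c ^+ d); split=> // [|i]; first by rewrite mulf_neq0 ?expf_neq0.
rewrite iterS /fmap -mulrA -(meval_homog (iter m (fmap f) x) c (fh i)); congr (_ * _).
by apply: meval_eq => j; rewrite E.
Qed.

Definition scale (a : F) (f : polymap F n) : polymap F n := fun i => a *: f i.

Lemma scale_End a f : a != 0 -> is_End d f -> is_End d (scale a f).
Proof.
move=> a0 [fh fE]; split=> [i|x E]; first exact: dhomogZ.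
apply: fE => i; have := E i; rewrite mevalZ => /eqP; rewrite mulf_eq0 (negPf a0) /=.
by move/eqP.
Qed.

Lemma scale_crit a f x : a != 0 -> crit (scale a f) x <-> crit f x.
Proof.
move=> a0; have E : jac_det (scale a f) x = a ^+ N * jac_det f x.
  rewrite /jac_det -detZ; congr (\det _); apply/matrixP => i j; rewrite !mxE.
  by rewrite mderivZ mevalZ.
split=> -[xn]; rewrite /crit E => /eqP.
  by rewrite mulf_eq0 expf_eq0 (negPf a0) andbF /= => /eqP.
by move=> /eqP J0; split=> //; rewrite J0 mulr0.
Qed.

Lemma scale_crit_iter a f m y : a != 0 -> crit_iter (scale a f) m y <-> crit_iter f m y.
Proof.
move=> a0; elim: m y => [|m IH] y; first exact: scale_crit.
have fE x i : fmap (scale a f) x i = a * fmap f x i by rewrite /fmap mevalZ.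
rewrite /crit_iter !iterS -/(crit_iter f m) -/(crit_iter (scale a f) m).
split=> -[x [/IH cx [c [c0 ->]]]]; exists x; split=> //.
  exists (c * a); split; first by rewrite mulf_neq0.
  by apply: functional_extensionality => i; rewrite fE mulrA.
exists (c / a); split; first by rewrite mulf_neq0 ?invr_eq0.
by apply: functional_extensionality => i; rewrite fE mulrA divfK.
Qed.

Lemma scale_pcf a f k l : a != 0 -> pcf_rel f k l -> pcf_rel (scale a f) k l.
Proof.
move=> a0 [k1 H]; split=> // y /(scale_crit_iter _ _ _ a0) /H.
by move/(scale_crit_iter _ _ _ a0).
Qed.

Lemma scale_coeffs a f j : @coeffs F n d (scale a f) j = a * @coeffs F n d f j.
Proof. by rewrite /coeffs mcoeffZ. Qed.

End Dynamics.

(** On the line through [c], [G] is a polynomial in [a] whose coefficients are the values of its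
    components at [c]; it is multiplied by ['X] to cover [a = 0]. *)
Lemma homog_vanish (F : closedFieldType) M (G : {mpoly F[M]}) w (c : 'I_M -> F) :
  (forall a, a != 0 -> G.@[fun j => a * c j] = 0) -> (pihomog mdeg w G).@[c] = 0.
Proof.
move=> H; have [lt|ge] := ltnP w (msize G); last first.
  suff -> : pihomog mdeg w G = 0 by rewrite meval0.
  apply/mpolyP => m; rewrite mcoeff_pihomog mcoeff0; case: eqP => // mw.
  by apply/eqP; rewrite mcoeff_eq0; apply: contraL ge => /msize_mdeg_lt; rewrite mw -ltnNge.
pose P := \poly_(k < msize G) (pihomog mdeg k G).@[c].
have P0 : 'X * P = 0.
  apply: NNPP => /eqP /poly_nonroot[a]; rewrite hornerM hornerX mulf_eq0 negb_or => /andP[a0].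
  rewrite horner_poly; case/eqP; rewrite -[RHS](H a a0).
  transitivity ((\sum_(k < msize G) pihomog mdeg k G).@[fun j => a * c j]); last first.
    by rewrite -(@pihomog_partitionE _ _ mdeg _ G (leqnn _)).
  rewrite [RHS](rmorph_sum (meval _)) /=.
  by apply: eq_bigr => k _; rewrite (meval_homog c a (pihomogP mdeg k G)) mulrC.
have /eqP := P0; rewrite mulf_eq0 polyX_eq0 /= => /eqP /(congr1 (fun p : {poly F} => p`_w)).
by rewrite coef_poly lt coef0.
Qed.

(** * Assembly of the generic conditions *)

Section Main.
Variables (F : closedFieldType) (charF0 : [pchar F] =i pred0) (n d l : nat).
Hypotheses (hd : (3 <= d)%N) (hn : (2 <= n)%N).
Local Notation N := n.+1.
Local Notation R := {mpoly F[n.+1]}.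

Lemma gen_recovers_all :
  gen d (fun f : polymap F n => prime_elt (hJ f) -> recovers (hJ f) (fmi f l)).
Proof.
have [l0|l0] := posnP l; last by apply: gen_recovers_pos => //; lia.
exists 1; split=> [|f fh _ hp]; first exact: oner_neq0.
rewrite l0; exists (fun k => 'X_k); split=> [j k|k]; rewrite !cmpX.
  by rewrite mulrC; apply: eqm_refl.
apply: (ndvd_var (hJ_homog fh)); have -> : d.-1 = d.-2.+1 by lia.
by rewrite mulnS; lia.
Qed.

Lemma gen_not_pcf : gen d (fun f : polymap F n => is_End d f -> forall k, ~ pcf_rel f k l).
Proof.
have n0 : (0 < n)%N by lia. have n1 : (1 < n)%N by lia. have d0 : (0 < d)%N by lia.
have d1 : (1 < d)%N by lia.
pose j1 : 'I_n := Ordinal n0; pose j2 : 'I_n := Ordinal n1.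
have j12 : j1 != j2 by [].
have ax i := @gen_axis F n d i charF0 d0.
have G := gen_and (gen_and (@gen_fstruct F n d d0) (gen_plane charF0 d1 n1 j12))
  (gen_and (gen_and (ax ord_max) (ax (widen_ord (leqnSn n) j1)))
    (gen_and (ax (widen_ord (leqnSn n) j2)) gen_recovers_all)).
apply: gen_imp G => f fh [[Sf pl] [[a0 a1] [a2 rec]]] fE k [k1 pcf].
have {}pl := pl fE; have hh := hJ_homog fh.
have e0 : (0 < N * d.-1)%N by rewrite muln_gt0 /=; lia.
have hp : prime_elt (hJ f) by apply: plane_prime hh e0 a0 j12 pl.
have [Aw [Arel And]] := rec hp.
have nrm m (s a : R) : s \is m.-homog -> ~ dvdR (hJ f) s -> integ (hJ f) a s ->
    exists b, eqm (hJ f) a (s * b).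
  exact: (normal_integ hp hh e0 a0 a1 a2 j12 pl).
have [Su] := fstruct_fmi l Sf; have [Sg] := fstruct_fmi (k + l) Sf.
(* The degrees are [dl = d ^ l] and [D = d ^ k], with [D > 1] since [k >= 1]; the canonical degree
   is [N * (d - 1) - N = N * (d - 2)]. *)
apply: (@no_lift F charF0 N (d ^ l)%N (d ^ (k + l))%N (d ^ k)%N (N * d.-2)%N (N * d.-1)%N
  _ _ Su Sg (hJ f) Aw) => //.
- by rewrite -expnD addnC.
- by rewrite -{1}(expn0 d) ltn_exp2l.
- by rewrite -mulnS; congr (_ * _)%N; lia.
- by rewrite muln_gt0 /=; lia.
(* [no_lift] works with the affine cone, whose vertex is no point of projective space; it lifts to
   itself. *)
move=> x hx; have [x0|xn] := classic (x = (fun=> 0)).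
  exists x, 1; split=> [//||i]; first exact: oner_neq0.
  by rewrite mul1r !(homog_eval0 (fmi_homog _ i fh)) ?expn_gt0 ?d0 // => j; rewrite x0.
have cx : crit f x by split=> //; rewrite -hJ_eval.
have [z [c [[_ cz] c0 E]]] := crit_iter_ex fh (pcf _ (crit_iter_orbit (k + l) cx)).
by exists z, c; split=> // [|i]; rewrite ?hJ_eval // !fmi_eval E.
Qed.

End Main.

Theorem theorem3 (F : closedFieldType) (charF0 : [pchar F] =i pred0)
  (n d l : nat) (hd : (3 <= d)%N) (hn : (2 <= n)%N) (hl : (l <= 2)%N) :
  exists G : {mpoly F[#|coef_index n d|]},
    G != 0 /\ (exists e, G \is e.-homog) /\
    forall f : polymap F n,
      is_End d f -> (exists k, pcf_type f k l) -> G.@[@coeffs F n d f] = 0.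
Proof.
have [G [G0 H]] := gen_not_pcf charF0 l hd hn; have [w Gw] := homog_neq0 G0.
exists (pihomog mdeg w G); split=> //; split; first by exists w; apply: pihomogP.
move=> f fE [k [pcf _]]; apply: homog_vanish => a a0; apply: NNPP => /eqP ne.
have sE := scale_End a0 fE.
have ne' : G.@[@coeffs F n d (scale a f)] != 0.
  apply: contraNneq ne => E; apply/eqP; rewrite -[RHS]E; apply: meval_eq => j.
  by rewrite scale_coeffs.
exact: (H _ sE.1 ne' sE k (scale_pcf a0 pcf)).
Qed.
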